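(* The parameterized problem Short$_{\text{Staller}}$ MB Dom Game is $\mathrm{W}[1]$-complete.
   Context: All graphs are finite, simple and undirected. For a vertex $x$ of a graph $G=(V,E)$, $N[x]=\{x\}\cup\{y : xy\in E\}$ is its closed neighborhood. The Maker-Breaker domination game on $G$ is played by two players, Dominator and Staller, who alternately claim one unclaimed vertex of $G$. Dominator wins if the vertices she claims contain a dominating set of $G$ (a set $D$ such that every vertex is in $D$ or adjacent to a vertex of $D$); otherwise Staller wins, i.e. Staller wins if and only if he claims all the vertices of $N[x]$ for some vertex $x$. Short$_{\text{Staller}}$ MB Dom Game is the following parameterized problem. Input: a graph $G$, the first player (Dominator or Staller), and an integer $k$. Parameter: $k$. Question: does Staller have a strategy that claims the whole closed neighborhood of some vertex of $G$ in at most $k$ moves (i.e. using at most $k$ of his own moves), against every play of Dominator? Completeness is with respect to FPT (parameterized) reductions. *)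

(* Defs.v *)
From mathcomp Require Import all_boot.
Set Implicit Arguments.
Unset Strict Implicit.
Unset Printing Implicit Defensive.

(** * Turing machines *)

Variant move := MoveL | MoveR | Stay.

(* A two-way infinite tape over {0, 1, blank}, blank being [None].  In [(l, r)],
   [r] lists the cells from the head rightwards and [l] the cells to the left
   of the head, nearest first; all cells beyond the two lists are blank. *)
Definition tape : Type := (seq (option bool) * seq (option bool))%type.

Definition tape_of (w : seq bool) : tape := ([::], [seq Some b | b <- w]).

Definition tape_read (t : tape) : option bool := head None t.2.

Definition tape_write (a : option bool) (t : tape) : tape :=
  (t.1, a :: behead t.2).

Definition tape_move (m : move) (t : tape) : tape :=
  match m with
  | MoveL => (behead t.1, head None t.1 :: t.2)
  | MoveR => (head None t.2 :: t.1, behead t.2)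
  | Stay => t
  end.

(* The word that starts at the head and ends before the first blank. *)
Definition tape_word (t : tape) : seq bool :=
  pmap id (take (index None t.2) t.2).

(* Deterministic machines with two input/output tapes (numbers 0 and 1) and
   any number of work tapes. *)
Record machine := Machine {
  work_tapes : nat;
  state : finType;
  start : state;
  halting : pred state;
  delta : state -> {ffun 'I_work_tapes.+2 -> option bool} ->
          state * ('I_work_tapes.+2 -> option bool * move)
}.

Definition config (M : machine) : Type :=
  (state M * ('I_(work_tapes M).+2 -> tape))%type.

Definition step (M : machine) (c : config M) : config M :=
  if halting c.1 then c else
  let a := delta c.1 [ffun i => tape_read (c.2 i)] in
  (a.1, fun i => tape_move (a.2 i).2 (tape_write (a.2 i).1 (c.2 i))).

(* The word [x] is on tape 0 and the number [k], in unary, is on tape 1. *)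
Definition init (M : machine) (x : seq bool) (k : nat) : config M :=
  (start M, fun i => match val i with
                     | 0 => tape_of x
                     | 1 => tape_of (nseq k true)
                     | _ => tape_of [::]
                     end).

(* On input [(x, k)], [M] halts after at most [t] steps with output
   [(x', k')]. *)
Definition computes_within (M : machine) (x : seq bool) (k t : nat)
    (x' : seq bool) (k' : nat) : Prop :=
  exists2 s, s <= t &
  let c := iter s (@step M) (init M x k) in
  [/\ halting c.1, tape_word (c.2 ord0) = x'
    & tape_word (c.2 (lift ord0 ord0)) = nseq k' true].

Definition computable (f : nat -> nat) : Prop :=
  exists M : machine, forall n, exists t x, computes_within M [::] n t x (f n).

(** * Parameterized problems and reductions *)

Definition param_problem : Type := seq bool -> nat -> Prop.

Definition fpt_reducible (A B : param_problem) : Prop :=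
  exists (M : machine) (f g : nat -> nat) (c : nat),
    [/\ computable f, computable g
      & forall x k, exists x' k',
          [/\ computes_within M x k (f k * (size x).+1 ^ c) x' k',
              k' <= g k
            & A x k <-> B x' k']].

(** * Encodings *)

Definition encode_nat (n : nat) : seq bool := rcons (nseq n true) false.

Definition encode_pred n (P : pred 'I_n) : seq bool :=
  [seq P i | i <- enum 'I_n].

Definition encode_rel n (e : rel 'I_n) : seq bool :=
  [seq e i j | i <- enum 'I_n, j <- enum 'I_n].

(** * Weighted circuit satisfiability and the W-hierarchy *)

(* Circuits, depth, weft and W[t] follow Cygan et al., Parameterized Algorithms
   (Springer 2015), chapter 13.  The type of a node is determined by its indegree: 0 for input nodes, 1 for
   negations, at least 2 for and-nodes and or-nodes.  The label [is_and]
   tells the latter two apart; it is irrelevant on the other nodes. *)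
Record circuit n := Circuit {
  arc : rel 'I_n;
  is_and : pred 'I_n;
  output : 'I_n
}.

Section Circuit.
Variables (n : nat) (C : circuit n).

Definition indegree (i : 'I_n) : nat := #|[set j | arc C j i]|.

Definition is_input (i : 'I_n) : bool := indegree i == 0.

Definition is_large (i : 'I_n) : bool := 2 < indegree i.

(* The digraph is acyclic and the output node has outdegree 0. *)
Definition circuit_wf : Prop :=
  (forall i p, p <> [::] -> path (arc C) i p -> last i p <> i) /\
  (forall i, ~~ arc C (output C) i).

Definition depth_le (d : nat) : Prop :=
  forall i p, is_input i -> path (arc C) i p -> last i p = output C ->
    size p <= d.

Definition weft_le (t : nat) : Prop :=
  forall i p, is_input i -> path (arc C) i p -> last i p = output C ->
    count is_large (i :: p) <= t.

(* [v] gives the value of every node.  As the circuit is acyclic, it is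
   determined by the assignment, i.e. by its restriction to the inputs. *)
Definition valuation (v : pred 'I_n) : Prop :=
  forall i, match indegree i with
  | 0 => True
  | 1 => v i = ~~ [exists (j | arc C j i), v j]
  | _ => v i = if is_and C i then [forall (j | arc C j i), v j]
               else [exists (j | arc C j i), v j]
  end.

Definition weighted_sat (k : nat) : Prop :=
  exists v : pred 'I_n,
    [/\ valuation v, v (output C) & #|[set i | is_input i && v i]| = k].

Definition encode_circuit : seq bool :=
  encode_nat n ++ encode_rel (arc C) ++ encode_pred (is_and C)
  ++ encode_pred (pred1 (output C)).

End Circuit.

Definition wcs (t d : nat) : param_problem := fun x k =>
  exists n (C : circuit n),
    [/\ circuit_wf C, weft_le C t, depth_le C d, x = encode_circuit C
      & weighted_sat C k].

Definition in_W (t : nat) (A : param_problem) : Prop :=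
  exists d, fpt_reducible A (wcs t d).

Definition W_hard (t : nat) (A : param_problem) : Prop :=
  forall B, in_W t B -> fpt_reducible B A.

Definition W_complete (t : nat) (A : param_problem) : Prop :=
  in_W t A /\ W_hard t A.

(** * The Maker-Breaker domination game *)

Variant player := Dominator | Staller.

Definition is_staller (a : player) : bool :=
  if a is Staller then true else false.

Definition opponent (a : player) : player :=
  if a is Staller then Dominator else Staller.

Section Game.
Variables (V : finType) (adj : rel V) (first : player).

Definition closed_nbhd (x : V) : {set V} := [set y | (y == x) || adj x y].

(* A history is the sequence of the claimed vertices, oldest first. *)
Definition to_move (p : seq V) : player := iter (size p) opponent first.

Fixpoint staller_moves (a : player) (p : seq V) : seq V :=
  if p is v :: q then
    if a is Staller then v :: staller_moves Dominator q
    else staller_moves Staller q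
  else [::].

Definition strategy (s : seq V -> V) : Prop :=
  forall p, uniq p -> size p < #|V| -> s p \notin p.

Definition follows (s : seq V -> V) (p : seq V) : Prop :=
  forall q v r, p = q ++ v :: r -> to_move q = Staller -> v = s q.

(* Plays go on until all vertices are claimed; what happens after Staller's
   first [k] moves is irrelevant. *)
Definition staller_wins_within (k : nat) : Prop :=
  exists2 s, strategy s &
  forall p, uniq p -> size p = #|V| -> follows s p ->
    exists x, {subset closed_nbhd x <= take k (staller_moves first p)}.

End Game.

Definition encode_game n (adj : rel 'I_n) (first : player) : seq bool :=
  encode_nat n ++ encode_rel adj ++ [:: is_staller first].

Definition short_staller_mb_dom_game : param_problem := fun x k =>
  exists n (adj : rel 'I_n) (first : player),
    [/\ symmetric adj, irreflexive adj, x = encode_game adj first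
      & staller_wins_within adj first k].

(* Main.v *)
From mathcomp Require Import all_boot.
From mathcomp Require Import zify ring.
From Stdlib Require Import FunctionalExtensionality Classical.
Require Import Defs.
Set Implicit Arguments.
Unset Strict Implicit.
Unset Printing Implicit Defensive.

(* Both directions go through binary constraint satisfaction (CSP) whose number
   of variables is bounded in the parameter and whose domain is polynomial.

   Membership.  If Staller wins in [k] moves, he wins within a set of vertices
   whose size is bounded in [k], so that only Dominator's moves in this set
   matter.  A CSP can then guess the set, Staller's answers to all sequences of
   moves of Dominator, and the neighborhoods claimed in the end; it becomes a
   circuit of weft 1 that forbids the bad pairs of values.

   Hardness.  In a circuit of weft 1 and depth [d], a large gate that needs a
   single good child gets a guessed witness; whether the output is true is then
   refuted by boundedly many inputs.  So it is enough to check the output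
   against every choice of boundedly many of the gaps between the [k] true
   inputs, and these checks are constraints between pairs of guesses.

   In the game of a CSP, Staller first picks the values.  He then claims the
   root of one of several copies of a gadget and, level by level, one vertex of
   each pair, while Dominator claims the other one and so chooses a constraint
   to be tested.  In the end Staller threatens two leaves, one of which is
   available only if the test succeeds.  Copies make up for the moves that
   Dominator gains while Staller picks values; picks made too late yield only
   one threat.

   Reductions are computed by programs for Turing machines, in a class of
   functions of a word and of unary counters closed under bounded recursion. *)

(** * Turing machine programs *)

(** Hardness concerns every problem that some machine reduces to circuits, with arbitrary computable
    bounds. The parameter that this machine outputs is only known to be at most [g k], so the second
    stage needs a time bound monotone in its parameter. Towers of exponentials provide one, and a
    tower of [g k] is again computable. Counters hold numbers of moderate size, hence no set of
    nodes. Depth only bounds the part of a circuit that leads to the output, so a cycle may lie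
    anywhere, and acyclicity needs a memory of one bit per node. It is kept in the word, which may
    be rewritten in rounds before the output is produced. In the game, Staller's budget has no
    slack: one move for each variable and each level, one for a root, one for a leaf. If he claims a
    root earlier, some variable still lacks a pick, and Dominator steers that copy to the test of
    this variable against itself; a later pick then creates a single threat, which she can answer.
    The delicate point is that several copies may be opened early; each must wait for a different
    variable. *)

Definition sym := option bool.

(* A tape up to trailing blanks: the cells to the left of the head, and the
   cells from the head rightwards. *)
Definition atape : Type := ((nat -> sym) * (nat -> sym))%type.

Definition view (t : tape) : atape := (nth None t.1, nth None t.2).
Definition blank : atape := (fun _ => None, fun _ => None).
Definition aread (T : atape) : sym := T.2 0.
Definition awrite (a : sym) (T : atape) : atape :=
  (T.1, fun i => if i is _.+1 then T.2 i else a).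
Definition scons (a : sym) (f : nat -> sym) (i : nat) : sym :=
  if i is j.+1 then f j else a.
Definition amove (m : move) (T : atape) : atape :=
  match m with
  | MoveL => (fun i => T.1 i.+1, scons (T.1 0) T.2)
  | MoveR => (scons (T.2 0) T.1, fun i => T.2 i.+1)
  | Stay => T
  end.

Notation fext := functional_extensionality.

Lemma view_read t : aread (view t) = tape_read t.
Proof. by case: t => l [|a r]. Qed.

Lemma view_step m a t :
  view (tape_move m (tape_write a t)) = amove m (awrite a (view t)).
Proof.
case: t => l r; case: m => /=; rewrite /view /amove /awrite /tape_write /=.
- by congr (_, _); apply: fext => -[|[|i]] //=; rewrite ?nth_behead //;
    case: l => [|? ?] //=; rewrite ?nth_nil ?nth_behead //; case: r => [|??].
- by congr (_, _); apply: fext => -[|i] //=; rewrite ?nth_behead.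
- by congr (_, _); apply: fext => -[|i] //=; rewrite ?nth_behead.
Qed.

Lemma awriteK T : awrite (aread T) T = T.
Proof. by case: T => l r; congr (_, _); apply: fext => -[|i]. Qed.

Lemma moveRL T : amove MoveL (amove MoveR T) = T.
Proof. by case: T => l r; congr (_, _); apply: fext => -[|i]. Qed.

Definition has_word (T : atape) (w : seq bool) : Prop :=
  forall i, i <= size w -> T.2 i = nth None (map Some w) i.

Lemma tape_wordP t w : tape_word t = w <-> has_word (view t) w.
Proof.
case: t => l r; rewrite /tape_word /view /has_word /=; split.
- elim: r w => [|a r IH] w /=; first by move=> <- [].
  case: a => [b|] /=; last by move=> <- [].
  by move=> <- [|i] //= Hi; apply: IH.
- elim: r w => [|a r IH] w /=.
    by case: w => [|b w] // /(_ 0 isT).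
  case: w => [|b w] H.
    by move: (H 0 isT) => /= ->.
  move: (H 0 isT) => /= ->; rewrite /=; congr cons.
  by apply: IH => i Hi; apply: (H i.+1).
Qed.

(** Tapes are addressed by arbitrary numbers, so that programs can be placed anywhere and combined;
    the number of tapes is fixed only in [machine_of]. [Call] embeds a given machine, of which
    nothing is known, on consecutive tapes from its first argument on. *)
Inductive prog : Type :=
| Move of nat & move
| Write of nat & sym
| Seq of prog & prog
| If of nat & pred sym & prog & prog
| While of nat & pred sym & prog
| Call of nat & machine.

Fixpoint pstate (p : prog) : finType :=
  match p with
  | Move _ _ | Write _ _ => unit
  | Seq p q => (pstate p + pstate q)%type
  | If _ _ p q => option (pstate p + pstate q)%type
  | While _ _ p => option (pstate p)
  | Call _ M => state M
  end.

Fixpoint entry (p : prog) : pstate p :=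
  match p with
  | Move _ _ | Write _ _ => tt
  | Seq p q => inl (entry p)
  | If _ _ p q => None
  | While _ _ p => None
  | Call _ M => start M
  end.

Definition acts := nat -> sym * move.
Definition keep (r : nat -> sym) : acts := fun j => (r j, Stay).
Definition act1 (r : nat -> sym) i (a : sym * move) : acts :=
  fun j => if j == i then a else (r j, Stay).

Definition machine_acts (o n : nat) (r : nat -> sym)
    (a : 'I_n -> sym * move) : acts :=
  fun j => if o <= j then
             if insub (j - o) is Some i then a i else (r j, Stay)
           else (r j, Stay).

(** A missing next state signals the exit, which the compound programs redirect. The state [None] of
    [If] and [While] is the test and costs one step. *)
Fixpoint pnext (p : prog) : pstate p -> (nat -> sym) ->
    option (pstate p) * acts :=
  match p return pstate p -> (nat -> sym) -> option (pstate p) * acts with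
  | Move i m => fun _ r => (None, act1 r i (r i, m))
  | Write i a => fun _ r => (None, act1 r i (a, Stay))
  | Seq p q => fun s r =>
    match s with
    | inl s => let: (s', a) := pnext s r in
               (Some (if s' is Some s' then inl s' else inr (entry q)), a)
    | inr s => let: (s', a) := pnext s r in (omap inr s', a)
    end
  | If i f p q => fun s r =>
    match s with
    | None => (Some (Some (if f (r i) then inl (entry p) else inr (entry q))),
               keep r)
    | Some (inl s) => let: (s', a) := pnext s r in
                      (omap (fun s => Some (inl s)) s', a)
    | Some (inr s) => let: (s', a) := pnext s r in
                      (omap (fun s => Some (inr s)) s', a)
    end
  | While i f p => fun s r =>
    match s with
    | None => (if f (r i) then Some (Some (entry p)) else None, keep r)
    | Some s => let: (s', a) := pnext s r in (Some s', a)
    end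
  | Call o M => fun s r =>
    if halting s then (None, keep r) else
    let a := delta s [ffun i : 'I_(work_tapes M).+2 => r (o + i)] in
    (Some a.1, machine_acts o r a.2)
  end.

Definition tapes := nat -> atape.
Definition reads (c : tapes) : nat -> sym := fun j => aread (c j).
Definition apply_acts (a : acts) (c : tapes) : tapes :=
  fun j => amove (a j).2 (awrite (a j).1 (c j)).
Definition upd (c : tapes) i T : tapes := fun j => if j == i then T else c j.

Lemma apply_keep c : apply_acts (keep (reads c)) c = c.
Proof. by apply: fext => j; rewrite /apply_acts /= awriteK. Qed.

Lemma apply_act1 c i a :
  apply_acts (act1 (reads c) i a) c = upd c i (amove a.2 (awrite a.1 (c i))).
Proof.
apply: fext => j; rewrite /apply_acts /act1 /upd.
by case: eqP => [->|] //=; rewrite awriteK.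
Qed.

Inductive run (p : prog) : pstate p -> tapes -> nat -> tapes -> Prop :=
| run_exit s c a :
    pnext s (reads c) = (None, a) -> run s c 1 (apply_acts a c)
| run_step s c a s' t c' :
    pnext s (reads c) = (Some s', a) -> run s' (apply_acts a c) t c' ->
    run s c t.+1 c'.

(* [ex p c b c']: started on [c], [p] exits on [c'] after at most [b] steps. *)
Definition ex p c b c' := exists2 t, t <= b & run (entry p) c t c'.

Lemma ex_le p c b b' c' : ex p c b c' -> b <= b' -> ex p c b' c'.
Proof. by case=> t Ht H Hb; exists t => //; apply: leq_trans Hb. Qed.

Lemma ex_eq p c b c' c'' : ex p c b c' -> c' =1 c'' -> ex p c b c''.
Proof. by move=> H /fext <-. Qed.

Lemma ex_move i m c : ex (Move i m) c 1 (upd c i (amove m (c i))).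
Proof.
exists 1 => //.
have := @run_exit (Move i m) tt c _ (erefl _).
by rewrite apply_act1 /= awriteK.
Qed.

Lemma ex_write i a c : ex (Write i a) c 1 (upd c i (awrite a (c i))).
Proof.
exists 1 => //.
have := @run_exit (Write i a) tt c _ (erefl _).
by rewrite apply_act1.
Qed.

Lemma run_seqr p q s c t c' :
  run s c t c' -> @run (Seq p q) (inr s) c t c'.
Proof.
elim=> {s c t c'} [s c a H|s c a s' t c' H _ IH].
  by apply: run_exit; rewrite /= H.
by apply: run_step IH; rewrite /= H.
Qed.

Lemma run_seq p q s c t c' t2 c2 :
  run s c t c' -> run (entry q) c' t2 c2 ->
  @run (Seq p q) (inl s) c (t + t2) c2.
Proof.
move=> H Hq; elim: H Hq => {s c t c'} [s c a H|s c a s' t c' H _ IH] Hq.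
  by apply: run_step (run_seqr _ Hq); rewrite /= H.
by apply: run_step (IH Hq); rewrite /= H.
Qed.

Lemma ex_seq p q c b c' b2 c2 :
  ex p c b c' -> ex q c' b2 c2 -> ex (Seq p q) c (b + b2) c2.
Proof.
case=> t Ht H [t2 Ht2 H2]; exists (t + t2); first exact: leq_add.
exact: run_seq H H2.
Qed.

Lemma run_if1 i f p q s c t c' :
  run s c t c' -> @run (If i f p q) (Some (inl s)) c t c'.
Proof.
elim=> {s c t c'} [s c a H|s c a s' t c' H _ IH].
  by apply: run_exit; rewrite /= H.
by apply: run_step IH; rewrite /= H.
Qed.

Lemma run_if2 i f p q s c t c' :
  run s c t c' -> @run (If i f p q) (Some (inr s)) c t c'.
Proof.
elim=> {s c t c'} [s c a H|s c a s' t c' H _ IH].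
  by apply: run_exit; rewrite /= H.
by apply: run_step IH; rewrite /= H.
Qed.

Lemma ex_if i (f : pred sym) p q c b c' :
  (if f (aread (c i)) then ex p c b c' else ex q c b c') ->
  ex (If i f p q) c b.+1 c'.
Proof.
case E: (f _) => -[t Ht H]; exists t.+1 => //.
  by apply: run_step; [by rewrite /= E|rewrite apply_keep; apply: run_if1].
by apply: run_step; [by rewrite /= E|rewrite apply_keep; apply: run_if2].
Qed.

Lemma ex_while0 i (f : pred sym) p c :
  ~~ f (aread (c i)) -> ex (While i f p) c 1 c.
Proof.
move=> E; exists 1 => //; rewrite -{2}[c]apply_keep.
by apply: run_exit; rewrite /= (negPf E).
Qed.

Lemma run_while i f p s c t c' t2 c2 :
  run s c t c' -> @run (While i f p) None c' t2 c2 ->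
  @run (While i f p) (Some s) c (t + t2) c2.
Proof.
move=> H Hq; elim: H Hq => {s c t c'} [s c a H|s c a s' t c' H _ IH] Hq.
  by apply: run_step Hq; rewrite /= H.
by apply: run_step (IH Hq); rewrite /= H.
Qed.

Lemma ex_while1 i (f : pred sym) p c b c' b2 c2 :
  f (aread (c i)) -> ex p c b c' -> ex (While i f p) c' b2 c2 ->
  ex (While i f p) c (b + b2).+1 c2.
Proof.
move=> E [t Ht H] [t2 Ht2 H2]; exists (t + t2).+1.
  by rewrite ltnS leq_add.
apply: run_step; first by rewrite /= E.
rewrite apply_keep; exact: run_while H H2.
Qed.

(** The tapes are indexed by the number of rounds left, which suits loops that count down. *)
Lemma ex_loop i (f : pred sym) p (c : nat -> tapes) n b :
  ~~ f (aread (c 0 i)) ->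
  (forall j, j < n -> f (aread (c j.+1 i)) /\ ex p (c j.+1) b (c j)) ->
  ex (While i f p) (c n) (n * b.+1).+1 (c 0).
Proof.
move=> H0; elim: n => [|n IH] H; first exact: ex_while0.
have [Hf Hp] := H n (ltnSn n).
have := ex_while1 Hf Hp (IH (fun j Hj => H j (ltnW Hj))).
by rewrite mulSn addSn addnS.
Qed.

Definition call_post (o : nat) (M : machine) (c : tapes)
    (tp : 'I_(work_tapes M).+2 -> tape) : tapes :=
  fun j => if o <= j then
             if insub (j - o) is Some i then view (tp i) else c j
           else c j.

Lemma ex_call o M c x k s :
  (forall i : 'I_(work_tapes M).+2, c (o + i) = view ((init M x k).2 i)) ->
  let cf := iter s (@step M) (init M x k) in
  halting cf.1 ->
  ex (Call o M) c s.+1 (call_post o c cf.2).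
Proof.
rewrite /ex; have -> : entry (Call o M) = (init M x k).1 by [].
elim: s (init M x k) c => [|s IH] [st tp] c Hc Hh; cbn [fst snd] in *.
  cbn [fst snd iter] in *; exists 1 => //.
  have -> : call_post o c tp = c.
    apply: fext => j; rewrite /call_post; case: leqP => // Hj.
    case: insubP => // i _ Hi; by rewrite -Hc Hi subnKC.
  rewrite -{2}[c]apply_keep; apply: run_exit => /=.
  by rewrite Hh.
rewrite iterSr in Hh *.
(* Halting configurations are fixed by [step], so the machine may have stopped before step [s]. *)
case Hst: (halting st).
  have E n : iter n (@step M) (st, tp) = (st, tp).
    by elim: n => // n /= ->; rewrite /step /= Hst.
  have E1 : step (st, tp) = (st, tp) by rewrite /step /= Hst.
  have := IH (st, tp) c Hc; rewrite E1 E => /(_ Hst) [t Ht Hr].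
  by exists t => //; apply: ltnW.
set a := delta st [ffun i => tape_read (tp i)].
have Er : [ffun i : 'I_(work_tapes M).+2 => reads c (o + i)]
    = [ffun i => tape_read (tp i)].
  by apply/ffunP => i; rewrite !ffunE /reads Hc view_read.
pose c1 := apply_acts (machine_acts o (reads c) a.2) c.
have Hst1 : step (st, tp) = (a.1, fun i => tape_move (a.2 i).2 (tape_write (a.2 i).1 (tp i))).
  by rewrite /step /= Hst.
have Hin (i : 'I_(work_tapes M).+2) : insub (o + i - o) = Some i.
  by rewrite addKn valK.
have Hc1 (i : 'I_(work_tapes M).+2) : c1 (o + i) = view ((step (st, tp)).2 i).
  rewrite Hst1 /= view_step /c1 /apply_acts /machine_acts leq_addr.
  by rewrite Hin Hc.
have [t Ht Hr] := IH (step (st, tp)) c1 Hc1 Hh.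
exists t.+1 => //.
set cf := iter s _ _ in Hr *.
have -> : call_post o c cf.2 = call_post o c1 cf.2.
  apply: fext => j; rewrite /call_post /c1 /apply_acts /machine_acts.
  case: leqP => Hj; last by rewrite /= awriteK.
  by case: insubP => // H; rewrite /= awriteK.
apply: run_step; first by rewrite /= Hst.
by rewrite Er -/a -/c1; rewrite Hst1 in Hr; exact: Hr.
Qed.

Fixpoint fits (p : prog) (N : nat) : bool :=
  match p with
  | Move i _ | Write i _ => i < N
  | Seq p q => fits p N && fits q N
  | If i _ p q => [&& i < N, fits p N & fits q N]
  | While i _ p => (i < N) && fits p N
  | Call o M => o + (work_tapes M).+2 <= N
  end.

Lemma fits_le p N N' : fits p N -> N <= N' -> fits p N'.
Proof.
move=> + HN; elim: p => /=.
- by move=> i _ Hi; apply: leq_trans HN.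
- by move=> i _ Hi; apply: leq_trans HN.
- by move=> p IHp q IHq /andP[/IHp -> /IHq ->].
- move=> i f p IHp q IHq /and3P[Hi /IHp -> /IHq ->].
  by rewrite (leq_trans Hi).
- by move=> i f p IHp /andP[Hi /IHp ->]; rewrite (leq_trans Hi).
- by move=> o M Hi; apply: leq_trans HN.
Qed.

(** Programs see infinitely many tapes, machines finitely many. This locality makes the restriction
    in [machine_of] faithful. *)
Lemma pnext_ext p N (s : pstate p) r r' : fits p N ->
  (forall j, j < N -> r j = r' j) ->
  (pnext s r).1 = (pnext s r').1 /\
  (forall j, j < N -> (pnext s r).2 j = (pnext s r').2 j).
Proof.
move=> + Hr; elim: p s => /=.
- move=> i m _ Hi; split=> // j Hj; rewrite /act1 !Hr //.
- move=> i a _ Hi; split=> // j Hj; rewrite /act1 !Hr //.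
- move=> p IHp q IHq s /andP[Hp Hq]; case: s => s.
    have := IHp s Hp; case: (pnext s r) (pnext s r') => s1 a1 [s2 a2] /=.
    by case=> ->.
  have := IHq s Hq; case: (pnext s r) (pnext s r') => s1 a1 [s2 a2] /=.
  by case=> ->.
- move=> i f p IHp q IHq s /and3P[Hi Hp Hq]; case: s => [[s|s]|].
  + have := IHp s Hp; case: (pnext s r) (pnext s r') => s1 a1 [s2 a2] /=.
    by case=> ->.
  + have := IHq s Hq; case: (pnext s r) (pnext s r') => s1 a1 [s2 a2] /=.
    by case=> ->.
  + by rewrite /= /keep Hr //; split=> // j Hj; rewrite Hr.
- move=> i f p IHp s /andP[Hi Hp]; case: s => [s|].
  + have := IHp s Hp; case: (pnext s r) (pnext s r') => s1 a1 [s2 a2] /=.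
    by case=> ->.
  + by rewrite /= /keep Hr //; split=> // j Hj; rewrite Hr.
- move=> o M s Hf; case: ifP => Hs.
    by split=> // j Hj; rewrite /= /keep Hr.
  have -> : [ffun i : 'I_(work_tapes M).+2 => r (o + i)] =
            [ffun i : 'I_(work_tapes M).+2 => r' (o + i)].
    apply/ffunP => i; rewrite !ffunE Hr //.
    by apply: leq_trans Hf; rewrite ltn_add2l.
  split=> //= j Hj; rewrite /machine_acts; case: ifP => // _; last by rewrite Hr.
  by case: insubP => // _; rewrite Hr.
Qed.

Definition ext_reads n (r : {ffun 'I_n -> sym}) : nat -> sym :=
  fun j => if insub j is Some i then r i else None.

Definition machine_of (p : prog) (n : nat) : machine :=
  @Machine n (option (pstate p)) (Some (entry p)) (fun s => s == None)
    (fun s r => if s is Some s then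
                  let: (s', a) := pnext s (ext_reads r) in
                  (s', fun i : 'I_n.+2 => a i)
                else (None, fun i => (r i, Stay))).

Lemma machine_of_run p n s c t c' (tp : 'I_n.+2 -> tape) :
  fits p n.+2 -> run s c t c' -> (forall i : 'I_n.+2, view (tp i) = c i) ->
  exists2 tp', iter t (@step (machine_of p n)) (Some s, tp) = (None, tp') &
    forall i : 'I_n.+2, view (tp' i) = c' i.
Proof.
move=> Hf H; elim: H tp => {s c t c'} [s c a H|s c a s' t c' H _ IH] tp Htp.
all: have Hext j : j < n.+2 ->
     ext_reads [ffun i => tape_read (tp i)] j = reads c j.
all: try by move=> Hj; rewrite /ext_reads insubT ffunE -view_read Htp.
all: have [] := pnext_ext s Hf Hext; rewrite H.
- case E: (pnext s _) => [s1 a1] /= H1 H2; rewrite {}H1 in E.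
  exists (fun i : 'I_n.+2 => tape_move (a1 i).2 (tape_write (a1 i).1 (tp i))).
    by rewrite /step /= E.
  by move=> i; rewrite view_step Htp H2.
- case E: (pnext s _) => [s1 a1] /= H1 H2; rewrite {}H1 in E.
  have [|tp' Htp' Hv] :=
      IH (fun i : 'I_n.+2 => tape_move (a1 i).2 (tape_write (a1 i).1 (tp i))).
    by move=> i; rewrite view_step Htp H2.
  exists tp' => //; rewrite -Htp' -iterS iterSr; congr (iter t _ _).
  by rewrite /step /= E.
Qed.

Definition initial x k : tapes := fun j =>
  match j with
  | 0 => view (tape_of x)
  | 1 => view (tape_of (nseq k true))
  | _ => blank
  end.

Lemma blank_view : blank = view (tape_of [::]).
Proof. by rewrite /blank /view; congr (_, _); apply: fext => i; rewrite nth_nil. Qed.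

Lemma view_init M x k (i : 'I_(work_tapes M).+2) :
  view ((init M x k).2 i) = initial x k i.
Proof.
rewrite /init /initial /=; case: (val i) => [|[|j]] //.
by rewrite blank_view.
Qed.

Lemma machine_computes p n x k b c' x' k' :
  fits p n.+2 -> ex p (initial x k) b c' ->
  has_word (c' 0) x' -> has_word (c' 1) (nseq k' true) ->
  computes_within (machine_of p n) x k b x' k'.
Proof.
move=> Hf [t Ht Hr] H0 H1.
have [i|tp' E Hv] := machine_of_run (tp := (init (machine_of p n) x k).2) Hf Hr.
  exact: view_init.
exists t => //; rewrite /= {1 2 3}[init _ _ _]surjective_pairing /= E /=; split=> //.
- by apply/tape_wordP; rewrite Hv.
- by apply/tape_wordP; rewrite Hv.
Qed.

(** * Counters *)

(* A counter is a tape whose only mark is at the origin, the value being the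
   position of the head. *)
Definition cnt (v : nat) : atape :=
  (fun i => if i.+1 == v then Some true else None,
   fun i => if (v == 0) && (i == 0) then Some true else None).

Definition wordt (x : seq bool) : atape := view (tape_of x).

Definition nz : pred sym := fun s => s != Some true.
Definition nonblank : pred sym := fun s => s != None.
Definition inc i := Move i MoveR.
Definition dec i := Move i MoveL.
Definition skip := Move 0 Stay.

Lemma cntR v : amove MoveR (cnt v) = cnt v.+1.
Proof.
congr (_, _); apply: fext => i; last by rewrite /= andbF.
by case: i => [|i] /=; case: v => [|v] //=; rewrite eqSS; case: eqP.
Qed.

Lemma cntL v : amove MoveL (cnt v.+1) = cnt v.
Proof. by rewrite -cntR moveRL. Qed.

Lemma cnt_nz v : nz (aread (cnt v)) = (v != 0).
Proof. by case: v. Qed.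

Lemma cnt0_blank : awrite (Some true) blank = cnt 0.
Proof. by congr (_, _); apply: fext => -[|i]. Qed.

Lemma updE c i T : upd c i T i = T.
Proof. by rewrite /upd eqxx. Qed.

Lemma updN c i T j : j != i -> upd c i T j = c j.
Proof. by rewrite /upd => /negPf ->. Qed.

Lemma upd_id c i : upd c i (c i) = c.
Proof. by apply: fext => j; rewrite /upd; case: eqP => [->|]. Qed.

Lemma upd_upd c i T T' : upd (upd c i T) i T' = upd c i T'.
Proof. by apply: fext => j; rewrite /upd; case: eqP. Qed.

Ltac updt :=
  let j := fresh "j" in
  apply: fext => j; rewrite /upd;
  repeat (case: eqP => [?|?] //=); try congruence; try lia; subst;
  try congruence.

Ltac updv := repeat (first [rewrite updE | rewrite updN; [|by lia]]).

Ltac lookup :=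
  updv; rewrite ?subn0 //;
  match goal with H : forall i : nat, _ -> _ = cnt _ |- _ => apply H; lia end.

Lemma ex_skip c : ex skip c 1 c.
Proof. by rewrite -{2}[c](upd_id c 0); apply: ex_move. Qed.

Lemma ex_inc i c v : c i = cnt v -> ex (inc i) c 1 (upd c i (cnt v.+1)).
Proof. by move=> H; rewrite -cntR -H; apply: ex_move. Qed.

Lemma ex_dec i c v : c i = cnt v.+1 -> ex (dec i) c 1 (upd c i (cnt v)).
Proof. by move=> H; rewrite -cntL -H; apply: ex_move. Qed.

Lemma ex_cnt_loop i p (S : nat -> tapes) n b :
  (forall j, j <= n -> S j i = cnt j) ->
  (forall j, j < n -> ex p (upd (S j.+1) i (cnt j)) b (S j)) ->
  ex (While i nz (Seq (dec i) p)) (S n) (n * b.+2).+1 (S 0).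
Proof.
move=> Hc Hp; apply: ex_loop; first by rewrite Hc.
move=> j Hj; rewrite Hc // cnt_nz; split=> //.
by apply: ex_le (ex_seq (ex_dec (Hc _ _)) (Hp _ Hj)) _.
Qed.

Definition clr i := While i nz (Seq (dec i) skip).

Lemma ex_clr i c n : c i = cnt n -> ex (clr i) c (n * 3).+1 (upd c i (cnt 0)).
Proof.
move=> H; rewrite -{1}[c](upd_id c i) H.
apply: (@ex_cnt_loop i skip (fun j => upd c i (cnt j))).
  by move=> j _; rewrite updE.
by move=> j _; rewrite upd_upd; apply: ex_skip.
Qed.

Definition mv i j := While i nz (Seq (dec i) (inc j)).

Lemma ex_mv i j c n m : c i = cnt n -> c j = cnt m -> i != j ->
  ex (mv i j) c (n * 3).+1 (upd (upd c i (cnt 0)) j (cnt (m + n))).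
Proof.
move=> Hi Hj Hij.
pose S k := upd (upd c i (cnt k)) j (cnt (m + (n - k))).
have E : c = S n by rewrite /S subnn addn0; updt.
rewrite {1}E.
have -> : upd (upd c i (cnt 0)) j (cnt (m + n)) = S 0 by rewrite /S subn0.
apply: ex_cnt_loop => k Hk; first by rewrite /S updN // updE.
apply: ex_eq (ex_inc (v := m + (n - k.+1)) _) _.
  by rewrite updN 1?eq_sym // /S updE.
have -> : (m + (n - k.+1)).+1 = m + (n - k) by lia.
by move=> l; rewrite /S; congr (_ l); updt.
Qed.

Definition mv2 i j k := While i nz (Seq (dec i) (Seq (inc j) (inc k))).

Lemma ex_mv2 i j k c n m l : c i = cnt n -> c j = cnt m -> c k = cnt l ->
  i != j -> i != k -> j != k ->
  ex (mv2 i j k) c (n * 4).+1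
    (upd (upd (upd c i (cnt 0)) j (cnt (m + n))) k (cnt (l + n))).
Proof.
move=> Hi Hj Hk Hij Hik Hjk.
pose S q := upd (upd (upd c i (cnt q)) j (cnt (m + (n - q)))) k (cnt (l + (n - q))).
have E : c = S n by rewrite /S subnn !addn0; updt.
rewrite {1}E.
have -> : upd (upd (upd c i (cnt 0)) j (cnt (m + n))) k (cnt (l + n)) = S 0.
  by rewrite /S subn0.
apply: ex_cnt_loop => q Hq; first by rewrite /S updN // updN // updE.
have E1 : upd (S q.+1) i (cnt q) j = cnt (m + (n - q.+1)).
  by rewrite updN 1?eq_sym // /S updN // updE.
have E2 : upd (upd (S q.+1) i (cnt q)) j (cnt (m + (n - q.+1)).+1) k
  = cnt (l + (n - q.+1)).
  by rewrite updN 1?eq_sym // updN 1?eq_sym // /S updE.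
apply: ex_eq (ex_seq (ex_inc E1) (ex_inc E2)) _.
have -> : (m + (n - q.+1)).+1 = m + (n - q) by lia.
have -> : (l + (n - q.+1)).+1 = l + (n - q) by lia.
by move=> z; rewrite /S; congr (_ z); updt.
Qed.

Definition constp dst c := iter c (Seq (inc dst)) skip.

Lemma ex_constp dst c n v : c dst = cnt v ->
  ex (constp dst n) c n.+1 (upd c dst (cnt (v + n))).
Proof.
elim: n c v => [|n IH] c v H.
  by rewrite addn0 -H upd_id; apply: ex_skip.
rewrite /constp /= addnS -addSn -(upd_upd c dst (cnt v.+1)).
apply: ex_le (ex_seq (ex_inc H) (IH _ v.+1 _)) _ => //.
by rewrite updE.
Qed.

Lemma fits_constp dst n N : 0 < N -> dst < N -> fits (constp dst n) N.
Proof. by move=> H0 H; elim: n => //= n IH; rewrite H. Qed.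

Lemma readR j T : aread (iter j (amove MoveR) T) = T.2 j.
Proof.
rewrite /aread -[j in RHS]addn0; elim: j 0 => // j IH k.
by rewrite iterS /= IH addSnnS.
Qed.

(* Moves the head of tape [w] [n] cells to the right, [n] being the value of
   counter [i], which is moved to counter [j]; [rewindp] undoes this. *)
Definition seekp w i j := While i nz (Seq (dec i) (Seq (inc j) (Move w MoveR))).
Definition rewindp w i := While i nz (Seq (dec i) (Move w MoveL)).

Lemma ex_seekp w i j c n : c i = cnt n -> c j = cnt 0 ->
  i != j -> i != w -> j != w ->
  ex (seekp w i j) c (n * 4).+1
    (upd (upd (upd c i (cnt 0)) j (cnt n)) w (iter n (amove MoveR) (c w))).
Proof.
move=> Hi Hj Hij Hiw Hjw.
pose S q := upd (upd (upd c i (cnt q)) j (cnt (n - q))) w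
   (iter (n - q) (amove MoveR) (c w)).
have E : c = S n by rewrite /S subnn; updt.
rewrite {1}E.
have -> : upd (upd (upd c i (cnt 0)) j (cnt n)) w
  (iter n (amove MoveR) (c w)) = S 0 by rewrite /S subn0.
apply: ex_cnt_loop => q Hq; first by rewrite /S updN // updN // updE.
have E1 : upd (S q.+1) i (cnt q) j = cnt (n - q.+1).
  by rewrite updN 1?eq_sym // /S updN // updE.
apply: ex_eq (ex_seq (ex_inc E1) (ex_move _ _ _)) _.
have E3 : (n - q.+1).+1 = n - q by lia.
rewrite E3 => z; rewrite /S; congr (_ z).
rewrite (updN _ _ (i := j)) 1?eq_sym // (updN _ _ (i := i)) 1?eq_sym // updE.
rewrite -iterS E3; updt.
Qed.

Lemma ex_rewindp w i c n T : c i = cnt n -> c w = iter n (amove MoveR) T ->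
  i != w ->
  ex (rewindp w i) c (n * 3).+1 (upd (upd c i (cnt 0)) w T).
Proof.
move=> Hi Hw Hiw.
pose S q := upd (upd c i (cnt q)) w (iter q (amove MoveR) T).
have E : c = S n by rewrite /S; updt.
rewrite {1}E.
have -> : upd (upd c i (cnt 0)) w T = S 0 by [].
apply: ex_cnt_loop => q Hq; first by rewrite /S updN // updE.
apply: ex_eq (ex_move _ _ _) _.
rewrite (updN _ _ (i := i)) 1?eq_sym // {2}/S updE iterS moveRL.
by move=> z; rewrite /S; congr (_ z); updt.
Qed.

Lemma wordt_nth x j : (wordt x).2 j = nth None (map Some x) j.
Proof. by []. Qed.

(* Leaves the number of cells passed in the (zero) counter [t], and adds it
   to the counter [dst]. *)
Definition lenp w t dst :=
  While w nonblank (Seq (Move w MoveR) (Seq (inc t) (inc dst))).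

Lemma ex_lenp w t dst c x v : has_word (c w) x -> c t = cnt 0 ->
  c dst = cnt v -> w != t -> w != dst -> t != dst ->
  ex (lenp w t dst) c (size x * 4).+1
    (upd (upd (upd c w (iter (size x) (amove MoveR) (c w))) t (cnt (size x)))
       dst (cnt (v + size x))).
Proof.
move=> Hx Ht Hd Hwt Hwd Htd; set n := size x.
pose S q := upd (upd (upd c w (iter (n - q) (amove MoveR) (c w)))
   t (cnt (n - q))) dst (cnt (v + (n - q))).
have E : c = S n by rewrite /S subnn addn0; updt.
rewrite {1}E.
have -> : upd (upd (upd c w (iter n (amove MoveR) (c w))) t (cnt n))
  dst (cnt (v + n)) = S 0 by rewrite /S subn0.
have Hr q : q <= n -> aread (S q w) = nth None (map Some x) (n - q).
  by move=> Hq; rewrite /S updN // updN // updE readR Hx // leq_subr.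
apply: ex_loop => [|q Hq].
  by rewrite Hr // subn0 nth_default // size_map.
rewrite Hr //; split.
  by rewrite (nth_map false) //; lia.
have E1 : upd (S q.+1) w (amove MoveR (S q.+1 w)) t = cnt (n - q.+1).
  by rewrite updN 1?eq_sym // /S updN // updE.
have E2 : upd (upd (S q.+1) w (amove MoveR (S q.+1 w))) t
   (cnt (n - q.+1).+1) dst = cnt (v + (n - q.+1)).
  by rewrite updN 1?eq_sym // updN 1?eq_sym // /S updE.
apply: ex_eq (ex_seq (ex_move _ _ _) (ex_seq (ex_inc E1) (ex_inc E2))) _.
have E3 : (n - q.+1).+1 = n - q by lia.
have -> : (v + (n - q.+1)).+1 = v + (n - q) by lia.
have -> : S q.+1 w = iter (n - q.+1) (amove MoveR) (c w).
  by rewrite /S updN // updN // updE.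
rewrite -iterS E3 => z; rewrite /S; congr (_ z); updt.
Qed.

(** * Functions computed by programs *)

(* A family of bounds that is closed, up to a change of index, under products
   and compositions. *)
Record majorants := Majorants {
  mj :> nat -> nat -> nat;
  mj_mono : forall a b N N', a <= b -> N <= N' -> mj a N <= mj b N';
  mj_id : forall N, N.+2 <= mj 1 N;
  mj_mul : forall a b, exists c, forall N, mj a N * mj b N <= mj c N;
  mj_comp : forall a b, exists c, forall N, mj a (mj b N) <= mj c N
}.

Section Poly.
(** The shift keeps the base above 1, so that a larger exponent gives a larger bound even at
    [N = 0]. *)
Let pol c N := N.+2 ^ c.

Let pol_mono a b N N' : a <= b -> N <= N' -> pol a N <= pol b N'.
Proof.
move=> Hab HN; apply: (@leq_trans (N.+2 ^ b)); first by rewrite leq_pexp2l.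
by rewrite /pol; case: b {Hab} => // b; rewrite leq_exp2r.
Qed.

Let pol_id N : N.+2 <= pol 1 N.
Proof. by []. Qed.

Let pol_mul a b : exists c, forall N, pol a N * pol b N <= pol c N.
Proof. by exists (a + b) => N; rewrite /pol expnD. Qed.

Let pol_comp a b : exists c, forall N, pol a (pol b N) <= pol c N.
Proof.
exists (b.+2 * a) => N; rewrite /pol expnM.
case: a => // a; rewrite leq_exp2r //.
have H : 0 < N.+2 ^ b by rewrite expn_gt0.
by rewrite 2!expnS; nia.
Qed.

Definition poly : majorants := Majorants pol_mono pol_id pol_mul pol_comp.
End Poly.

(** Towers of exponentials, the usual majorants of elementary functions. *)
Fixpoint tow c N := if c is c'.+1 then 2 ^ tow c' N else N.+2.

Section Tow.

Lemma tow_ge c N : N.+2 <= tow c N.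
Proof. by elim: c => //= c IH; apply: leq_trans (ltnW (ltn_expl _ _)). Qed.

Let tow_mono a b N N' : a <= b -> N <= N' -> tow a N <= tow b N'.
Proof.
move=> Hab HN; apply: (@leq_trans (tow a N')).
  by elim: a {Hab} => //= a IH; rewrite leq_pexp2l.
rewrite -(subnK Hab); elim: (b - a) => //= d IH.
by apply: leq_trans IH (ltnW (ltn_expl _ _)).
Qed.

Let tow_id N : N.+2 <= tow 1 N.
Proof. exact: tow_ge. Qed.

Let tow_mul a b : exists c, forall N, tow a N * tow b N <= tow c N.
Proof.
exists (maxn a b).+2 => N; set c := maxn a b.
have Ha : tow a N <= tow c N by apply: tow_mono; rewrite ?leq_maxl.
have Hb : tow b N <= tow c N by apply: tow_mono; rewrite ?leq_maxr.
apply: leq_trans (leq_mul Ha Hb) _; rewrite /=.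
set x := tow c N.
have H1 : x * x <= 2 ^ (x + x) by rewrite expnD; apply: leq_mul; apply: ltnW; apply: ltn_expl.
apply: leq_trans H1 _; rewrite leq_pexp2l //.
have Hx : 2 <= x by apply: leq_trans (tow_ge c N).
case: x Hx => // x Hx; rewrite expnS mul2n -addnn.
by have := ltn_expl x (isT : 1 < 2); lia.
Qed.

Let tow_comp a b : exists c, forall N, tow a (tow b N) <= tow c N.
Proof.
exists (a + b.+1) => N; elim: a => [|a IH].
  rewrite /=; set x := tow b N.
  have Hx : 2 <= x by apply: leq_trans (tow_ge b N).
  elim: x Hx => // -[|[|x]] IH _ //; rewrite expnS.
  by have := IH isT; lia.
by rewrite /= leq_pexp2l.
Qed.

Definition elem : majorants := Majorants tow_mono tow_id tow_mul tow_comp.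
End Tow.

(** * Bounded recursion and its compilation to programs *)

Section Def.
Variable mj : majorants.
Implicit Types F G H N A : seq bool -> seq nat -> nat.

Definition bnd F := exists c, forall x e, F x e <= mj c (size x + sumn e).

Lemma bnd_le F G : bnd G -> (forall x e, F x e <= G x e) -> bnd F.
Proof. by case=> c Hc H; exists c => x e; apply: leq_trans (Hc x e). Qed.

Lemma bnd_base : bnd (fun x e => (size x + sumn e).+2).
Proof. by exists 1 => x e; apply: mj_id. Qed.

Lemma mj_lift c c' (N : nat) : c <= c' -> mj c N <= mj c' N.
Proof. by move=> H; apply: mj_mono. Qed.

Lemma mj_ge c (N : nat) : 1 <= c -> N.+2 <= mj c N.
Proof. by move=> H; apply: leq_trans (mj_id _ _) (mj_lift _ H). Qed.

Lemma bnd_mul F G : bnd F -> bnd G -> bnd (fun x e => F x e * G x e).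
Proof.
case=> a Ha [b Hb]; have [c Hc] := mj_mul mj a b; exists c => x e.
by apply: leq_trans (Hc _); apply: leq_mul.
Qed.

Lemma bnd_add F G : bnd F -> bnd G -> bnd (fun x e => F x e + G x e).
Proof.
move=> [a Ha] [b Hb]; set a' := maxn a 1; set b' := maxn b 1.
have [c Hc] := mj_mul mj a' b'; exists c => x e.
apply: leq_trans (Hc _); set X := _ + sumn e.
have H1 : F x e <= mj a' X by apply: leq_trans (Ha x e) _; apply: mj_lift; rewrite leq_maxl.
have H2 : G x e <= mj b' X by apply: leq_trans (Hb x e) _; apply: mj_lift; rewrite leq_maxl.
have H3 : X.+2 <= mj a' X by apply: mj_ge; rewrite leq_maxr.
have H4 : X.+2 <= mj b' X by apply: mj_ge; rewrite leq_maxr.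
by apply: leq_trans (leq_add H1 H2) _; nia.
Qed.

Lemma bnd_const c : bnd (fun _ _ => c).
Proof.
elim: c => [|c IH]; first by exists 0.
have := bnd_add IH bnd_base; move/bnd_le; apply=> x e; lia.
Qed.

Lemma bnd_succ F : bnd F -> bnd (fun x e => (F x e).+1).
Proof. by move=> H; apply: bnd_le (bnd_add H (bnd_const 1)) _ => x e; rewrite addn1. Qed.

Lemma bnd_size : bnd (fun x e => size x).
Proof. by apply: bnd_le bnd_base _ => x e; lia. Qed.

Lemma bnd_sumn : bnd (fun x e => sumn e).
Proof. by apply: bnd_le bnd_base _ => x e; lia. Qed.

Lemma bnd_mj c F : bnd F -> bnd (fun x e => mj c (F x e)).
Proof.
case=> a Ha; have [c' Hc] := mj_comp mj c a; exists c' => x e.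
by apply: leq_trans (Hc _); apply: mj_mono.
Qed.

Ltac bounded := repeat match goal with
  | H : bnd ?F |- bnd ?G => exact: H
  | |- bnd (fun _ _ => _ + _) => apply: bnd_add
  | |- bnd (fun _ _ => _ * _) => apply: bnd_mul
  | |- bnd (fun _ _ => _.+1) => apply: bnd_succ
  | _ => exact: bnd_size || exact: bnd_sumn || exact: bnd_const ||
         apply: bnd_mj
  end.

(** Bounded recursion over a word [x] and an environment [e] of numbers. The side condition of
    [d_rec] bounds every intermediate value, because a counter has to hold it. With [poly], running
    times are polynomial in the word and the unary environment; with [elem], towers are allowed,
    which serves for functions of the parameter. *)
Inductive def : (seq bool -> seq nat -> nat) -> Prop :=
| d_const c : def (fun _ _ => c)
| d_var i : def (fun _ e => nth 0 e i)
| d_size : def (fun x _ => size x)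
| d_bit F : def F -> def (fun x e => nth false x (F x e))
| d_succ F : def F -> def (fun x e => (F x e).+1)
| d_pred F : def F -> def (fun x e => (F x e).-1)
| d_drop n F : def F -> def (fun x e => F x (drop n e))
| d_let n F G : def F -> def G -> def (fun x e => F x (G x e :: drop n e))
| d_rec N H A B : def N -> def H -> def A -> bnd B ->
    (forall x e i, i <= N x e ->
       iteri i (fun j a => H x [:: j, a & e]) (A x e) <= B x e) ->
    def (fun x e => iteri (N x e) (fun j a => H x [:: j, a & e]) (A x e)).

Lemma sumn_drop n e : sumn (drop n e) <= sumn e.
Proof. by rewrite -{2}(cat_take_drop n e) sumn_cat leq_addl. Qed.

Lemma nth_sumn e i : nth 0 e i <= sumn e.
Proof.
elim: e i => [|a e IH] [|i] //=; first exact: leq_addr.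
by apply: leq_trans (IH i) (leq_addl _ _).
Qed.

Lemma def_bnd F : def F -> bnd F.
Proof.
elim=> {F}.
- exact: bnd_const.
- by move=> i; apply: bnd_le bnd_sumn _ => x e; apply: nth_sumn.
- exact: bnd_size.
- by move=> F _ _; apply: bnd_le (bnd_const 1) _ => x e; case: (nth _ _ _).
- by move=> F _ IH; apply: bnd_succ.
- by move=> F _ IH; apply: bnd_le IH _ => x e; apply: leq_pred.
- move=> n F _ [c Hc]; exists c => x e; apply: leq_trans (Hc _ _) _.
  by apply: mj_mono => //; rewrite leq_add2l sumn_drop.
- move=> n F G _ [c Hc] _ HG.
  apply: bnd_le (bnd_mj c (bnd_add bnd_base HG)) _ => x e.
  apply: leq_trans (Hc _ _) _; apply: mj_mono => //=.
  by have := sumn_drop n e; lia.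
- move=> N H A B _ _ _ _ _ _ HB Hb; apply: bnd_le HB _ => x e.
  exact: Hb.
Qed.

(* [p] adds [F x e] to counter [dst]; [w] holds the word, [rho] lists the
   tapes of the environment, and the tapes from [fr] on are free. *)
Definition implements F c w rho dst fr p top :=
  forall s x e v, size e = size rho -> s w = wordt x ->
    (forall i, i < size rho -> s (nth 0 rho i) = cnt (nth 0 e i)) ->
    (forall j, fr <= j < top -> s j = cnt 0) -> s dst = cnt v ->
    ex p s (mj c (size x + sumn e)) (upd s dst (cnt (v + F x e))).

Definition placed w rho dst fr :=
  [/\ w < fr, dst < fr, all (fun i => i < fr) rho, dst \notin rho &
    w != dst /\ w \notin rho].

(** The time index [c] is chosen before the placement, so a subprogram may be compiled on any tapes
    without changing its bound. *)
Definition programmable F := exists c, forall w rho dst fr,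
  placed w rho dst fr -> exists p top,
    [/\ fits p top, fr <= top & implements F c w rho dst fr p top].

Lemma placed_sub w rho dst fr rho' dst' fr' :
  placed w rho dst fr ->
  (forall i, i \in rho' -> (i \in rho) || (fr <= i < fr')) ->
  fr <= fr' -> dst' < fr' -> dst' \notin rho' -> w != dst' ->
  placed w rho' dst' fr'.
Proof.
case=> Hw Hd /allP Hr Hn [Hwd Hwr] H Hf Hd' Hn' Hwd'; split=> //.
- by lia.
- apply/allP => i /H /orP[/Hr|]; lia.
split=> //; apply/negP => /H /orP[]; first by rewrite (negPf Hwr).
  by lia.
Qed.

Lemma implements_bnd F w rho dst fr p top (T : seq bool -> seq nat -> nat) c :
  (forall x e, T x e <= mj c (size x + sumn e)) ->
  (forall s x e v, size e = size rho -> s w = wordt x ->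
    (forall i, i < size rho -> s (nth 0 rho i) = cnt (nth 0 e i)) ->
    (forall j, fr <= j < top -> s j = cnt 0) -> s dst = cnt v ->
    ex p s (T x e) (upd s dst (cnt (v + F x e)))) ->
  implements F c w rho dst fr p top.
Proof. by move=> HT H s x e v *; apply: ex_le (HT _ _); apply: H. Qed.

Lemma placed_nth w rho dst fr i : placed w rho dst fr -> i < size rho ->
  [/\ nth 0 rho i < fr, nth 0 rho i != dst & nth 0 rho i != w].
Proof.
case=> _ _ /allP Hr Hn [_ Hw] Hi; have H := mem_nth 0 Hi; split.
- exact: Hr.
- by apply: contraNneq Hn => <-.
- by apply: contraNneq Hw => <-.
Qed.

Lemma prog_const n : programmable (fun _ _ => n).
Proof.
have [c Hc] := bnd_const n.+1; exists c => w rho dst fr [Hw Hd _ _ [_ _]].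
exists (constp dst n), fr; split=> //; first by apply: fits_constp => //; lia.
apply: (implements_bnd (T := fun _ _ => n.+1)) => //.
by move=> s x e v _ _ _ _ Hs; apply: ex_constp.
Qed.

Lemma prog_var i : programmable (fun _ e => nth 0 e i).
Proof.
pose T (x : seq bool) e := (sumn e * 4).+1 + (sumn e * 4).+1.
have [c Hc] : bnd T.
  by rewrite /T; bounded.
exists c => w rho dst fr HP; have [Hw Hd _ _ [_ _]] := HP.
case: (ltnP i (size rho)) => Hi; last first.
  exists skip, fr; split=> //=; first by lia.
  apply: (implements_bnd Hc) => s x e v Hs _ _ _ Hv.
  rewrite nth_default ?Hs // addn0 -Hv upd_id.
  by apply: ex_le (ex_skip _) _; rewrite /T; lia.
have [Hf Hn Hnw] := placed_nth HP Hi.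
set r := nth 0 rho i in Hf Hn Hnw.
(* Reading a counter destroys it; a second copy on a free tape restores it. *)
exists (Seq (mv2 r fr dst) (mv fr r)), fr.+1; split=> //=.
  by do !(apply/andP; split); lia.
apply: (implements_bnd Hc) => s x e v Hs Hsw He H0 Hv.
have Er := He i Hi; rewrite -/r in Er.
have Ht : s fr = cnt 0 by apply: H0; lia.
have Hle := nth_sumn e i; set a := nth 0 e i in Er Hle *.
have E1 := ex_mv2 Er Ht Hv; rewrite !add0n in E1.
have {E1} E1 := E1 ltac:(lia) Hn ltac:(lia).
set s1 := upd _ _ _ in E1.
have E2 : ex (mv fr r) s1 (a * 3).+1 (upd (upd s1 fr (cnt 0)) r (cnt (0 + a))).
  apply: ex_mv; last by lia.
    by rewrite /s1; lookup.
  by rewrite /s1; lookup.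
apply: ex_le (ex_eq (ex_seq E1 E2) _) _; last by rewrite /T; lia.
by move=> z; congr (_ z); rewrite /s1 add0n; updt.
Qed.

Lemma prog_size : programmable (fun x _ => size x).
Proof.
pose T (x : seq bool) (e : seq nat) := (size x * 4).+1 + (size x * 3).+1.
have [c Hc] : bnd T.
  by rewrite /T; bounded.
exists c => w rho dst fr HP; have [Hw Hd _ _ [Hwd _]] := HP.
exists (Seq (lenp w fr dst) (rewindp w fr)), fr.+1; split=> //=.
  by do !(apply/andP; split); lia.
apply: (implements_bnd Hc) => s x e v Hs Hsw He H0 Hv.
have Ht : s fr = cnt 0 by apply: H0; lia.
have E1 : ex (lenp w fr dst) s _ _ := @ex_lenp w fr dst s x v _ Ht Hv ltac:(lia) Hwd ltac:(lia).
have Hx : has_word (s w) x by rewrite Hsw.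
have {Hx} E1 := E1 Hx.
set s1 := upd _ _ _ in E1.
have E2 : ex (rewindp w fr) s1 (size x * 3).+1 (upd (upd s1 fr (cnt 0)) w (s w)).
  apply: ex_rewindp; last by lia.
    by rewrite /s1; lookup.
  by rewrite /s1; lookup.
apply: ex_le (ex_eq (ex_seq E1 E2) _) _; last by rewrite /T; lia.
by move=> z; congr (_ z); rewrite /s1; updt.
Qed.

Lemma prog_bit F : bnd F -> programmable F ->
  programmable (fun x e => nth false x (F x e)).
Proof.
move=> HF [c0 HP0].
pose T x e := mj c0 (size x + sumn e) + (F x e * 4).+1 + 2 + (F x e * 3).+1.
have [c Hc] : bnd T.
  rewrite /T; bounded.
exists c => w rho dst fr HP; have [Hw Hd Hr _ [Hwd Hwr]] := HP.
have Hfr : fr \notin rho by apply/negP => /(allP Hr); rewrite ltnn.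
have HP' : placed w rho fr fr.+2.
  by apply: placed_sub HP _ _ _ _ _; rewrite ?Hfr //; try lia; move=> i ->.
have [p [top [Hp Htop HI]]] := HP0 _ _ _ _ HP'.
exists (Seq (Seq p (seekp w fr fr.+1))
  (Seq (If w (pred1 (Some true)) (inc dst) skip) (rewindp w fr.+1))), top.
split; [|by lia|].
  by rewrite /= Hp /=; do !(apply/andP; split); lia.
apply: (implements_bnd Hc) => s x e v Hs Hsw He H0 Hv.
have Hz j : fr <= j < fr.+2 -> s j = cnt 0 by move=> Hj; apply: H0; lia.
have E0 := HI s x e 0 Hs Hsw He.
have {E0} E0 := E0 (fun j Hj => H0 j ltac:(lia)) (Hz fr ltac:(lia)).
rewrite add0n in E0; set n := F x e in E0 *.
set s0 := upd _ _ _ in E0.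
have E1 := @ex_seekp w fr fr.+1 s0 n ltac:(by rewrite /s0; lookup)
  ltac:(by rewrite /s0; lookup) ltac:(lia) ltac:(lia) ltac:(lia).
set s1 := upd _ _ _ in E1.
have Hb : aread (s1 w) = nth None (map Some x) n.
  by rewrite /s1 updE readR /s0 updN ?Hsw //; lia.
have E2 : ex (If w (pred1 (Some true)) (inc dst) skip) s1 2
   (upd s1 dst (cnt (v + nth false x n))).
  have Hd1 : s1 dst = cnt v by rewrite /s1 /s0; lookup.
  apply: ex_if; rewrite Hb; case: (ltnP n (size x)) => Hn.
    rewrite (nth_map false) //=; case: (nth _ _ _) => /=.
      by rewrite addn1; apply: ex_inc.
    by rewrite addn0 -Hd1 upd_id; apply: ex_skip.
  rewrite nth_default ?size_map // nth_default //= addn0 -Hd1 upd_id.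
  exact: ex_skip.
set s2 := upd _ _ _ in E2.
have E3 : ex (rewindp w fr.+1) s2 (n * 3).+1 (upd (upd s2 fr.+1 (cnt 0)) w (s0 w)).
  apply: ex_rewindp; last by lia.
    by rewrite /s2 /s1; lookup.
  by rewrite /s2 /s1; lookup.
apply: ex_le (ex_eq (ex_seq (ex_seq E0 E1) (ex_seq E2 E3)) _) _.
  have Hz0 := Hz fr ltac:(lia); have Hz1 := Hz fr.+1 ltac:(lia).
  by move=> z; congr (_ z); rewrite /s2 /s1 /s0; updt.
by rewrite /T -/n; lia.
Qed.

Lemma prog_succ F : programmable F -> programmable (fun x e => (F x e).+1).
Proof.
move=> [c0 HP0].
have [c Hc] : bnd (fun x e => mj c0 (size x + sumn e) + 1).
  by apply: bnd_add (bnd_const 1); apply/bnd_mj/bnd_add; [apply: bnd_size|apply: bnd_sumn].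
exists c => w rho dst fr HP; have [Hw Hd _ _ [Hwd Hwr]] := HP.
have [p [top [Hp Htop HI]]] := HP0 _ _ _ _ HP.
exists (Seq p (inc dst)), top; split=> //=; first by rewrite Hp /=; lia.
apply: (implements_bnd Hc) => s x e v Hs Hsw He H0 Hv.
have E0 := HI s x e v Hs Hsw He H0 Hv.
apply: ex_eq (ex_seq E0 (ex_inc (updE _ _ _))) _.
by move=> z; congr (_ z); rewrite upd_upd addnS.
Qed.

Lemma prog_pred F : bnd F -> programmable F ->
  programmable (fun x e => (F x e).-1).
Proof.
move=> HF [c0 HP0].
pose T x e := mj c0 (size x + sumn e) + (2 + (F x e * 3).+1).
have [c Hc] : bnd T.
  rewrite /T; bounded.
exists c => w rho dst fr HP; have [Hw Hd Hr _ [Hwd Hwr]] := HP.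
have Hfr : fr \notin rho by apply/negP => /(allP Hr); rewrite ltnn.
have HP' : placed w rho fr fr.+1.
  by apply: placed_sub HP _ _ _ _ _; rewrite ?Hfr //; try lia; move=> i ->.
have [p [top [Hp Htop HI]]] := HP0 _ _ _ _ HP'.
exists (Seq p (Seq (If fr nz (dec fr) skip) (mv fr dst))), top.
split; [|by lia|].
  by rewrite /= Hp /=; do !(apply/andP; split); lia.
apply: (implements_bnd Hc) => s x e v Hs Hsw He H0 Hv.
have Hz : s fr = cnt 0 by apply: H0; lia.
have E0 := HI s x e 0 Hs Hsw He (fun j Hj => H0 j ltac:(lia)) Hz.
rewrite add0n in E0; set n := F x e in E0 *.
set s0 := upd _ _ _ in E0.
have E1 : ex (If fr nz (dec fr) skip) s0 2 (upd s fr (cnt n.-1)).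
  apply: ex_if; rewrite /s0 updE cnt_nz; case: (n) => [|k] /=.
    exact: ex_skip.
  by rewrite -(upd_upd s fr (cnt k.+1) (cnt k)); apply: ex_dec; rewrite updE.
have E2 := @ex_mv fr dst (upd s fr (cnt n.-1)) n.-1 v ltac:(lookup)
  ltac:(lookup) ltac:(lia).
apply: ex_le (ex_eq (ex_seq E0 (ex_seq E1 E2)) _) _.
  by move=> z; congr (_ z); updt.
by rewrite /T -/n; lia.
Qed.

Lemma prog_drop n F : programmable F -> programmable (fun x e => F x (drop n e)).
Proof.
move=> [c HP0]; exists c => w rho dst fr HP; have [Hw Hd Hr Hdr [Hwd Hwr]] := HP.
have HP' : placed w (drop n rho) dst fr.
  apply: placed_sub HP _ _ _ _ _ => //.
  - by move=> i /mem_drop ->.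
  - by apply: contra Hdr => /mem_drop.
have [p [top [Hp Htop HI]]] := HP0 _ _ _ _ HP'.
exists p, top; split=> // s x e v Hs Hsw He H0 Hv.
apply: ex_le (HI s x (drop n e) v _ Hsw _ H0 Hv) _.
- by rewrite !size_drop Hs.
- by move=> i; rewrite size_drop => Hi; rewrite !nth_drop He //; lia.
- by apply: mj_mono => //; rewrite leq_add2l sumn_drop.
Qed.

Lemma prog_let n F G : bnd G -> programmable F -> programmable G ->
  programmable (fun x e => F x (G x e :: drop n e)).
Proof.
move=> HG [c1 HP1] [c0 HP0].
pose T x e := mj c0 (size x + sumn e) +
  (mj c1 (size x + (G x e + sumn e)) + (G x e * 3).+1).
have [c Hc] : bnd T.
  rewrite /T; bounded.
exists c => w rho dst fr HP; have [Hw Hd Hr Hdr [Hwd Hwr]] := HP.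
have Hfr : fr \notin rho by apply/negP => /(allP Hr); rewrite ltnn.
have HP' : placed w rho fr fr.+1.
  by apply: placed_sub HP _ _ _ _ _; rewrite ?Hfr //; try lia; move=> i ->.
have [p [top [Hp Htop HI]]] := HP0 _ _ _ _ HP'.
have HP'' : placed w (fr :: drop n rho) dst fr.+1.
  apply: placed_sub HP _ _ _ _ _ => //; try lia.
  - by move=> i; rewrite inE => /orP[/eqP ->|/mem_drop ->] //; lia.
  - rewrite inE negb_or; apply/andP; split; first by lia.
    by apply: contra Hdr => /mem_drop.
have [q [top2 [Hq Htop2 HI2]]] := HP1 _ _ _ _ HP''.
exists (Seq p (Seq q (clr fr))), (maxn top top2); split; [|by lia|].
  rewrite /= (fits_le Hp) ?leq_maxl // (fits_le Hq) ?leq_maxr //=.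
  by apply/and3P; split; lia.
apply: (implements_bnd Hc) => s x e v Hs Hsw He H0 Hv.
have Hz : s fr = cnt 0 by apply: H0; lia.
have E0 := HI s x e 0 Hs Hsw He (fun j Hj => H0 j ltac:(lia)) Hz.
rewrite add0n in E0; set g := G x e in E0 *.
set s0 := upd _ _ _ in E0.
have E1 : ex q s0 (mj c1 (size x + (g + sumn e))) (upd s0 dst (cnt (v + F x (g :: drop n e)))).
  apply: ex_le (HI2 s0 x (g :: drop n e) v _ _ _ _ _) _.
  - by rewrite /= !size_drop Hs.
  - by rewrite /s0; lookup.
  - move=> [|i] /=; first by rewrite /s0 updE.
    rewrite size_drop ltnS => Hi; rewrite !nth_drop.
    have Hi' : n + i < size rho by lia.
    have [Hf _ _] := placed_nth HP Hi'.
    by rewrite /s0; lookup.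
  - by move=> j Hj; rewrite /s0 ; lookup.
  - by rewrite /s0; lookup.
  - by apply: mj_mono => //=; have := sumn_drop n e; lia.
set s1 := upd s0 dst _ in E1.
have E2 := @ex_clr fr s1 g ltac:(by rewrite /s1 /s0; lookup).
apply: ex_le (ex_eq (ex_seq E0 (ex_seq E1 E2)) _) _.
  by move=> z; congr (_ z); rewrite /s1 /s0; updt.
by rewrite /T -/g.
Qed.

(** Four free tapes hold the rounds left, the index, the accumulator and its next value. Programs
    add to their target, so the next value is computed on a zero counter and moved into the
    accumulator after the latter is cleared. *)
Lemma prog_iteri N H A B : bnd N -> bnd B ->
  (forall x e i, i <= N x e ->
       iteri i (fun j a => H x [:: j, a & e]) (A x e) <= B x e) ->
  programmable N -> programmable H -> programmable A ->
  programmable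
    (fun x e => iteri (N x e) (fun j a => H x [:: j, a & e]) (A x e)).
Proof.
move=> HN HB Hle [cN HPN] [cH HPH] [cA HPA].
pose T1 x e := mj cH (size x + (N x e + (B x e + sumn e))).
pose T x e := mj cN (size x + sumn e) + (mj cA (size x + sumn e) +
  ((N x e * (T1 x e + ((B x e * 3).+1 + ((B x e * 3).+1 + 1))).+2).+1 +
  ((B x e * 3).+1 + (N x e * 3).+1))).
have [c Hc] : bnd T.
  rewrite /T /T1; bounded.
exists c => w rho dst fr HP; have [Hw Hd Hr Hdr [Hwd Hwr]] := HP.
have Hfr j : fr <= j -> j \notin rho.
  by move=> Hj; apply/negP => /(allP Hr); lia.
have HP1 : placed w rho fr (fr + 4).
  by apply: placed_sub HP _ _ _ _ _; rewrite ?Hfr //; try lia; move=> i ->.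
have HP2 : placed w rho fr.+2 (fr + 4).
  by apply: placed_sub HP _ _ _ _ _; rewrite ?Hfr //; try lia; move=> i ->.
have HP3 : placed w [:: fr.+1, fr.+2 & rho] fr.+3 (fr + 4).
  apply: placed_sub HP _ _ _ _ _ => //; try lia.
    by move=> i; rewrite !inE => /or3P[/eqP ->|/eqP ->|->]; rewrite ?orbT //; lia.
  by rewrite !inE !negb_or Hfr //; lia.
have [pN [t1 [Hf1 Ht1 I1]]] := HPN _ _ _ _ HP1.
have [pA [t2 [Hf2 Ht2 I2]]] := HPA _ _ _ _ HP2.
have [pH [t3 [Hf3 Ht3 I3]]] := HPH _ _ _ _ HP3.
exists (Seq pN (Seq pA (Seq (While fr nz (Seq (dec fr)
   (Seq pH (Seq (clr fr.+2) (Seq (mv fr.+3 fr.+2) (inc fr.+1))))))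
   (Seq (mv fr.+2 dst) (clr fr.+1))))), (maxn t1 (maxn t2 t3)).
split; [|by lia|].
  have G1 : fits pN (maxn t1 (maxn t2 t3)) by apply: fits_le Hf1 _; lia.
  have G2 : fits pA (maxn t1 (maxn t2 t3)) by apply: fits_le Hf2 _; lia.
  have G3 : fits pH (maxn t1 (maxn t2 t3)) by apply: fits_le Hf3 _; lia.
  by rewrite /= G1 G2 G3 /=; do ?(apply/andP; split); lia.
apply: (implements_bnd Hc) => s x e v Hs Hsw He H0 Hv.
have Z j : fr <= j < fr + 4 -> s j = cnt 0 by move=> Hj; apply: H0; lia.
have Z0 := Z fr ltac:(lia). have Z1 := Z fr.+1 ltac:(lia).
have Z2 := Z fr.+2 ltac:(lia). have Z3 := Z fr.+3 ltac:(lia).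
have E0 := I1 s x e 0 Hs Hsw He (fun j Hj => H0 j ltac:(lia)) Z0.
rewrite add0n in E0; set n := N x e in E0 *.
set s0 := upd _ _ _ in E0.
have Hnr i : i < size rho -> nth 0 rho i < fr.
  by move=> Hi; have [] := placed_nth HP Hi.
have Hz0 j : fr + 4 <= j < t2 -> s0 j = cnt 0.
  by move=> Hj; rewrite /s0; lookup.
have He0 i : i < size rho -> s0 (nth 0 rho i) = cnt (nth 0 e i).
  by move=> Hi; have Hi' := Hnr i Hi; rewrite /s0; updv; apply: He.
have E1 := I2 s0 x e 0 Hs ltac:(by rewrite /s0; lookup) He0
  Hz0
  ltac:(by rewrite /s0; lookup).
rewrite add0n in E1.
pose acc i := iteri i (fun j a => H x [:: j, a & e]) (A x e).
have Hacc i : i <= n -> acc i <= B x e by apply: Hle.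
pose S j := upd (upd (upd s fr (cnt j)) fr.+1 (cnt (n - j))) fr.+2 (cnt (acc (n - j))).
have ES : upd s0 fr.+2 (cnt (A x e)) = S n.
  by rewrite /S /s0 subnn; updt.
rewrite ES in E1.
have E2 : ex (While fr nz (Seq (dec fr)
   (Seq pH (Seq (clr fr.+2) (Seq (mv fr.+3 fr.+2) (inc fr.+1)))))) (S n)
   (n * (T1 x e + ((B x e * 3).+1 + ((B x e * 3).+1 + 1))).+2).+1 (S 0).
  apply: ex_cnt_loop => j Hj; first by rewrite /S; lookup.
  set i := n - j.+1; have Hi : n - j = i.+1 by lia.
  set sa := upd (S j.+1) fr (cnt j).
  have F1 : ex pH sa (T1 x e) (upd sa fr.+3 (cnt (0 + acc i.+1))).
    apply: ex_le (I3 sa x [:: i, acc i & e] 0 _ _ _ _ _) _.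
    - by rewrite /= Hs.
    - by rewrite /sa /S; lookup.
    - move=> [|[|k]] /=.
      + by rewrite /sa /S; lookup.
      + by rewrite /sa /S; lookup.
      + rewrite !ltnS => Hk; have := Hnr k Hk => ?.
        by rewrite /sa /S; lookup.
    - by move=> k Hk; rewrite /sa /S ; lookup.
    - by rewrite /sa /S; lookup.
    - rewrite /T1; apply: mj_mono => //=.
      have Hin : i <= n by lia.
      by have := Hacc i Hin; rewrite -/n; lia.
  rewrite add0n in F1; set sb := upd sa _ _ in F1.
  have F2 : ex (clr fr.+2) sb (B x e * 3).+1 (upd sb fr.+2 (cnt 0)).
    apply: ex_le (ex_clr (n := acc i) _) _.
      by rewrite /sb /sa /S; lookup.
    have Hin : i <= n by lia.
    by have := Hacc i Hin; lia.
  set sc := upd sb _ _ in F2.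
  have F3 : ex (mv fr.+3 fr.+2) sc (B x e * 3).+1
      (upd (upd sc fr.+3 (cnt 0)) fr.+2 (cnt (0 + acc i.+1))).
    apply: ex_le (ex_mv _ _ _) _; last 1 first.
    - have Hin : i.+1 <= n by lia.
      by have := Hacc i.+1 Hin; lia.
    - by rewrite /sc /sb; lookup.
    - by rewrite /sc updE.
    - by lia.
  rewrite add0n in F3; set sd := upd (upd sc _ _) _ _ in F3.
  have F4 : ex (inc fr.+1) sd 1 (upd sd fr.+1 (cnt i.+1)).
    apply: ex_inc; rewrite /sd /sc /sb /sa /S.
    by lookup.
  apply: ex_eq (ex_seq F1 (ex_seq F2 (ex_seq F3 F4))) _.
  by move=> z; congr (_ z); rewrite /sd /sc /sb /sa /S Hi; updt.
have E3 : ex (mv fr.+2 dst) (S 0) (B x e * 3).+1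
   (upd (upd (S 0) fr.+2 (cnt 0)) dst (cnt (v + acc n))).
  apply: ex_le (ex_mv _ _ _) _; last 1 first.
  - by have := Hacc n (leqnn _); lia.
  - by rewrite /S updE subn0.
  - by rewrite /S; lookup.
  - by lia.
set s3 := upd (upd (S 0) _ _) _ _ in E3.
have E4 : ex (clr fr.+1) s3 (n * 3).+1 (upd s3 fr.+1 (cnt 0)).
  apply: ex_clr; rewrite /s3 /S subn0.
  by lookup.
apply: ex_eq (ex_seq E0 (ex_seq E1 (ex_seq E2 (ex_seq E3 E4)))) _.
by move=> z; congr (_ z); rewrite /s3 /S /acc; updt.
Qed.

Theorem def_programmable F : def F -> programmable F.
Proof.
elim=> {F}.
- exact: prog_const.
- exact: prog_var.
- exact: prog_size.
- by move=> F HF; apply: prog_bit; apply: def_bnd.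
- by move=> F HF; apply: prog_succ.
- by move=> F HF; apply: prog_pred; apply: def_bnd.
- by move=> n F HF; apply: prog_drop.
- by move=> n F G HF IHF HG; apply: prog_let => //; apply: def_bnd.
- move=> N H A B HN IN HH IH HA IA HB Hle.
  by apply: prog_iteri HB Hle IN IH IA; apply: def_bnd.
Qed.

End Def.

Ltac bounded := repeat match goal with
  | H : bnd _ ?F |- bnd _ ?G => exact: H
  | |- bnd _ (fun _ _ => _ + _) => apply: bnd_add
  | |- bnd _ (fun _ _ => _ * _) => apply: bnd_mul
  | |- bnd _ (fun _ _ => _.+1) => apply: bnd_succ
  | _ => exact: bnd_size || exact: bnd_sumn || exact: bnd_const ||
         apply: bnd_mj
  end.

(** * Arithmetic and bounded quantifiers by bounded recursion *)

Section Closure.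
Variable mj : majorants.
Implicit Types F G N : seq bool -> seq nat -> nat.
Implicit Types P Q : seq bool -> seq nat -> bool.
Notation def := (def mj).

Lemma def_ext F G : (forall x e, F x e = G x e) -> def F -> def G.
Proof. by move=> H; have -> : F = G by apply: fext => x; apply: fext => e. Qed.

Lemma def_leaf i F : (forall x e, F x e = nth 0 e i) -> def F.
Proof. by move=> H; apply: def_ext (d_var mj i) => x e; rewrite H. Qed.

Lemma def_behead F : def F -> def (fun x e => F x (behead e)).
Proof. by move/(d_drop 1); apply: def_ext => x e; rewrite drop1. Qed.

Lemma def_add F G : def F -> def G -> def (fun x e => F x e + G x e).
Proof.
move=> HF HG.
have HH : def (fun x e => (nth 0 e 1).+1) by apply/d_succ/d_var.
have HB : bnd mj (fun x e => F x e + G x e) by apply: bnd_add; apply: def_bnd.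
have E x e i : iteri i (fun _ a => a.+1) (F x e) = F x e + i.
  by elim: i => [|i /= ->]; rewrite ?addn0 ?addnS.
apply: def_ext (d_rec HG HH HF HB _) => x e; first by rewrite E.
by move=> i Hi; rewrite /= E leq_add2l.
Qed.

Lemma def_sub F G : def F -> def G -> def (fun x e => F x e - G x e).
Proof.
move=> HF HG.
have HH : def (fun x e => (nth 0 e 1).-1) by apply/d_pred/d_var.
have E x e i : iteri i (fun _ a => a.-1) (F x e) = F x e - i.
  by elim: i => [|i /= ->]; rewrite ?subn0 ?subnS.
apply: def_ext (d_rec HG HH HF (def_bnd HF) _) => x e; first by rewrite E.
by move=> i Hi; rewrite /= E leq_subr.
Qed.

Lemma def_mul F G : def F -> def G -> def (fun x e => F x e * G x e).
Proof.
move=> HF HG.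
have HH : def (fun x e => nth 0 e 1 + F x (drop 2 e)).
  by apply: def_add; [apply: d_var|apply: d_drop].
have HB : bnd mj (fun x e => F x e * G x e) by apply: bnd_mul; apply: def_bnd.
have E x e i : iteri i (fun _ a => a + F x e) 0 = F x e * i.
  by elim: i => [|i /= ->]; rewrite ?muln0 // mulnS addnC.
apply: def_ext (d_rec HG HH (d_const mj 0) HB _) => x e.
  by rewrite /= drop0 E.
by move=> i Hi; rewrite /= drop0 E leq_mul2l Hi orbT.
Qed.

Lemma def_leq F G : def F -> def G -> def (fun x e => F x e <= G x e : nat).
Proof.
move=> HF HG; have := def_sub (d_const mj 1) (def_sub HF HG).
by apply: def_ext => x e; rewrite /leq; case: (F x e - G x e) => [|[]].
Qed.

Lemma def_and P Q : def P -> def Q -> def (fun x e => P x e && Q x e : nat).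
Proof.
move=> HP HQ; apply: def_ext (def_mul HP HQ) => x e.
by case: (P x e); case: (Q x e).
Qed.

Lemma def_not P : def P -> def (fun x e => ~~ P x e : nat).
Proof.
move=> HP; apply: def_ext (def_sub (d_const mj 1) HP) => x e.
by case: (P x e).
Qed.

Lemma def_or P Q : def P -> def Q -> def (fun x e => P x e || Q x e : nat).
Proof.
move=> HP HQ; apply: def_ext (def_not (def_and (def_not HP) (def_not HQ))).
by move=> x e; rewrite negb_and !negbK.
Qed.

Lemma def_imp P Q : def P -> def Q -> def (fun x e => P x e ==> Q x e : nat).
Proof.
move=> HP HQ; apply: def_ext (def_or (def_not HP) HQ) => x e.
by rewrite implybE.
Qed.

Lemma def_eqn F G : def F -> def G -> def (fun x e => F x e == G x e : nat).
Proof.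
move=> HF HG; apply: def_ext (def_and (def_leq HF HG) (def_leq HG HF)) => x e.
by rewrite eqn_leq.
Qed.

Lemma def_if P F G : def P -> def F -> def G ->
  def (fun x e => if P x e then F x e else G x e).
Proof.
move=> HP HF HG.
have := def_add (def_mul HP HF) (def_mul (def_not HP) HG).
by apply: def_ext => x e; case: (P x e); rewrite !(mul1n, mul0n, addn0).
Qed.

Lemma def_ifb P Q Q' : def P -> def Q -> def Q' ->
  def (fun x e => (if P x e then Q x e else Q' x e) : nat).
Proof.
move=> HP HF HG; apply: def_ext (def_if HP HF HG) => x e.
by case: (P x e).
Qed.

Lemma def_eqb P Q : def P -> def Q -> def (fun x e => P x e == Q x e : nat).
Proof.
move=> HP HQ; apply: def_ext (def_ifb HP HQ (def_not HQ)) => x e.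
by case: (P x e); case: (Q x e).
Qed.

Lemma def_sum N (F : seq bool -> nat -> seq nat -> nat) : def N ->
  def (fun x e => F x (nth 0 e 0) (behead e)) ->
  def (fun x e => sumn [seq F x i e | i <- iota 0 (N x e)]).
Proof.
move=> HN HF; have [c Hc] := def_bnd HF.
have HH : def (fun x e => nth 0 e 1 + F x (nth 0 e 0) (drop 2 e)).
  apply: def_add; first exact: d_var.
  (* The body sees index and accumulator in front of the environment; the index is put back without
     the accumulator. *)
  exact: (d_let 2 HF (d_var mj 0)).
pose B x e := N x e * mj c (size x + (N x e + sumn e)).
have HB : bnd mj B.
  apply: bnd_mul; first exact: def_bnd.
  apply: bnd_mj; apply: bnd_add (bnd_size _) (bnd_add (def_bnd HN) (bnd_sumn _)).
have E x e i : iteri i (fun j a => a + F x j e) 0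
   = sumn [seq F x i e | i <- iota 0 i].
  elim: i => // n IH; rewrite [LHS]/= IH.
  by rewrite -addn1 iotaD map_cat sumn_cat /= addn0.
apply: def_ext (d_rec HN HH (d_const mj 0) HB _) => x e.
  by rewrite /= drop0 E.
move=> i Hi; rewrite /= drop0 E /B.
apply: (@leq_trans (i * mj c (size x + (N x e + sumn e)))); last first.
  by rewrite leq_mul2r Hi orbT.
have H j : j < i -> F x j e <= mj c (size x + (N x e + sumn e)).
  move=> Hj; apply: leq_trans (Hc x (j :: e)) _; apply: mj_mono => //=.
  by lia.
suff G n : n <= i -> sumn [seq F x i e | i <- iota 0 n] <=
    n * mj c (size x + (N x e + sumn e)) by exact: G.
elim: n => // j IH Hj.
rewrite -addn1 iotaD map_cat sumn_cat /= addn0 mulnDl mul1n leq_add //.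
  by apply: IH; rewrite ltnW.
exact: H.
Qed.

Lemma def_all N (P : seq bool -> nat -> seq nat -> bool) : def N ->
  def (fun x e => P x (nth 0 e 0) (behead e)) ->
  def (fun x e => all (fun i => P x i e) (iota 0 (N x e)) : nat).
Proof.
move=> HN HP.
have H0 := def_sum HN (F := fun x i e => (~~ P x i e : nat)) (def_not HP).
apply: def_ext (def_eqn H0 (d_const mj 0)) => x e; congr nat_of_bool.
by elim: (iota _ _) => //= a s IH; rewrite addn_eq0 IH eqb0 negbK.
Qed.

Lemma def_has N (P : seq bool -> nat -> seq nat -> bool) : def N ->
  def (fun x e => P x (nth 0 e 0) (behead e)) ->
  def (fun x e => has (fun i => P x i e) (iota 0 (N x e)) : nat).
Proof.
move=> HN HP.
have H0 := def_all HN (P := fun x i e => ~~ P x i e) (def_not HP).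
apply: def_ext (def_not H0) => x e; congr nat_of_bool.
by rewrite -has_predC; apply: eq_has => i /=; rewrite negbK.
Qed.

Lemma def_count N (P : seq bool -> nat -> seq nat -> bool) : def N ->
  def (fun x e => P x (nth 0 e 0) (behead e)) ->
  def (fun x e => count (fun i => P x i e) (iota 0 (N x e))).
Proof.
move=> HN HP.
apply: def_ext (def_sum HN (F := fun x i e => (P x i e : nat)) HP) => x e.
by elim: (iota _ _) => //= a s ->.
Qed.

(** Division counts the positive multiples of the divisor up to the dividend. *)
Lemma def_div F G : def F -> def G -> def (fun x e => F x e %/ G x e).
Proof.
move=> HF HG.
have H0 : def (fun x e => sumn [seq ((0 < G x e) && (i.+1 * G x e <= F x e) : nat)
    | i <- iota 0 (F x e)]).
  apply: (def_sum HF).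
  apply: def_and; first exact: def_leq (d_const _ 1) (def_behead HG).
  apply: def_leq (def_behead HF).
  exact: def_mul (d_succ (d_var _ 0)) (def_behead HG).
apply: def_ext H0 => x e; move: (F x e) (G x e) => m d.
case: d => [|d].
  by rewrite divn0; elim: (iota _ _) => //= a s ->.
have H q n : n <= q -> m %/ d.+1 <= q ->
   sumn [seq ((0 < d.+1) && (i.+1 * d.+1 <= m) : nat) | i <- iota 0 n]
   = minn n (m %/ d.+1).
  elim: n => [|n IH] Hn Hq; first by rewrite min0n.
  rewrite -[n.+1]addn1 iotaD map_cat sumn_cat (IH (ltnW Hn) Hq) /=.
  rewrite add0n -leq_divRL // addn1; move: (m %/ d.+1) => k.
  by case E: (n < k) => /=; lia.
by rewrite (H m) ?leq_div //; apply/minn_idPr; apply: leq_div.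
Qed.

Lemma def_mod F G : def F -> def G -> def (fun x e => F x e %% G x e).
Proof.
move=> HF HG.
apply: def_ext (def_sub HF (def_mul (def_div HF HG) HG)) => x e.
by rewrite {1}(divn_eq (F x e) (G x e)) addKn.
Qed.

Lemma def_expc F c : def F -> def (fun x e => F x e ^ c).
Proof.
move=> HF; elim: c => [|c IH]; first exact: d_const.
by apply: def_ext (def_mul HF IH) => x e; rewrite expnS.
Qed.

Lemma def_odd F : def F -> def (fun x e => odd (F x e) : nat).
Proof.
move=> HF; apply: def_ext (def_mod HF (d_const mj 2)) => x e.
by rewrite modn2.
Qed.

(** Powers exceed polynomial bounds, so the iteration is capped at a number that is already
    available; up to the cap it yields the true power. *)
Lemma def_powcap F G N : def F -> def G -> def N ->
  def (fun x e => iter (N x e) (fun a => minn (a * F x e) (G x e)) 1).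
Proof.
move=> HF HG HN.
have HH : def (fun x e => if nth 0 e 1 * F x (drop 2 e) <= G x (drop 2 e)
   then nth 0 e 1 * F x (drop 2 e) else G x (drop 2 e)).
  by apply: def_if; [apply: def_leq|apply: def_mul|];
    rewrite ?/mul; try apply: def_mul; try apply: d_var; try apply: d_drop.
have HB : bnd mj (fun x e => G x e + 1).
  exact: bnd_add (def_bnd HG) (bnd_const _ _).
have E x e n : iteri n (fun j a => if a * F x e <= G x e then a * F x e else G x e) 1
   = iter n (fun a => minn (a * F x e) (G x e)) 1.
  by elim: n => //= n ->; rewrite /minn; case: ltngtP => // ->.
apply: def_ext (d_rec HN HH (d_const mj 1) HB _) => x e.
  by rewrite /= drop0 E.
move=> i Hi; rewrite /= drop0 E.
by case: i {Hi} => [|i] /=; [rewrite addn1|apply: leq_trans (geq_minr _ _) (leq_addr _ _)].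
Qed.

End Closure.

Lemma def_exp2 F : def elem F -> def elem (fun x e => 2 ^ F x e).
Proof.
move=> HF.
have HH : def elem (fun x e => nth 0 e 1 + nth 0 e 1).
  by apply: def_add; apply: d_var.
have HB : bnd elem (fun x e => 2 ^ F x e).
  by have [c Hc] := def_bnd HF; exists c.+1 => x e; rewrite /= leq_exp2l.
have E i : iteri i (fun _ a => a + a) 1 = 2 ^ i.
  by elim: i => //= i ->; rewrite expnS mul2n addnn.
apply: def_ext (d_rec HF HH (d_const _ 1) HB _) => x e; first by rewrite /= E.
by move=> i Hi; rewrite /= E leq_exp2l.
Qed.

Lemma def_tow c F : def elem F -> def elem (fun x e => tow c (F x e)).
Proof.
by move=> HF; elim: c => [|c IH] /=; [do 2!apply: d_succ|apply: def_exp2].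
Qed.

Ltac def_hook := fail.
Ltac def_leaf_tac :=
  solve [ eapply def_leaf; intros; rewrite ?nth_behead; reflexivity
        | apply: d_const | apply: d_size ].
Ltac def_step :=
  first [ def_leaf_tac | def_hook |
  lazymatch goal with
  | |- def _ (fun x e => nat_of_bool (@?P x e && @?Q x e)) => apply: def_and
  | |- def _ (fun x e => nat_of_bool (@?P x e || @?Q x e)) => apply: def_or
  | |- def _ (fun x e => nat_of_bool (@?P x e ==> @?Q x e)) => apply: def_imp
  | |- def _ (fun x e => nat_of_bool (~~ @?P x e)) => apply: def_not
  | |- def _ (fun x e => nat_of_bool (@?F x e <= @?G x e)) => apply: def_leq
  | |- def _ (fun x e => nat_of_bool (@?F x e == @?G x e)) =>
      first [apply: def_eqn | apply: def_eqb]
  | |- def _ (fun x e => nat_of_bool (odd _)) => apply: def_odd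
  | |- def _ (fun x e => nat_of_bool (nth false x _)) => apply: d_bit
  | |- def _ (fun x e => nat_of_bool (all _ (iota 0 _))) => apply: def_all
  | |- def _ (fun x e => nat_of_bool (has _ (iota 0 _))) => apply: def_has
  | |- def _ (fun x e => nat_of_bool (if _ then _ else _)) => apply: def_ifb
  | |- def _ (fun x e => count _ (iota 0 _)) => apply: def_count
  | |- def _ (fun x e => sumn (map _ (iota 0 _))) => apply: def_sum
  | |- def _ (fun x e => if _ then _ else _) => apply: def_if
  | |- def _ (fun x e => @?F x e + @?G x e) => apply: def_add
  | |- def _ (fun x e => @?F x e - @?G x e) => apply: def_sub
  | |- def _ (fun x e => @?F x e * @?G x e) => apply: def_mul
  | |- def _ (fun x e => @?F x e %/ @?G x e) => apply: def_div
  | |- def _ (fun x e => @?F x e %% @?G x e) => apply: def_mod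
  | |- def _ (fun x e => (@?F x e) ^ _) => apply: def_expc
  | |- def _ (fun x e => (@?F x e).+1) => apply: d_succ
  | |- def _ (fun x e => (@?F x e).-1) => apply: d_pred
  end ].
Ltac deft := repeat def_step.

(** * Words *)

(** Words are produced from the last letter to the first, so that the head ends on the first letter,
    where the output is read. *)
Definition pushl (y : seq bool) (T : atape) : atape :=
  foldr (fun b T => awrite (Some b) (amove MoveL T)) T y.

Lemma pushl_right y T i : (pushl y T).2 i =
  if i < size y then Some (nth false y i) else T.2 (i - size y).
Proof. by elim: y i => [|b y IH] [|i] //=; rewrite IH. Qed.

Lemma pushl_left y T i : (pushl y T).1 i = T.1 (i + size y).
Proof. by elim: y i => [|b y IH] i; rewrite ?addn0 //= IH addSnnS. Qed.

Lemma pushl_blank y : pushl y blank = wordt y.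
Proof.
rewrite [pushl _ _]surjective_pairing; congr (_, _); apply: fext => i.
  by rewrite pushl_left nth_nil.
rewrite pushl_right; case: ltnP => H; first by rewrite (nth_map false).
by rewrite nth_default ?size_map.
Qed.

Lemma pushl_word y T : T.2 0 = None -> has_word (pushl y T) y.
Proof.
move=> H i; rewrite leq_eqVlt pushl_right => /orP[/eqP ->|Hi].
  by rewrite ltnn subnn H nth_default // size_map.
by rewrite Hi (nth_map false).
Qed.

Lemma blank_wordt : blank = wordt [::].
Proof. exact: blank_view. Qed.

Lemma wordt_has x : has_word (wordt x) x.
Proof. by []. Qed.

Definition eat n (T : atape) : atape := iter n (fun T => amove MoveR (awrite None T)) T.

Lemma eat_right n T i : (eat n T).2 i = T.2 (n + i).
Proof. by elim: n i => [|n IH] i //=; rewrite IH addnS. Qed.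

Lemma eat_word n x : eat n (wordt x) = wordt (drop n x).
Proof.
elim: n => [|n IH]; first by rewrite drop0.
rewrite /eat iterS -/(eat n _) IH; congr (_, _); apply: fext => i /=.
  by case: i => //= i; rewrite nth_nil.
by rewrite !map_drop !nth_drop addSnnS.
Qed.

Lemma iterR_view n T : iter n (amove MoveR) T =
  (fun i => if i < n then T.2 (n.-1 - i) else T.1 (i - n), fun i => T.2 (n + i)).
Proof.
elim: n => [|n IH].
  by case: T => l r; congr (_, _); apply: fext => i; rewrite subn0.
rewrite iterS IH; congr (_, _); apply: fext => -[|i] //=.
- by rewrite addn0 subn0.
- by rewrite ltnS subSS; case: n {IH} => [|n] //=; rewrite subSS.
- by rewrite addnS.
- by rewrite addnS.
Qed.

Lemma write_word x q b : awrite (Some b) (iter (size x) (amove MoveR) (wordt x))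
  = awrite (Some b) (iter (size x) (amove MoveR) (wordt (rcons x q))).
Proof.
rewrite !iterR_view; congr (_, _); apply: fext => i /=.
  by case: ltnP => H; rewrite ?nth_nil // map_rcons nth_rcons size_map; case: ltnP => //; lia.
case: i => [|i] //=; rewrite !nth_default // ?size_map ?size_rcons; lia.
Qed.

Lemma push_word x b :
  amove MoveR (awrite (Some b) (iter (size x) (amove MoveR) (wordt x)))
  = iter (size x).+1 (amove MoveR) (wordt (rcons x b)).
Proof.
rewrite (write_word x b b) iterS; set T := iter _ _ _.
have -> : Some b = aread T; last by rewrite awriteK.
by rewrite /T readR wordt_nth map_rcons nth_rcons size_map ltnn eqxx.
Qed.

(* Moves the word on tape [a] to the blank tape [w]; its length is added to
   the counter [l]. *)
Definition copyp a w t l :=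
  Seq (While a nonblank
    (Seq (If a (pred1 (Some true)) (Write w (Some true)) (Write w (Some false)))
    (Seq (Move w MoveR) (Seq (Write a None) (Seq (Move a MoveR)
      (Seq (inc t) (inc l)))))))
  (rewindp w t).

Lemma ex_copyp a w t l c x v : uniq [:: a; w; t; l] ->
  has_word (c a) x -> c w = blank -> c t = cnt 0 -> c l = cnt v ->
  ex (copyp a w t l) c (size x * 12 + 3)
    (upd (upd (upd c a (eat (size x) (c a))) w (wordt x))
       l (cnt (v + size x))).
Proof.
rewrite /= !inE !negb_or !andbT => /and3P[/and3P[Haw Hat Hal] /andP[Hwt Hwl] Htl].
move=> Hx Hw Ht Hl; set n := size x.
pose S q := upd (upd (upd (upd c a (eat (n - q) (c a)))
   w (iter (n - q) (amove MoveR) (wordt (take (n - q) x))))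
   t (cnt (n - q))) l (cnt (v + (n - q))).
have E : c = S n.
  by rewrite /S subnn addn0 take0 -blank_wordt; updt.
have E1 : ex (While a nonblank
    (Seq (If a (pred1 (Some true)) (Write w (Some true)) (Write w (Some false)))
    (Seq (Move w MoveR) (Seq (Write a None) (Seq (Move a MoveR)
      (Seq (inc t) (inc l))))))) (S n) (n * 8).+1 (S 0).
  clear E.
  have Hr q : q <= n -> aread (S q a) = nth None (map Some x) (n - q).
    move=> Hq; rewrite /S; updv; rewrite /aread eat_right addn0.
    by apply: Hx; apply: leq_subr.
  apply: ex_loop => [|q Hq].
    by rewrite Hr // subn0 nth_default // size_map.
  have Hq' : n - q.+1 < size x by lia.
  set p := n - q.+1 in Hq'.
  rewrite Hr // (nth_map false) //; split=> //.
  set b := nth false x p.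
  have F1 : ex (If a (pred1 (Some true)) (Write w (Some true)) (Write w (Some false)))
     (S q.+1) 2 (upd (S q.+1) w (awrite (Some b) (S q.+1 w))).
    apply: ex_if; rewrite Hr // (nth_map false) // -/p -/b.
    by case: b => /=; apply: ex_write.
  have F2 := ex_seq F1 (ex_seq (ex_move w MoveR _) (ex_seq (ex_write a None _)
    (ex_seq (ex_move a MoveR _) (ex_seq (@ex_inc t _ p _) (@ex_inc l _ (v + p) _))))).
  apply: ex_eq (F2 _ _) _.
  - by rewrite /S -/p; updv.
  - by rewrite /S -/p; updv.
  have Sw : S q.+1 w = iter p (amove MoveR) (wordt (take p x)).
    by rewrite /S; updv.
  have Sa : S q.+1 a = eat p (c a) by rewrite /S; updv.
  have Hp : n - q = p.+1 by rewrite /p; lia.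
  have Pw : amove MoveR (awrite (Some b) (S q.+1 w))
      = iter p.+1 (amove MoveR) (wordt (take p.+1 x)).
    have := push_word (take p x) b; rewrite size_takel; last exact: ltnW.
    by rewrite Sw (take_nth false Hq').
  move=> z; congr (_ z); updv.
  rewrite Pw Sa; apply: fext => j; rewrite /S -/p Hp /upd.
  by repeat (case: eqP => [?|?] //=); subst; try congruence; try lia;
    rewrite ?addnS.
have S0w : S 0 w = iter n (amove MoveR) (wordt x).
  by rewrite /S subn0 take_size; updv.
have S0t : S 0 t = cnt n by rewrite /S subn0; updv.
rewrite {1}E; clear E; apply: ex_le (ex_eq (ex_seq E1 (ex_rewindp S0t S0w _)) _) _.
- by rewrite eq_sym.
- by move=> z; congr (_ z); rewrite /S subn0; updt.
- by lia.
Qed.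

Definition readp a l := While a nonblank (Seq (Move a MoveR) (inc l)).

Lemma ex_readp a l c x v : a != l -> has_word (c a) x -> c l = cnt v ->
  ex (readp a l) c (size x * 3).+1
    (upd (upd c a (iter (size x) (amove MoveR) (c a))) l (cnt (v + size x))).
Proof.
move=> Hal Hx Hl; set n := size x.
pose S q := upd (upd c a (iter (n - q) (amove MoveR) (c a))) l (cnt (v + (n - q))).
have E : c = S n by rewrite /S subnn addn0; updt.
rewrite {1}E; clear E.
have -> : upd (upd c a (iter n (amove MoveR) (c a))) l (cnt (v + n)) = S 0.
  by rewrite /S subn0.
have Hr q : q <= n -> aread (S q a) = nth None (map Some x) (n - q).
  by move=> Hq; rewrite /S; updv; rewrite readR; apply: Hx; apply: leq_subr.
apply: ex_loop => [|q Hq].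
  by rewrite Hr // subn0 nth_default // size_map.
rewrite Hr // (nth_map false); last by lia.
split=> //.
have El : upd (S q.+1) a (amove MoveR (S q.+1 a)) l = cnt (v + (n - q.+1)).
  by rewrite /S; updv.
apply: ex_eq (ex_seq (ex_move _ _ _) (ex_inc El)) _ => z.
have -> : S q.+1 a = iter (n - q.+1) (amove MoveR) (c a) by rewrite /S; updv.
rewrite -iterS /S; congr (_ z).
have -> : (n - q.+1).+1 = n - q by lia.
have -> : (v + (n - q.+1)).+1 = v + (n - q) by lia.
updt.
Qed.

Definition erasep w := While w nonblank (Seq (Write w None) (Move w MoveR)).

Lemma ex_erasep w c x : c w = wordt x ->
  ex (erasep w) c (size x * 3).+1 (upd c w blank).
Proof.
move=> Hx; set n := size x.
pose S q := upd c w (eat (n - q) (c w)).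
have E : c = S n by rewrite /S subnn; updt.
rewrite {1}E; clear E.
have -> : upd c w blank = S 0.
  by rewrite /S subn0 Hx eat_word drop_size blank_wordt.
have Hr q : q <= n -> aread (S q w) = nth None (map Some x) (n - q).
  by move=> Hq; rewrite /S; updv; rewrite Hx /aread eat_right addn0.
apply: ex_loop => [|q Hq].
  by rewrite Hr // subn0 nth_default // size_map.
rewrite Hr // (nth_map false); last by lia.
split=> //.
apply: ex_eq (ex_seq (ex_write _ _ _) (ex_move _ _ _)) _ => z.
rewrite /S; updv; congr (_ z); rewrite !upd_upd.
by have -> : n - q = (n - q.+1).+1 by lia.
Qed.

(* Pushes a word of length [n], the value of counter [i], to the left on tape
   [a]; program [p] computes its letters on counter [r]. *)
Definition emitp a i r p :=
  While i nz (Seq (dec i) (Seq p (Seq (Move a MoveL)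
    (Seq (If r nz (Write a (Some true)) (Write a (Some false))) (clr r))))).

Lemma ex_emitp a i r p c n (f : nat -> nat) b m : uniq [:: a; i; r] ->
  c i = cnt n -> c r = cnt 0 ->
  (forall j, j < n -> f j <= m) ->
  (forall j T, j < n -> ex p (upd (upd c i (cnt j)) a T) b
     (upd (upd (upd c i (cnt j)) a T) r (cnt (f j)))) ->
  ex (emitp a i r p) c (n * (b + m * 3 + 6)).+1
    (upd (upd c i (cnt 0)) a (pushl (mkseq (fun j => f j != 0) n) (c a))).
Proof.
rewrite /= !inE !negb_or !andbT => /andP[/andP[Hai Har] Hir] Hi Hr Hm Hp.
set y := mkseq _ _.
have Sy : size y = n by rewrite size_mkseq.
pose S q := upd (upd c i (cnt q)) a (pushl (drop q y) (c a)).
have E : c = S n by rewrite /S -{2}Sy drop_size; updt.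
rewrite {1}E; clear E.
have -> : upd (upd c i (cnt 0)) a (pushl y (c a)) = S 0 by rewrite /S drop0.
apply: ex_le (ex_cnt_loop (b := b + (1 + (2 + (m * 3).+1))) _ _) _; last by nia.
  by move=> j Hj; rewrite /S; updv.
move=> j Hj.
have -> : upd (S j.+1) i (cnt j) = upd (upd c i (cnt j)) a (pushl (drop j.+1 y) (c a)).
  by rewrite /S; updt.
set T := pushl _ _; set s1 := upd (upd _ _ _) _ _.
have F1 : ex p s1 b _ := Hp j T Hj.
set s2 := upd s1 _ _ in F1.
have F2 := ex_move a MoveL s2; set s3 := upd s2 _ _ in F2.
have s3r : s3 r = cnt (f j) by rewrite /s3 /s2; updv.
have s3a : s3 a = amove MoveL T by rewrite /s3 /s2 /s1; updv.
have F3 : ex (If r nz (Write a (Some true)) (Write a (Some false))) s3 2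
   (upd s3 a (awrite (Some (f j != 0)) (amove MoveL T))).
  apply: ex_if; rewrite s3r cnt_nz -s3a.
  by case: (f j != 0); apply: ex_write.
set s4 := upd s3 a _ in F3.
have F4 : ex (clr r) s4 (m * 3).+1 (upd s4 r (cnt 0)).
  apply: ex_le (ex_clr (n := f j) _) _; first by rewrite /s4; updv.
  by have := Hm j Hj; lia.
apply: ex_eq (ex_seq F1 (ex_seq F2 (ex_seq F3 F4))) _ => z.
rewrite /S (drop_nth false) ?Sy // /= -/T {1}/y nth_mkseq //.
by rewrite /s4 /s3 /s2 /s1; congr (_ z); updt.
Qed.

Fixpoint initp i m := if m is m'.+1 then Seq (Write i (Some true)) (initp i.+1 m')
  else skip.

Lemma ex_initp i m c : (forall j, i <= j < i + m -> c j = blank) ->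
  ex (initp i m) c m.+1 (fun j => if i <= j < i + m then cnt 0 else c j).
Proof.
elim: m i c => [|m IH] i c H.
  apply: ex_eq (ex_skip _) _ => j; case: ifP => //; lia.
have E := ex_seq (ex_write i (Some true) c) (IH i.+1 _ _).
apply: ex_eq (E _) _.
  by move=> j Hj; rewrite updN ?H //; lia.
move=> j; rewrite H ?cnt0_blank /upd; last by lia.
case: (eqVneq j i) => [->|Hne].
  by rewrite ltnn leqnn /=; case: ifP => //; lia.
by case: ifP => H1; case: ifP => H2 //; lia.
Qed.

Lemma fits_initp i m N : 0 < N -> i + m <= N -> fits (initp i m) N.
Proof.
elim: m i => [|m IH] i HN H //=; apply/andP; split; first by lia.
by apply: IH => //; lia.
Qed.

(** * Composition with a reduction *)

Section State.
Variables (o top : nat) (s0 : tapes).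
Hypothesis Ho : 2 <= o.

(* Tapes [0] and [1], and the tapes from [o] on, the latter given by a list. *)
Definition st T0 T1 (l : seq atape) : tapes := fun j =>
  if j == 0 then T0 else if j == 1 then T1 else
  if (o <= j) && (j < top) then nth (cnt 0) l (j - o) else s0 j.

Lemma st_nth T0 T1 l i : o + i < top -> st T0 T1 l (o + i) = nth (cnt 0) l i.
Proof.
move=> Hi; rewrite /st leq_addr Hi addKn /=.
by case: eqP => H; [lia|case: eqP => H'; [lia|]].
Qed.

Lemma upd_st T0 T1 l i T : i < size l -> o + i < top ->
  upd (st T0 T1 l) (o + i) T = st T0 T1 (set_nth (cnt 0) l i T).
Proof.
move=> Hi Ht; apply: fext => j; rewrite /upd /st nth_set_nth /=.
case: eqP => [->|Hj].
  rewrite leq_addr Ht addKn eqxx /=.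
  by case: eqP => H; [lia|case: eqP => H'; [lia|]].
by case: ifP => // _; case: ifP => // _; case: ifP => // Hk; case: eqP => //; lia.
Qed.

Lemma upd_st0 T0 T1 l T : upd (st T0 T1 l) 0 T = st T T1 l.
Proof. by apply: fext => j; rewrite /upd /st; case: eqP. Qed.

Lemma upd_st1 T0 T1 l T : upd (st T0 T1 l) 1 T = st T0 T l.
Proof. by apply: fext => j; rewrite /upd /st; case: eqP => [->|]. Qed.

Lemma ex_def (mj : majorants) F c wi di rho p tp fr T0 T1 l x e v :
  implements mj F c (o + wi) [seq o + i | i <- rho] (o + di) fr p tp ->
  tp <= top -> o + size l <= fr -> fr <= tp -> all (gtn (size l)) rho ->
  wi < size l -> nth (cnt 0) l wi = wordt x ->
  [seq nth (cnt 0) l i | i <- rho] = [seq cnt i | i <- e] ->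
  di < size l -> nth (cnt 0) l di = cnt v ->
  ex p (st T0 T1 l) (mj c (size x + sumn e))
    (st T0 T1 (set_nth (cnt 0) l di (cnt (v + F x e)))).
Proof.
move=> HI Htp Hl Hfr Hrho Hwl Hw He Hdl Hd.
have Hs : size e = size rho by rewrite -(size_map cnt) -He size_map.
have Hin i : i < size l -> o + i < top by lia.
rewrite -upd_st // ?Hin //.
apply: (HI _ x e v); rewrite ?size_map ?st_nth ?Hin //.
- move=> i Hi; rewrite (nth_map 0) // st_nth; last first.
    by apply: Hin; apply: (allP Hrho); apply: mem_nth.
  by rewrite -(nth_map 0 (cnt 0) (nth (cnt 0) l)) // He (nth_map 0) // Hs.
- move=> j Hj; have -> : j = o + (j - o) by lia.
  by rewrite st_nth; [apply: nth_default|]; lia.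
Qed.

End State.

(** * A program for a reduction given by bounded recursion *)

Definition elem_fun (E : nat -> nat) := def elem (fun _ e => E (nth 0 e 0)).

Fixpoint all_elem (Es : seq (nat -> nat)) : Prop :=
  if Es is E :: Es' then elem_fun E /\ all_elem Es' else True.

Lemma elem_bnd E : elem_fun E -> exists c, forall k, E k <= tow c k.
Proof.
by move=> H; have [c Hc] := def_bnd H; exists c => k;
  have := Hc [::] [:: k]; rewrite /= addn0.
Qed.

Lemma all_elem_bnd Es : all_elem Es ->
  exists c, forall k, sumn [seq E k | E <- Es] <= tow c k.
Proof.
elim: Es => [|E Es IH] /=; first by exists 0.
case=> /elem_bnd [c1 H1] /IH [c2 H2].
have [c Hc] : exists c, forall k, tow c1 k * tow c2 k <= tow c k := mj_mul elem c1 c2.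
exists c => k; apply: leq_trans (Hc k).
have := H1 k; have := H2 k; have := tow_ge c1 k; have := tow_ge c2 k.
by move: (tow c1 k) (tow c2 k) => X Y *; nia.
Qed.

Lemma finalp_ex o c v T1 : 2 <= o -> c (o + 6) = cnt v -> c 1 = T1 ->
  ex (While (o + 6) nz (Seq (dec (o + 6)) (Seq (Move 1 MoveL) (Write 1 (Some true)))))
    c (v * 4).+1 (upd (upd c (o + 6) (cnt 0)) 1 (pushl (nseq v true) T1)).
Proof.
move=> Ho Hc H1.
pose S' q := upd (upd c (o + 6) (cnt q)) 1 (pushl (nseq (v - q) true) T1).
have E : c = S' v by rewrite /S' subnn /=; updt.
rewrite {1}E; clear E.
have -> : upd (upd c (o + 6) (cnt 0)) 1 (pushl (nseq v true) T1) = S' 0.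
  by rewrite /S' subn0.
apply: (ex_cnt_loop (b := 2)) => j Hj; first by rewrite /S'; updv.
apply: ex_eq (ex_seq (ex_move _ _ _) (ex_write _ _ _)) _ => z.
rewrite /S'; have -> : v - j = (v - j.+1).+1 by lia.
by congr (_ z); updv; updt.
Qed.

Section Main.
Variable o : nat.
Hypothesis Ho : 2 <= o.

Lemma placed_st fr wi di rho : o + wi < fr -> o + di < fr ->
  all (fun i => o + i < fr) rho -> di \notin rho -> wi \notin rho ->
  wi != di -> placed (o + wi) [seq o + i | i <- rho] (o + di) fr.
Proof.
move=> H1 H2 H3 H4 H5 H6; split=> //.
- by rewrite all_map.
- by rewrite mem_map //; apply: addnI.
split; first by rewrite eqn_add2l.
by rewrite mem_map //; apply: addnI.
Qed.

(* Counter [8] holds the parameter [k]; tape [1] is blank. *)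
Lemma Es_prog fr Es i0 : all_elem Es -> 8 < i0 -> o + (i0 + size Es) <= fr ->
  exists p tp h, [/\ fits p tp, fr <= tp &
  forall top s0 T0 T1 l k, tp <= top ->
    size l = i0 + size Es -> nth (cnt 0) l 1 = blank ->
    nth (cnt 0) l 8 = cnt k ->
    (forall i, i0 <= i -> nth (cnt 0) l i = cnt 0) ->
    ex p (st o top s0 T0 T1 l) (tow h k)
     (st o top s0 T0 T1 (take i0 l ++ [seq cnt (E k) | E <- Es]))].
Proof.
elim: Es i0 => [|E Es IH] i0 /=.
  move=> _ Hi Hf; exists skip, fr, 0; split=> //=; first by lia.
  move=> top s0 T0 T1 l k Ht Hl _ _ _; rewrite cats0 -(addn0 i0) -Hl take_size.
  by apply: ex_le (ex_skip _) _.
move=> [HE HEs] Hi Hf.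
have [p1 [t1 [h1 [Hf1 Ht1 H1]]]] := IH i0.+1 HEs ltac:(lia) ltac:(lia).
have [c Hc] := def_programmable HE.
have HP : placed (o + 1) [seq o + i | i <- [:: 8]] (o + i0) fr.
  by apply: placed_st; rewrite /= ?inE; lia.
have [p2 [t2 [Hf2 Ht2 HI]]] := Hc _ _ _ _ HP.
exists (Seq p2 p1), (maxn t1 t2), (maxn c h1).+1; split.
- by rewrite /= (fits_le Hf1) ?leq_maxl // (fits_le Hf2) ?leq_maxr.
- by lia.
move=> top s0 T0 T1 l k Ht Hl N1 N8 NZ.
have G1 := @ex_def o top s0 Ho elem _ c 1 i0 [:: 8] p2 t2 fr T0 T1 l [::] [:: k] 0 HI
  ltac:(lia) ltac:(lia) Ht2 ltac:(by rewrite /= andbT; lia) ltac:(lia)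
  ltac:(by rewrite N1 blank_wordt) ltac:(by rewrite /= N8) ltac:(lia) ltac:(exact: NZ).
set l1 := set_nth _ _ _ _ in G1.
have Sl1 : size l1 = i0.+1 + size Es by rewrite /l1 size_set_nth Hl; lia.
have Nl1 i : nth (cnt 0) l1 i = if i == i0 then cnt (E k) else nth (cnt 0) l i.
  by rewrite /l1 nth_set_nth.
have G2 := H1 top s0 T0 T1 l1 k ltac:(lia) Sl1 ltac:(by rewrite Nl1; case: eqP; [lia|])
   ltac:(by rewrite Nl1; case: eqP; [lia|])
   ltac:(by move=> i Hii; rewrite Nl1; case: eqP; [lia|move=> _; apply: NZ; lia]).
apply: ex_le (ex_eq (ex_seq G1 G2) _) _.
  move=> z; congr (st _ _ _ _ _ _ z).
  rewrite (take_nth (cnt 0)) ?Sl1; last by lia.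
  rewrite cat_rcons Nl1 eqxx; congr (_ ++ _ :: _).
  apply: (@eq_from_nth _ (cnt 0)).
    by rewrite !size_take Sl1 Hl; do ?case: ifP; lia.
  move=> i; rewrite size_take Sl1 => Hii; have Hi0 : i < i0 by move: Hii; case: ifP; lia.
  by rewrite !nth_take // Nl1; case: eqP => //; lia.
rewrite /= addn0.
have Ha : tow c k <= tow (maxn c h1) k by apply: (mj_mono elem); rewrite ?leq_maxl.
have Hb : tow h1 k <= tow (maxn c h1) k by apply: (mj_mono elem); rewrite ?leq_maxr.
set X := tow (maxn c h1) k in Ha Hb *.
have HX : X + X <= 2 ^ X.
  have : 2 <= X by apply: leq_trans (tow_ge _ _).
  case: (X) => // y _; rewrite expnS mul2n -addnn.
  by have := ltn_expl y (isT : 1 < 2); lia.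
by apply: leq_trans HX; rewrite add0n; apply: leq_add.
Qed.

Variables (Es : seq (nat -> nat)) (K : nat -> nat) (S N1 : seq nat -> nat)
  (b1 b N : seq bool -> seq nat -> nat).
Hypotheses (HEs : all_elem Es) (HK : elem_fun K)
  (HS : def poly (fun _ e => S e)) (HN1 : def poly (fun _ e => N1 e))
  (Hb1 : def poly b1) (Hb : def poly b) (HN : def poly N).

(** What a reduction may use besides the word: the size of the input, the parameter and finitely
    many elementary functions of it. With this fixed environment the word is rewritten [S] times,
    and the output is read off the last word letter by letter. *)
Definition env_of (x : seq bool) k := size x :: k :: [seq E k | E <- Es].
Definition word_step e (w : seq bool) := mkseq (fun i => b1 w (i :: e) != 0) (N1 e).
Definition word_of (x : seq bool) k :=
  iter (S (env_of x k)) (word_step (env_of x k)) x.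
Definition out_of (x : seq bool) k :=
  let w := word_of x k in
  mkseq (fun i => b w (i :: env_of x k) != 0) (N w (env_of x k)).

Lemma size_word_iter e x n : size (iter n (word_step e) x) <= size x + N1 e.
Proof. by case: n => [|n] /=; rewrite ?leq_addr // size_mkseq leq_addl. Qed.

(** The tapes from [o] on: the word, a second word tape, then counters for auxiliary use, the length
    to emit, a letter, the rounds left and the new parameter; the environment starts at offset 7,
    with the parameter at 8. *)
Definition LL W1 W2 t vN vb vS vK (e : seq nat) : seq atape :=
  [:: W1, W2, cnt t, cnt vN, cnt vb, cnt vS, cnt vK & [seq cnt i | i <- e]].

Lemma LL_env W1 W2 t vN vb vS vK e :
  [seq nth (cnt 0) (LL W1 W2 t vN vb vS vK e) i | i <- iota 7 (size e)]
  = [seq cnt i | i <- e].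
Proof.
have -> : 7 = 7 + 0 by []; rewrite iotaDl -map_comp.
rewrite (eq_map (_ : _ =1 nth (cnt 0) [seq cnt i | i <- e])) //.
by rewrite -{1}(size_map cnt) -/(mkseq _ _) mkseq_nth.
Qed.

Let n := size Es.
Let fr := o + 9 + n.
Let rho := iota 7 (n + 2).

Lemma rho_all : all (fun i => o + i < fr) rho.
Proof. by apply/allP => i; rewrite mem_iota /fr; lia. Qed.

Lemma loop_prog : exists p tp (T : seq bool -> seq nat -> nat),
  [/\ fits p tp, fr <= tp, bnd poly T &
  forall top s0 T0 T1 e x vS vK, tp <= top -> size e = n + 2 ->
    ex p (st o top s0 T0 T1 (LL (wordt x) blank 0 0 0 vS vK e)) (vS * T x e).+1
      (st o top s0 T0 T1
        (LL (wordt (iter vS (word_step e) x)) blank 0 0 0 0 vK e))].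
Proof.
have [cN PN] := def_programmable HN1.
have HPN : placed (o + 1) [seq o + i | i <- rho] (o + 3) fr.
  by apply: placed_st; rewrite ?rho_all /fr /rho ?mem_iota //; lia.
have [pN [tN [FN TN IN]]] := PN _ _ _ _ HPN.
have [cb Pb] := def_programmable Hb1.
have HPb : placed (o + 0) [seq o + i | i <- 3 :: rho] (o + 4) fr.
  by apply: placed_st; rewrite /= ?rho_all /fr /rho ?inE ?mem_iota //=; lia.
have [pb [tb [Fb Tb Ib]]] := Pb _ _ _ _ HPb.
have [cm Hm] := def_bnd Hb1.
(* The next word is emitted on the second word tape while the old one is still read, and then
   replaces it. *)
pose body := Seq pN (Seq (emitp (o + 1) (o + 3) (o + 4) pb) (Seq (erasep (o + 0))
  (Seq (copyp (o + 1) (o + 0) (o + 2) (o + 4)) (clr (o + 4))))).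
pose X (x : seq bool) e := size x + N1 e + (N1 e + sumn e).
pose T1f x e := poly cN (sumn e) + ((N1 e * (poly cb (X x e) + poly cm (X x e) * 3 + 6)).+1
  + (((size x + N1 e) * 3).+1 + ((N1 e * 12 + 3) + (N1 e * 3).+1))).
pose T (x : seq bool) e := (T1f x e).+2.
exists (While (o + 5) nz (Seq (dec (o + 5)) body)), (maxn tN tb), T; split.
- have F1 : fits pN (maxn tN tb) by apply: fits_le FN _; lia.
  have F2 : fits pb (maxn tN tb) by apply: fits_le Fb _; lia.
  by move: TN Tb; rewrite /= F1 F2 /fr /= => *; do ?(apply/andP; split); lia.
- by lia.
- have BN := def_bnd HN1.
  by rewrite /T /T1f /X; bounded.
move=> top s0 T0 T1 e x vS vK Htop He.
pose w q := iter q (word_step e) x.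
pose Sq q := st o top s0 T0 T1 (LL (wordt (w (vS - q))) blank 0 0 0 q vK e).
have -> : st o top s0 T0 T1 (LL (wordt x) blank 0 0 0 vS vK e) = Sq vS.
  by rewrite /Sq subnn.
have -> : st o top s0 T0 T1 (LL (wordt (iter vS (word_step e) x)) blank 0 0 0 0 vK e)
    = Sq 0 by rewrite /Sq subn0.
have Hlt i : i < 9 + n -> o + i < top by rewrite /fr in TN; lia.
have SL W1 W2 t a2 a3 a4 a5 : size (LL W1 W2 t a2 a3 a4 a5 e) = 9 + n.
  by rewrite /= size_map He; lia.
have Hrho : iota 7 (size e) = rho by rewrite He /rho.
have US T0' T1' W1 W2 t a2 a3 a4 a5 i T' : i < 7 ->
   upd (st o top s0 T0' T1' (LL W1 W2 t a2 a3 a4 a5 e)) (o + i) T' =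
   st o top s0 T0' T1' (set_nth (cnt 0) (LL W1 W2 t a2 a3 a4 a5 e) i T').
  by move=> Hi; apply: upd_st; rewrite ?SL //; [lia|apply: Hlt; lia].
have SN T0' T1' W1 W2 t a2 a3 a4 a5 i : i < 7 ->
   st o top s0 T0' T1' (LL W1 W2 t a2 a3 a4 a5 e) (o + i) =
   nth (cnt 0) (LL W1 W2 t a2 a3 a4 a5 e) i.
  by move=> Hi; apply: st_nth => //; apply: Hlt; lia.
apply: (ex_cnt_loop (b := T1f x e)).
  by move=> j _; rewrite /Sq SN.
move=> j Hj; rewrite {1}/Sq US //=.
set w0 := w _.
have Hw1 : w (vS - j) = word_step e w0.
  by rewrite /w0 /w -iterS; congr (iter _ _ _); lia.
have Hsw : size w0 <= size x + N1 e by apply: size_word_iter.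
have Hal W1 W2 t a2 a3 a4 a5 : all (gtn (size (LL W1 W2 t a2 a3 a4 a5 e))) rho.
  by apply/allP => i; rewrite mem_iota SL /=; lia.
have Hfrl W1 W2 t a2 a3 a4 a5 : o + size (LL W1 W2 t a2 a3 a4 a5 e) <= fr.
  by rewrite SL /fr; lia.
have G1 := @ex_def o top s0 Ho poly _ cN 1 3 rho pN tN fr T0 T1
  (LL (wordt w0) blank 0 0 0 j vK e) [::] e 0 IN ltac:(lia) (Hfrl _ _ _ _ _ _ _) TN
  (Hal _ _ _ _ _ _ _) ltac:(by rewrite SL; lia) blank_wordt
  ltac:(by rewrite -Hrho LL_env) ltac:(by rewrite SL; lia) (erefl _).
rewrite /= !add0n in G1.
have G2 := @ex_emitp (o + 1) (o + 3) (o + 4) pb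
  (st o top s0 T0 T1 (LL (wordt w0) blank 0 (N1 e) 0 j vK e)) (N1 e)
  (fun i => b1 w0 (i :: e)) (poly cb (X x e)) (poly cm (X x e)).
have {G2} G2 := G2 ltac:(by rewrite /= !inE; lia) ltac:(by rewrite SN)
  ltac:(by rewrite SN).
have HX i : i < N1 e -> size w0 + (i + sumn e) <= X x e by rewrite /X; lia.
have {G2} G2 := G2 (fun i Hi => leq_trans (Hm w0 (i :: e))
   (mj_mono poly (leqnn cm) (HX i Hi))).
have G2' i T' : i < N1 e -> ex pb
  (upd (upd (st o top s0 T0 T1 (LL (wordt w0) blank 0 (N1 e) 0 j vK e)) (o + 3)
     (cnt i)) (o + 1) T') (poly cb (X x e))
  (upd (upd (upd (st o top s0 T0 T1 (LL (wordt w0) blank 0 (N1 e) 0 j vK e)) (o + 3)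
     (cnt i)) (o + 1) T') (o + 4) (cnt (b1 w0 (i :: e)))).
  move=> Hi; rewrite (US _ _ _ _ _ _ _ _ _ 3) //= -/(LL _ _ _ _ _ _ _ _).
  rewrite (US _ _ _ _ _ _ _ _ _ 1) //= -/(LL _ _ _ _ _ _ _ _).
  rewrite (US _ _ _ _ _ _ _ _ _ 4) //.
  apply: ex_le (mj_mono poly (leqnn cb) (HX i Hi)).
  apply: (@ex_def o top s0 Ho poly b1 cb 0 4 (3 :: rho) pb tb fr T0 T1
    (LL (wordt w0) T' 0 i 0 j vK e) w0 (i :: e) 0) => //; try lia.
  - by rewrite /= Hal.
  - by rewrite [LHS]/= -Hrho LL_env.
have {G2' G2} G2 := G2 G2'.
rewrite (US _ _ _ _ _ _ _ _ _ 3) //= -/(LL _ _ _ _ _ _ _ _) in G2.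
rewrite (US _ _ _ _ _ _ _ _ _ 1) //= SN //= pushl_blank in G2.
rewrite -/(word_step e w0) -/(LL _ _ _ _ _ _ _ _) in G2.
set w1 := word_step e w0 in G2 Hw1.
have G3 := @ex_erasep (o + 0) (st o top s0 T0 T1 (LL (wordt w0) (wordt w1) 0 0 0 j vK e))
   w0 ltac:(by rewrite SN).
rewrite US //= -/(LL _ _ _ _ _ _ _ _) in G3.
have G4 := @ex_copyp (o + 1) (o + 0) (o + 2) (o + 4)
  (st o top s0 T0 T1 (LL blank (wordt w1) 0 0 0 j vK e)) w1 0
  ltac:(by rewrite /= !inE; lia) ltac:(by rewrite SN) ltac:(by rewrite SN)
  ltac:(by rewrite SN) ltac:(by rewrite SN).
rewrite SN // [nth _ _ _]/= eat_word drop_size -blank_wordt in G4.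
rewrite (US _ _ _ _ _ _ _ _ _ 1) // [set_nth _ _ _ _]/= -/(LL _ _ _ _ _ _ _ _) in G4.
rewrite (US _ _ _ _ _ _ _ _ _ 0) // [set_nth _ _ _ _]/= -/(LL _ _ _ _ _ _ _ _) in G4.
rewrite (US _ _ _ _ _ _ _ _ _ 4) // [set_nth _ _ _ _]/= -/(LL _ _ _ _ _ _ _ _) in G4.
rewrite add0n in G4.
have G5 := @ex_clr (o + 4) (st o top s0 T0 T1 (LL (wordt w1) blank 0 0 (size w1) j vK e))
   (size w1) ltac:(by rewrite SN).
rewrite US // [set_nth _ _ _ _]/= -/(LL _ _ _ _ _ _ _ _) in G5.
have Sw1 : size w1 = N1 e by rewrite size_mkseq.
rewrite /Sq Hw1; apply: ex_le (ex_seq G1 (ex_seq G2 (ex_seq G3 (ex_seq G4 G5)))) _.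
by rewrite /T1f Sw1 /= !leq_add2l leq_add2r ltnS leq_mul2r Hsw orbT.
Qed.

End Main.

Section Main.
Variable o : nat.
Hypothesis Ho : 2 <= o.
Variables (Es : seq (nat -> nat)) (K : nat -> nat) (S N1 : seq nat -> nat)
  (b1 b N : seq bool -> seq nat -> nat).
Hypotheses (HEs : all_elem Es) (HK : elem_fun K)
  (HS : def poly (fun _ e => S e)) (HN1 : def poly (fun _ e => N1 e))
  (Hb1 : def poly b1) (Hb : def poly b) (HN : def poly N).
Let n := size Es.
Let fr := o + 9 + n.
Let rho := iota 7 (n + 2).

(** The bound keeps the parameter inside a tower and the word inside a polynomial, the shape that
    composes with another reduction. *)
Lemma main_prog : exists p top c h, [/\ fits p top, o <= top &
  forall s x k, has_word (s 0) x -> has_word (s 1) (nseq k true) ->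
    (forall j, o <= j < top -> s j = blank) ->
    exists s', [/\ ex p s ((size x + tow h k) ^ c) s',
      has_word (s' 0) (out_of Es S N1 b1 b N x k) & has_word (s' 1) (nseq (K k) true)]].
Proof.
have [pE [tE [hE [FE TE IE]]]] := @Es_prog o Ho fr Es 9 HEs isT ltac:(rewrite /fr; lia).
have [cK PK] := def_programmable HK.
have HPK : placed (o + 1) [seq o + i | i <- [:: 8]] (o + 6) fr.
  by apply: placed_st; rewrite /= ?inE /fr //; lia.
have [pK [tK [FK TK IK]]] := PK _ _ _ _ HPK.
have [cS PS] := def_programmable HS.
have HPS : placed (o + 1) [seq o + i | i <- rho] (o + 5) fr.
  by apply: placed_st; rewrite ?(rho_all Ho Es) /fr /rho ?mem_iota //; lia.
have [pS [tS [FS TS IS]]] := PS _ _ _ _ HPS.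
have [pL [tL [TLf [FL TL BL IL]]]] := loop_prog Ho Es HN1 Hb1.
have [cN PN] := def_programmable HN.
have HPN : placed (o + 0) [seq o + i | i <- rho] (o + 3) fr.
  by apply: placed_st; rewrite ?(rho_all Ho Es) /fr /rho ?mem_iota //; lia.
have [pN [tN [FN TN IN]]] := PN _ _ _ _ HPN.
have [cb Pb] := def_programmable Hb.
have HPb : placed (o + 0) [seq o + i | i <- 3 :: rho] (o + 4) fr.
  by apply: placed_st; rewrite /= ?(rho_all Ho Es) /fr /rho ?inE ?mem_iota //=; lia.
have [pb [tb [Fb Tb Ib]]] := Pb _ _ _ _ HPb.
have [cmN HmN] := def_bnd HN.
have [cm Hm] := def_bnd Hb.
have [cE HcE] := all_elem_bnd HEs.
have [cK' HcK] := elem_bnd HK.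
set top := maxn tE (maxn tK (maxn tS (maxn tL (maxn tN tb)))).
pose finalp := While (o + 6) nz (Seq (dec (o + 6)) (Seq (Move 1 MoveL) (Write 1 (Some true)))).
pose p := Seq (initp (o + 2) (top - (o + 2))) (Seq (copyp 0 (o + 0) (o + 2) (o + 7))
  (Seq (readp 1 (o + 8)) (Seq pE (Seq pK (Seq pS (Seq pL (Seq pN
    (Seq (emitp 0 (o + 3) (o + 4) pb) finalp)))))))).
pose X (x : seq bool) e := size x + N1 e + sumn e.
pose Y x e := X x e + poly cmN (X x e).
pose TP x e := top + (size x * 12 + 3 + ((sumn e * 3).+1 + (poly cS (sumn e) +
  ((S e * TLf x e).+1 + (poly cN (X x e) + (poly cmN (X x e) *
   (poly cb (Y x e) + poly cm (Y x e) * 3 + 6)).+1))))).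
have BTP : bnd poly TP.
  have BS := def_bnd HS; have BN1 := def_bnd HN1.
  by rewrite /TP /Y /X; bounded.
have [cP HcP] := BTP.
have [h Hh] : exists h, forall k,
   k + tow cE k + tow hE k + tow cK k + tow cK' k * 4 + 4 <= tow h k.
  have D : def elem (fun _ e => nth 0 e 0 + tow cE (nth 0 e 0) + tow hE (nth 0 e 0)
     + tow cK (nth 0 e 0) + tow cK' (nth 0 e 0) * 4 + 4).
    by repeat first [apply: def_add | apply: def_mul | apply: d_const |
       apply: def_tow | apply: d_var].
  have [c Hc] := def_bnd D; exists c => k; have := Hc [::] [:: k].
  by rewrite /= addn0.
(* The input size counts twice, as a word and as a counter. Squaring absorbs this factor 2, whence
   the doubled exponent. *)
exists p, top, (cP + 1).*2.+2, h.
have Htop : fr <= top by rewrite /top; lia.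
have LE : [/\ tE <= top, tK <= top, tS <= top, tL <= top & (tN <= top) && (tb <= top)].
  by rewrite /top; split; lia.
case: LE => lE lK lS lL /andP[lN lb].
clearbody top.
have Hlt i : i < 9 + n -> o + i < top by move: Htop; rewrite /fr; lia.
have Ht0 : (0 < top) && (1 < top) by have := Hlt 0 isT; lia.
split; [|by move: Htop; rewrite /fr; lia|].
  rewrite /p /= (fits_le FE lE) (fits_le FK lK) (fits_le FS lS) (fits_le FL lL).
  have F0 : fits (initp (o + 2) (top - (o + 2))) top.
    by apply: fits_initp; move: Htop; rewrite /fr; lia.
  by case/andP: Ht0 => t0 t1; rewrite (fits_le FN lN) (fits_le Fb lb) F0 /= t0 t1 !Hlt.
move=> s x k H0 H1 Hblank.
pose e0 := 0 :: 0 :: nseq n 0.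
pose st' := st o top s.
have SL W1 W2 t a2 a3 a4 a5 e : size e = n + 2 ->
   size (LL W1 W2 t a2 a3 a4 a5 e) = 9 + n.
  by move=> He; rewrite /= size_map He; lia.
have US T0' T1' W1 W2 t a2 a3 a4 a5 e i T' : size e = n + 2 -> i < 9 ->
   upd (st' T0' T1' (LL W1 W2 t a2 a3 a4 a5 e)) (o + i) T' =
   st' T0' T1' (set_nth (cnt 0) (LL W1 W2 t a2 a3 a4 a5 e) i T').
  by move=> He Hi; apply: upd_st; rewrite ?SL //; [lia|apply: Hlt; lia].
have SN T0' T1' W1 W2 t a2 a3 a4 a5 e i : i < 9 ->
   st' T0' T1' (LL W1 W2 t a2 a3 a4 a5 e) (o + i) =
   nth (cnt 0) (LL W1 W2 t a2 a3 a4 a5 e) i.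
  by move=> Hi; apply: st_nth => //; apply: Hlt; lia.
have Hal W1 W2 t a2 a3 a4 a5 e : size e = n + 2 ->
   all (gtn (size (LL W1 W2 t a2 a3 a4 a5 e))) rho.
  by move=> He; apply/allP => i; rewrite mem_iota SL //=; lia.
have Hfrl W1 W2 t a2 a3 a4 a5 e : size e = n + 2 ->
   o + size (LL W1 W2 t a2 a3 a4 a5 e) <= fr.
  by move=> He; rewrite SL // /fr; lia.
have Se0 : size e0 = n + 2 by rewrite /= size_nseq; lia.
set T0 := s 0; set T1 := s 1.
have G1 : ex (initp (o + 2) (top - (o + 2))) s top (st' T0 T1 (LL blank blank 0 0 0 0 0 e0)).
  apply: ex_le (ex_eq (ex_initp _) _) _.
  - by move=> j Hj; apply: Hblank; lia.
  - move=> j; rewrite /st' /st.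
    case: (eqVneq j 0) => [->|j0]; first by case: ifP => //; lia.
    case: (eqVneq j 1) => [->|j1]; first by case: ifP => //; lia.
    case: (leqP o j) => Hj /=; last by case: ifP => //; lia.
    case: (ltnP j top) => Hjt /=; last by case: ifP => //; lia.
    have [i Ei] : exists i, j = o + i by exists (j - o); lia.
    move: Hjt; rewrite Ei addKn {j j0 j1 Hj Ei} => Hit.
    case: ifP => Hi2; last first.
      rewrite Hblank; last by lia.
      by move: i Hi2 Hit => [|[|i]] // Hi2 Hit; lia.
    move: i Hi2 {Hit} => [|[|[|[|[|[|[|[|[|i]]]]]]]]] //= H; try by lia.
    by rewrite map_nseq nth_nseq if_same.
  - by move: Htop; rewrite /fr; lia.
have G2 := @ex_copyp 0 (o + 0) (o + 2) (o + 7) (st' T0 T1 (LL blank blank 0 0 0 0 0 e0))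
  x 0 ltac:(by rewrite /= !inE; lia) H0 ltac:(by rewrite SN) ltac:(by rewrite SN)
  ltac:(by rewrite SN).
rewrite upd_st0 US // [set_nth _ _ _ _]/= in G2.
rewrite -/(LL (wordt x) blank 0 0 0 0 0 e0) US // [set_nth _ _ _ _]/= add0n in G2.
set T0' := eat _ _ in G2.
pose e1 := size x :: 0 :: nseq n 0.
have Se1 : size e1 = n + 2 by rewrite /= size_nseq; lia.
rewrite -/(LL (wordt x) blank 0 0 0 0 0 e1) in G2.
(* The head must rest on a blank, which will end the output pushed to its left. *)
have HT0' : T0'.2 0 = None.
  by rewrite /T0' eat_right addn0 H0 // nth_default // size_map.
have G3 := @ex_readp 1 (o + 8) (st' T0' T1 (LL (wordt x) blank 0 0 0 0 0 e1))
  (nseq k true) 0 ltac:(lia) H1 ltac:(by rewrite SN).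
rewrite upd_st1 // US // [set_nth _ _ _ _]/= add0n size_nseq in G3.
set T1' := iter _ _ _ in G3.
pose e2 := size x :: k :: nseq n 0.
have Se2 : size e2 = n + 2 by rewrite /= size_nseq; lia.
rewrite -/(LL (wordt x) blank 0 0 0 0 0 e2) in G3.
have HT1' : T1'.2 0 = None.
  rewrite /T1' -/(aread _) readR; have := H1 k; rewrite size_nseq leqnn => /(_ isT) ->.
  by rewrite nth_default // size_map size_nseq.
have G4 := IE top s T0' T1' (LL (wordt x) blank 0 0 0 0 0 e2) k lE
  ltac:(by rewrite SL) (erefl _) (erefl _).
have {G4} G4 := G4 ltac:(by move=> [|[|[|[|[|[|[|[|[|i]]]]]]]]] // _ /=;
   rewrite map_nseq nth_nseq if_same).
set e := env_of Es x k.
have Se : size e = n + 2 by rewrite /= size_map addn2.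
have EL : take 9 (LL (wordt x) blank 0 0 0 0 0 e2) ++ [seq cnt (E k) | E <- Es]
  = LL (wordt x) blank 0 0 0 0 0 e.
  have -> : [seq cnt (E k) | E <- Es] = map cnt [seq E k | E <- Es].
    by rewrite -map_comp.
  by rewrite /= take0.
rewrite EL in G4.
have Hrho : iota 7 (size e) = rho by rewrite Se.
have G5 := @ex_def o top s Ho elem _ cK 1 6 [:: 8] pK tK fr T0' T1'
  (LL (wordt x) blank 0 0 0 0 0 e) [::] [:: k] 0 IK lK (Hfrl _ _ _ _ _ _ _ _ Se) TK
  ltac:(by rewrite SL) ltac:(by rewrite SL) blank_wordt (erefl _)
  ltac:(by rewrite SL) (erefl _).
rewrite [set_nth _ _ _ _]/= add0n in G5.
rewrite -/(LL (wordt x) blank 0 0 0 0 (K k) e) in G5.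
have G6 := @ex_def o top s Ho poly _ cS 1 5 rho pS tS fr T0' T1'
  (LL (wordt x) blank 0 0 0 0 (K k) e) [::] e 0 IS lS (Hfrl _ _ _ _ _ _ _ _ Se) TS
  (Hal _ _ _ _ _ _ _ _ Se) ltac:(by rewrite SL) blank_wordt
  ltac:(by rewrite -Hrho LL_env) ltac:(by rewrite SL) (erefl _).
rewrite [set_nth _ _ _ _]/= add0n in G6.
rewrite -/(LL (wordt x) blank 0 0 0 (S e) (K k) e) in G6.
have G7 := IL top s T0' T1' e x (S e) (K k) lL Se.
rewrite -/(word_of Es S N1 b1 x k) in G7; set w := word_of Es S N1 b1 x k in G7.
have Hsw : size w <= size x + N1 e by apply: size_word_iter.
have HXw : size w + sumn e <= X x e by rewrite /X leq_add2r.
have G8 := @ex_def o top s Ho poly _ cN 0 3 rho pN tN fr T0' T1'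
  (LL (wordt w) blank 0 0 0 0 (K k) e) w e 0 IN lN (Hfrl _ _ _ _ _ _ _ _ Se) TN
  (Hal _ _ _ _ _ _ _ _ Se) ltac:(by rewrite SL) (erefl _)
  ltac:(by rewrite -Hrho LL_env) ltac:(by rewrite SL) (erefl _).
rewrite [set_nth _ _ _ _]/= add0n in G8.
set vN := N w e in G8.
rewrite -/(LL (wordt w) blank 0 vN 0 0 (K k) e) in G8.
have HvN : vN <= poly cmN (X x e).
  by apply: leq_trans (HmN w e) _; apply: (mj_mono poly).
have HY i : i < vN -> size w + (i + sumn e) <= Y x e by rewrite /Y; lia.
have G9 := @ex_emitp 0 (o + 3) (o + 4) pb
  (st' T0' T1' (LL (wordt w) blank 0 vN 0 0 (K k) e)) vN
  (fun i => b w (i :: e)) (poly cb (Y x e)) (poly cm (Y x e))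
  ltac:(by rewrite /= !inE; lia) ltac:(by rewrite SN) ltac:(by rewrite SN)
  (fun i Hi => leq_trans (Hm w (i :: e)) (mj_mono poly (leqnn cm) (HY i Hi))).
have G9' i T' : i < vN -> ex pb
  (upd (upd (st' T0' T1' (LL (wordt w) blank 0 vN 0 0 (K k) e)) (o + 3)
     (cnt i)) 0 T') (poly cb (Y x e))
  (upd (upd (upd (st' T0' T1' (LL (wordt w) blank 0 vN 0 0 (K k) e)) (o + 3)
     (cnt i)) 0 T') (o + 4) (cnt (b w (i :: e)))).
  move=> Hi; rewrite US // [set_nth _ _ _ _]/=.
  rewrite -/(LL (wordt w) blank 0 i 0 0 (K k) e) upd_st0 US //.
  apply: ex_le (mj_mono poly (leqnn cb) (HY i Hi)).
  apply: (@ex_def o top s Ho poly b cb 0 4 (3 :: rho) pb tb fr T' T1'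
    (LL (wordt w) blank 0 i 0 0 (K k) e) w (i :: e) 0) => //.
  - exact: Hfrl.
  - by apply/andP; split; [rewrite SL|exact: Hal].
  - by rewrite [LHS]/= -Hrho LL_env.
have {G9' G9} G9 := G9 G9'.
rewrite US // [set_nth _ _ _ _]/= -/(LL (wordt w) blank 0 0 0 0 (K k) e) upd_st0 in G9.
set T0'' := pushl _ _ in G9.
have G10 := @finalp_ex o (st' T0'' T1' (LL (wordt w) blank 0 0 0 0 (K k) e)) (K k) T1'
  Ho ltac:(by rewrite SN) (erefl _).
rewrite US // upd_st1 in G10.
pose sf := st' T0'' (pushl (nseq (K k) true) T1')
  (set_nth (cnt 0) (LL (wordt w) blank 0 0 0 0 (K k) e) 6 (cnt 0)).
have Hl1 : size x + sumn e + 2 <= size x * 2 + tow h k.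
  have := HcE k; have := Hh k; rewrite /e /env_of /=; lia.
exists sf; split.
- have C9 := ex_seq G9 G10.
  have C8 := ex_seq G8 C9.
  have C7 := ex_seq G7 C8.
  have C6 := ex_seq G6 C7.
  have C5 := ex_seq G5 C6.
  have C4 := ex_seq G4 C5.
  have C3 := ex_seq G3 C4.
  have C2 := ex_seq G2 C3.
  have C1 := ex_seq G1 C2.
  apply: ex_le C1 _.
  have Hin : k <= sumn e by rewrite /e /env_of /=; lia.
  have HT : TP x e <= (size x * 2 + tow h k) ^ cP.
    apply: leq_trans (HcP x e) _; rewrite /=; case: (cP) => // cP'.
    rewrite leq_exp2r //. by rewrite -addn2.
  have HkA := Hh k; have HK' := HcK k.
  set A := tow h k in HT HkA *; set X0 := size x in HT *.
  set t := (X in X <= _); have Ht : t <= TP x e + A.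
    rewrite /t /TP /= !addn0 !add0n.
    have B1 : (size w + sumn e).+2 ^ cN <= (X x e).+2 ^ cN.
      by case: (cN) => // q; rewrite leq_exp2r.
    have B2 : vN * ((Y x e).+2 ^ cb + (Y x e).+2 ^ cm * 3 + 6) <=
       (X x e).+2 ^ cmN * ((Y x e).+2 ^ cb + (Y x e).+2 ^ cm * 3 + 6).
      by rewrite leq_mul2r HvN orbT.
    by move: B1 B2 => /=; rewrite -/X0; clear -HkA HK'; lia.
  apply: leq_trans Ht _.
  have HA : 4 <= A by lia.
  have H3 : TP x e + A <= (X0 * 2 + A) ^ cP.+2.
    apply: leq_trans (leq_add HT (leqnn _)) _; rewrite 2!expnS.
    set B := X0 * 2 + A.
    have HB : A <= B by apply: leq_addl.
    have : 0 < B ^ cP by rewrite expn_gt0; apply/orP; left; lia.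
    move: (B ^ cP) => Z HZ; clear -HA HB HZ.
    apply: (@leq_trans (2 * (B * Z))); last by rewrite leq_mul2r; apply/orP; right; lia.
    have H1 : Z <= B * Z by apply: leq_pmull; lia.
    have H2 : B <= B * Z by apply: leq_pmulr.
    by lia.
  apply: leq_trans H3 _.
  apply: (@leq_trans (((X0 + A) ^ 2) ^ cP.+2)).
    rewrite leq_exp2r // expnS expn1; clear -HA.
    by apply: (@leq_trans (2 * (X0 + A))); [lia|rewrite leq_mul2r; apply/orP; right; lia].
  by rewrite -expnM leq_pexp2l //; clear -HA; lia.
- by apply: pushl_word.
- by apply: pushl_word.
Qed.

End Main.

(** * Composition of machines and computable bounds *)

Definition pushp i t a :=
  Seq (While i nz (Seq (dec i) (Seq (inc t) (Seq (Move a MoveL) (Write a (Some true))))))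
    (mv t i).

Lemma ex_pushp i t a c v : c i = cnt v -> c t = cnt 0 -> i != t -> i != a -> t != a ->
  exists b, ex (pushp i t a) c b (upd c a (pushl (nseq v true) (c a))).
Proof.
move=> Hi Ht Hit Hia Hta.
pose S q := upd (upd (upd c i (cnt q)) t (cnt (v - q))) a (pushl (nseq (v - q) true) (c a)).
have E : c = S v by rewrite /S subnn /=; updt.
have G1 : ex (While i nz (Seq (dec i) (Seq (inc t) (Seq (Move a MoveL) (Write a (Some true))))))
   (S v) (v * (1 + (1 + 1)).+2).+1 (S 0).
  apply: ex_cnt_loop => j Hj; first by rewrite /S; updv.
  have F : upd (S j.+1) i (cnt j) t = cnt (v - j.+1) by rewrite /S; updv.
  apply: ex_eq (ex_seq (ex_inc F) (ex_seq (ex_move _ _ _) (ex_write _ _ _))) _ => z.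
  rewrite /S; have -> : v - j = (v - j.+1).+1 by lia.
  by congr (_ z); updv; updt.
have G2 := @ex_mv t i (S 0) v 0 ltac:(by rewrite /S subn0; updv)
  ltac:(by rewrite /S; updv) ltac:(by rewrite eq_sym).
eexists; rewrite {1}E; clear E; apply: ex_eq (ex_seq G1 G2) _ => z.
by congr (_ z); rewrite /S subn0; updt.
Qed.

Lemma call_post_out o M c tp j : (j < o) || (o + (work_tapes M).+2 <= j) ->
  @call_post o M c tp j = c j.
Proof.
move=> H; rewrite /call_post; case: leqP => // Hj; case: insubP => // i Hi _.
by move: Hi H Hj; lia.
Qed.

Lemma call_post_in o M c tp (i : 'I_(work_tapes M).+2) :
  @call_post o M c tp (o + i) = view (tp i).
Proof. by rewrite /call_post leq_addr addKn valK. Qed.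

(** The bounds [f] and [g] of a reduction are given by machines only. These are called as black
    boxes on disjoint blocks of tapes, before the elementary part runs. *)
Lemma computable2 f g F : computable f -> computable g -> def elem F ->
  computable (fun k => F [::] [:: f k; g k; k]).
Proof.
move=> [Mf Hf] [Mg Hg] HF.
set og := 2 + (work_tapes Mf).+2; set o := og + (work_tapes Mg).+2.
have Hog : 4 <= og by rewrite /og; lia.
have Ho : og + 2 <= o by rewrite /o; lia.
have [c Hc] := def_programmable HF.
have HP : placed o [:: o + 3; o + 4; o + 1] (o + 5) (o + 6).
  by split; rewrite /= ?inE; lia.
have [pF [top [Fp Tp IF]]] := Hc _ _ _ _ HP.
pose p := Seq (initp (o + 1) (top - (o + 1))) (Seq (readp 1 (o + 1))
  (Seq (pushp (o + 1) (o + 2) 3) (Seq (Call 2 Mf) (Seq (readp 3 (o + 3))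
  (Seq (pushp (o + 1) (o + 2) (og + 1)) (Seq (Call og Mg) (Seq (readp (og + 1) (o + 4))
  (Seq pF (pushp (o + 5) (o + 2) 1))))))))).
exists (machine_of p (top - 2)) => k.
have [t1 [x1 C1]] := Hf k; have [t2 [x2 C2]] := Hg k.
case: C1 => s1 _ /= [Hh1 _ W1]; case: C2 => s2 _ /= [Hh2 _ W2].
pose c0 := initial [::] k.
have B0 j : j != 1 -> c0 j = blank.
  by case: j => [|[|j]] // _; rewrite /c0 /= -blank_view.
have G1 := @ex_initp (o + 1) (top - (o + 1)) c0 ltac:(by move=> j Hj; apply: B0; lia).
set c1 := fun j => _ in G1.
have V1 j : o < j < top -> c1 j = cnt 0 by move=> Hj; rewrite /c1; case: ifP => //; lia.
have O1 j : j <= o -> c1 j = c0 j by move=> Hj; rewrite /c1; case: ifP => //; lia.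
have G2 := @ex_readp 1 (o + 1) c1 (nseq k true) 0 ltac:(lia)
  ltac:(by rewrite O1; [apply: wordt_has|lia]) (V1 (o + 1) ltac:(lia)).
rewrite add0n size_nseq in G2; set T1 := iter _ _ _ in G2.
have HT1 : T1.2 0 = None.
  rewrite /T1 -/(aread _) readR O1 /=; last by lia.
  by rewrite nth_default // size_map size_nseq.
set c2 := upd _ _ _ in G2.
have [b3 G3] := @ex_pushp (o + 1) (o + 2) 3 c2 k ltac:(by rewrite /c2; updv)
  ltac:(by rewrite /c2; updv; apply: V1; lia) ltac:(lia) ltac:(lia) ltac:(lia).
have E3 : c2 3 = blank by rewrite /c2; updv; rewrite O1 ?B0 //; lia.
rewrite E3 pushl_blank in G3; set c3 := upd _ _ _ in G3.
have I3 (i : 'I_(work_tapes Mf).+2) : c3 (2 + i) = view ((init Mf [::] k).2 i).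
  rewrite view_init; case: (eqVneq (nat_of_ord i) 1) => [->|Hi]; first by rewrite /c3; updv.
  rewrite -/c0 B0 //; have Hi2 : 2 + i < og by have := ltn_ord i; rewrite /og; lia.
  by rewrite /c3 /c2; updv; rewrite O1 ?B0 //; lia.
have G4 := @ex_call 2 Mf c3 [::] k s1 I3 Hh1.
set tp1 := (iter s1 _ _).2 in G4 W1; set c4 := call_post _ _ _ in G4.
have O4 j : (j < 2) || (og <= j) -> c4 j = c3 j by move=> Hj; apply: call_post_out.
have E4 : has_word (c4 3) (nseq (f k) true).
  rewrite -[3]/(2 + val (lift ord0 ord0 : 'I_(work_tapes Mf).+2)) /c4 call_post_in.
  by apply/tape_wordP.
have E4b : c4 (o + 3) = cnt 0 by rewrite O4 /c3 /c2; updv; [apply: V1|]; lia.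
have G5 := @ex_readp 3 (o + 3) c4 _ 0 ltac:(lia) E4 E4b.
rewrite add0n size_nseq in G5; set T3 := iter _ _ _ in G5; set c5 := upd _ _ _ in G5.
have [b6 G6] := @ex_pushp (o + 1) (o + 2) (og + 1) c5 k
  ltac:(by rewrite /c5; updv; rewrite O4 /c3 /c2; updv; try lia)
  ltac:(by rewrite /c5; updv; rewrite O4 /c3 /c2; updv; [apply: V1|]; lia)
  ltac:(lia) ltac:(lia) ltac:(lia).
have E6 : c5 (og + 1) = blank.
  by rewrite /c5; updv; rewrite O4 /c3 /c2; updv; [rewrite O1 ?B0 //|]; lia.
rewrite E6 pushl_blank in G6; set c6 := upd _ _ _ in G6.
have I6 (i : 'I_(work_tapes Mg).+2) : c6 (og + i) = view ((init Mg [::] k).2 i).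
  rewrite view_init; case: (eqVneq (nat_of_ord i) 1) => [->|Hi]; first by rewrite /c6; updv.
  rewrite -/c0 B0 //; have Hi2 : og + i < o by have := ltn_ord i; rewrite /o; lia.
  rewrite /c6 /c5; updv; rewrite O4; last by lia.
  by rewrite /c3 /c2; updv; rewrite O1 ?B0 //; lia.
have G7 := @ex_call og Mg c6 [::] k s2 I6 Hh2.
set tp2 := (iter s2 _ _).2 in G7 W2; set c7 := call_post _ _ _ in G7.
have O7 j : (j < og) || (o <= j) -> c7 j = c6 j by move=> Hj; apply: call_post_out.
have E7 : has_word (c7 (og + 1)) (nseq (g k) true).
  rewrite -[1]/(val (lift ord0 ord0 : 'I_(work_tapes Mg).+2)) /c7 call_post_in.
  by apply/tape_wordP.
have E7b : c7 (o + 4) = cnt 0.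
  rewrite O7 /c6 /c5; updv; last by lia.
  by rewrite O4 /c3 /c2; updv; [apply: V1|]; lia.
have G8 := @ex_readp (og + 1) (o + 4) c7 _ 0 ltac:(lia) E7 E7b.
rewrite add0n size_nseq in G8; set T4 := iter _ _ _ in G8; set c8 := upd _ _ _ in G8.
have V8 j : o < j -> j != o + 1 -> j != o + 3 -> j != o + 4 -> c8 j = c1 j.
  move=> H1 H2 H3 H4; rewrite /c8; updv; rewrite O7 /c6 /c5; updv; last by lia.
  by rewrite O4 /c3 /c2; updv; try lia.
have E8a : c8 (o + 1) = cnt k.
  rewrite /c8; updv; rewrite O7 /c6 /c5; updv; last by lia.
  by rewrite O4 /c3 /c2; updv; try lia.
have E8b : c8 (o + 3) = cnt (f k).
  by rewrite /c8; updv; rewrite O7 /c6 /c5; updv; try lia.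
have E8w : c8 o = wordt [::].
  rewrite /c8; updv; rewrite O7 /c6 /c5; updv; last by lia.
  rewrite O4 /c3 /c2; updv; last by lia.
  by rewrite O1 // B0 ?blank_wordt //; lia.
have E81 : c8 1 = T1.
  rewrite /c8; updv; rewrite O7 /c6 /c5; updv; last by lia.
  by rewrite O4 /c3 /c2; updv.
have G9 := IF c8 [::] [:: f k; g k; k] 0 (erefl _) E8w
  ltac:(by move=> [|[|[|i]]] //= _; rewrite /c8; updv)
  ltac:(by move=> j Hj; rewrite V8 ?V1 //; lia)
  ltac:(by rewrite V8 ?V1 //; lia).
rewrite add0n in G9; set r := F _ _ in G9; set c9 := upd _ _ _ in G9.
have [b10 G10] := @ex_pushp (o + 5) (o + 2) 1 c9 r
  ltac:(by rewrite /c9; updv) ltac:(by rewrite /c9; updv; rewrite V8 ?V1 //; lia)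
  ltac:(lia) ltac:(lia) ltac:(lia).
set c10 := upd _ _ _ in G10.
have G := ex_seq G1 (ex_seq G2 (ex_seq G3 (ex_seq G4 (ex_seq G5 (ex_seq G6
    (ex_seq G7 (ex_seq G8 (ex_seq G9 G10)))))))).
eexists; exists [::]; apply: machine_computes G _ _.
- have -> : (top - 2).+2 = top by lia.
  have L i : i <= 6 -> o + i <= top by lia.
  have F0 : fits (initp (o + 1) (top - (o + 1))) top by apply: fits_initp; lia.
  rewrite /= F0 Fp /=; rewrite -/og.
  have -> : og + (work_tapes Mg).+2 = o by [].
  by do ?(apply/andP; split); lia.
- have -> : c10 0 = blank; last by case.
  rewrite /c10; updv; rewrite /c9; updv.
  rewrite /c8; updv; rewrite O7 /c6 /c5; updv; last by lia.
  rewrite O4 /c3 /c2; updv; last by lia.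
  by rewrite O1 // B0.
- rewrite /c10; updv; apply: pushl_word.
  by rewrite /c9; updv; rewrite E81.
Qed.

Lemma computable_id : computable id.
Proof.
exists (@Machine 0 unit tt (fun _ => true) (fun s r => (s, fun i => (r i, Stay)))) => k.
exists 0, [::], 0 => //=; split=> //=.
by apply/tape_wordP/wordt_has.
Qed.

Lemma fpt_reducible_refl A : fpt_reducible A A.
Proof.
exists (@Machine 0 unit tt (fun _ => true) (fun s r => (s, fun i => (r i, Stay)))).
exists id, id, 0; split; [exact: computable_id|exact: computable_id|].
move=> x k; exists x, k; split=> //; exists 0 => //=; split=> //=.
- by apply/tape_wordP/wordt_has.
- by apply/tape_wordP/wordt_has.
Qed.

(** A step adds at most two cells, one by writing beyond the list and one by moving left. *)
Lemma size_tape_run M x k s :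
  size (((iter s (@step M) (init M x k)).2 ord0).2) <= size x + s * 2.
Proof.
elim: s => [|s IH] /=; first by rewrite size_map; lia.
set c := iter _ _ _ in IH *; rewrite /step; case: ifP => _ /=.
  by apply: leq_trans IH _; lia.
set t := c.2 ord0 in IH *; case: (_.2 ord0).2; rewrite /tape_move /tape_write /=;
  rewrite ?size_behead; lia.
Qed.

(** A reduction by an unknown machine is followed by an explicit map. The intermediate parameter
    [k'] is only known to satisfy [k' <= g k]; since towers are monotone, time and parameter of the
    second stage are bounded through [g k]. *)
Theorem fpt_extend A B C (Es : seq (nat -> nat)) K S N1 b1 b N :
  fpt_reducible A B -> all_elem Es -> elem_fun K ->
  def poly (fun _ e => S e) -> def poly (fun _ e => N1 e) ->
  def poly b1 -> def poly b -> def poly N ->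
  (forall x k, B x k <-> C (out_of Es S N1 b1 b N x k) (K k)) ->
  fpt_reducible A C.
Proof.
move=> [M [f [g [c [Cf Cg HM]]]]] HEs HK HS HN1 Hb1 Hb HN HBC.
set o := (work_tapes M).+2.
have [p [top [cm [h [Fp Tp Hp]]]]] := @main_prog o isT Es K S N1 b1 b N HEs HK HS HN1 Hb1 Hb HN.
have [cK HcK] := elem_bnd HK.
pose Ff (x : seq bool) e :=
  (nth 0 e 0 * 3 + tow h (nth 0 e 1) + 4) ^ cm + nth 0 e 0 + 2.
have HFf : def elem Ff.
  rewrite /Ff; repeat first [apply: def_add | apply: def_mul | apply: d_const |
       apply: def_tow | apply: d_var | apply: def_expc].
pose Fg (x : seq bool) e := tow cK (nth 0 e 1).
have HFg : def elem Fg by apply: def_tow; apply: d_var.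
exists (machine_of (Seq (Call 0 M) p) (top - 2)).
exists (fun k => Ff [::] [:: f k; g k; k]), (fun k => Fg [::] [:: f k; g k; k]).
exists (c.+1 * cm + c); split; [exact: computable2|exact: computable2|].
move=> x k; have [x' [k' [[s Hs /= [Hh W0 W1]] Hk' HAB]]] := HM x k.
exists (out_of Es S N1 b1 b N x' k'), (K k'); split; last first.
- by rewrite HAB.
- by apply: leq_trans (HcK _) _; apply: (mj_mono elem).
have I0 (i : 'I_(work_tapes M).+2) : initial x k (0 + i) = view ((init M x k).2 i).
  by rewrite view_init.
have G1 := @ex_call 0 M (initial x k) x k s I0 Hh.
set cf := iter s _ _ in Hh W0 W1 G1; set c1 := call_post _ _ _ in G1.
have E0 : has_word (c1 0) x'.
  rewrite -[0]/(0 + val (ord0 : 'I_(work_tapes M).+2)) /c1 call_post_in.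
  by apply/tape_wordP.
have E1 : has_word (c1 1) (nseq k' true).
  rewrite -[1]/(0 + val (lift ord0 ord0 : 'I_(work_tapes M).+2)) /c1 call_post_in.
  by apply/tape_wordP.
have [j Hj|s' [G2 F0 F1]] := Hp c1 x' k' E0 E1.
  rewrite /c1 call_post_out; last by apply/orP; right; rewrite add0n; lia.
  by case: j Hj => [|[|j]].
apply: machine_computes (ex_le (ex_seq G1 G2) _) F0 F1.
  have -> : (top - 2).+2 = top by move: Tp; rewrite /o; lia.
  by rewrite /= Fp add0n Tp.
have Hsx : size x' <= size x + s * 2.
  apply: leq_trans (size_tape_run M x k s); rewrite -W0 /tape_word.
  rewrite size_pmap; apply: leq_trans (count_size _ _) _.
  by rewrite size_take; case: ltnP => // /ltnW.
set z := (size x).+1 in Hs *.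
have Hz : 0 < z ^ c by rewrite expn_gt0.
set a := f k in Hs *; set t := tow h (g k).
have Ht : tow h k' <= t by apply: (mj_mono elem).
have HB : size x' + tow h k' <= (a * 3 + t + 4) * z ^ c.+1.
  rewrite expnS; move: (z ^ c) Hz Hs => Z HZ Hs.
  have H1 : size x <= z * Z by apply: leq_trans (leq_pmulr _ HZ).
  have H2 : a * Z <= a * (z * Z) by rewrite leq_mul2l leq_pmull ?orbT.
  have H3 : t <= t * (z * Z) by apply: leq_pmulr; rewrite muln_gt0 HZ.
  rewrite !mulnDl; move: (z * Z) H1 H2 H3 => Y H1 H2 H3.
  by clear -Hsx Hs Ht H1 H2 H3; lia.
rewrite /Ff /= -/a -/t expnD.
have H1 : (size x' + tow h k') ^ cm <= (a * 3 + t + 4) ^ cm * z ^ (c.+1 * cm).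
  rewrite expnM -expnMn; case: (cm) => // q; by rewrite leq_exp2r.
have H2 : 0 < z ^ (c.+1 * cm) by rewrite expn_gt0.
move: ((_ + _) ^ cm) ((a * 3 + t + 4) ^ cm) (z ^ (c.+1 * cm)) (z ^ c) H1 H2 Hz Hs.
move=> D D' Y Z H1 H2 H3 H4; clear -H1 H2 H3 H4.
have H5 : D' * Y <= D' * (Y * Z) by rewrite leq_mul2l leq_pmulr ?orbT.
have H6 : a * Z <= a * (Y * Z) by rewrite leq_mul2l leq_pmull ?orbT.
have H7 : 0 < Y * Z by rewrite muln_gt0 H2.
by rewrite !mulnDl; move: (Y * Z) H5 H6 H7 => W; lia.
Qed.

(** * The game on a set of allowed vertices *)

Section Sw.
Variables (V : finType) (adj : rel V).
Implicit Types (S A B : {set V}) (q : seq V).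

Definition won A := [exists x, closed_nbhd adj x \subset A].

(* Staller, to move and owning [A], can own a closed neighborhood within [k]
   moves in [S], where [B] cannot be used any more.  Both players may pass. *)
Fixpoint sw S k A B : bool :=
  won A || if k is k'.+1 then
    [forall u, sw S k' A (u |: B)] ||
    [exists v in S, (v \notin B) && [forall u, sw S k' (v |: A) (u |: B)]]
  else false.

Lemma won_mono A A' : A \subset A' -> won A -> won A'.
Proof.
by move=> H /existsP[x Hx]; apply/existsP; exists x; apply: subset_trans H.
Qed.

Lemma sw_won S k A B : won A -> sw S k A B.
Proof. by case: k => [|k] /= ->. Qed.

Lemma sw_mono S k A A' B B' : A \subset A' -> B' \subset B ->
  sw S k A B -> sw S k A' B'.
Proof.
elim: k A A' B B' => [|k IH] A A' B B' HA HB /=.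
  by rewrite !orbF; apply: won_mono.
case/or3P => [H|/forallP H|/exists_inP[v Hv /andP[Hn /forallP H]]].
- by rewrite (won_mono HA H).
- apply/or3P/Or32/forallP => u; apply: IH (H u) => //.
  exact: setUS.
- apply/or3P/Or33/exists_inP; exists v => //.
  rewrite (contra (subsetP HB v) Hn); apply/forallP => u.
  by apply: IH (H u); apply: setUS.
Qed.

(** Blocking a vertex that Staller owns does no harm: if it was to be his next move, he passes. *)
Lemma sw_block S k A B v : v \in A -> sw S k A B -> sw S k A (v |: B).
Proof.
elim: k A B => [|k IH] A B Hv //=.
case/or3P => [->//|/forallP H|/exists_inP[w Hw /andP[Hn /forallP H]]].
  by apply/or3P/Or32/forallP => u; rewrite setUCA; apply: IH (H u).
case: (eqVneq w v) => [E|Hwv].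
  apply/or3P/Or32/forallP => u; rewrite setUCA; apply: IH => //.
  have := H u; rewrite E; congr (sw _ _ _ _); apply/setUidPr.
  by rewrite sub1set.
apply/or3P/Or33/exists_inP; exists w => //.
rewrite in_setU1 negb_or Hwv Hn; apply/forallP => u.
by rewrite setUCA; apply: IH (H u); rewrite in_setU1 Hv orbT.
Qed.

Lemma sw_full S k A : (exists x : V, true) -> sw S k A setT -> won A.
Proof.
case=> x0 _; elim: k A => [|k IH] A /=; first by rewrite orbF.
case/or3P => [//|/forallP /(_ x0)|/exists_inP[v _]]; last by rewrite inE.
by rewrite setUT; apply: IH.
Qed.

(** * Strategies in actual plays versus the recursive predicate *)

Section Real.
Variable first : player.
Let sm : seq V -> seq V := staller_moves first.

Lemma staller_moves_cat a q r : staller_moves a (q ++ r) =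
  staller_moves a q ++ staller_moves (iter (size q) opponent a) r.
Proof.
elim: q a => //= v q IH a; rewrite -iterS iterSr.
by case: a; rewrite IH.
Qed.

Lemma to_move_cat q r : to_move first (q ++ r) =
  iter (size r) opponent (to_move first q).
Proof. by rewrite /to_move size_cat addnC iterD. Qed.

Lemma follows_rcons s q v : follows first s q ->
  (to_move first q = Staller -> v = s q) -> follows first s (rcons q v).
Proof.
move=> Hf Hv q1 w r; case/lastP: r => [|r z].
  by rewrite cats1 => /rcons_inj[<- <-] /Hv.
rewrite -rcons_cons -rcons_cat => /rcons_inj[E _]; exact: Hf E.
Qed.

Lemma free_vertex q : size q < #|V| -> exists v, v \notin q.
Proof.
move=> H; case: (pickP [pred v | v \notin q]) => [v Hv|Hq]; first by exists v.
have : #|V| <= size q.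
  apply: leq_trans (card_size q); apply: subset_leq_card.
  by apply/subsetP => v _; have /negbFE := Hq v.
by rewrite leqNgt H.
Qed.

Lemma extend_play s q : strategy s -> uniq q -> follows first s q ->
  exists r, [/\ uniq (q ++ r), size (q ++ r) = #|V| & follows first s (q ++ r)].
Proof.
move=> Hs; move: {2}(#|V| - size q) (leqnn (#|V| - size q)) => n.
elim: n q => [|n IH] q Hn Hu Hf.
  exists [::]; rewrite cats0; split=> //.
  apply/eqP; rewrite eqn_leq -(card_uniqP Hu) max_card /=.
  by rewrite (card_uniqP Hu); move: Hn; rewrite leqn0 subn_eq0.
case: (ltnP (size q) #|V|) => Hlt; last first.
  exists [::]; rewrite cats0; split=> //.
  by apply/eqP; rewrite eqn_leq Hlt andbT -(card_uniqP Hu) max_card.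
have [v0 Hv0] := free_vertex Hlt.
pose v := if is_staller (to_move first q) then s q else v0.
have Hv : v \notin q by rewrite /v; case: ifP => // _; apply: Hs.
have Ef : follows first s (rcons q v) by apply: follows_rcons => //; rewrite /v => ->.
have [||r [H1 H2 H3]] := IH (rcons q v) _ _ Ef.
- by rewrite size_rcons; lia.
- by rewrite rcons_uniq Hv.

by exists (v :: r); rewrite -cat_rcons.
Qed.

Definition wins_by s k := forall p, uniq p -> size p = #|V| -> follows first s p ->
  exists x, {subset closed_nbhd adj x <= take k (sm p)}.

(** [B] may be smaller than the set of claimed vertices. If Dominator repeats a claimed vertex,
    hence passes, the actual play lets her claim some free vertex, which [B] ignores. On a full
    board the strategy has already won. *)
Lemma strategy_sw s k j q B : strategy s -> wins_by s k -> uniq q ->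
  follows first s q -> to_move first q = Staller -> k = size (sm q) + j ->
  B \subset [set x in q] -> sw setT j [set x in sm q] B.
Proof.
move=> Hs Hw.
have Hfull q' j' B' : uniq q' -> follows first s q' -> size q' = #|V| ->
   size (sm q') <= k -> sw setT j' [set x in sm q'] B'.
  move=> Hu Hf Hsz Hk; apply: sw_won; have [x Hx] := Hw q' Hu Hsz Hf.
  apply/existsP; exists x; apply/subsetP => y /Hx; rewrite inE.
  exact: mem_take.
have Hsize q' : uniq q' -> size q' <= #|V|.
  by move=> Hu; rewrite -(card_uniqP Hu) max_card.
elim: j q B => [|j IH] q B Hu Hf Ht Hk HB.
  have [r [H1 H2 H3]] := extend_play Hs Hu Hf.
  have [x Hx] := Hw _ H1 H2 H3.
  apply: sw_won; apply/existsP; exists x; apply/subsetP => y /Hx.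
  by rewrite /sm staller_moves_cat Hk addn0 take_size_cat // inE.
case: (ltnP (size q) #|V|) => Hlt; last first.
  apply: Hfull => //; last by rewrite Hk leq_addr.
  by apply/eqP; rewrite eqn_leq Hsize.
set v := s q; have Hv : v \notin q by apply: Hs.
set q1 := rcons q v.
have Hu1 : uniq q1 by rewrite rcons_uniq Hv.
have Hf1 : follows first s q1 by apply: follows_rcons.
have E1 : sm q1 = rcons (sm q) v.
  by rewrite /sm /q1 -!cats1 staller_moves_cat -/(to_move _ _) Ht.
have T1 : to_move first q1 = Dominator by rewrite /q1 -cats1 to_move_cat Ht.
have Hset : v |: [set x in sm q] = [set x in sm q1].
  by apply/setP => x; rewrite !inE E1 mem_rcons inE.
have Hvq x : (x \in q1) = (x == v) || (x \in q) by rewrite mem_rcons inE.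
have HvB : v \notin B by apply: contra Hv => /(subsetP HB); rewrite inE.
apply/or3P/Or33/exists_inP; exists v => //; rewrite HvB /=; apply/forallP => u.
rewrite Hset.
have IH2 w : w \notin q1 -> (u == w) || (u \in q1) -> sw setT j [set x in sm q1] (u |: B).
  move=> Hw1 Huw.
  have E2 : sm (rcons q1 w) = sm q1.
    by rewrite /sm -!cats1 staller_moves_cat -/(to_move _ _) -/q1 T1 /= cats0.
  rewrite -E2; apply: IH.
  - by rewrite rcons_uniq Hw1.
  - by apply: follows_rcons => //; rewrite T1.
  - by rewrite -cats1 to_move_cat T1.
  - by rewrite E2 E1 size_rcons Hk addSnnS.
  - apply/subsetP => x; rewrite !inE mem_rcons inE => /predU1P[->//|/(subsetP HB)].
    by rewrite inE Hvq => ->; rewrite !orbT.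
case: (boolP (u \in q1)) => Hu1'; last by apply: (IH2 u) => //; rewrite eqxx.
case: (ltnP (size q1) #|V|) => Hlt1.
  by have [w Hw1] := free_vertex Hlt1; apply: (IH2 w); rewrite ?Hu1' ?orbT.
apply: Hfull => //; first by apply/eqP; rewrite eqn_leq Hlt1 Hsize.
by rewrite E1 size_rcons Hk addnS ltnS leq_addr.
Qed.

Section Build.
Variables (x0 : V) (k : nat).

Definition good q v := (v \notin q) &&
  [forall u, sw setT (k - (size (sm q)).+1) (v |: [set x in sm q])
     (u |: [set x in q])].

(** A winning pass becomes the claim of any free vertex, which is good by monotonicity. The
    remaining cases only make the function total. *)
Definition strat q : V :=
  if [pick v | good q v] is Some v then v
  else if [pick v | v \notin q] is Some v then v else x0.

Lemma strat_strategy : strategy strat.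
Proof.
move=> q Hu Hlt; rewrite /strat; case: pickP => [v /andP[]//|_].
case: pickP => // H; have [v Hv] := free_vertex Hlt.
by have := H v; rewrite Hv.
Qed.

Lemma sw_strategy p q r : uniq p -> size p = #|V| -> follows first strat p ->
  p = q ++ r -> to_move first q = Staller -> size (sm q) <= k ->
  sw setT (k - size (sm q)) [set x in sm q] [set x in q] ->
  exists x, {subset closed_nbhd adj x <= take k (sm p)}.
Proof.
move=> Hu Hsz Hf.
have Hx0 : exists x : V, true by exists x0.
have Hwon q' r' : p = q' ++ r' -> size (sm q') <= k -> won [set x in sm q'] ->
    exists x, {subset closed_nbhd adj x <= take k (sm p)}.
  move=> E Hk /existsP[x /subsetP Hx]; exists x => y /Hx; rewrite inE => Hy.
  rewrite E /sm staller_moves_cat take_cat -/sm.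
  by case: ltnP => H; [have := leq_trans H Hk; rewrite ltnn|rewrite mem_cat Hy].
have Hfull q' : p = q' -> [set x in q'] = setT.
  move=> E; apply/setP => x; rewrite !inE -E.
  have /subset_cardP : #|p| = #|V| by rewrite (card_uniqP Hu).
  by move/(_ (subset_predT _)) => ->.
move: {2}(size r) (leqnn (size r)) => n.
elim: n q r => [|n IH] q r Hn Ep Ht Hk Hsw.
  move: Hn Ep; rewrite leqn0 size_eq0 => /eqP ->; rewrite cats0 => Ep.
  apply: (Hwon q [::]); rewrite ?cats0 //.
  by move: Hsw; rewrite (Hfull _ Ep); apply: sw_full.
case: (boolP (won [set x in sm q])) => Hw; first exact: Hwon Ep Hk Hw.
case: r Hn Ep => [|v r] Hn Ep.
  rewrite cats0 in Ep; apply: (Hwon q [::]); rewrite ?cats0 //.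
  by move: Hsw; rewrite (Hfull _ Ep); apply: sw_full.
have Ev : v = strat q by apply: (Hf q v r).
have Hlt : size (sm q) < k.
  rewrite ltn_neqAle Hk andbT; apply: contra Hw => /eqP E.
  by move: Hsw; rewrite E subnn /= orbF.
have Hvq : v \notin q.
  rewrite Ev; apply: strat_strategy.
    by move: Hu; rewrite Ep cat_uniq => /andP[].
  by rewrite -Hsz Ep size_cat /= addnS ltnS leq_addr.
have Hg : good q v.
  rewrite Ev /strat; case: pickP => [w //|Hno].
  move: Hsw; have -> : k - size (sm q) = (k - (size (sm q)).+1).+1 by lia.
  rewrite /= (negPf Hw) /= => /orP[/forallP H|/exists_inP[w _ /andP[Hwq H]]].
    have := Hno v; rewrite /good Hvq => /negbT/negP[]; apply/forallP => u.
    by apply: sw_mono (H u) => //; apply: subsetUr.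
  by have := Hno w; rewrite /good; move: Hwq; rewrite inE => ->; rewrite H.
case/andP: Hg => _ /forallP Hg.
set q1 := rcons q v.
have E1 : sm q1 = rcons (sm q) v.
  by rewrite /sm /q1 -!cats1 staller_moves_cat -/(to_move _ _) Ht.
have T1 : to_move first q1 = Dominator by rewrite /q1 -cats1 to_move_cat Ht.
have Hset : v |: [set x in sm q] = [set x in sm q1].
  by apply/setP => x; rewrite !inE E1 mem_rcons inE.
have Hset' : v |: [set x in q] = [set x in q1].
  by apply/setP => x; rewrite !inE mem_rcons inE.
case: r Hn Ep => [|u r] Hn Ep.
  rewrite cats1 -/q1 in Ep; apply: (Hwon q1 [::]); rewrite ?cats0 //.
    by rewrite E1 size_rcons.
  by have := Hg v; rewrite Hset Hset' (Hfull _ Ep); apply: sw_full.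
have E2 : sm (rcons q1 u) = sm q1.
  by rewrite /sm -!cats1 staller_moves_cat -/(to_move _ _) -/q1 T1 /= cats0.
apply: (IH (rcons q1 u) r).
- by move: Hn => /=; lia.
- by rewrite /q1 !cat_rcons.
- by rewrite -cats1 to_move_cat T1.
- by rewrite E2 E1 size_rcons.
- have := Hg u; rewrite E2 E1 size_rcons -E1 Hset => H.
  have -> : [set x in rcons q1 u] = v |: (u |: [set x in q]).
    by rewrite setUCA Hset'; apply/setP => x; rewrite !inE mem_rcons inE.
  by apply: sw_block => //; rewrite inE E1 mem_rcons mem_head.
Qed.

End Build.

Definition swf k := if is_staller first then sw setT k set0 set0
  else [forall u, sw setT k set0 [set u]].

(** Without vertices there is no function [seq V -> V], while [swf] may hold vacuously; hence the
    first conjunct. *)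
Lemma staller_winsP k : staller_wins_within adj first k <->
  (exists x : V, true) /\ swf k.
Proof.
have E0 : [set x in [::] : seq V] = set0 by apply/setP => x; rewrite !inE.
split.
- case=> s Hs Hw.
  have Hx : exists x : V, true by exists (s [::]).
  split=> //; rewrite /swf; case Ef: first.
    apply/forallP => u /=.
    have := @strategy_sw s k k [:: u] [set u] Hs Hw.
    rewrite /sm Ef /= E0; apply=> //.
    + move=> [|z q] v r; first by [].
      by case: q => [|? ?].
    + by apply/subsetP => x; rewrite !inE.
  have := @strategy_sw s k k [::] set0 Hs Hw.
  rewrite /sm Ef /= E0; apply=> //.
  by move=> [|? ?].
- case=> -[x0 _] Hsw; exists (strat x0 k); first exact: strat_strategy.
  move=> p Hu Hsz Hf; move: Hsw; rewrite /swf.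
  case Eb: (is_staller first) => Hsw; last first.
    have Ef : first = Dominator by case: (first) Eb.
    case: p Hu Hsz Hf => [|u p] Hu Hsz Hf.
      by have := fintype0 x0 (esym Hsz).
    apply: (sw_strategy Hu Hsz Hf (erefl ([:: u] ++ p))).
    + by rewrite /to_move Ef.
    + by rewrite /sm Ef.
    + rewrite /sm Ef /= subn0 E0; have := forallP Hsw u.
      by congr (is_true (sw _ _ _ _)); apply/setP => x; rewrite !inE.
  have Ef : first = Staller by case: (first) Eb.
  apply: (sw_strategy Hu Hsz Hf (erefl ([::] ++ p))).
  + by rewrite /to_move Ef.
  + by rewrite /sm Ef.
  + by rewrite /sm Ef /= subn0 E0.
Qed.

End Real.
End Sw.

(** * Encodings *)

Lemma mkseq_add T (f : nat -> T) m n :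
  mkseq f (m + n) = mkseq f m ++ mkseq (fun i => f (m + i)) n.
Proof. by rewrite /mkseq iotaD map_cat -[0 + m]addn0 iotaDl -map_comp. Qed.

Lemma encode_natE n : encode_nat n = mkseq (fun i => i < n) n.+1.
Proof.
rewrite /encode_nat mkseqS ltnn; congr rcons.
apply: (@eq_from_nth _ false); rewrite ?size_mkseq ?size_nseq // => i Hi.
by rewrite nth_nseq nth_mkseq Hi.
Qed.

Lemma encode_predE n (P : pred 'I_n) (p : pred nat) :
  (forall i, P i = p i) -> encode_pred P = mkseq p n.
Proof.
move=> H; rewrite /encode_pred /mkseq -val_enum_ord -map_comp.
exact: eq_map.
Qed.

Lemma encode_relE n (e : rel 'I_n) (a : rel nat) :
  (forall i j, e i j = a i j) ->
  encode_rel e = mkseq (fun t => a (t %/ n) (t %% n)) (n * n).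
Proof.
move=> H.
have G m : m <= n -> [seq a i j | i <- iota 0 m, j <- iota 0 n] =
   mkseq (fun t => a (t %/ n) (t %% n)) (m * n).
  elim: m => [|m IH] Hm; first by rewrite mul0n.
  rewrite -addn1 iotaD allpairs_cat IH 1?ltnW //= cats0.
  rewrite mulnDl mul1n mkseq_add; congr (_ ++ _).
  rewrite /mkseq; apply/eq_in_map => j; rewrite mem_iota => /andP[_ Hj].
  by rewrite divnMDl 1?modnMDl ?divn_small ?modn_small ?addn0 //; lia.
rewrite -G // -val_enum_ord /encode_rel allpairs_mapl allpairs_mapr.
exact: eq_allpairs.
Qed.

Definition csize n := n.+1 + (n * n + (n + n)).

Definition cbit n (a : rel nat) (g : pred nat) o i :=
  if i <= n then i < n else
  if i - n.+1 < n * n then a ((i - n.+1) %/ n) ((i - n.+1) %% n) else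
  if i - n.+1 - n * n < n then g (i - n.+1 - n * n)
  else i - n.+1 - n * n - n == o.

Lemma encode_circuitE n (C : circuit n) (a : rel nat) (g : pred nat) (o : nat) :
  (forall i j : 'I_n, arc C i j = a i j) -> (forall i : 'I_n, is_and C i = g i) ->
  output C = o :> nat ->
  encode_circuit C = mkseq (cbit n a g o) (csize n).
Proof.
move=> Ha Hg Ho; rewrite /encode_circuit /csize !mkseq_add encode_natE.
rewrite (encode_relE Ha) (encode_predE Hg).
rewrite (@encode_predE n (pred1 (output C)) (pred1 o)); last first.
  by move=> i; rewrite /= -Ho.
congr (_ ++ (_ ++ (_ ++ _))); rewrite /mkseq; apply/eq_in_map => i;
  rewrite mem_iota add0n /= /cbit => Hi.
- by have -> : i <= n by exact: Hi.
- by rewrite ifN ?addKn; [rewrite Hi|lia].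
- by rewrite ifN ?addKn; [rewrite ifN ?addKn; [rewrite Hi|lia]|lia].
- rewrite ifN ?addKn; last by lia.
  rewrite ifN ?addKn; last by lia.
  by rewrite ifN ?addKn //; lia.
Qed.

Definition gsize n := n.+1 + (n * n + 1).

Definition gbit n (a : rel nat) (b : bool) i :=
  if i <= n then i < n else
  if i - n.+1 < n * n then a ((i - n.+1) %/ n) ((i - n.+1) %% n) else b.

Lemma encode_gameE n (e : rel 'I_n) first (a : rel nat) :
  (forall i j : 'I_n, e i j = a i j) ->
  encode_game e first = mkseq (gbit n a (is_staller first)) (gsize n).
Proof.
move=> Ha; rewrite /encode_game /gsize !mkseq_add encode_natE (encode_relE Ha).
congr (_ ++ (_ ++ _)).
- by rewrite /mkseq; apply/eq_in_map => i; rewrite mem_iota add0n /= /gbit => Hi; have -> : i <= n by exact: Hi.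
- rewrite /mkseq; apply/eq_in_map => i; rewrite mem_iota add0n /= /gbit => Hi.
  by rewrite ifN ?addKn; [rewrite Hi|lia].
- suff E : gbit n a (is_staller first) (n.+1 + (n * n + 0)) = is_staller first.
    by rewrite -{1}E.
  rewrite /gbit ifN ?addKn; last by lia.
  by rewrite ifN //; lia.
Qed.

(* The number of nodes or vertices read off an encoding, and the entries of
   its adjacency matrix. *)
Definition nl (x : seq bool) := index false x.
Definition arcx (x : seq bool) i j := nth false x ((nl x).+1 + (i * nl x + j)).

Lemma nl_enc n (f : nat -> bool) m : n < m -> (forall i, i <= n -> f i = (i < n)) ->
  nl (mkseq f m) = n.
Proof.
move=> Hnm Hf; rewrite /nl.
have -> : m = n + (m - n) by lia.
rewrite mkseq_add index_cat.
have -> : (false \in mkseq f n) = false.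
  apply/negbTE/mapP => -[i]; rewrite mem_iota => /andP[_ Hi].
  by rewrite Hf ?Hi // ltnW.
rewrite size_mkseq; case E: (m - n) => [|k]; first by lia.
by rewrite /= addn0 Hf // ltnn eqxx addn0.
Qed.

Lemma nl_prefix x i : i <= nl x -> nl x < size x -> nth false x i = (i < nl x).
Proof.
move=> Hi Hn; case: (ltnP i (nl x)) => H.
  by have := before_find false H; case: (nth _ _ _).
have -> : i = index false x by apply/eqP; rewrite eqn_leq Hi H.
by rewrite nth_index // -index_mem.
Qed.

Lemma nl_bits i j n x : n = nl x -> i < n -> j < n ->
  forall t, t = i * n + j -> t < n * n /\ t %/ n = i /\ t %% n = j.
Proof.
move=> _ Hi Hj t ->; rewrite divnMDl 1?modnMDl ?divn_small ?modn_small ?addn0;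
  try lia.
split=> //; nia.
Qed.

Lemma arcx_circuit n (C : circuit n) (i j : 'I_n) :
  arcx (encode_circuit C) i j = arc C i j.
Proof.
pose a i j := if insub i is Some i then if insub j is Some j then arc C i j
  else false else false.
pose g i := if insub i is Some i then is_and C i else false.
have Ha (i' j' : 'I_n) : arc C i' j' = a i' j' by rewrite /a !valK.
have Hg (i' : 'I_n) : is_and C i' = g i' by rewrite /g !valK.
rewrite (encode_circuitE Ha Hg (erefl _)) /arcx.
have E : nl (mkseq (cbit n a g (output C)) (csize n)) = n.
  apply: nl_enc; first by rewrite /csize; lia.
  by move=> k Hk; rewrite /cbit Hk.
have [H1 [H2 H3]] := nl_bits (esym E) (ltn_ord i) (ltn_ord j) (erefl (i * n + j)).
rewrite E nth_mkseq; last by rewrite /csize; lia.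
by rewrite /cbit ifN ?addKn; [rewrite H1 H2 H3 Ha|lia].
Qed.

Definition andx (x : seq bool) i := nth false x ((nl x).+1 + (nl x * nl x + i)).
Definition outx (x : seq bool) i :=
  nth false x ((nl x).+1 + (nl x * nl x + (nl x + i))).

Lemma nl_circuit n (C : circuit n) : nl (encode_circuit C) = n.
Proof.
pose a i j := if insub i is Some i then if insub j is Some j then arc C i j
  else false else false.
pose g i := if insub i is Some i then is_and C i else false.
have Ha (i' j' : 'I_n) : arc C i' j' = a i' j' by rewrite /a !valK.
have Hg (i' : 'I_n) : is_and C i' = g i' by rewrite /g !valK.
rewrite (encode_circuitE Ha Hg (erefl _)).
apply: nl_enc; first by rewrite /csize; lia.
by move=> k Hk; rewrite /cbit Hk.
Qed.

Lemma andx_circuit n (C : circuit n) (i : 'I_n) :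
  andx (encode_circuit C) i = is_and C i.
Proof.
pose a i j := if insub i is Some i then if insub j is Some j then arc C i j
  else false else false.
pose g i := if insub i is Some i then is_and C i else false.
have Ha (i' j' : 'I_n) : arc C i' j' = a i' j' by rewrite /a !valK.
have Hg (i' : 'I_n) : is_and C i' = g i' by rewrite /g !valK.
rewrite /andx nl_circuit (encode_circuitE Ha Hg (erefl _)).
have Hi := ltn_ord i.
rewrite nth_mkseq; last by rewrite /csize; lia.
rewrite /cbit ifN ?addKn; last by lia.
by rewrite ifN ?addKn; [rewrite Hi Hg|lia].
Qed.

Lemma outx_circuit n (C : circuit n) i : i < n ->
  outx (encode_circuit C) i = (i == output C).
Proof.
move=> Hi.
pose a i j := if insub i is Some i then if insub j is Some j then arc C i j
  else false else false.
pose g i := if insub i is Some i then is_and C i else false.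
have Ha (i' j' : 'I_n) : arc C i' j' = a i' j' by rewrite /a !valK.
have Hg (i' : 'I_n) : is_and C i' = g i' by rewrite /g !valK.
rewrite /outx nl_circuit (encode_circuitE Ha Hg (erefl _)).
rewrite nth_mkseq; last by rewrite /csize; lia.
rewrite /cbit ifN ?addKn; last by lia.
rewrite ifN ?addKn; last by lia.
by rewrite ifN ?addKn //; lia.
Qed.

Lemma size_circuit n (C : circuit n) : size (encode_circuit C) = csize n.
Proof.
rewrite /encode_circuit !size_cat size_rcons size_nseq /encode_rel.
by rewrite size_allpairs /encode_pred 2!size_map size_enum_ord.
Qed.

(* [x], possibly followed by further bits, encodes a circuit of size [L]. *)
Definition circuit_word (x : seq bool) (L : nat) :=
  [&& nl x < L, L == csize (nl x) & count (outx x) (iota 0 (nl x)) == 1].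

Definition decode_circuit (x : seq bool) (o : 'I_(nl x)) : circuit (nl x) :=
  @Circuit (nl x) (fun i j => arcx x i j) (fun i => andx x i) o.

Lemma circuit_wordP x : circuit_word x (size x) ->
  exists o : 'I_(nl x), x = encode_circuit (@decode_circuit x o).
Proof.
case/and3P => Hn /eqP Hs Hc.
have : has (outx x) (iota 0 (nl x)) by rewrite has_count (eqP Hc).
case/hasP => o; rewrite mem_iota => /andP[_ Ho] Hout.
exists (Ordinal Ho).
rewrite (@encode_circuitE _ (decode_circuit (Ordinal Ho)) (arcx x) (andx x) o) //.
apply: (@eq_from_nth _ false); rewrite ?size_mkseq // => i Hi.
rewrite nth_mkseq /cbit; last by rewrite -Hs.
case: (leqP i (nl x)) => H1; first by rewrite nl_prefix.
set n := nl x in Ho Hn Hs H1 Hc *.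
case: ltnP => H2.
  rewrite /arcx -/n; congr nth.
  by rewrite -divn_eq; lia.
case: ltnP => H3.
  by rewrite /andx -/n; congr nth; lia.
have H4 : i - n.+1 - n * n - n < n by move: Hi; rewrite Hs /csize -/n; lia.
set j := i - n.+1 - n * n - n in H4 *.
have -> : nth false x i = outx x j by rewrite /outx -/n; congr nth; rewrite /j; lia.
case: eqP => [->//|Hjo]; apply/negbTE/negP => Hj.
have : 1 < count (outx x) (iota 0 n).
  rewrite -size_filter.
  apply: (@leq_trans (size [:: j; o])) => //; apply: uniq_leq_size.
    by rewrite /= inE andbT; apply/eqP.
  by move=> y; rewrite !inE mem_filter mem_iota => /orP[] /eqP ->; rewrite ?Hj ?Hout.
by rewrite (eqP Hc).
Qed.

Lemma circuit_word_enc n (C : circuit n) :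
  circuit_word (encode_circuit C) (size (encode_circuit C)).
Proof.
rewrite /circuit_word size_circuit nl_circuit eqxx /= /csize; apply/andP; split; first by lia.
apply/eqP; have Ho := ltn_ord (output C).
have E : {in iota 0 n, outx (encode_circuit C) =1 pred1 (output C : nat)}.
  by move=> i; rewrite mem_iota => /andP[_ Hi]; rewrite outx_circuit.
by rewrite (eq_in_count E) count_uniq_mem ?iota_uniq // mem_iota Ho.
Qed.

Lemma nl_game n (e : rel 'I_n) first : nl (encode_game e first) = n.
Proof.
pose a i j := if insub i is Some i then if insub j is Some j then e i j
  else false else false.
have Ha (i' j' : 'I_n) : e i' j' = a i' j' by rewrite /a !valK.
rewrite (encode_gameE first Ha).
apply: nl_enc; first by rewrite /gsize; lia.
by move=> k Hk; rewrite /gbit Hk.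
Qed.

Lemma size_game n (e : rel 'I_n) first : size (encode_game e first) = gsize n.
Proof.
rewrite /encode_game !size_cat size_rcons size_nseq /encode_rel.
by rewrite size_allpairs !size_enum_ord.
Qed.

Definition firstx (x : seq bool) := nth false x ((nl x).+1 + nl x * nl x).

Lemma arcx_game n (e : rel 'I_n) first (i j : 'I_n) :
  arcx (encode_game e first) i j = e i j.
Proof.
pose a i j := if insub i is Some i then if insub j is Some j then e i j
  else false else false.
have Ha (i' j' : 'I_n) : e i' j' = a i' j' by rewrite /a !valK.
rewrite /arcx nl_game (encode_gameE first Ha).
have [H1 [H2 H3]] := nl_bits (esym (nl_game e first)) (ltn_ord i) (ltn_ord j)
  (erefl (i * n + j)).
rewrite nth_mkseq; last by rewrite /gsize; lia.
by rewrite /gbit ifN ?addKn; [rewrite H1 H2 H3 Ha|lia].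
Qed.

Lemma firstx_game n (e : rel 'I_n) first :
  firstx (encode_game e first) = is_staller first.
Proof.
pose a i j := if insub i is Some i then if insub j is Some j then e i j
  else false else false.
have Ha (i' j' : 'I_n) : e i' j' = a i' j' by rewrite /a !valK.
rewrite /firstx nl_game (encode_gameE first Ha).
rewrite nth_mkseq; last by rewrite /gsize; lia.
rewrite /gbit ifN ?addKn; last by lia.
by rewrite ltnn.
Qed.

Definition game_word (x : seq bool) (L : nat) :=
  [&& nl x < L, L == gsize (nl x),
     all (fun i => ~~ arcx x i i) (iota 0 (nl x)) &
     all (fun i => all (fun j => arcx x i j == arcx x j i) (iota 0 (nl x)))
       (iota 0 (nl x))].

Definition adjx (x : seq bool) : rel 'I_(nl x) := fun i j => arcx x i j.
Definition playerx (x : seq bool) := if firstx x then Staller else Dominator.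

Lemma game_wordP x : game_word x (size x) ->
  [/\ symmetric (@adjx x), irreflexive (@adjx x) &
      x = encode_game (@adjx x) (playerx x)].
Proof.
case/and4P => Hn /eqP Hs /allP Hi /allP Hsym; split.
- move=> i j; have Hin (k : 'I_(nl x)) : (k : nat) \in iota 0 (nl x).
    by rewrite mem_iota /=.
  by apply/eqP; apply: (allP (Hsym i (Hin i))).
- by move=> i; apply/negbTE/Hi; rewrite mem_iota /=.
rewrite (@encode_gameE _ (@adjx x) (playerx x) (arcx x)) //.
apply: (@eq_from_nth _ false); rewrite ?size_mkseq // => i Hi'.
rewrite nth_mkseq /gbit; last by rewrite -Hs.
case: (leqP i (nl x)) => H1; first by rewrite nl_prefix.
set n := nl x in Hn Hs H1 *.
case: ltnP => H2.
  rewrite /arcx -/n; congr nth.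
  by rewrite -divn_eq; lia.
have -> : i = n.+1 + n * n by move: Hi'; rewrite Hs /gsize -/n; lia.
by rewrite /playerx /firstx -/n; case: (nth _ _ _).
Qed.

Lemma game_word_enc n (e : rel 'I_n) first : symmetric e -> irreflexive e ->
  game_word (encode_game e first) (size (encode_game e first)).
Proof.
move=> Hs Hi; rewrite /game_word size_game nl_game eqxx /= /gsize.
apply/and3P; split; first by lia.
- apply/allP => i; rewrite mem_iota => /andP[_ H].
  by rewrite (arcx_game e first (Ordinal H) (Ordinal H)) Hi.
- apply/allP => i; rewrite mem_iota => /andP[_ H].
  apply/allP => j; rewrite mem_iota => /andP[_ H'].
  rewrite (arcx_game e first (Ordinal H) (Ordinal H')).
  by rewrite (arcx_game e first (Ordinal H') (Ordinal H)) Hs.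
Qed.

(** The position of the first [false] as a count, a form that bounded recursion provides. *)
Lemma nlE x : nl x = count (fun i => all (fun j => nth false x j) (iota 0 i.+1))
  (iota 0 (size x)).
Proof.
have H m : m <= size x -> count (fun i => all (fun j => nth false x j) (iota 0 i.+1))
    (iota 0 m) = minn (nl x) m.
  elim: m => [|m IH] Hm; first by rewrite minn0.
  rewrite -[m.+1]addn1 iotaD count_cat IH 1?ltnW // add0n.
  have E (P : pred nat) : count P (iota m 1) = P m by rewrite /= addn0.
  rewrite E; have -> : all (fun j => nth false x j) (iota 0 m.+1) = (m < nl x).
    apply/idP/idP.
      move/allP => Ha; rewrite ltnNge; apply/negP => Hge.
      have := Ha (nl x); rewrite mem_iota ltnS Hge => /(_ isT).
      by rewrite nth_index // -index_mem; apply: leq_ltn_trans Hge Hm.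
    move=> Hlt; apply/allP => j; rewrite mem_iota => /andP[_ Hj].
    have Hjn : j < nl x by apply: leq_trans Hj Hlt.
    by have := before_find false Hjn; case: (nth _ _ _).
  by case: ltnP => /= ?; lia.
by rewrite H //; apply/esym/minn_idPl; apply: index_size.
Qed.

Section DefEnc.
Variable mj : majorants.
Notation def := (def mj).

Lemma def_nl : def (fun x e => nl x).
Proof.
apply: (def_ext (F := fun x e => count (fun i => all (fun j => nth false x j)
   (iota 0 i.+1)) (iota 0 (size x)))); first by move=> x e; rewrite nlE.
deft.
Qed.

Lemma def_arcx F G : def F -> def G -> def (fun x e => arcx x (F x e) (G x e) : nat).
Proof.
move=> HF HG; apply/d_bit/def_add; first exact/d_succ/def_nl.
by apply: def_add => //; apply: def_mul => //; apply: def_nl.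
Qed.

Lemma def_andx F : def F -> def (fun x e => andx x (F x e) : nat).
Proof.
move=> HF; apply/d_bit/def_add; first exact/d_succ/def_nl.
by apply: def_add => //; apply: def_mul; apply: def_nl.
Qed.

Lemma def_outx F : def F -> def (fun x e => outx x (F x e) : nat).
Proof.
move=> HF; apply/d_bit/def_add; first exact/d_succ/def_nl.
apply: def_add; first by apply: def_mul; apply: def_nl.
by apply: def_add => //; apply: def_nl.
Qed.

Lemma def_firstx : def (fun x e => firstx x : nat).
Proof.
apply/d_bit/def_add; first exact/d_succ/def_nl.
by apply: def_mul; apply: def_nl.
Qed.
End DefEnc.

Ltac def_hook ::=
  first [ apply: def_nl | apply: def_arcx | apply: def_andx | apply: def_outx
        | apply: def_firstx ].

(** * From constraint satisfaction to circuits *)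

(* Binary constraint satisfaction with [m] variables and [V] values; the case
   [i = j] gives unary constraints. *)
Definition bcsp (m V : nat) (c : nat -> nat -> nat -> nat -> bool) : Prop :=
  exists s : nat -> nat, (forall i, i < m -> s i < V) /\
    (forall i j, i < m -> j < m -> c i (s i) j (s j)).

Section CircuitOfCsp.
Variables (m V : nat) (c : nat -> nat -> nat -> nat -> bool).

(* Input [p] says that variable [p %/ V] has value [p %% V]. *)
Definition cpair p q := c (p %/ V) (p %% V) (q %/ V) (q %% V).
(** Different inputs for one variable clash, so a true set of inputs assigns each variable at most
    one value. Unary constraints are tested along with every pair. *)
Definition okp p q := (p == q) || [&& p %/ V != q %/ V, cpair p q, cpair q p,
  cpair p p & cpair q q].

Let N0 := m * V.
Definition clast (N0 : nat) := N0 + N0 + N0 * N0.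

(* The nodes are [N0] inputs, their negations, for all inputs [p] and [q] the
   clause [~ p \/ ~ q], or a tautology if [p] and [q] are compatible, and the
   conjunction of the clauses. *)
Definition carc (N0 : nat) a b :=
  [|| (a < N0) && (b == N0 + a),
      [&& N0 + N0 <= b, b < clast N0 &
        (a == N0 + (b - (N0 + N0)) %/ N0) ||
        (a == if okp ((b - (N0 + N0)) %/ N0) ((b - (N0 + N0)) %% N0)
              then (b - (N0 + N0)) %/ N0 else N0 + (b - (N0 + N0)) %% N0)] |
      [&& b == clast N0, N0 + N0 <= a & a < clast N0]].

Definition csp_circuit : circuit (clast N0).+1 :=
  @Circuit (clast N0).+1 (fun a b => carc N0 a b) (fun b => b == clast N0 :> nat)
    ord_max.

Hypotheses (Hm : 2 <= m) (HV : 1 <= V).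

Let last := clast N0.
Let C := csp_circuit.

Lemma csp_N0 : 2 <= N0.
Proof. by rewrite /N0; nia. Qed.

Lemma or_node p q : p < N0 -> q < N0 -> N0 + N0 + (p * N0 + q) < last.
Proof. by move=> Hp Hq; rewrite /last /clast; nia. Qed.

Lemma or_div p q : q < N0 -> (p * N0 + q) %/ N0 = p /\ (p * N0 + q) %% N0 = q.
Proof.
by move=> Hq; rewrite divnMDl ?modnMDl ?divn_small ?modn_small ?addn0 //; lia.
Qed.

Lemma or_split b : N0 + N0 <= b < last -> exists p q,
  [/\ p < N0, q < N0 & b = N0 + N0 + (p * N0 + q)].
Proof.
move=> H; exists ((b - (N0 + N0)) %/ N0), ((b - (N0 + N0)) %% N0).
have H0 := csp_N0; rewrite ltn_mod -divn_eq ltn_divLR ?(ltnW H0) //.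
by split; rewrite ?(ltnW H0) //; move: H; rewrite /last /clast; lia.
Qed.

(** For compatible inputs, and for [p = q], the clause is the tautology [~ p \/ p]. The two literals
    of a clause thus always differ, so it has indegree 2 and does not turn into a negation. *)
Definition lit p q := if okp p q then p else N0 + q.

Lemma carc_or a p q : p < N0 -> q < N0 ->
  carc N0 a (N0 + N0 + (p * N0 + q)) = (a == N0 + p) || (a == lit p q).
Proof.
move=> Hp Hq; have H1 := or_node Hp Hq; have [H2 H3] := or_div p Hq.
have H5 : (N0 + N0 + (p * N0 + q) == clast N0) = false by exact: ltn_eqF.
have H4 : (a < N0) && (N0 + N0 + (p * N0 + q) == N0 + a) = false by lia.
by rewrite /carc H4 addKn H2 H3 H1 H5 leq_addr /= orbF.
Qed.

Lemma carc_not a b : N0 <= b < N0 + N0 -> carc N0 a b = (a == b - N0).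
Proof.
move=> Hb; rewrite /carc; have -> : (N0 + N0 <= b) = false by lia.
have -> : (b == clast N0) = false by rewrite /clast; nia.
by rewrite /= orbF; lia.
Qed.

Lemma carc_in a b : b < N0 -> carc N0 a b = false.
Proof.
move=> Hb; rewrite /carc; have -> : (N0 + N0 <= b) = false by lia.
have -> : (b == clast N0) = false by rewrite /clast; nia.
by rewrite /= orbF; lia.
Qed.

Lemma carc_last a : carc N0 a last = (N0 + N0 <= a < last).
Proof.
have H := csp_N0; rewrite /carc -/last ltnn andbF /= eqxx.
by have -> : (a < N0) && (last == N0 + a) = false by rewrite /last /clast; nia.
Qed.

(** The layers of the circuit: inputs, negations, clauses, output. Arcs go to higher layers, which
    settles acyclicity and depth 3; weft 1 follows because only the output is large. *)
Definition level a := (N0 <= a) + (N0 + N0 <= a) + (last <= a).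

Lemma carc_level a b : carc N0 a b -> level a < level b.
Proof.
have H := csp_N0; rewrite /carc -/last /level /last => /or3P[/andP[H1 /eqP ->]|/and3P[H1 H2 H3]|].
- by rewrite /clast; nia.
- have [p [q [Hp Hq E]]] : exists p q, [/\ p < N0, q < N0 & b = N0 + N0 + (p * N0 + q)].
    by apply: or_split; rewrite H1.
  have [E1 E2] := or_div p Hq.
  rewrite E addKn E1 E2 in H3.
  have Ha : a < N0 + N0.
    by case/orP: H3 => /eqP ->; [|case: ifP => _]; lia.
  rewrite (ltn_geF Ha) H1 -/(clast N0).
  have -> : N0 <= b by lia.
  have -> : clast N0 <= a = false by rewrite /clast; nia.
  by case: (N0 <= a); lia.
- case/and3P => /eqP -> H1 H2; rewrite H1 leqnn (ltn_geF H2).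
  have -> : N0 + N0 <= clast N0 by rewrite /clast leq_addr.
  have -> : N0 <= clast N0 by rewrite /clast -addnA leq_addr.
  by case: (N0 <= a).
Qed.

Lemma path_level (i : 'I_(clast N0).+1) p : path (arc C) i p ->
  level i + size p <= level (seq.last i p).
Proof.
elim: p i => [|j p IH] i /=; first by rewrite addn0.
by case/andP => /carc_level H /IH; lia.
Qed.

Lemma path_gt (i : 'I_(clast N0).+1) p : path (arc C) i p ->
  p != [::] -> level i < level (seq.last i p).
Proof. by case: p => // j p /path_level /=; lia. Qed.

Lemma csp_wf : circuit_wf C.
Proof.
split=> [i p /eqP Hp Hpath E|i].
  by have := path_gt Hpath Hp; rewrite E ltnn.
apply/negP => /carc_level; rewrite /= /level -/last.
have -> : N0 + N0 <= last by rewrite /last /clast leq_addr.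
have -> : N0 <= last by rewrite /last /clast -addnA leq_addr.
rewrite leqnn; case: (_ <= i); case: (_ <= i); case: (_ <= i) => //.
Qed.

Lemma level_le a : level a <= 3.
Proof. by rewrite /level; case: (_ <= a); case: (_ <= a); case: (_ <= a). Qed.

Lemma csp_depth : depth_le C 3.
Proof.
by move=> i p _ /path_level H _; have := level_le (seq.last i p); clear -H; lia.
Qed.

Lemma deg_input (b : 'I_(clast N0).+1) : b < N0 -> indegree C b = 0.
Proof.
move=> Hb; rewrite /indegree; apply/eqP; rewrite cards_eq0; apply/eqP/setP => a.
by rewrite !inE /= carc_in.
Qed.

Lemma deg_not (b : 'I_(clast N0).+1) : N0 <= b < N0 + N0 -> indegree C b = 1.
Proof.
move=> Hb; rewrite /indegree.
have Ha : b - N0 < (clast N0).+1 by have := ltn_ord b; lia.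
rewrite -(cards1 (Ordinal Ha)); congr #|pred_of_set _|; apply/setP => a.
by rewrite !inE /= carc_not.
Qed.

Lemma lit_neq p q : p < N0 -> q < N0 -> N0 + p != lit p q.
Proof.
move=> Hp Hq; rewrite /lit; case: ifP => H; first by lia.
rewrite eqn_add2l; apply: contraFN H => /eqP ->.
by rewrite /okp eqxx.
Qed.

Lemma lit_lt p q : p < N0 -> q < N0 -> lit p q < N0 + N0.
Proof. by move=> Hp Hq; rewrite /lit; case: ifP; lia. Qed.

Lemma last_ge : N0 + N0 <= last.
Proof. by rewrite /last /clast leq_addr. Qed.

Lemma deg_or (b : 'I_(clast N0).+1) : N0 + N0 <= b < last -> indegree C b = 2.
Proof.
move=> Hb; have [p [q [Hp Hq E]]] := or_split Hb; rewrite /indegree.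
have Hl := last_ge; have Hl' := lit_lt Hp Hq; rewrite /last in Hl.
have H1 : N0 + p < (clast N0).+1 by lia.
have H2 : lit p q < (clast N0).+1 by lia.
have -> : [set j | arc C j b] = [set Ordinal H1; Ordinal H2].
  by apply/setP => a; rewrite !inE /= E carc_or.
by rewrite cards2 -val_eqE /= lit_neq.
Qed.

Lemma deg_last (b : 'I_(clast N0).+1) : b = last :> nat -> 1 < indegree C b.
Proof.
move=> E; rewrite /indegree; have H := csp_N0.
have H1 : N0 + N0 < (clast N0).+1 by rewrite /clast; lia.
have H2 : N0 + N0 + 1 < (clast N0).+1 by rewrite /clast; nia.
have : [set Ordinal H1; Ordinal H2] \subset [set j | arc C j b].
  apply/subsetP => a; rewrite !inE /= E carc_last => /orP[] /eqP -> /=;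
    rewrite /last /clast; nia.
move/subset_leq_card; rewrite cards2 -val_eqE /=; lia.
Qed.

Lemma node_cases (b : nat) : b < (clast N0).+1 ->
  [\/ b < N0, N0 <= b < N0 + N0, N0 + N0 <= b < last | b = last].
Proof.
rewrite ltnS leq_eqVlt => /predU1P[->|Hb]; first exact: Or44.
case: (ltnP b N0) => H1; first exact: Or41.
case: (ltnP b (N0 + N0)) => H2; [exact: Or42|exact: Or43].
Qed.

Lemma csp_weft : weft_le C 1.
Proof.
move=> i p _ Hp _.
have Hl j : is_large C j -> j = last :> nat.
  rewrite /is_large; case: (node_cases (ltn_ord j)) => // H.
  - by rewrite deg_input.
  - by rewrite deg_not.
  - by rewrite deg_or.
elim: p i Hp => [|j p IH] i /=; first by case: (is_large C i).
case/andP => Hij Hp; case Hi: (is_large C i); last by rewrite add0n; apply: IH.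
have := carc_level Hij; rewrite (Hl _ Hi).
have -> : level last = 3.
  rewrite /level leqnn last_ge.
  by have -> : N0 <= last by have := last_ge; lia.
by have := level_le j; clear; lia.
Qed.

Lemma is_inputE (b : 'I_(clast N0).+1) : is_input C b = (b < N0).
Proof.
rewrite /is_input; case: (node_cases (ltn_ord b)) => H.
- by rewrite deg_input // H.
- by rewrite deg_not //; lia.
- by rewrite deg_or //; lia.
- have := deg_last H; case: (indegree C b) => // n _; have := last_ge.
  by rewrite H; lia.
Qed.

(** There are [m] true inputs and no two belong to one variable, so by counting each variable has
    exactly one. *)
Lemma sat_csp : weighted_sat C m -> bcsp m V c.
Proof.
case=> v [Hv Hout HT].
set T := [set _ | _] in HT.
have HN := csp_N0.
have Hnn a : a <= last -> a < (clast N0).+1 by [].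
have Hll := last_ge.
have Hok (p q : 'I_(clast N0).+1) : p \in T -> q \in T -> okp p q.
  rewrite !inE !is_inputE => /andP[Hp vp] /andP[Hq vq].
  apply/negPn/negP => Hno.
  have Hor := or_node Hp Hq.
  pose b := Ordinal (Hnn _ (ltnW Hor)).
  have vb : v b.
    have := Hv ord_max; have Hd := @deg_last ord_max (erefl _).
    case Ed: (indegree C ord_max) Hd => [|[|n]] // _.
    rewrite [is_and _ _]/= eqxx Hout => /esym/forall_inP; apply.
    by rewrite /= carc_last Hor leq_addr.
  have := Hv b; rewrite deg_or; last by rewrite /= Hor leq_addr.
  rewrite [is_and _ _]/= (ltn_eqF Hor) vb => /esym/exists_inP[a].
  rewrite /= carc_or // /lit (negPf Hno) => Ha va.
  have Hna (r : 'I_(clast N0).+1) : r < N0 -> a = N0 + r :> nat -> v r -> False.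
    move=> Hr Ea vr; have := Hv a; rewrite deg_not; last by lia.
    rewrite va => /esym/existsP[]; exists r; rewrite vr andbT /= carc_not; lia.
  by case/orP: Ha => /eqP Ha; [apply: (Hna p)|apply: (Hna q)].
have HTN p : p \in T -> p < N0 by rewrite inE is_inputE => /andP[].
have HV0 : 0 < V by [].
have m0 : 0 < m by lia.
have Hdiv p : p < N0 -> p %/ V < m by rewrite ltn_divLR.
pose f (p : 'I_(clast N0).+1) : 'I_m := Ordinal (ltn_pmod (p %/ V) m0).
have fE p : p \in T -> f p = p %/ V :> nat.
  by move=> Hp; rewrite /= modn_small // Hdiv // HTN.
have Hinj : {in T &, injective f}.
  move=> p q Hp Hq E; have : okp p q by apply: Hok.
  case/orP => [/eqP/val_inj //|/andP[/eqP[]]].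
  by rewrite -!fE // E.
have Hall i : i < m -> exists2 p : 'I_(clast N0).+1, p \in T & p %/ V = i.
  move=> Hi; have E : f @: T = setT.
    apply/eqP; rewrite eqEcard subsetT cardsT card_ord.
    by rewrite (card_in_imset Hinj) HT leqnn.
  have : Ordinal Hi \in f @: T by rewrite E inE.
  by case/imsetP => p Hp Ep; exists p => //; rewrite -fE // -Ep.
pose s i := if [pick p : 'I_(clast N0).+1 | (p \in T) && (p %/ V == i)] is Some p
  then p %% V else 0.
have Hs i : i < m -> exists p : 'I_(clast N0).+1,
   [/\ p \in T, p %/ V = i & s i = p %% V].
  move=> Hi; rewrite /s; case: pickP => [p /andP[H1 /eqP H2]|H]; first by exists p.
  by have [p Hp Ep] := Hall i Hi; have := H p; rewrite Hp Ep eqxx.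
exists s; split=> [i Hi|i j Hi Hj].
  by have [p [_ _ ->]] := Hs i Hi; rewrite ltn_mod.
have [p [Tp Ep ->]] := Hs i Hi; have [q [Tq Eq ->]] := Hs j Hj.
case: (eqVneq i j) => [Eij|Nij]; last first.
  case/orP: (Hok p q Tp Tq) => [/eqP E|].
    by move: Nij; rewrite -Ep -Eq E eqxx.
  by case/and4P => _; rewrite /cpair Ep Eq.
(* A unary constraint is tested only together with another variable, which exists because
   [2 <= m]. *)
have [i' [Hi' Ni']] : exists i', i' < m /\ i' != i.
  by case: (eqVneq i 0) => [->|H]; [exists 1|exists 0; rewrite eq_sym].
have [r [Tr Er _]] := Hs i' Hi'.
have Epq : p = q.
  case/orP: (Hok p q Tp Tq) => [/eqP/val_inj //|/andP[]].
  by rewrite Ep Eq Eij eqxx.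
case/orP: (Hok p r Tp Tr) => [/eqP E|/and5P[_ _ _ H _]].
  by move: Ni'; rewrite -Er -Ep E eqxx.
by move: H; rewrite /cpair -Epq Ep -Eij.
Qed.

Lemma csp_sat : bcsp m V c -> weighted_sat C m.
Proof.
case=> s [Hs Hc]; have HN := csp_N0; have Hll := last_ge.
have HV0 : 0 < V by [].
have Hdiv p : p < N0 -> p %/ V < m by rewrite ltn_divLR.
pose t p := p %% V == s (p %/ V).
have Ht p q : p < N0 -> q < N0 -> t p -> t q -> okp p q.
  move=> Hp Hq /eqP tp /eqP tq; rewrite /okp.
  case: (eqVneq (p %/ V) (q %/ V)) => [E|E] /=.
    by rewrite (divn_eq p V) (divn_eq q V) tp tq E eqxx.
  by rewrite /cpair tp tq !Hc ?Hdiv // orbT.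
pose w a := if a < N0 then t a else if a < N0 + N0 then ~~ t (a - N0) else true.
pose v (a : 'I_(clast N0).+1) := w a.
have wlit p q : p < N0 -> q < N0 -> w (N0 + p) || w (lit p q).
  move=> Hp Hq; rewrite /w /lit addKn.
  have -> : (N0 + p < N0) = false by lia.
  have -> : (N0 + p < N0 + N0) by lia.
  case H: (okp p q); first by rewrite /= Hp; case: (t p).
  have -> : (N0 + q < N0) = false by lia.
  have -> : (N0 + q < N0 + N0) by lia.
  rewrite addKn -negb_and; apply/negP => /andP[tp tq].
  by move: H; rewrite Ht.
exists v; split.
- move=> b; case: (node_cases (ltn_ord b)) => H.
  + by rewrite deg_input.
  + rewrite deg_not // /v /w; have -> : (b < N0) = false by lia.
    have -> : b < N0 + N0 by lia.
    congr negb; apply/idP/existsP => [Hb|[a]].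
      have Ha : b - N0 < (clast N0).+1 by have := ltn_ord b; lia.
      exists (Ordinal Ha); rewrite /= carc_not // eqxx /= /v /w /=.
      by have -> : b - N0 < N0 by lia.
    rewrite /= carc_not // /v /w => /andP[/eqP ->].
    by have -> : b - N0 < N0 by lia.
  + rewrite deg_or // [is_and _ _]/=.
    have -> : (b == clast N0 :> nat) = false by case/andP: H => _ /ltn_eqF.
    rewrite {1}/v /w; have -> : (b < N0) = false by lia.
    have -> : (b < N0 + N0) = false by lia.
    apply/esym/existsP; have [p [q [Hp Hq E]]] := or_split H.
    have Hl' := lit_lt Hp Hq; rewrite /last in Hll.
    have H1 : N0 + p < (clast N0).+1 by lia.
    have H2 : lit p q < (clast N0).+1 by lia.
    case/orP: (wlit p q Hp Hq) => Hw.
      by exists (Ordinal H1); rewrite /v /= E carc_or // eqxx Hw.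
    by exists (Ordinal H2); rewrite /v /= E carc_or // eqxx Hw orbT.
  + have := deg_last H; case: (indegree C b) => [|[|n]] // _.
    rewrite [is_and _ _]/= H eqxx {1}/v /w H.
    have -> : (last < N0) = false by lia.
    have -> : (last < N0 + N0) = false by lia.
    apply/esym/forall_inP => a; rewrite /= H carc_last => Ha; rewrite /v /w.
    have -> : (a < N0) = false by lia.
    by have -> : (a < N0 + N0) = false by lia.
- rewrite /v /w /= -/last; have -> : (last < N0) = false by lia.
  by have -> : (last < N0 + N0) = false by lia.
- have Hlt (i : 'I_m) : i * V + s i < N0.
    have := Hs i (ltn_ord i); have := ltn_ord i; rewrite /N0; nia.
  have Hlt' (i : 'I_m) : i * V + s i < (clast N0).+1.
    by have := Hlt i; rewrite /last in Hll; lia.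
  pose g (i : 'I_m) : 'I_(clast N0).+1 := Ordinal (Hlt' i).
  have gV (i : 'I_m) : (i * V + s i) %/ V = i /\ (i * V + s i) %% V = s i.
    have Hsi := Hs i (ltn_ord i).
    by rewrite divnMDl // modnMDl divn_small ?modn_small ?addn0.
  have gi : injective g.
    move=> i j [] E; apply: val_inj => /=.
    by have [<- _] := gV i; have [<- _] := gV j; rewrite E.
  rewrite -[RHS](card_ord m) -cardsT -(card_imset _ gi); congr #|pred_of_set _|.
  apply/setP => a; rewrite inE is_inputE; apply/andP/imsetP => [[Ha]|[i _ ->]].
    rewrite /v /w Ha => /eqP ta; exists (Ordinal (Hdiv _ Ha)) => //.
    by apply: val_inj; rewrite /= -ta -divn_eq.
  rewrite Hlt; split=> //; rewrite /v /w /= Hlt /t.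
  by have [-> ->] := gV i.
Qed.

End CircuitOfCsp.

(** * From the game to constraint satisfaction *)

(** One vertex to claim, a set that works against one reply, and a further set for each reply inside
    that set. *)
Fixpoint sbound k := if k is k'.+1 then (sbound k' + sbound k' * sbound k').+1 else 1.

(** * Small sets of vertices on which Staller wins *)

Section SmallS.
Variables (V : finType) (adj : rel V).
Implicit Types (S A B : {set V}).

Lemma sw_allowed S S' k A B : S \subset S' -> sw adj S k A B -> sw adj S' k A B.
Proof.
move=> HS; elim: k A B => [|k IH] A B //=.
case/or3P => [->//|/forallP H|/exists_inP[v Hv /andP[Hn /forallP H]]].
  by apply/or3P/Or32/forallP => u; apply: IH.
apply/or3P/Or33/exists_inP; exists v; first exact: (subsetP HS).
by rewrite Hn; apply/forallP => u; apply: IH.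
Qed.

Lemma sw_outside S k A B u : u \notin S -> sw adj S k A B -> sw adj S k A (u |: B).
Proof.
move=> Hu; elim: k A B => [|k IH] A B //=.
case/or3P => [->//|/forallP H|/exists_inP[v Hv /andP[Hn /forallP H]]].
  by apply/or3P/Or32/forallP => w; rewrite setUCA; apply: IH.
apply/or3P/Or33/exists_inP; exists v => //.
rewrite in_setU1 negb_or Hn andbT; apply/andP; split.
  by apply: contraNneq Hu => <-.
by apply/forallP => w; rewrite setUCA; apply: IH.
Qed.

(** Take [S0] for one arbitrary reply. By [sw_outside] a reply outside [S0] does not disturb the win
    there, so only replies in [S0], at most [sbound k] many, need sets of their own. *)
Lemma small_reply k A B :
  (forall A B, sw adj setT k A B -> exists2 S : {set V}, #|S| <= sbound k & sw adj S k A B) ->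
  (forall u, sw adj setT k A (u |: B)) ->
  exists2 S : {set V}, #|S| <= sbound k + sbound k * sbound k & forall u, sw adj S k A (u |: B).
Proof.
move=> IH H; case: (pickP (@predT V)) => [u0 _|V0]; last first.
  by exists set0; [rewrite cards0|move=> u; have := V0 u].
have [S0 c0 s0] := IH _ _ (H u0).
have HT u : exists S : {set V}, (#|S| <= sbound k) && sw adj S k A (u |: B).
  by have [S c s] := IH _ _ (H u); exists S; rewrite c.
pose T u := xchoose (HT u).
have cT u : #|T u| <= sbound k by have /andP[] := xchooseP (HT u).
have sT u : sw adj (T u) k A (u |: B) by have /andP[] := xchooseP (HT u).
exists (S0 :|: \bigcup_(u in S0) T u).
  apply: leq_trans (leq_card_setU _ _) (leq_add c0 _).
  apply: (@leq_trans (\sum_(u in S0) sbound k)); last first.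
    by rewrite sum_nat_const leq_mul2r c0 orbT.
  apply: (@leq_trans (\sum_(u in S0) #|T u|)); last exact: leq_sum.
  elim/big_rec2: _ => [|u C D _ HCD]; first by rewrite cards0.
  by apply: leq_trans (leq_card_setU _ _) _; rewrite leq_add2l.
move=> u; case: (boolP (u \in S0)) => Hu.
  apply: sw_allowed (sT u); apply: subsetU; apply/orP; right.
  exact: bigcup_sup.
apply: sw_allowed (subsetUl _ _) _; apply: sw_outside => //.
by apply: sw_mono s0 => //; apply: subsetUr.
Qed.

Lemma small_sw k A B : sw adj setT k A B ->
  exists2 S : {set V}, #|S| <= sbound k & sw adj S k A B.
Proof.
elim: k A B => [|k IH] A B /=.
  by rewrite orbF => H; exists set0; [rewrite cards0|rewrite H].
case/or3P => [H|/forallP H|/exists_inP[v _ /andP[Hn /forallP H]]].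
- by exists set0; [rewrite cards0|rewrite H].
- have [S c s] := small_reply IH H; exists S; first exact: leq_trans c _.
  by apply/or3P/Or32/forallP.
- have [S c s] := small_reply IH H; exists (v |: S).
    by rewrite cardsU1; case: (v \in S); lia.
  apply/or3P/Or33/exists_inP; exists v; first exact: setU11.
  rewrite Hn; apply/forallP => u; apply: sw_allowed (s u); exact: subsetUr.
Qed.
End SmallS.

Lemma sbound_gt0 k : 0 < sbound k. Proof. by case: k. Qed.

Lemma small_swf (V : finType) (adj : rel V) first k : swf adj first k ->
  exists2 S : {set V}, #|S| <= sbound k.+1 &
    if is_staller first then sw adj S k set0 set0
    else [forall u, sw adj S k set0 [set u]].
Proof.
rewrite /swf; case: ifP => _.
  by case/small_sw => S c s; exists S => //; apply: leq_trans c _ => /=; lia.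
move/forallP => H.
have [|S c s] := @small_reply V adj k set0 set0 (@small_sw V adj k).
  by move=> u; rewrite setU0.
exists S; first by apply: leq_trans c _ => /=.
by apply/forallP => u; have := s u; rewrite setU0.
Qed.

(** * The constraint problem of a short game *)

Section GameCsp.
Variables (n : nat) (a : rel nat) (fs : bool) (k M W : nat).

(** The power [M ^ l], capped at [W] to be definable with polynomial bounds. A number [w < W] lists
    moves of Dominator as digits in base [M], each the index of a vertex in the small set; [dl j] of
    them precede Staller's move [j], both counted from 0. *)
Definition cpow l := iter l (fun b => minn (b * M) W) 1.
Definition dg w l := w %/ cpow l %% M.
Definition dl j := j + ~~ fs.
Definition nbh x y := (y == x) || a x y.
(** Ranks enumerate the closed neighborhood of [x] in increasing order; [rk x n] is its size. *)
Definition rk x y := count (nbh x) (iota 0 y).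
Definition beta := n + M + k + 1.
Definition vx v := v %% beta.
Definition vy v := v %/ beta %% beta.
Definition vj v := v %/ (beta * beta) %% beta.
Definition vs v := v %/ (beta * beta * beta) %% beta.
(** Three kinds of variables. Kind A: the vertex with index [q]. Kind B: for a word [wd q] of
    Dominator's moves and [j = sl q], the index of Staller's move [j]; a value that is no index of a
    vertex is a pass. Kind C: for a word and [i = ci q], the vertex [vy] of rank [i] in the
    neighborhood of [vx] that is claimed at the end, with the move [vj] and the index [vs] that
    claimed it. *)
Definition isA q := q < M.
Definition wd q := (q - M) %/ (2 * k.+1).
Definition sl q := (q - M) %% (2 * k.+1).
Definition isB q := (M <= q) && (sl q <= k).
Definition isC q := (M <= q) && (k < sl q).
Definition ci q := sl q - k.+1.

Definition live q v := ci q < rk (vx v) n.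

(** Each conjunct looks at one or two variables only. Freshness of an answer is a unary constraint,
    since the word in the number of the variable already lists Dominator's moves. The last conjunct
    compares a complete word with the answer to its own prefix of length [dl (vj v)]. *)
Definition gcon q v r w :=
  [&& [&& isA q, isA r & q != r] ==> (v != w),
   (isB q) ==> (v < M) ==> all (fun l => dg (wd q) l != v) (iota 0 (dl (sl q))),
   (isC q) ==> [&& vx v < n, rk (vx v) n <= k &
      live q v ==> [&& nbh (vx v) (vy v), rk (vx v) (vy v) == ci q, vy v < n,
        vj v < k & vs v < M]],
   [&& isC q, isC r & wd q == wd r] ==> (vx v == vx w),
   [&& isC q, isA r, live q v & vs v == r] ==> (w == vy v) &
   [&& isC q, isB r, live q v, vj v == sl r &
     wd q %% cpow (dl (vj v)) == wd r] ==> (w == vs v)].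

Definition gm := M + W * (2 * k.+1).
Definition gV := beta * beta * beta * beta.

Hypotheses (HM : 0 < M) (HW : W = M ^ k.+1).

Lemma cpowE l : l <= k.+1 -> cpow l = M ^ l.
Proof.
elim: l => [|l IH] Hl //=; rewrite -/(cpow l) IH 1?ltnW // -expnSr HW.
by apply/minn_idPl; apply: leq_pexp2l.
Qed.

Lemma dl_le j : j <= k -> dl j <= k.+1.
Proof. by rewrite /dl; case: fs => /=; lia. Qed.

Lemma W_gt0 : 0 < W. Proof. by rewrite HW expn_gt0 HM. Qed.

Lemma dg_lt w l : dg w l < M. Proof. exact: ltn_pmod. Qed.

Lemma dg_mod w l t : l < t -> t <= k.+1 -> dg (w %% cpow t) l = dg w l.
Proof.
move=> Hl Ht; rewrite /dg !cpowE //; last by lia.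
rewrite [in RHS](divn_eq w (M ^ t)).
have -> : w %/ M ^ t * M ^ t = w %/ M ^ t * M ^ (t - l.+1) * M * M ^ l.
  by rewrite -!mulnA -expnS -expnD; congr (_ * M ^ _); lia.
by rewrite divnMDl ?expn_gt0 ?HM // modnMDl.
Qed.

Definition snoc w t d := w %% M ^ t + d * M ^ t.

Lemma snoc_lt w t d : t <= k -> d < M -> snoc w t d < W.
Proof.
move=> Ht Hd; have Hp : 0 < M ^ t by rewrite expn_gt0 HM.
have H1 : w %% M ^ t < M ^ t by rewrite ltn_mod.
apply: (@leq_trans (M ^ t.+1)); last by rewrite HW leq_pexp2l.
by rewrite /snoc expnS; nia.
Qed.

Lemma snoc_mod w t d t' : t' <= t -> t <= k -> snoc w t d %% cpow t' = w %% cpow t'.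
Proof.
move=> H Ht; rewrite cpowE /snoc; last by lia.
have E : M ^ t = M ^ (t - t') * M ^ t' by rewrite -expnD subnK.
rewrite addnC E mulnA modnMDl modn_dvdm //; exact: dvdn_mull.
Qed.

Lemma snoc_last w t d : t <= k -> d < M -> dg (snoc w t d) t = d.
Proof.
move=> Ht Hd; have Hp : 0 < M ^ t by rewrite expn_gt0 HM.
rewrite /dg cpowE /snoc; last by lia.
by rewrite addnC divnMDl // divn_small ?ltn_mod // addn0 modn_small.
Qed.

Lemma snoc_dg w t d l : l < t -> t <= k -> dg (snoc w t d) l = dg w l.
Proof.
move=> Hl Ht; have Ht' : t <= k.+1 by lia.
by rewrite -(dg_mod _ Hl Ht') snoc_mod // dg_mod.
Qed.

Definition iB j w := M + (w * (2 * k.+1) + j).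
Definition iC w i := M + (w * (2 * k.+1) + (k.+1 + i)).

Lemma iB_p j w : j <= k -> [/\ isB (iB j w), wd (iB j w) = w & sl (iB j w) = j].
Proof.
move=> Hj; have H : j < 2 * k.+1 by lia.
rewrite /isB /iB /wd /sl addKn leq_addr divnMDl // modnMDl.
by rewrite divn_small ?modn_small ?addn0.
Qed.

Lemma iC_p w i : i <= k ->
  [/\ isC (iC w i), wd (iC w i) = w, ci (iC w i) = i & sl (iC w i) = k.+1 + i].
Proof.
move=> Hi; have H : k.+1 + i < 2 * k.+1 by lia.
rewrite /isC /ci /iC /wd /sl addKn leq_addr divnMDl // modnMDl.
by rewrite divn_small ?modn_small ?addn0 //; split=> //; lia.
Qed.

Lemma idx_lt r w : w < W -> r < 2 * k.+1 -> M + (w * (2 * k.+1) + r) < gm.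
Proof. by rewrite /gm => H1 H2; rewrite ltn_add2l; nia. Qed.

Lemma rk_nth x N i : i < rk x N -> exists y, [/\ y < N, nbh x y & rk x y = i].
Proof.
elim: N => [|N IH] //; rewrite /rk -[N.+1]addn1 iotaD count_cat /= addn0 add0n.
case Hx: (nbh x N) => /=; rewrite ?addn0 ?addn1 ?ltnS => H; last first.
  by have [y [Hy H1 H2]] := IH H; exists y; split=> //; lia.
case: (ltngtP i (rk x N)) H => // [H _|-> _]; last by exists N; split=> //; lia.
by have [y [Hy H1 H2]] := IH H; exists y; split=> //; lia.
Qed.

Lemma rk_mono x y z : y < z -> nbh x y -> rk x y < rk x z.
Proof.
move=> Hyz Hy; rewrite /rk; have -> : z = y + 1 + (z - y.+1) by lia.
by rewrite !iotaD !count_cat /= addn0 add0n Hy; lia.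
Qed.

Lemma rk_inj x y z : nbh x y -> nbh x z -> rk x y = rk x z -> y = z.
Proof.
by move=> Hy Hz E; case: (ltngtP y z) => // /(rk_mono (x := x)) H;
  [have := H Hy|have := H Hz]; rewrite E ltnn.
Qed.

Section Correct.
Variables (adj : rel 'I_n) (first : player).
Hypotheses (Ha : forall i j : 'I_n, adj i j = a i j) (Hf : is_staller first = fs).

Lemma nbhP (x y : 'I_n) : (y \in closed_nbhd adj x) = nbh x y.
Proof. by rewrite inE Ha. Qed.

Section Sound.
Variable s : nat -> nat.
Hypothesis Hs : forall i j, i < gm -> j < gm -> gcon i (s i) j (s j).

Lemma A_lt b : b < M -> b < gm. Proof. by rewrite /gm; lia. Qed.

Lemma s_inj b b' : b < M -> b' < M -> s b = s b' -> b = b'.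
Proof.
move=> Hb Hb' E; apply/eqP; case/and3P: (Hs (A_lt Hb) (A_lt Hb')) => H _ _.
by apply: contraTT H => Hn; rewrite /isA Hb Hb' Hn E eqxx.
Qed.

Lemma s_fresh j w l : j <= k -> w < W -> s (iB j w) < M -> l < dl j ->
  dg w l != s (iB j w).
Proof.
move=> Hj Hw Hv Hl; have [Bq Wq Sq] := iB_p w Hj.
have Hq : iB j w < gm by apply: idx_lt => //; lia.
case/and3P: (Hs Hq Hq) => _ H _; move: H; rewrite Bq Hv Wq Sq /= => /allP; apply.
by rewrite mem_iota.
Qed.

(** If Staller owns what the kind B variables prescribe along [w], then the kind C variables exhibit
    a closed neighborhood among it. *)
Lemma leaf_won w (A : {set 'I_n}) : w < W ->
  (forall (y : 'I_n) j, j < k -> s (iB j (w %% cpow (dl j))) < M ->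
     s (s (iB j (w %% cpow (dl j)))) = y -> y \in A) -> won adj A.
Proof.
move=> Hw HA.
have HC i : i <= k -> iC w i < gm by move=> Hi; apply: idx_lt => //; lia.
have C0 := HC 0 (leq0n _); have [c0 w0 i0 _] := iC_p w (leq0n k).
case/and5P: (Hs C0 C0) => _ _ H _ /andP[_ _]; move: H.
rewrite c0 /= => /and3P[Hx Hr _]; pose x := Ordinal Hx.
apply/existsP; exists x; apply/subsetP => y; rewrite nbhP => Hy.
have Hi : rk x y <= k by apply: leq_trans (ltnW (rk_mono (ltn_ord y) Hy)) Hr.
have [c1 w1 i1 _] := iC_p w Hi; have C1 := HC _ Hi.
set q := iC w _ in c1 w1 i1 C1.
have Eq : vx (s q) = x.
  case/and5P: (Hs C1 C0) => _ _ _ H /andP[_ _]; move: H.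
  by rewrite c1 c0 w1 w0 eqxx /= => /eqP.
have Hl : live q (s q) by rewrite /live Eq i1; apply: rk_mono Hy.
case/and5P: (Hs C1 C1) => _ _ H _ /andP[_ _]; move: H.
rewrite c1 /= => /and3P[_ _]; rewrite Hl Eq i1 => /and5P[H1 /eqP H2 H3 H4 H5].
have {}H2 : vy (s q) = y by apply: rk_inj H1 Hy H2.
have Hj : vj (s q) <= k by lia.
set w' := w %% cpow (dl (vj (s q))).
have Hw' : w' < W by apply: leq_ltn_trans (leq_mod _ _) Hw.
have [b1 wb sb] := iB_p w' Hj.
have HB : iB (vj (s q)) w' < gm by apply: idx_lt => //; lia.
have Es : s (iB (vj (s q)) w') = vs (s q).
  case/and5P: (Hs C1 HB) => _ _ _ _ /andP[_].
  by rewrite c1 b1 Hl sb wb w1 !eqxx /= => /eqP.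
apply: (HA y _ H4); rewrite -/w' Es //.
case/and5P: (Hs C1 (A_lt H5)) => _ _ _ _ /andP[H _]; move: H.
by rewrite c1 /isA H5 Hl eqxx /= => /eqP ->.
Qed.

(** A move outside the small set gets digit 0 through the reduction modulo [M]. This is harmless:
    the answers then merely avoid a vertex that need not be blocked. *)
Definition digit_of (u : 'I_n) := find (fun b => s b == u) (iota 0 M) %% M.

Lemma digit_lt u : digit_of u < M. Proof. exact: ltn_pmod. Qed.

Lemma digit_ofP (u : 'I_n) b : b < M -> s b = u -> digit_of u = b.
Proof.
move=> Hb E; have Hh : has (fun b => s b == u) (iota 0 M).
  by apply/hasP; exists b; rewrite ?mem_iota ?E ?eqxx.
have Hlt := Hh; rewrite has_find size_iota in Hlt.
rewrite /digit_of modn_small //; have := nth_find 0 Hh.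
rewrite nth_iota // add0n => /eqP E'; apply: s_inj => //.
by rewrite E' E.
Qed.

(** The word [w] records the play so far. Answers are looked up at prefixes of [w], so recording a
    further move leaves the earlier claims unchanged. *)
Lemma sound_sw i j w (A B : {set 'I_n}) : j + i = k -> w < W ->
  (forall (y : 'I_n) j', j' < j -> s (iB j' (w %% cpow (dl j'))) < M ->
     s (s (iB j' (w %% cpow (dl j')))) = y -> y \in A) ->
  (forall (y : 'I_n) b, y \in B -> b < M -> s b = y -> exists2 l, l < dl j & dg w l = b) ->
  sw adj setT i A B.
Proof.
elim: i j w A B => [|i IH] j w A B Hk Hw HA HB.
  by apply/sw_won/(leaf_won Hw) => y j' Hj'; apply: HA; lia.
have Hj : j < k by lia.
have Ht : dl j <= k by have := @dl_le j; rewrite /dl; case: fs => /=; lia.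
have HM' w' u := snoc_lt w' Ht (digit_lt u).
have Hw1 : w %% cpow (dl j) < W by apply: leq_ltn_trans (leq_mod _ _) Hw.
have HB1 (u y : 'I_n) b : y \in u |: B -> b < M -> s b = y ->
    exists2 l, l < dl j.+1 & dg (snoc w (dl j) (digit_of u)) l = b.
  rewrite in_setU1 => /predU1P[->|Hy] Hb E.
    by exists (dl j); [rewrite /dl|rewrite snoc_last ?digit_lt //; apply: digit_ofP].
  have [l Hl <-] := HB y b Hy Hb E; exists l; last exact: snoc_dg.
  by move: Hl; rewrite /dl; lia.
set q := iB j (w %% cpow (dl j)).
have Hmod (u : 'I_n) j' : j' <= j ->
   snoc w (dl j) (digit_of u) %% cpow (dl j') = w %% cpow (dl j').
  by move=> Hj'; apply: snoc_mod => //; rewrite /dl; lia.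
case: (boolP ((s q < M) && (s (s q) < n))) => [/andP[H1 H2]|Hno].
  apply/or3P/Or33/exists_inP; exists (Ordinal H2); rewrite ?inE //.
  apply/andP; split.
    apply/negP => /HB /(_ H1 (erefl _)) [l Hl E].
    have := s_fresh (ltnW Hj) Hw1 H1 Hl.
    by rewrite dg_mod ?E ?eqxx // ltnW.
  apply/forallP => u; apply: (IH j.+1 (snoc w (dl j) (digit_of u))) => //.
  - by rewrite addSn -addnS.
  - move=> y j'; rewrite ltnS => Hj'; rewrite Hmod // in_setU1.
    case: (ltngtP j' j) Hj' => // [Hj' _ G1 G2|-> _ G1 G2].
      by rewrite (HA y j') ?orbT.
    by apply/orP; left; apply/eqP/val_inj; rewrite /= -G2.
  - by move=> y b; apply: HB1.
apply/or3P/Or32/forallP => u.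
apply: (IH j.+1 (snoc w (dl j) (digit_of u))) => //.
- by rewrite addSn -addnS.
- move=> y j'; rewrite ltnS => Hj'; rewrite Hmod //.
  case: (ltngtP j' j) Hj' => // [Hj' _ G1 G2|-> _ G1 G2].
    exact: (HA y j').
  by move: Hno; rewrite G1 G2 ltn_ord.
- by move=> y b; apply: HB1.
Qed.

Lemma sound_swf : swf adj first k.
Proof.
rewrite /swf Hf; case E: fs.
  apply: (@sound_sw k 0 0) => //; first exact: W_gt0.
  by move=> y b; rewrite inE.
apply/forallP => u; apply: (@sound_sw k 0 (snoc 0 0 (digit_of u))) => //.
  by apply: snoc_lt => //; apply: digit_lt.
move=> y b; rewrite inE => /eqP -> Hb Es; exists 0; first by rewrite /dl E.
by rewrite snoc_last ?digit_lt //; apply: digit_ofP.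
Qed.
End Sound.

Section Complete.
Variable S : {set 'I_n}.
Hypotheses (HS : #|S| <= M) (n_gt0 : 0 < n).
Hypothesis HSw : if fs then sw adj S k set0 set0
  else [forall u, sw adj S k set0 [set u]].

(** Indices beyond the size of [S] receive the distinct numbers [n + b], which are no vertices; so
    different indices keep different values. *)
Definition sA b := nth (n + b) [seq val v | v <- enum S] b.

Lemma sA_real b : b < #|S| -> sA b < n.
Proof.
move=> Hb; have : sA b \in [seq val v | v <- enum S].
  by apply: mem_nth; rewrite size_map -cardE.
by case/mapP => v _ ->; apply: ltn_ord.
Qed.

Lemma sA_dummy b : #|S| <= b -> sA b = n + b.
Proof. by move=> Hb; rewrite /sA nth_default // size_map -cardE. Qed.

Lemma sA_inj b b' : sA b = sA b' -> b = b'.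
Proof.
case: (ltnP b #|S|) => Hb; case: (ltnP b' #|S|) => Hb'.
- have Hs c : c < #|S| -> c < size [seq val v | v <- enum S].
    by rewrite size_map -cardE.
  rewrite /sA (set_nth_default 0 (n + b) (Hs _ Hb)).
  rewrite (set_nth_default 0 (n + b') (Hs _ Hb')) => /eqP.
  rewrite nth_uniq ?Hs // => [/eqP //|].
  by rewrite map_inj_uniq ?enum_uniq //; apply: val_inj.
- by have := sA_real Hb; rewrite (sA_dummy Hb'); lia.
- by have := sA_real Hb'; rewrite (sA_dummy Hb); lia.
- by rewrite !sA_dummy //; lia.
Qed.

Definition idx (v : 'I_n) := index v (enum S).

Lemma idxP v : v \in S -> idx v < M /\ sA (idx v) = v.
Proof.
move=> Hv; have Hi : idx v < size (enum S) by rewrite index_mem mem_enum.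
split; first by apply: leq_trans HS; rewrite cardE.
by rewrite /sA (nth_map v) // nth_index // mem_enum.
Qed.

Definition pick_move j (AB : {set 'I_n} * {set 'I_n}) : option 'I_n :=
  [pick v | [&& v \in S, v \notin AB.2 &
     [forall u, sw adj S (k - j.+1) (v |: AB.1) (u |: AB.2)]]].

Definition after (D : nat -> nat) l (B : {set 'I_n}) :=
  [set y : 'I_n | (y \in B) || (sA (D l) == y)].

(** The position before Staller's move [j] when Dominator plays the digits of [D] and Staller
    follows a fixed choice of winning moves. By [st_ext] it depends only on the digits played so
    far, so answers can be stored per prefix. *)
Fixpoint play (D : nat -> nat) j : {set 'I_n} * {set 'I_n} :=
  if j is j'.+1 then
    let AB := play D j' in
    (if pick_move j' AB is Some v then v |: AB.1 else AB.1, after D (dl j') AB.2)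
  else (set0, if fs then set0 else after D 0 set0).

Definition sg D j := pick_move j (play D j).

Lemma st_ext D D' j : (forall l, l < dl j -> D l = D' l) -> play D j = play D' j.
Proof.
elim: j => [|j IH] H /=.
  by case E: fs; rewrite // /after H // /dl E.
rewrite IH; last by move=> l Hl; apply: H; move: Hl; rewrite /dl; lia.
by rewrite /after H // /dl; lia.
Qed.

Lemma sw_after j A B D l : (forall u, sw adj S j A (u |: B)) -> sw adj S j A (after D l B).
Proof.
move=> H; case: (ltnP (sA (D l)) n) => Hl.
  apply: sw_mono (H (Ordinal Hl)) => //; apply/subsetP => y; rewrite !inE.
  by case/orP => [->|/eqP E]; rewrite ?orbT // -val_eqE /= E eqxx.
apply: sw_mono (H (Ordinal n_gt0)) => //; apply/subsetP => y; rewrite !inE.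
case/orP => [->|/eqP E]; first by rewrite orbT.
by move: Hl; rewrite E leqNgt ltn_ord.
Qed.

Lemma st_sw D j : j <= k -> sw adj S (k - j) (play D j).1 (play D j).2.
Proof.
elim: j => [|j IH] Hj /=.
  move: HSw; rewrite subn0; case: fs => // /forallP H.
  by apply: sw_after => u; rewrite setU0.
have := IH (ltnW Hj); set A := (play D j).1; set B := (play D j).2.
have -> : k - j = (k - j.+1).+1 by lia.
rewrite /pick_move -/A -/B; case: pickP => [v /and3P[_ _ /forallP H] _|Hno].
  exact: sw_after.
case/or3P => [H|/forallP H|/exists_inP[v Hv /andP[Hn H]]].
- exact: sw_won.
- exact: sw_after.
- by have := Hno v; rewrite Hv Hn H.
Qed.

Lemma st_won D : won adj (play D k).1.
Proof. by have := st_sw D (leqnn k); rewrite subnn /= orbF. Qed.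

Lemma st_claimed D j (y : 'I_n) : y \in (play D j).1 -> exists2 j', j' < j & sg D j' = Some y.
Proof.
elim: j => [|j IH] /=; first by rewrite inE.
have HI : y \in (play D j).1 -> exists2 j', j' < j.+1 & sg D j' = Some y.
  by move=> /IH[j' H1 H2]; exists j' => //; rewrite ltnW.
case E: (pick_move j (play D j)) => [v|] //.
by rewrite in_setU1 => /predU1P[->|] //; exists j.
Qed.

Lemma st_card D j : #|(play D j).1| <= j.
Proof.
elim: j => [|j IH] /=; first by rewrite cards0.
case: (pick_move _ _) => [v|]; last exact: leqW.
by rewrite cardsU1; case: (v \notin _); rewrite ?add1n ?add0n // leqW.
Qed.

Lemma st_blocked D j l (y : 'I_n) : l < dl j -> sA (D l) = y -> y \in (play D j).2.
Proof.
move=> Hl E; elim: j Hl => [|j IH] /=.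
  by rewrite /dl; case: fs => //=; case: l E => //; rewrite !inE => ->; rewrite eqxx.
rewrite {1}/dl => Hl; rewrite !inE; case: (eqVneq l (dl j)) => [El|Nl].
  by rewrite -El E eqxx orbT.
by rewrite IH // /dl; move: Nl; rewrite /dl; lia.
Qed.

Definition sB j w := if sg (dg w) j is Some v then idx v else M.

Definition witness P : 'I_n :=
  odflt (Ordinal n_gt0) [pick x | closed_nbhd adj x \subset (play (dg P) k).1].

Lemma witnessP P : closed_nbhd adj (witness P) \subset (play (dg P) k).1.
Proof.
rewrite /witness; case: pickP => [x //|H].
by case/existsP: (st_won (dg P)) => x Hx; have := H x; rewrite Hx.
Qed.

Definition nth_nbr P i : 'I_n :=
  odflt (Ordinal n_gt0) [pick y : 'I_n | nbh (witness P) y && (rk (witness P) y == i)].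

Definition when P (y : 'I_n) := find (fun j => sg (dg P) j == Some y) (iota 0 k).

Lemma nth_nbrP P i : i < rk (witness P) n ->
  [/\ nbh (witness P) (nth_nbr P i), rk (witness P) (nth_nbr P i) = i,
      when P (nth_nbr P i) < k &
      sg (dg P) (when P (nth_nbr P i)) = Some (nth_nbr P i)].
Proof.
move=> Hi; have [H1 H2] : nbh (witness P) (nth_nbr P i) /\ rk (witness P) (nth_nbr P i) = i.
  rewrite /nth_nbr; case: pickP => [y /andP[H1 /eqP H2] //|Hno].
  have [y [Hy H1 H2]] := rk_nth Hi.
  by have := Hno (Ordinal Hy); rewrite /= H1 H2 eqxx.
set y := nth_nbr P i in H1 H2 *.
have : y \in (play (dg P) k).1 by apply: (subsetP (witnessP P)); rewrite nbhP.
case/st_claimed => j Hj E.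
have Hh : has (fun j => sg (dg P) j == Some y) (iota 0 k).
  by apply/hasP; exists j; rewrite ?mem_iota ?E ?eqxx.
have Hw := Hh; rewrite has_find size_iota in Hw; split=> //.
by have := nth_find 0 Hh; rewrite nth_iota // add0n => /eqP.
Qed.

Lemma witness_small P : rk (witness P) n <= k.
Proof.
apply: leq_trans (st_card (dg P) k); apply: leq_trans (subset_leq_card (witnessP P)).
rewrite /rk -val_enum_ord count_map -size_filter.
rewrite -(card_uniqP (filter_uniq _ (enum_uniq _))); apply: subset_leq_card.
by apply/subsetP => y; rewrite mem_filter nbhP => /andP[].
Qed.

Definition enc x y j v := x + y * beta + j * (beta * beta) + v * (beta * beta * beta).

Lemma enc_lt x y j v : x < beta -> y < beta -> j < beta -> v < beta ->
  enc x y j v < gV.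
Proof.
move=> Hx Hy Hj Hv; rewrite /enc /gV.
set b2 := beta * beta; set b3 := b2 * beta.
have H1 : x + y * beta < b2 by rewrite /b2; nia.
have H2 : x + y * beta + j * b2 < b3 by rewrite /b3; nia.
nia.
Qed.

Lemma encP x y j v : x < beta -> y < beta -> j < beta -> v < beta ->
  [/\ vx (enc x y j v) = x, vy (enc x y j v) = y, vj (enc x y j v) = j &
      vs (enc x y j v) = v].
Proof.
move=> Hx Hy Hj Hv; have Hb : 0 < beta by rewrite /beta addn1.
have E : enc x y j v = x + (y + (j + v * beta) * beta) * beta by rewrite /enc; ring.
have E1 u w : u < beta -> (u + w * beta) %% beta = u.
  by move=> Hu; rewrite addnC modnMDl modn_small.
have E2 u w : u < beta -> (u + w * beta) %/ beta = w.
  by move=> Hu; rewrite addnC divnMDl // divn_small // addn0.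
by rewrite /vx /vy /vj /vs !divnMA E !(E1, E2) // modn_small.
Qed.

Definition sC P i := enc (witness P) (nth_nbr P i) (when P (nth_nbr P i))
  (sB (when P (nth_nbr P i)) P).

Definition sol q := if q < M then sA q else
  if sl q <= k then sB (sl q) (wd q) else sC (wd q) (ci q).

Lemma lt_beta u : [|| u < n, u <= M | u <= k] -> u < beta.
Proof. by rewrite /beta; lia. Qed.

Lemma sB_le j w : sB j w <= M.
Proof.
rewrite /sB /sg /pick_move; case: pickP => [v /andP[Hv _]|//].
by have [H _] := idxP Hv; apply: ltnW.
Qed.

Lemma sC_dec P i : [/\ vx (sC P i) = witness P, vy (sC P i) = nth_nbr P i,
  vj (sC P i) = when P (nth_nbr P i) & vs (sC P i) = sB (when P (nth_nbr P i)) P].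
Proof.
have Hw : when P (nth_nbr P i) <= k.
  by rewrite /when -{2}(size_iota 0 k) find_size.
apply: encP; apply: lt_beta; rewrite ?ltn_ord ?Hw ?sB_le ?orbT //.
Qed.

Lemma gV_ge u : u <= n + M -> u < gV.
Proof.
move=> H; have Hb : u < beta by rewrite /beta; lia.
apply: leq_trans Hb _; rewrite /gV -!mulnA leq_pmulr // !muln_gt0.
by rewrite /beta addn1.
Qed.

Lemma sol_lt q : q < gm -> sol q < gV.
Proof.
move=> Hq; rewrite /sol; case: (ltnP q M) => Hm.
  case: (ltnP q #|S|) => H.
    by have := sA_real H; move=> {}H; apply: gV_ge; lia.
  by rewrite sA_dummy //; apply: gV_ge; lia.
case: (leqP (sl q) k) => Hk; first by apply: gV_ge; apply: leq_trans (sB_le _ _) (leq_addl _ _).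
have Hw P i: when P (nth_nbr P i) <= k.
  by rewrite /when -{2}(size_iota 0 k) find_size.
by apply: enc_lt; apply: lt_beta; rewrite ?ltn_ord ?Hw ?sB_le ?orbT.
Qed.

Lemma sB_mod j P : j <= k -> sB j (P %% cpow (dl j)) = sB j P.
Proof.
move=> Hj; rewrite /sB /sg; suff -> : play (dg (P %% cpow (dl j))) j = play (dg P) j by [].
by apply: st_ext => l Hl; apply: dg_mod => //; apply: dl_le.
Qed.

Lemma sB_some j P y : sg (dg P) j = Some y -> sB j P < M /\ sA (sB j P) = y.
Proof.
rewrite /sB => E; rewrite E; move: E; rewrite /sg /pick_move.
by case: pickP => [v /andP[Hv _] [<-]|//]; apply: idxP.
Qed.

Lemma sol_ok q r : q < gm -> r < gm -> gcon q (sol q) r (sol r).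
Proof.
move=> Hq Hr; rewrite /gcon.
have EA u : isA u -> sol u = sA u by rewrite /isA /sol => ->.
have EB u : isB u -> sol u = sB (sl u) (wd u).
  by rewrite /isB /sol leqNgt => /andP[/negPf -> ->].
have EC u : isC u -> sol u = sC (wd u) (ci u).
  by rewrite /isC /sol leqNgt => /andP[/negPf ->]; rewrite ltnNge => /negPf ->.
have Cq u : isC u -> live u (sol u) -> ci u < rk (witness (wd u)) n.
  by move=> c; rewrite /live (EC u c); have [-> _ _ _] := sC_dec (wd u) (ci u).
apply/and5P; split; [| | | |apply/andP; split]; apply/implyP.
- by case/and3P => Aq Ar Hqr; apply: contraNneq Hqr; rewrite !EA // => /sA_inj ->.
- move=> Bq; apply/implyP; rewrite EB // => Hv; apply/allP => l; rewrite mem_iota => /andP[_ Hl].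
  apply/negP => /eqP E; move: Hv; rewrite -E.
  case Es: (sg (dg (wd q)) (sl q)) => [y|]; last by move: E; rewrite /sB Es; have := dg_lt (wd q) l; lia.
  have [_ Hy] := sB_some Es; rewrite -E in Hy.
  have := st_blocked Hl Hy; move: Es; rewrite /sg /pick_move; case: pickP => // v /and3P[_ Hv _] [<-].
  by rewrite (negPf Hv).
- move=> c; have Hl := Cq q c; move: Hl; rewrite EC //.
  have [-> -> Ej ->] := sC_dec (wd q) (ci q) => Hl.
  rewrite ltn_ord witness_small; apply/implyP => /Hl /nth_nbrP[H1 H2 H3 H4].
  by rewrite H1 H2 eqxx ltn_ord Ej H3; have [-> _] := sB_some H4.
- case/and3P => c c' /eqP E; rewrite !EC //.
  by have [-> _ _ _] := sC_dec (wd q) (ci q); have [-> _ _ _] := sC_dec (wd r) (ci r); rewrite E.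
- case/and4P => c Ar Hl; have := Cq q c Hl => /nth_nbrP[H1 H2 H3 H4].
  rewrite EC // EA //; have [_ -> _ ->] := sC_dec (wd q) (ci q) => /eqP <-.
  by have [_ ->] := sB_some H4.
- case/and5P => c Br Hl /eqP E1 /eqP E2; have := Cq q c Hl => /nth_nbrP[H1 H2 H3 H4].
  rewrite EB // -E2 -E1 EC //; have [_ _ -> ->] := sC_dec (wd q) (ci q).
  by rewrite sB_mod // ltnW.
Qed.

Lemma complete_bcsp : bcsp gm gV gcon.
Proof.
exists sol; split=> [q|q r]; first exact: sol_lt.
exact: sol_ok.
Qed.

End Complete.
End Correct.
End GameCsp.

(** * The membership reduction *)

Ltac def_asm := match goal with H : def _ _ |- _ =>
  first [ exact: H | exact: (def_behead H) | exact: (def_behead (def_behead H))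
        | exact: (def_behead (def_behead (def_behead H))) ] end.
Ltac def_hook ::=
  first [ def_asm | apply: def_nl | apply: def_arcx | apply: def_andx | apply: def_outx
        | apply: def_firstx | apply: def_powcap ].

(** The cap [2 ^ (F * N)] is elementary and exceeds all the powers involved. *)
Lemma def_expn F N : def elem F -> def elem N -> def elem (fun x e => F x e ^ N x e).
Proof.
move=> HF HN.
have H : def elem (fun x e => iter (N x e) (fun a => minn (a * F x e) (2 ^ (F x e * N x e))) 1).
  by apply: def_powcap => //; apply: def_exp2; apply: def_mul.
apply: def_ext H => x e; set f := F x e; set m := N x e.
have G i : i <= m -> iter i (fun a => minn (a * f) (2 ^ (f * m))) 1 = f ^ i.
  elim: i => [|i IH] Hi //=; rewrite IH 1?ltnW // -expnSr.
  apply/minn_idPl; apply: (@leq_trans ((2 ^ f) ^ i.+1)).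
    by rewrite leq_exp2r // ltnW // ltn_expl.
  by rewrite -expnM leq_pexp2l // leq_mul2l Hi orbT.
exact: G.
Qed.

Lemma sbound_le k : (sbound k).+1 <= 2 ^ (2 ^ k).
Proof.
elim: k => [|k IH] //=; rewrite expnS mulnC expnM -mulnn.
have H := sbound_gt0 k; apply: leq_trans (leq_mul IH IH).
by move: (sbound k) H => m; clear; nia.
Qed.

Lemma def_sbound F : def elem F -> def elem (fun x e => sbound (F x e)).
Proof.
move=> HF.
have HH : def elem (fun x e => (nth 0 e 1 + nth 0 e 1 * nth 0 e 1).+1) by deft.
have HB : def elem (fun x e => 2 ^ (2 ^ F x e)) by do 2!apply: def_exp2.
have E n : iteri n (fun _ a => (a + a * a).+1) 1 = sbound n by elim: n => //= n ->.
apply: def_ext (d_rec HF HH (d_const elem 1) (def_bnd HB) _) => x e; first exact: E.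
move=> i Hi; rewrite E; apply: leq_trans (ltnW (sbound_le i)) _.
by rewrite leq_pexp2l // leq_pexp2l.
Qed.

Section Def.
Variable mj : majorants.
Notation def := (def mj).

Lemma def_carc N0 V (c : seq bool -> seq nat -> nat -> nat -> nat -> nat -> bool) F G :
  def N0 -> def V -> def F -> def G ->
  (forall q v r w, def q -> def v -> def r -> def w ->
     def (fun x e => c x e (q x e) (v x e) (r x e) (w x e) : nat)) ->
  def (fun x e => carc (V x e) (c x e) (N0 x e) (F x e) (G x e) : nat).
Proof.
move=> HN HV HF HG Hc; rewrite /carc /okp /cpair /clast.
repeat first [def_step | apply: Hc].
Qed.

Lemma def_gcon Fk FM FW q v r w : def Fk -> def FM -> def FW ->
  def q -> def v -> def r -> def w ->
  def (fun x e => gcon (nl x) (arcx x) (firstx x) (Fk x e) (FM x e) (FW x e)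
    (q x e) (v x e) (r x e) (w x e) : nat).
Proof.
move=> Hk HM HW Hq Hv Hr Hw.
rewrite /gcon /live /rk /nbh /dg /ci /isA /isB /isC /wd /sl /vx /vy /vj /vs /beta /dl /cpow.
deft.
Qed.

Lemma def_game_word : def (fun x e => game_word x (size x) : nat).
Proof. rewrite /game_word /gsize; deft. Qed.
End Def.

Section Def.
Variable mj : majorants.
Lemma def_csize F : def mj F -> def mj (fun x e => csize (F x e)).
Proof. by move=> HF; rewrite /csize; deft. Qed.

Lemma def_gsize F : def mj F -> def mj (fun x e => gsize (F x e)).
Proof. by move=> HF; rewrite /gsize; deft. Qed.

Lemma def_clast F : def mj F -> def mj (fun x e => clast (F x e)).
Proof. by move=> HF; rewrite /clast; deft. Qed.
End Def.

Lemma encode_csp_circuit m V c :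
  encode_circuit (csp_circuit m V c) =
  mkseq (cbit (clast (m * V)).+1 (carc V c (m * V)) (pred1 (clast (m * V))) (clast (m * V)))
    (csize (clast (m * V)).+1).
Proof. exact: encode_circuitE. Qed.

Lemma encode_circuit_inj n : injective (@encode_circuit n).
Proof.
move=> C C' E.
have Earc : arc C =2 arc C' by move=> i j; rewrite -!arcx_circuit E.
have Eand : is_and C =1 is_and C' by move=> i; rewrite -!andx_circuit E.
have Eout : output C = output C'.
  have := outx_circuit C (ltn_ord (output C)).
  by rewrite E outx_circuit // eqxx => /eqP/val_inj.
case: C C' {E} Earc Eand Eout => a g o [a' g' o'] /= Ea Eg <-.
congr Circuit; last exact: fext.
by apply: fext => i; apply: fext => j; apply: Ea.
Qed.

Lemma bcsp_wcs m V c : 2 <= m -> 1 <= V ->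
  wcs 1 3 (encode_circuit (csp_circuit m V c)) m <-> bcsp m V c.
Proof.
move=> Hm HV; split=> [[n [C [_ _ _ E]]]|H].
  have En := congr1 nl E; rewrite !nl_circuit in En.
  case: n / En C E => C /encode_circuit_inj <-; exact: sat_csp.
exists (clast (m * V)).+1, (csp_circuit m V c); split=> //.
- exact: csp_wf.
- exact: csp_weft.
- exact: csp_depth.
- exact: csp_sat.
Qed.

(* The environment is [i :: size x :: k :: M :: W :: _]. *)
Definition membership_bit (x : seq bool) (e : seq nat) : bool :=
  let k := nth 0 e 2 in let M := nth 0 e 3 in let W := nth 0 e 4 in
  let V := gV (nl x) k M in
  let N0 := gm k M W * V in
  cbit (clast N0).+1
    (carc V (gcon (nl x) (arcx x) (firstx x) k M W) N0) (pred1 (clast N0)) (clast N0)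
    (nth 0 e 0).

Lemma def_membership_bit mj : def mj (fun x e => membership_bit x e : nat).
Proof.
have H2 : def mj (fun x e => nth 0 e 2) by apply: d_var.
have H3 : def mj (fun x e => nth 0 e 3) by apply: d_var.
have H4 : def mj (fun x e => nth 0 e 4) by apply: d_var.
have HV : def mj (fun x e => gV (nl x) (nth 0 e 2) (nth 0 e 3)).
  by rewrite /gV /beta; deft.
have HN : def mj (fun x e => gm (nth 0 e 2) (nth 0 e 3) (nth 0 e 4) *
    gV (nl x) (nth 0 e 2) (nth 0 e 3)).
  by apply: def_mul => //; rewrite /gm; deft.
have HL := def_clast HN.
rewrite /membership_bit /cbit /=.
deft; apply: (@def_carc _ _ _ (fun x e => gcon (nl x) (arcx x) (firstx x)
    (nth 0 e 2) (nth 0 e 3) (nth 0 e 4)) _ _ HN HV); deft.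
by move=> *; apply: def_gcon.
Qed.

Lemma game_in_W : in_W 1 short_staller_mb_dom_game.
Proof.
exists 3.
have HM : elem_fun (fun k => sbound k.+1) by apply/def_sbound/d_succ/d_var.
have HW : elem_fun (fun k => sbound k.+1 ^ k.+1).
  by apply: def_expn; [apply/def_sbound/d_succ/d_var|apply/d_succ/d_var].
apply: (@fpt_extend _ _ _ [:: fun k => sbound k.+1; fun k => sbound k.+1 ^ k.+1]
  (fun k => gm k (sbound k.+1) (sbound k.+1 ^ k.+1)) (fun _ => 0) (fun _ => 0)
  (fun _ _ => 0) (fun x e => membership_bit x e : nat)
  (fun x e => if game_word x (size x) && (0 < nl x) then
     csize (clast (gm (nth 0 e 1) (nth 0 e 2) (nth 0 e 3) *
       gV (nl x) (nth 0 e 1) (nth 0 e 2))).+1 else 0)).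
- exact: fpt_reducible_refl.
- by [].
- apply: def_add => //; apply: def_mul => //; apply: def_mul; first exact: d_const.
  exact/d_succ/d_var.
- exact: d_const.
- exact: d_const.
- exact: d_const.
- exact: def_membership_bit.
- apply: def_if; [|apply/def_csize/d_succ/def_clast; rewrite /gm /gV /beta; deft|exact: d_const].
  by apply: def_and; [apply: def_game_word|deft].
move=> x k; set M := sbound k.+1; set W := M ^ k.+1.
have HM0 : 0 < M by apply: sbound_gt0.
rewrite /out_of /word_of /=.
(* For a word that encodes no game with a vertex the output is empty, and the empty word encodes no
   circuit. *)
case: ifP => [/andP[Hx Hn]|Hno]; last first.
  split=> [[n [adj [first [Hs Hi Ex /staller_winsP[[v _] _]]]]]|[n [C [_ _ _]]]].
    by case/negP: Hno; rewrite Ex game_word_enc // nl_game; case: v => i; lia.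
  by move/(congr1 size); rewrite size_mkseq size_circuit /csize.
have [Hs Hi Ex] := game_wordP Hx.
set a := arcx x; set fs := firstx x.
set w := mkseq _ _; have -> : w = encode_circuit (csp_circuit (gm k M W) (gV (nl x) k M)
    (gcon (nl x) a fs k M W)).
  rewrite encode_csp_circuit /w /mkseq; apply: eq_map => i.
  by rewrite /membership_bit /=; case: (cbit _ _ _ _ _).
rewrite bcsp_wcs; last first.
- by rewrite /gV /beta !addn1 !muln_gt0.
- rewrite /gm; have : 0 < W by rewrite expn_gt0 HM0.
  by move: HM0; clear; nia.
have Ha (i j : 'I_(nl x)) : @adjx x i j = a i j by [].
have Hf : is_staller (playerx x) = fs by rewrite /playerx /fs; case: (firstx x).
split=> [[n [adj [first [_ _ E /staller_winsP[_ Hsw]]]]]|[s [Hs1 Hs2]]].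
  have En : n = nl x by rewrite E nl_game.
  subst n.
  have Ha' (i j : 'I_(nl x)) : adj i j = a i j by have := arcx_game adj first i j; rewrite -E.
  have Hf' : is_staller first = fs by have := firstx_game adj first; rewrite -E.
  have [S HS HSw] := small_swf Hsw; rewrite Hf' in HSw.
  exact: (complete_bcsp HM0 (erefl W) Ha' Hf' HS Hn HSw).
exists (nl x), (@adjx x), (playerx x); split=> //.
apply/staller_winsP; split; first by exists (Ordinal Hn).
exact: (sound_swf HM0 (erefl W) Ha Hf Hs2).
Qed.

(** * From constraint satisfaction to the game *)

Definition bit w q := odd (w %/ 2 ^ q).

Lemma bitS w q : bit w q.+1 = bit w./2 q.
Proof. by rewrite /bit expnS divnMA divn2. Qed.

Lemma bit0 w : bit w 0 = odd w. Proof. by rewrite /bit divn1. Qed.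

Lemma half_lt w h : w < 2 ^ h.+1 -> w./2 < 2 ^ h.
Proof. by rewrite expnS -divn2 => H; rewrite ltn_divLR // mulnC. Qed.

Lemma bit_ext h w w' : w < 2 ^ h -> w' < 2 ^ h ->
  (forall q, q < h -> bit w q = bit w' q) -> w = w'.
Proof.
elim: h w w' => [|h IH] w w' Hw Hw' H; first by move: Hw Hw'; rewrite expn0; lia.
rewrite -(odd_double_half w) -(odd_double_half w') -!bit0 H //.
congr (_ + _.*2); apply: IH; [exact: half_lt|exact: half_lt|].
by move=> q Hq; rewrite -!bitS; apply: H.
Qed.

Lemma bit_ex h (f : nat -> bool) : exists2 w, w < 2 ^ h & forall q, q < h -> bit w q = f q.
Proof.
elim: h f => [|h IH] f; first by exists 0.
have [w Hw E] := IH (fun q => f q.+1).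
exists (f 0 + w.*2); first by rewrite expnS; case: (f 0); lia.
case=> [|q] Hq; first by rewrite bit0 oddD odd_double addbF; case: (f 0).
by rewrite bitS half_bit_double E.
Qed.

(** [VX x] is a pick, [VR d] the root of copy [d], and [VY d q b] for both [b] the pair at level
    [q]. [VL d w e] is a leaf at the end of branch [w], which stands for a test; [e > 0] codes the
    two picks tested, while [e = 0] means that nothing is tested. *)
Inductive vt := VX of nat | VR of nat | VY of nat & nat & bool | VL of nat & nat & nat.

(** * The gadget graph *)

Section Gadget.
Variables (m V : nat) (c : nat -> nat -> nat -> nat -> bool).

(** With [2 * m] levels there are at least [m * m] branches, one for each pair of variables, and so
    many level vertices that a neighborhood containing all of them exceeds Staller's budget. *)
Definition lv := m.*2.
(** Each value of each variable has [m.+1] twins, so that [m] moves of Dominator cannot block it. *)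
Definition nX := m * V * m.+1.
Definition nE := (nX * nX).+1.
Definition col x := x %/ (V * m.+1).
Definition valx x := x %/ m.+1 %% V.
Definition ti w := w %% m.
Definition tj w := w %/ m %% m.
(** In a test of a variable against itself both picks must be the same vertex; so two different
    picks for one variable fail. *)
Definition compat w x y :=
  [&& col x == ti w, col y == tj w, (ti w == tj w) ==> (x == y) &
      c (ti w) (valx x) (tj w) (valx y)].
Definition x1 e := e.-1 %/ nX.
Definition x2 e := e.-1 %% nX.
Definition badl w e := (0 < e) && ~~ compat w (x1 e) (x2 e).

Definition valid v := match v with
  | VX x => x < nX | VR d => d <= m | VY d q _ => (d <= m) && (q < lv)
  | VL d w e => [&& d <= m, w < 2 ^ lv & e < nE] end.

Definition link d w e u := match u with
  | VR d' => d == d' | VY d' q b => (d == d') && (b == bit w q)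
  | VX x => (0 < e) && ((x == x1 e) || (x == x2 e)) | VL _ _ _ => false end.

(** The vertices other than leaves form a clique. A leaf is joined to its root, its branch and its
    picks, and to all non-leaves if its picks fail the test. So only leaves whose test succeeds, or
    with [e = 0], have neighborhoods within Staller's reach. *)
Definition adjv u v := match u, v with
  | VL _ _ _, VL _ _ _ => false
  | VL d w e, _ => badl w e || link d w e v
  | _, VL d w e => badl w e || link d w e u
  | _, _ => true end.

Lemma adjvC u v : adjv u v = adjv v u.
Proof. by case: u; case: v. Qed.

Hypotheses (Hm : 1 < m) (HV : 0 < V).

Variables (T : finType) (view : T -> vt) (code : vt -> T).
Hypotheses (viewK : forall t, code (view t) = t) (validV : forall t, valid (view t))
  (codeK : forall v, valid v -> view (code v) = v).

Definition gadj (t u : T) := (t != u) && adjv (view t) (view u).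
Implicit Types A B D : {set T}.
Notation "v '\at' A" := (code v \in A) (at level 70).

(** One move for each variable and each level, one for a root and one for a leaf. *)
Definition kk := m + lv + 2.

Lemma code_inj u v : valid u -> valid v -> code u = code v -> u = v.
Proof. by move=> Hu Hv E; rewrite -(codeK Hu) E codeK. Qed.

Lemma nbhd_leaf d w e t : valid (VL d w e) -> ~~ badl w e ->
  (t \in closed_nbhd gadj (code (VL d w e))) = (t == code (VL d w e)) || link d w e (view t).
Proof.
move=> Hv Hb; rewrite inE /gadj codeK //; case: eqVneq => //= Ht.
by case: (view t) => //= *; rewrite (negPf Hb).
Qed.

Lemma x1_pair x y : y < nX -> x1 (x * nX + y).+1 = x.
Proof. by move=> Hy; rewrite /x1 /= divnMDl ?divn_small ?addn0 //; lia. Qed.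

Lemma x2_pair x y : y < nX -> x2 (x * nX + y).+1 = y.
Proof. by move=> Hy; rewrite /x2 /= modnMDl modn_small. Qed.

Lemma pair_lt x y : x < nX -> y < nX -> (x * nX + y).+1 < nE.
Proof. by rewrite /nE => Hx Hy; nia. Qed.

Lemma x12_lt e : 0 < e -> e < nE -> [/\ x1 e < nX, x2 e < nX & e = (x1 e * nX + x2 e).+1].
Proof.
rewrite /nE => H0 He; have Hn : 0 < nX by case: nX He => //; lia.
by rewrite /x1 /x2 ltn_mod Hn -divn_eq ltn_divLR //; split=> //; lia.
Qed.

Lemma col_lt x : x < nX -> col x < m.
Proof. by rewrite /nX -mulnA /col => H; rewrite ltn_divLR // muln_gt0 HV. Qed.

Lemma ti_lt w : ti w < m. Proof. by rewrite ltn_mod; lia. Qed.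
Lemma tj_lt w : tj w < m. Proof. by rewrite ltn_mod; lia. Qed.

(** * Staller wins if the constraints are satisfiable *)

Section StallerWins.
Variable s : nat -> nat.
Hypotheses (Hs : forall i, i < m -> s i < V)
  (Hc : forall i j, i < m -> j < m -> c i (s i) j (s j)).

Definition picked i A := exists x, [/\ x < nX, col x = i, valx x = s i & VX x \at A].

(** Both [VL d w 0] and [VL d w e], with [e] the picks for test [w], lack only the leaf itself.
    Dominator's last move [u] can block one of them. *)
Lemma double_threat d (f : nat -> bool) A B u : d <= m -> VR d \at A ->
  (forall i, i < m -> picked i A) ->
  (forall q, q < lv -> VY d q (f q) \at A) ->
  (forall w e, w < 2 ^ lv -> e < nE -> (forall q, q < lv -> bit w q = f q) ->
     ~~ (VL d w e \at B)) ->
  sw gadj setT 1 A (u |: B).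
Proof.
move=> Hd HR HP HY HB; have [w Hw Ew] := bit_ex lv f.
have [x [Hx Cx Vx Ax]] := HP _ (ti_lt w).
have [y [Hy Cy Vy Ay]] : exists y, [/\ y < nX, col y = tj w, valx y = s (tj w) &
    VX y \at A /\ ((ti w == tj w) ==> (x == y))].
  case: (eqVneq (ti w) (tj w)) => [<-|_]; first by exists x; rewrite Hx Cx Vx Ax eqxx.
  by have [y [? ? ? ?]] := HP _ (tj_lt w); exists y.
case: Ay => Ay Exy; set e := (x * nX + y).+1.
have He : e < nE by apply: pair_lt.
have Hb : ~~ badl w e.
  rewrite /badl /e /= x1_pair // x2_pair // /compat Cx Cy Vx Vy !eqxx Exy /= negbK.
  by apply: Hc; [apply: ti_lt|apply: tj_lt].
have Hwin e' : e' < nE -> ~~ badl w e' -> (0 < e' -> e' = e) -> u != code (VL d w e') ->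
    sw gadj setT 1 A (u |: B).
  move=> He' Hb' Ee' Hu; apply/or3P/Or33/exists_inP; exists (code (VL d w e')); first by rewrite inE.
  rewrite in_setU1 negb_or eq_sym Hu HB //; apply/forallP => u'.
  rewrite /= orbF; apply/existsP; exists (code (VL d w e')); apply/subsetP => t.
  have Hv : valid (VL d w e') by rewrite /valid Hd Hw.
  rewrite nbhd_leaf // in_setU1 => /orP[->//|]; rewrite -{3}(viewK t).
  have := validV t; case: (view t) => //=.
  - move=> z _ /andP[H0]; rewrite (Ee' H0) x1_pair // x2_pair //.
    by case/orP => /eqP ->; rewrite ?Ax ?Ay orbT.
  - by move=> d' _ /eqP <-; rewrite HR orbT.
  - by move=> d' q b /andP[_ Hq] /andP[/eqP <- /eqP ->]; rewrite Ew // HY // orbT.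
have v0 : valid (VL d w 0) by rewrite /valid Hd Hw.
have ve : valid (VL d w e) by rewrite /valid Hd Hw.
case: (eqVneq u (code (VL d w e))) => Hu; last exact: (Hwin e).
by apply: (Hwin 0) => //; rewrite Hu; apply/eqP => /(code_inj ve v0) [E]; have := ltn0Sn (x * nX + y); rewrite -/e E.
Qed.

(** [U] lists the open levels, and [u] is Dominator's latest move, not yet counted in [B]. Up to
    [u], no vertex of an open level is blocked, nor any leaf that is still reachable. *)
Lemma levels_win d (f : nat -> bool) (U : seq nat) A B u : uniq U ->
  (forall q, q \in U -> q < lv) -> d <= m -> VR d \at A ->
  (forall i, i < m -> picked i A) ->
  (forall q, q < lv -> q \notin U -> VY d q (f q) \at A) ->
  (forall q b, q \in U -> ~~ (VY d q b \at B)) ->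
  (forall w e, w < 2 ^ lv -> e < nE ->
     (forall q, q < lv -> q \notin U -> bit w q = f q) -> ~~ (VL d w e \at B)) ->
  sw gadj setT (size U).+1 A (u |: B).
Proof.
move: {2}(size U) (erefl (size U)) => n.
elim: n f U A B u => [|n IH] f U A B u Hn Uu HU Hd HR HP HY HB HL.
  move/eqP: (Hn); rewrite size_eq0 => /eqP E; rewrite E in HY HL *.
  apply: (double_threat u Hd HR HP (f := f)) => [q Hq|w e Hw He E'].
    exact: HY.
  by apply: HL => // q Hq _; apply: E'.
(* The claim reacts to [u]: Staller takes the partner of a level vertex just blocked, or a bit that
   leads away from a leaf just blocked; otherwise any open level will do. *)
have [q [b [Hq Hqb Hoth Hleaf]]] : exists q b, [/\ q \in U, code (VY d q b) != u,
    forall q' b', q' \in U -> u = code (VY d q' b') -> q' = q &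
    forall w e, w < 2 ^ lv -> e < nE -> u = code (VL d w e) -> bit w q = ~~ b].
  case: U Hn Uu HU {HY HB HL} => // q0 U _ _ HU.
  have Hq0 : q0 \in q0 :: U by rewrite mem_head.
  have vY q b : q \in q0 :: U -> valid (VY d q b) by move=> /HU H; rewrite /valid Hd.
  have vL w e : w < 2 ^ lv -> e < nE -> valid (VL d w e).
    by rewrite /valid Hd => -> ->.
  have Ev v : valid v -> u = code v -> view u = v by move=> Hv ->; apply: codeK.
  case Eu: (view u) => [x|d'|d' q b|d' w e].
  - exists q0, true; split=> //.
    + by apply/eqP => /esym/(Ev _ (vY _ _ Hq0)); rewrite Eu.
    + by move=> q' b' /(vY q' b') Hv /(Ev _ Hv); rewrite Eu.
    + by move=> w e Hw He /(Ev _ (vL w e Hw He)); rewrite Eu.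
  - exists q0, true; split=> //.
    + by apply/eqP => /esym/(Ev _ (vY _ _ Hq0)); rewrite Eu.
    + by move=> q' b' /(vY q' b') Hv /(Ev _ Hv); rewrite Eu.
    + by move=> w e Hw He /(Ev _ (vL w e Hw He)); rewrite Eu.
  - have Hno w e : w < 2 ^ lv -> e < nE -> u = code (VL d w e) -> False.
      by move=> Hw He /(Ev _ (vL w e Hw He)); rewrite Eu.
    case: (boolP ((d' == d) && (q \in q0 :: U))) => [/andP[/eqP Ed Hq]|Hnq].
      exists q, (~~ b); split=> //.
      + apply/eqP => /esym/(Ev _ (vY _ _ Hq)); rewrite Eu => -[_].
        by case: (b).
      + by move=> q' b' /(vY q' b') Hv /(Ev _ Hv); rewrite Eu => -[].
      + by move=> w e Hw He /(Hno w e Hw He).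
    exists q0, true; split=> //.
    + apply/eqP => /esym/(Ev _ (vY _ _ Hq0)); rewrite Eu => -[E1 E2 _].
      by move: Hnq; rewrite E1 E2 eqxx Hq0.
    + move=> q' b' Hq' /(Ev _ (vY q' b' Hq')); rewrite Eu => -[E1 E2 _].
      by move: Hnq; rewrite E1 E2 eqxx Hq'.
    + by move=> w e Hw He /(Hno w e Hw He).
  - exists q0, (~~ bit w q0); split=> //.
    + by apply/eqP => /esym/(Ev _ (vY _ _ Hq0)); rewrite Eu.
    + by move=> q' b' /(vY q' b') Hv /(Ev _ Hv); rewrite Eu.
    + by move=> w' e' Hw He /(Ev _ (vL w' e' Hw He)); rewrite Eu negbK => -[_ ->].
apply/or3P/Or33/exists_inP; exists (code (VY d q b)); first by rewrite inE.
rewrite in_setU1 negb_or Hqb HB //; apply/forallP => u'; rewrite Hn.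
have Esz : n = size (rem q U) by rewrite size_rem // Hn.
rewrite Esz; apply: (IH (fun q' => if q' == q then b else f q')) => //.
- exact: rem_uniq.
- by move=> q' /mem_rem; apply: HU.
- by rewrite in_setU1 HR orbT.
- by move=> i /HP[x [? ? ? H]]; exists x; rewrite in_setU1 H orbT.
- move=> q' Hq'; rewrite mem_rem_uniq // inE negb_and negbK in_setU1.
  by case: eqVneq => [->|_] /=; rewrite ?eqxx // => H; rewrite HY ?orbT.
- move=> q' b' ; rewrite mem_rem_uniq // inE => /andP[Hne Hq'].
  rewrite in_setU1 negb_or HB // andbT; apply/eqP => E.
  by move: Hne; rewrite /= (Hoth q' b' Hq' (esym E)) eqxx.
- move=> w e Hw He Hcons; rewrite in_setU1 negb_or; apply/andP; split.
    apply/eqP => E; have := Hleaf w e Hw He (esym E).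
    rewrite Hcons ?eqxx; [by case: (b)|exact: HU|].
    by rewrite mem_rem_uniq // inE eqxx.
  apply: HL => // q' Hq' Hn'; rewrite Hcons //; last first.
    by rewrite mem_rem_uniq // inE negb_and Hn' orbT.
  by case: eqP => // E; move: Hn'; rewrite E Hq.
Qed.

Lemma free_index (f : T -> nat) B : #|B| <= m -> exists2 d, d <= m & forall t, t \in B -> f t != d.
Proof.
move=> HB; pose F t : 'I_m.+1 := inord (f t).
have [d Hd] : exists d, d \notin F @: B.
  apply/existsP; rewrite -negb_forall; apply/negP => /forallP H.
  have : #|'I_m.+1| <= #|F @: B| by apply/subset_leq_card/subsetP => d _.
  by rewrite card_ord => /leq_trans/(_ (leq_imset_card _ _)); lia.
exists d; first by rewrite -ltnS.
move=> t Ht; apply: contra Hd => /eqP E; apply/imsetP; exists t => //.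
by apply: val_inj; rewrite /F E inord_val.
Qed.

(** While [n] picks are missing Dominator has made at most [m - n] moves, so among [m.+1] twins one
    is untouched, and in the end one of [m.+1] copies is. *)
Lemma picks_win n A B : n <= m -> #|B| <= m - n ->
  (forall i, i < m - n -> picked i A) -> sw gadj setT (n + lv.+2) A B.
Proof.
elim: n A B => [|n IH] A B Hn HB HP; rewrite ?subn0 in HB HP.
  pose cp t := match view t with VR d => d | VY d _ _ => d | VL d _ _ => d | VX _ => 0 end.
  have [d Hd Hfree] := free_index cp HB.
  have HV' v : valid v -> cp (code v) = d -> ~~ (v \at B).
    by move=> Hv E; apply/negP => /Hfree; rewrite E eqxx.
  apply/or3P/Or33/exists_inP; exists (code (VR d)); first by rewrite inE.
  have vR : valid (VR d) by [].
  rewrite HV' /cp ?codeK //; apply/forallP => u.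
  change (sw gadj setT lv.+1 (code (VR d) |: A) (u |: B)).
  have -> : lv.+1 = (size (iota 0 lv)).+1 by rewrite size_iota.
  apply: (@levels_win d (fun=> true)) => //.
  - exact: iota_uniq.
  - by move=> q; rewrite mem_iota.
  - exact: setU11.
  - by move=> i /HP[x [? ? ? H]]; exists x; rewrite in_setU1 H orbT.
  - by move=> q Hq; rewrite mem_iota Hq.
  - move=> q b; rewrite mem_iota => /andP[_ Hq].
    have Hv : valid (VY d q b) by rewrite /valid Hd.
    by apply: HV' => //; rewrite /cp codeK.
  - move=> w e Hw He _; have Hv : valid (VL d w e) by rewrite /valid Hd Hw.
    by apply: HV' => //; rewrite /cp codeK.
set i := m - n.+1 in HB HP.
have Hi : i < m by rewrite /i; lia.
pose tw t := match view t with VX x => x %% m.+1 | _ => 0 end.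
have HBm : #|B| <= m by lia.
have [d Hd Hfree] := free_index tw HBm.
set x := (i * V + s i) * m.+1 + d.
have Hsi := Hs Hi.
have Hx : x < nX by rewrite /x /nX; nia.
have vx : valid (VX x) by [].
have Ed : x %% m.+1 = d by rewrite /x modnMDl modn_small.
have Ex : x %/ m.+1 = i * V + s i by rewrite /x divnMDl // divn_small ?addn0.
apply/or3P/Or33/exists_inP; exists (code (VX x)); first by rewrite inE.
have -> : ~~ (VX x \at B) by apply/negP => /Hfree; rewrite /tw codeK // Ed eqxx.
apply/forallP => u; apply: IH; first exact: ltnW.
  by apply: leq_trans (leq_card_setU _ _) _; rewrite cards1 /i in HB *; lia.
move=> j Hj; case: (ltnP j i) => Hji.
  by have [y [? ? ? H]] := HP j Hji; exists y; rewrite in_setU1 H orbT.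
have -> : j = i by rewrite /i in Hji *; lia.
exists x; split=> //; last exact: setU11.
- by rewrite /col mulnC divnMA Ex divnMDl // divn_small ?addn0.
- by rewrite /valx Ex modnMDl modn_small.
Qed.

Lemma staller_sw : sw gadj setT kk set0 set0.
Proof.
rewrite /kk -addnA addn2; apply: picks_win; rewrite ?subnn ?cards0 //.
Qed.

End StallerWins.

(** * Dominator survives if the constraints are unsatisfiable *)

Section DominatorWins.
Hypothesis Hno : ~ bcsp m V c.

Definition inC d v := match v with
  | VX _ => false | VR d' => d' == d | VY d' _ _ => d' == d | VL d' _ _ => d' == d end.
Definition Cp d A := [set t in A | inC d (view t)].
Definition diag x := (x * nX + x).+1.

(** Every leaf neighborhood of the copy contains the root and one vertex of each pair, so none can
    be completed. *)
Definition dead D d := VR d \at D \/ exists2 q, q < lv & forall b, VY d q b \at D.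

(* Dominator has steered copy [d] to the leaves [w] up to level [q]. *)
Definition steered A D d w q := [/\ q <= lv, w < 2 ^ lv,
  forall l, l <= q -> l < lv -> VY d l (~~ bit w l) \at D &
  if q < lv then forall v, valid v -> inC d v -> v \at A ->
    v = VR d \/ exists2 l, l < q & v = VY d l (bit w l)
  else VL d w 0 \at D].

Definition quiet A d r :=
  r = 0 /\ forall w e, valid (VL d w e) -> ~~ badl w e ->
  ~~ (closed_nbhd gadj (code (VL d w e)) \subset A).

Definition incompat A w := forall x y, x < nX -> y < nX -> VX x \at A -> VX y \at A ->
  ~~ compat w x y.

(** The root was claimed with just enough moves left. Staller can win here only by spending all his
    remaining moves in this copy, so he adds no pick and the incompatible test [w] stays
    incompatible. *)
Definition tight A D d r w q := [/\ steered A D d w q, #|Cp d A| <= q.+1,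
  r + q.+1 <= lv.+2 & incompat A w].

(** The root was claimed early, and [w] tests against itself a variable that had no pick. Only the
    leaves [VL d w (diag x)] can pass. At the end of the branch Dominator pairs each of them with
    [VX x] and takes one when Staller takes the other; before that, a pick for this variable costs
    Staller the next level and thus the copy. *)
Definition cold A D d w q := [/\ steered A D d w q, ti w = tj w, VR d \at A &
  forall x, x < nX -> col x = ti w -> if q < lv then is_true (~~ (VX x \at A)) else
    (VX x \at A -> VL d w (diag x) \at D) /\ (VL d w (diag x) \at A -> VX x \at D)].

(** The reasons why Staller, with [r] moves left, will not win in copy [d]. The flag marks a cold
    copy, whose word names the variable it waits for. *)
Inductive okc A D r d : bool -> nat -> Prop :=
| ok_dead w : dead D d -> okc A D r d false w
| ok_fresh w : Cp d A = set0 -> okc A D r d false w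
| ok_hopeless w : #|Cp d A| + r < lv.+2 -> okc A D r d false w
| ok_quiet w : quiet A d r -> okc A D r d false w
| ok_tight w w' q : tight A D d r w' q -> okc A D r d false w
| ok_cold w q : cold A D d w q -> okc A D r d true w.

(** Cold copies wait for different variables, so a pick concerns at most one of them and a single
    reply suffices. [D] need only be a part of Dominator's vertices. *)
Definition Inv A D r := [/\ [disjoint A & D], #|A| + r <= kk & exists (kd : nat -> bool) tg,
  (forall d, d <= m -> okc A D r d (kd d) (tg d)) /\
  (forall d d', d <= m -> d' <= m -> kd d -> kd d' -> d != d' -> ti (tg d) != ti (tg d'))].

Lemma disj A D t : [disjoint A & D] -> t \in A -> t \in D -> False.
Proof. by move=> H HA HD; move: (disjointFr H HA); rewrite HD. Qed.

Lemma leaf_sub d w e A : valid (VL d w e) -> closed_nbhd gadj (code (VL d w e)) \subset A ->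
  [/\ VL d w e \at A, VR d \at A, forall q, q < lv -> VY d q (bit w q) \at A &
     0 < e -> VX (x1 e) \at A /\ VX (x2 e) \at A].
Proof.
move=> Hv /subsetP H; have [Hd Hw He] := and3P Hv.
have Hl v : valid v -> link d w e v -> v \at A.
  move=> Hv' Hlk; apply: H; rewrite inE /gadj !codeK //.
  case: eqVneq => //= _.
  by move: Hlk; rewrite /adjv; case: (v) => // *; apply/orP; right.
split.
- by apply: H; rewrite inE eqxx.
- by apply: Hl => //=.
- by move=> q Hq; apply: Hl; rewrite /= ?Hd ?eqxx.
- move=> H0; have [H1 H2 _] := x12_lt H0 He.
  by split; apply: Hl => //=; rewrite H0 eqxx ?orbT.
Qed.

(** Dominator owns the partners of the branch [w], so a completed leaf lies at the end of [w]; and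
    she owns the one with [e = 0]. *)
Lemma steered_won A D d w q w' e : steered A D d w q -> [disjoint A & D] -> valid (VL d w' e) ->
  closed_nbhd gadj (code (VL d w' e)) \subset A ->
  [/\ q = lv, w' = w & 0 < e].
Proof.
move=> [Hq Hw HY Hrest] Hdis Hv Hsub; have [HL HR HYA _] := leaf_sub Hv Hsub.
have [Hd Hw' He] := and3P Hv.
have Eb l : l <= q -> l < lv -> bit w' l = bit w l.
  move=> Hl Hl'; have := HYA l Hl'; have := HY l Hl Hl'.
  by case: (bit w l); case: (bit w' l) => //= H1 H2; case: (disj Hdis H2 H1).
case: ltnP Hrest => Hql Hrest.
  have vY : valid (VY d q (bit w' q)) by rewrite /valid Hd.
  have iY : inC d (VY d q (bit w' q)) by rewrite /=.
  case: (Hrest _ vY iY (HYA q Hql)) => [//|[l Hl [E _]]].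
  by move: Hl; rewrite E ltnn.
have Eq : q = lv by lia.
have Ew : w' = w by apply: bit_ext Hw' Hw _ => l Hl; apply: Eb => //; rewrite Eq ltnW.
split=> //; rewrite lt0n; apply/eqP => E0; rewrite Ew E0 in HL.
exact: disj Hdis HL Hrest.
Qed.

Lemma okc_not_won A D r d kd w w' e : okc A D r d kd w -> [disjoint A & D] ->
  valid (VL d w' e) -> ~~ badl w' e ->
  ~~ (closed_nbhd gadj (code (VL d w' e)) \subset A).
Proof.
move=> Hok Hdis Hv Hb; apply/negP => Hsub; have [HL HR HYA HX] := leaf_sub Hv Hsub.
have [Hd Hw' He] := and3P Hv.
case: Hok => {kd w} [w|w|w|w|w w'' q|w q].
- case=> [H|[q Hq H]]; first exact: disj Hdis HR H.
  exact: disj Hdis (HYA q Hq) (H _).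
- move/setP/(_ (code (VL d w' e))); rewrite !inE HL codeK //= eqxx //.
- rewrite ltnNge => /negP[]; apply: leq_trans (leq_addr r _).
  pose F (o : option (option 'I_lv)) := match o with
    | None => code (VL d w' e) | Some None => code (VR d)
    | Some (Some q) => code (VY d q (bit w' q)) end.
  have vR : valid (VR d) by [].
  have vY (q : 'I_lv) : valid (VY d q (bit w' q)) by rewrite /valid Hd ltn_ord.
  have Fi : injective F.
    by move=> [[q|]|] [[q'|]|] //= /code_inj; rewrite ?vR ?vY ?Hv => /(_ isT isT) // [/val_inj ->].
  have -> : lv.+2 = #|[set: option (option 'I_lv)]| by rewrite cardsT !card_option card_ord.
  rewrite -(card_imset _ Fi); apply: subset_leq_card; apply/subsetP => t /imsetP[o _ ->].
  case: o => [[q|]|]; rewrite inE /F ?(codeK (vY q)) ?(codeK vR) ?(codeK Hv) /= eqxx andbT //.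
  exact: HYA.
- by case=> _ /(_ w' e Hv Hb); rewrite Hsub.
- case=> Hl _ _ Hinc; have [Eq Ew H0] := steered_won Hl Hdis Hv Hsub.
  have [HX1 HX2] := HX H0; have [l1 l2 _] := x12_lt H0 He.
  have := Hinc _ _ l1 l2 HX1 HX2; move: Hb; rewrite /badl H0 Ew /= negbK.
  by move=> ->.
- case=> Hl Et _ Hp; have [Eq Ew H0] := steered_won Hl Hdis Hv Hsub.
  have [HX1 HX2] := HX H0; have [l1 l2 Ee] := x12_lt H0 He.
  move: Hb; rewrite /badl H0 /= negbK Ew => /and4P[/eqP C1 _ /implyP C2 _].
  have E12 : x1 e = x2 e by apply/eqP/C2/eqP.
  have := Hp _ l1 C1; rewrite Eq ltnn => -[/(_ HX1) HD _].
  have Ed : e = diag (x1 e) by rewrite {1}Ee -E12.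
  by rewrite -Ed -Ew in HD; apply: disj Hdis HL HD.
Qed.

(** Such a neighborhood contains the level vertices of all copies, more than [kk] of them. *)
Lemma big_nbhd A t : #|A| <= kk -> (if view t is VL d w e then badl w e else true) ->
  ~~ (closed_nbhd gadj t \subset A).
Proof.
move=> HA Ht; apply/negP => Hsub.
pose F (p : 'I_m.+1 * 'I_lv * bool) := code (VY p.1.1 p.1.2 p.2).
have vF (p : 'I_m.+1 * 'I_lv * bool) : valid (VY p.1.1 p.1.2 p.2).
  by rewrite /valid -ltnS !ltn_ord.
have Fi : injective F.
  move=> [[d q] b] [[d' q'] b'] /(code_inj (vF _) (vF _)) /= [Ed Eq ->].
  by congr (_, _, _); apply: val_inj.
have : F @: setT \subset A.
  apply: subset_trans Hsub; apply/subsetP => u /imsetP[p _ ->].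
  rewrite inE /gadj /F codeK //; case: eqVneq => //= _.
  by move: Ht; case: (view t) => //= d w e ->.
move/subset_leq_card; rewrite card_imset // cardsT !card_prod !card_ord card_bool => H.
have := leq_trans H HA; rewrite /kk /lv -mul2n; clear -Hm; nia.
Qed.

Lemma Inv_not_won A D r : Inv A D r -> ~~ won gadj A.
Proof.
move=> [Hdis HA [kd [tg [Hok _]]]]; apply/negP => /existsP[t Hsub].
have HA' : #|A| <= kk by apply: leq_trans HA; apply: leq_addr.
have := @big_nbhd A t HA'; rewrite Hsub /=; have := validV t; have := viewK t.
case: (view t) => [x|d|d q b|d w e] Et Hv Hbig; try by have := Hbig isT.
have Hd : d <= m by case/and3P: Hv.
case Hb: (badl w e) Hbig => Hbig; first by have := Hbig isT.
have := okc_not_won (Hok d Hd) Hdis Hv; rewrite Hb Et Hsub => H.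
by have := H isT.
Qed.

Lemma Cp_far d A t : ~~ inC d (view t) -> Cp d (t |: A) = Cp d A.
Proof.
move=> H; apply/setP => u; rewrite !inE; case: eqVneq => //= ->.
by rewrite (negPf H) andbF.
Qed.

Lemma Cp_near d A t : #|Cp d (t |: A)| <= (#|Cp d A|).+1.
Proof.
apply: (@leq_trans #|t |: Cp d A|); last by rewrite cardsU1; case: (_ \notin _).
apply: subset_leq_card; apply/subsetP => u; rewrite !inE => /andP[/orP[->//|->] ->].
by rewrite orbT.
Qed.

Lemma dead_mono D D' d : D \subset D' -> dead D d -> dead D' d.
Proof.
move=> /subsetP H [HR|[q Hq HY]]; first by left; apply: H.
by right; exists q => // b; apply: H.
Qed.

Lemma at_cons t A v : valid v -> v \at (t |: A) -> v = view t \/ v \at A.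
Proof. by move=> Hv; rewrite in_setU1 => /predU1P[<-|]; [left; rewrite codeK|right]. Qed.

Lemma steered_far A D D' d w q t : steered A D d w q -> ~~ inC d (view t) -> D \subset D' ->
  steered (t |: A) D' d w q.
Proof.
move=> [Hq Hw HY Hr] Hi /subsetP HD; split=> // [l Hl Hl'|]; first exact/HD/HY.
case: ltnP Hr => Hql Hr; last exact: HD.
move=> v Hv Hiv /(at_cons Hv) [E|]; first by move: Hi; rewrite -E Hiv.
exact: Hr.
Qed.

(** A move elsewhere takes from a tight copy a move it cannot spare, so the copy becomes hopeless. A
    cold copy is affected only by picks for its variable, which are excluded here. *)
Lemma okc_far A D D' r d kd w t : d <= m -> okc A D r.+1 d kd w -> ~~ inC d (view t) ->
  D \subset D' -> (kd -> forall x, view t = VX x -> col x != ti w) ->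
  okc (t |: A) D' r d kd w.
Proof.
move=> Hd Hok Hi HD; case: Hok => {kd w} [w H|w H|w H|w [//]|w w' q [Hl HC Hr _]|w q [Hl Et HR Hp]] Hk.
- by apply: ok_dead; apply: dead_mono H.
- by apply: ok_fresh; rewrite Cp_far.
- by apply: ok_hopeless; rewrite Cp_far //; lia.
- by apply: ok_hopeless; rewrite Cp_far //; lia.
- apply: (@ok_cold _ _ _ _ _ q); split=> //; first exact: steered_far Hl _ _.
    by rewrite in_setU1 HR orbT.
  have [Hq Hw _ _] := Hl; have HD' := subsetP HD.
  move=> x Hx Cx; have vx : valid (VX x) by [].
  have := Hp x Hx Cx; case: ltnP => Hql.
    move=> H; apply/negP => /(at_cons vx) [E|]; last exact/negP.
    by have := Hk isT x (esym E); rewrite Cx eqxx.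
  case=> H1 H2; split=> [/(at_cons vx) [E|]|].
  + by have := Hk isT x (esym E); rewrite Cx eqxx.
  + by move/H1; apply: HD'.
  + rewrite in_setU1 => /predU1P[E|]; last by move/H2; apply: HD'.
    by move: Hi; rewrite -E codeK /= ?eqxx // Hd Hw pair_lt.
Qed.

Lemma pselect_view t d q b : view t = VY d q b \/ view t <> VY d q b.
Proof.
case: (view t) => [x|d'|d' q' b'|d' w e]; try by right.
case: (eqVneq d' d) => [->|/eqP H]; last by right=> -[].
case: (eqVneq q' q) => [->|/eqP H]; last by right=> -[].
by case: (eqVneq b' b) => [->|/eqP H]; [left|right=> -[]].
Qed.

Definition reply A D t D' := [/\ D \subset D', [disjoint t |: A & D'] &
  exists u, D' \subset u |: D].

Lemma disj_cons A D t : [disjoint A & D] -> t \notin D -> [disjoint t |: A & D].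
Proof. by rewrite !disjoints_subset subUset sub1set inE => -> ->. Qed.

Lemma reply_none A D t : [disjoint A & D] -> t \notin D -> reply A D t D.
Proof.
move=> H Ht; split=> //; first exact: disj_cons.
by exists t; apply: subsetUr.
Qed.

Lemma reply_one A D t u : [disjoint A & D] -> t \notin D -> u \notin t |: A ->
  reply A D t (u |: D).
Proof.
move=> H Ht Hu; split; [exact: subsetUr| |by exists u].
rewrite disjoint_sym disj_cons // disjoint_sym; exact: disj_cons.
Qed.

(** Dominator already owns one vertex of level [q]; unless Staller takes the other one at once, she
    gets both. *)
Lemma kill A D d w q t : d <= m -> steered A D d w q -> q < lv -> view t <> VY d q (bit w q) ->
  code (VY d q (bit w q)) \notin t |: A /\ dead (code (VY d q (bit w q)) |: D) d.
Proof.
move=> Hd [Hq Hw HY Hr] Hql Ht; rewrite Hql in Hr.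
have vY b : valid (VY d q b) by rewrite /valid Hd.
split.
  apply/negP => /(at_cons (vY _)) [E|HA]; first exact/Ht.
  have iY : inC d (VY d q (bit w q)) by rewrite /=.
  by case: (Hr _ (vY _) iY HA) => [//|[l Hl [E _]]]; rewrite E ltnn in Hl.
right; exists q => // b; rewrite in_setU1; case: (eqVneq b (bit w q)) => [->|Hb].
  by rewrite eqxx.
have -> : b = ~~ bit w q by case: b (bit w q) Hb => [] [].
by rewrite HY ?orbT.
Qed.

(** Dominator enforces the next bit of [w] by taking the opposite vertex of the next level. After
    the last level she takes the leaf with [e = 0], leaving Staller only tested leaves. *)
Lemma advance A D d w q t : d <= m -> steered A D d w q -> q < lv -> view t = VY d q (bit w q) ->
  exists2 u, u \notin t |: A & steered (t |: A) (u |: D) d w q.+1.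
Proof.
move=> Hd [Hq Hw HY Hr] Hql Ht; rewrite Hql in Hr.
case: (ltnP q.+1 lv) => Hq1.
  have vY : valid (VY d q.+1 (~~ bit w q.+1)) by rewrite /valid Hd.
  exists (code (VY d q.+1 (~~ bit w q.+1))).
    apply/negP => /(at_cons vY) [|HA]; first by rewrite Ht => -[]; lia.
    have iY : inC d (VY d q.+1 (~~ bit w q.+1)) by rewrite /=.
    by case: (Hr _ vY iY HA) => [//|[l Hl [E _]]]; lia.
  split=> // [l|].
    rewrite leq_eqVlt => /predU1P[->|Hl] Hl'; rewrite in_setU1 ?eqxx // HY ?orbT //.
  rewrite Hq1 => v Hv Hi /(at_cons Hv) [->|HA].
    by right; exists q => //.
  by case: (Hr _ Hv Hi HA) => [|[l Hl E]]; [left|right; exists l => //; apply: ltnW].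
have vL : valid (VL d w 0) by rewrite /valid Hd Hw.
exists (code (VL d w 0)).
  apply/negP => /(at_cons vL) [|HA]; first by rewrite Ht.
  have iL : inC d (VL d w 0) by rewrite /=.
  by case: (Hr _ vL iL HA) => [|[l Hl]].
split=> // [l Hl Hl'|]; first by rewrite in_setU1 HY ?orbT //; lia.
by rewrite ltnNge Hq1 /= setU11.
Qed.

Lemma steered_notin A D d w q e : d <= m -> steered A D d w q -> q < lv -> e < nE -> ~~ (VL d w e \at A).
Proof.
move=> Hd [Hq Hw HY Hr] Hql He; rewrite Hql in Hr; apply/negP => HA.
have vL : valid (VL d w e) by rewrite /valid Hd Hw.
have iL : inC d (VL d w e) by rewrite /=.
by case: (Hr _ vL iL HA) => [//|[l Hl E]].
Qed.

Lemma incompat_near A w t d : inC d (view t) -> incompat A w -> incompat (t |: A) w.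
Proof.
move=> Hi H x y Hx Hy /(at_cons (v := VX x) Hx) [E|HA]; first by rewrite -E in Hi.
by move=> /(at_cons (v := VX y) Hy) [E|HA']; [rewrite -E in Hi|apply: H].
Qed.

(** The root of a fresh copy is excluded, as it requires choosing a test. If Staller enters a fresh
    copy elsewhere, Dominator takes the root. *)
Lemma okc_near A D r d kd w t : d <= m -> okc A D r.+1 d kd w -> inC d (view t) ->
  [disjoint A & D] -> t \notin D -> (Cp d A = set0 -> view t <> VR d) ->
  exists D' kd', [/\ reply A D t D', okc (t |: A) D' r d kd' w & kd' -> kd].
Proof.
move=> Hd Hok Hi Hdis HtD Hroot.
have R0 := reply_none Hdis HtD; have R1 u := @reply_one A D t u Hdis HtD.
case: Hok Hroot => {kd w} [w H|w H|w H|w [//]|w w' q [Hl HC Hr Hinc]|w q [Hl Et HR Hp]] Hroot.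
- by exists D, false; split=> //; apply: ok_dead.
- have vR : valid (VR d) by [].
  exists (code (VR d) |: D), false; split=> //.
    apply: R1; apply/negP => /(at_cons vR) [E|HA]; first exact/(Hroot H).
    by move/setP/(_ (code (VR d))): H; rewrite !inE HA codeK //= eqxx.
  by apply: ok_dead; left; apply: setU11.
- exists D, false; split=> //; apply: ok_hopeless.
  by have := Cp_near d A t; lia.
- case: (ltnP q lv) => Hq.
    case: (pselect_view t d q (bit w' q)) => Ht.
      have [u Hu Hl'] := advance Hd Hl Hq Ht.
      exists (u |: D), false; split=> //; first exact: R1.
      apply: (@ok_tight _ _ _ _ w w' q.+1); split=> //.
      + by apply: leq_trans (Cp_near d A t) _.
      + by rewrite addnS -addSn.
      + exact: incompat_near Hi Hinc.
    have [Hu Hdead] := kill Hd Hl Hq Ht.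
    by exists (code (VY d q (bit w' q)) |: D), false; split=> //; [apply: R1|apply: ok_dead].
  have Eq : q = lv by case: Hl => Hq' _ _ _; lia.
  exists D, false; split=> //; apply: ok_quiet; split; first by lia.
  move=> w1 e Hv Hb; apply/negP => Hsub; subst q.
  have Hl' : steered (t |: A) D d w' lv.
    by case: Hl => H1 H2 H3; rewrite ltnn => H4; split; rewrite ?ltnn.
  have [_ Ew H0] := steered_won Hl' (disj_cons Hdis HtD) Hv Hsub.
  have [_ _ He] := and3P Hv; have [l1 l2 _] := x12_lt H0 He.
  have [_ _ _ /(_ H0) [HX1 HX2]] := leaf_sub Hv Hsub.
  have := incompat_near Hi Hinc l1 l2 HX1 HX2.
  by move: Hb; rewrite /badl H0 Ew /= negbK => ->.
- have Hti x : VX x \at (t |: A) -> x < nX -> VX x \at A.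
    by move=> H Hx; case: (at_cons (v := VX x) Hx H) => // E; rewrite -E in Hi.
  case: (ltnP q lv) => Hq.
    case: (pselect_view t d q (bit w q)) => Ht.
      have [u Hu Hl'] := advance Hd Hl Hq Ht.
      exists (u |: D), true; split=> //; first exact: R1.
      apply: (@ok_cold _ _ _ _ _ q.+1); split=> //; first by rewrite in_setU1 HR orbT.
      move=> x Hx Cx; have := Hp x Hx Cx; rewrite Hq => HX.
      have HX' : ~~ (VX x \at (t |: A)) by apply: contra HX => /Hti; apply.
      case: ltnP => // _; split; first by rewrite (negPf HX').
      have vL : valid (VL d w (diag x)) by case: Hl => _ Hw _ _; rewrite /valid Hd Hw pair_lt.
      case/(at_cons vL) => [E|]; first by rewrite Ht in E.
      by rewrite (negPf (steered_notin Hd Hl Hq _)) ?pair_lt.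
    have [Hu Hdead] := kill Hd Hl Hq Ht.
    by exists (code (VY d q (bit w q)) |: D), false; split=> //; [apply: R1|apply: ok_dead].
  have Eq : q = lv by case: Hl => Hq' _ _ _; lia.
  have Hl' D' : D \subset D' -> steered (t |: A) D' d w q.
    move=> /subsetP HD; subst q; case: Hl => H1 H2 H3; rewrite ltnn => H4.
    split=> //; last by rewrite ltnn; apply: HD.
    by move=> l Hlq Hll; apply/HD/H3.
  have Hp' x : x < nX -> col x = ti w -> (VX x \at A -> VL d w (diag x) \at D) /\
    (VL d w (diag x) \at A -> VX x \at D).
    by move=> Hx Cx; have := Hp x Hx Cx; rewrite Eq ltnn.
  (* If Staller claims a diagonal leaf before its pick, Dominator takes that pick. *)
  case: (boolP [exists x : 'I_nX, (col x == ti w) && (code (VL d w (diag x)) == t)]).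
    case/existsP => x /andP[/eqP Cx /eqP Et'].
    have [H1 H2] := Hp' x (ltn_ord x) Cx.
    have HXA : ~~ (VX x \at (t |: A)).
      apply/negP => /Hti /(_ (ltn_ord x)) /H1; rewrite Et'; exact/negP.
    exists (code (VX x) |: D), true; split=> //; first exact: R1.
    apply: (@ok_cold _ _ _ _ _ q); split=> //; first exact/Hl'/subsetUr.
      by rewrite in_setU1 HR orbT.
    move=> y Hy Cy; rewrite Eq ltnn; have [H3 H4] := Hp' y Hy Cy; split.
      by move/Hti => /(_ Hy) /H3 HD; rewrite in_setU1 HD orbT.
    rewrite in_setU1 => /predU1P[E|/H4 HD]; last by rewrite in_setU1 HD orbT.
    have Hw : w < 2 ^ lv by case: Hl.
    have vL (z : nat) : z < nX -> valid (VL d w (diag z)) by move=> Hz; rewrite /valid Hd Hw pair_lt.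
    have Ev : VL d w (diag y) = VL d w (diag x).
      by apply: code_inj; rewrite ?vL // E Et'.
    case: Ev => Ev; have -> : y = x; last exact: setU11.
    by move: (congr1 x2 (congr1 S Ev)); rewrite !x2_pair.
  move/existsPn => Hnone; exists D, true; split=> //.
  apply: (@ok_cold _ _ _ _ _ q); split=> //; first exact: Hl'.
    by rewrite in_setU1 HR orbT.
  move=> y Hy Cy; rewrite Eq ltnn; have [H3 H4] := Hp' y Hy Cy; split.
    by move/Hti => /(_ Hy) /H3.
  rewrite in_setU1 => /predU1P[E|/H4 //].
  by have := Hnone (Ordinal Hy); rewrite /= Cy E !eqxx.
Qed.

Lemma sq_le : m * m <= 2 ^ lv.
Proof.
rewrite /lv -addnn expnD; apply: leq_mul; exact: ltnW (ltn_expl m _).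
Qed.

Lemma word_of_pair i j : i < m -> j < m ->
  [/\ i + j * m < 2 ^ lv, ti (i + j * m) = i & tj (i + j * m) = j].
Proof.
move=> Hi Hj; rewrite /ti /tj; split.
- by apply: leq_trans sq_le; nia.
- by rewrite addnC modnMDl modn_small.
- by rewrite addnC divnMDl ?divn_small ?addn0 ?modn_small //; lia.
Qed.

(** If all tests succeeded, the tests of variables against themselves would show a pick for each
    variable; with at most [m] vertices there would be exactly one each, and these would solve the
    instance. *)
Lemma incompat_ex A : #|A| <= m -> exists2 w, w < 2 ^ lv & incompat A w.
Proof.
move=> HA.
pose P w := [exists x : 'I_nX, exists y : 'I_nX,
  [&& VX x \at A, VX y \at A & compat w x y]].
case: (boolP [exists w : 'I_(2 ^ lv), ~~ P w]) => [/existsP[w Hw]|/existsPn Hall].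
  exists w; first exact: ltn_ord.
  move=> x y Hx Hy Ax Ay; apply: contra Hw => Hc.
  by apply/existsP; exists (Ordinal Hx); apply/existsP; exists (Ordinal Hy); apply/and3P.
case: Hno.
have m0 : 0 < m by lia.
have HP i j : i < m -> j < m -> exists x y, [/\ x < nX, y < nX, VX x \at A, VX y \at A &
    [/\ col x = i, col y = j, i = j -> x = y & c i (valx x) j (valx y)]].
  move=> Hi Hj; have [Hw E1 E2] := word_of_pair Hi Hj.
  have := Hall (Ordinal Hw); rewrite negbK => /existsP[x /existsP[y /and3P[Ax Ay]]].
  rewrite /compat E1 E2 => /and4P[/eqP C1 /eqP C2 /implyP C3 C4].
  by exists x, y; split=> //; split=> // E; apply/eqP/C3/eqP.
pose f t : 'I_m := Ordinal (ltn_pmod (if view t is VX x then col x else 0) m0).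
have fE x : x < nX -> f (code (VX x)) = col x :> nat.
  by move=> Hx; rewrite /f codeK //= modn_small // col_lt.
have Hinj : {in A &, injective f}.
  apply/imset_injP; rewrite eqn_leq leq_imset_card /=.
  apply: leq_trans HA _; rewrite -[X in X <= _](card_ord m) -cardsT.
  apply/subset_leq_card/subsetP => i _; apply/imsetP.
  have [x [y [Hx _ Ax _ [Cx _ _ _]]]] := HP i i (ltn_ord i) (ltn_ord i).
  by exists (code (VX x)) => //; apply: val_inj; exact: (esym (etrans (fE x Hx) Cx)).
have Huniq x y : x < nX -> y < nX -> VX x \at A -> VX y \at A -> col x = col y -> x = y.
  move=> Hx Hy Ax Ay E; have : code (VX x) = code (VX y).
    by apply: Hinj => //; apply: val_inj; rewrite /= [LHS]fE // [RHS]fE.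
  by move/(code_inj (u := VX x) (v := VX y) Hx Hy) => [].
pose s i := if [pick x : 'I_nX | (code (VX x) \in A) && (col x == i)] is Some x
  then valx x else 0.
have sE x : x < nX -> VX x \at A -> s (col x) = valx x.
  move=> Hx Ax; rewrite /s; case: pickP => [y /andP[Ay /eqP Cy]|H].
    by rewrite (Huniq y x).
  by have := H (Ordinal Hx); rewrite /= Ax eqxx.
exists s; split=> [i Hi|i j Hi Hj].
  have [x [y [Hx _ Ax _ [<- _ _ _]]]] := HP i i Hi Hi.
  by rewrite sE // ltn_mod.
have [x [y [Hx Hy Ax Ay [C1 C2 _ C]]]] := HP i j Hi Hj.
by rewrite -{2}C1 -{2}C2 !sE.
Qed.

(** There are three cases for the number [r] of moves left. Too few make the copy hopeless. With
    exactly [lv.+1] the copy is tight, and Staller owned at most [m] vertices before. With more he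
    owned fewer than [m], so [g], which sends an owned vertex to the variable it occupies, misses
    some variable, and this one is tested. *)
Lemma okc_root A D r d t (g : T -> nat) : d <= m -> Cp d A = set0 -> view t = VR d ->
  [disjoint A & D] -> t \notin D -> #|A| + r.+1 <= kk ->
  (forall x, x < nX -> VX x \at A -> g (code (VX x)) = col x) ->
  exists D' kd' w', [/\ reply A D t D', okc (t |: A) D' r d kd' w' &
    kd' -> forall u, u \in A -> g u != ti w'].
Proof.
move=> Hd HC Ht Hdis HtD HA Hg.
have R0 := reply_none Hdis HtD; have R1 u := @reply_one A D t u Hdis HtD.
have C1 : #|Cp d (t |: A)| <= 1 by apply: leq_trans (Cp_near d A t) _; rewrite HC cards0.
have Hfresh v : valid v -> inC d v -> v \at (t |: A) -> v = VR d.
  move=> Hv Hi /(at_cons Hv) [->//|HvA].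
  by move/setP/(_ (code v)): HC; rewrite !inE HvA codeK // Hi.
case: (leqP r lv) => Hr.
  exists D, false, 0; split=> //; apply: ok_hopeless; lia.
have lv0 : 0 < lv by rewrite /lv; lia.
have vY b : valid (VY d 0 b) by rewrite /valid Hd.
have Hu b : code (VY d 0 b) \notin t |: A.
  apply/negP => /(Hfresh _ (vY b)); rewrite /= eqxx => E; by have := E isT.
have Hlive w : w < 2 ^ lv -> steered (t |: A) (code (VY d 0 (~~ bit w 0)) |: D) d w 0.
  move=> Hw; split=> // [l|]; first by rewrite leqn0 => /eqP -> _; apply: setU11.
  by rewrite lv0 => v Hv Hi Hat; left; apply: Hfresh.
case: (leqP r lv.+1) => Hr'.
  have [|w Hw Hinc] := @incompat_ex A; first by move: HA; rewrite /kk; lia.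
  exists (code (VY d 0 (~~ bit w 0)) |: D), false, 0; split=> //; first exact: R1.
  apply: (@ok_tight _ _ _ _ 0 w 0); split=> //; [exact: Hlive|lia|].
  by apply: incompat_near Hinc; rewrite Ht /= ?eqxx.
have [i Hi Hfree] : exists2 i, i < m & forall u, u \in A -> g u != i.
  have HAm : #|A| <= m.-1 by move: HA; rewrite /kk; lia.
  have m1 : m.-1.+1 = m by lia.
  pose F u : 'I_m.-1.+1 := inord (g u).
  have [i Hi] : exists i, i \notin F @: A.
    apply/existsP; rewrite -negb_forall; apply/negP => /forallP H.
    have : #|'I_m.-1.+1| <= #|F @: A| by apply/subset_leq_card/subsetP => j _.
    by rewrite card_ord => /leq_trans/(_ (leq_imset_card _ _)); lia.
  exists i; first by have := ltn_ord i; lia.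
  move=> u Hu'; apply: contra Hi => /eqP E; apply/imsetP; exists u => //.
  by apply: val_inj; rewrite /F E inord_val.
have [Hw E1 E2] := word_of_pair Hi Hi; set w := i + i * m in Hw E1 E2.
exists (code (VY d 0 (~~ bit w 0)) |: D), true, w; split=> //; first exact: R1.
  apply: (@ok_cold _ _ _ _ _ 0); split; [exact: Hlive|by rewrite E1 E2| |].
    by rewrite -Ht viewK setU11.
  move=> x Hx Cx; rewrite lv0; apply/negP => /(at_cons (v := VX x) Hx) [E|HxA].
    by rewrite Ht in E.
  by have := Hfree _ HxA; rewrite Hg // Cx E1 eqxx.
by move=> _ u /Hfree; rewrite E1.
Qed.

Lemma okc_pick A D r d w q t x : d <= m -> cold A D d w q -> view t = VX x ->
  col x = ti w -> [disjoint A & D] -> t \notin D ->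
  exists D' kd', reply A D t D' /\ okc (t |: A) D' r d kd' w.
Proof.
move=> Hd [Hl Et HR Hp] Ht Cx Hdis HtD.
have R0 := reply_none Hdis HtD; have R1 u := @reply_one A D t u Hdis HtD.
have Hx : x < nX by have := validV t; rewrite Ht.
case: (ltnP q lv) => Hq.
  have [|Hu Hdead] := kill Hd Hl Hq (t := t); first by rewrite Ht.
  by exists (code (VY d q (bit w q)) |: D), false; split; [apply: R1|apply: ok_dead].
have Eq : q = lv by case: Hl => Hq' _ _ _; lia.
have Hw : w < 2 ^ lv by case: Hl.
have vL z : z < nX -> valid (VL d w (diag z)) by move=> Hz; rewrite /valid Hd Hw pair_lt.
have Hp' y : y < nX -> col y = ti w -> (VX y \at A -> VL d w (diag y) \at D) /\
    (VL d w (diag y) \at A -> VX y \at D).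
  by move=> Hy Cy; have := Hp y Hy Cy; rewrite Eq ltnn.
have Etx : t = code (VX x) by rewrite -Ht viewK.
exists (code (VL d w (diag x)) |: D), true; split.
  apply: R1; apply/negP => /(at_cons (vL _ Hx)) [E|]; first by rewrite Ht in E.
  by have [_ H] := Hp' x Hx Cx; move/H; rewrite -Etx (negPf HtD).
apply: (@ok_cold _ _ _ _ _ q); split=> //.
- by apply: steered_far Hl _ (subsetUr _ _); rewrite Ht.
- by rewrite in_setU1 HR orbT.
move=> y Hy Cy; rewrite Eq ltnn; have [H1 H2] := Hp' y Hy Cy; split.
  case/(at_cons (v := VX y) Hy) => [|/H1 HD]; last by rewrite in_setU1 HD orbT.
  by rewrite Ht => -[->]; apply: setU11.
case/(at_cons (vL _ Hy)) => [E|/H2 HD]; first by rewrite Ht in E.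
by rewrite in_setU1 HD orbT.
Qed.

Lemma Inv_assemble A D D' r kd tg d0 kd' w' t : t \notin A -> reply A D t D' ->
  #|A| + r.+1 <= kk ->
  (forall d, d <= m -> okc A D r.+1 d (kd d) (tg d)) ->
  (forall d d', d <= m -> d' <= m -> kd d -> kd d' -> d != d' -> ti (tg d) != ti (tg d')) ->
  okc (t |: A) D' r d0 kd' w' ->
  (kd' -> forall d, d <= m -> d != d0 -> kd d -> ti (tg d) != ti w') ->
  (forall d, d <= m -> d != d0 -> ~~ inC d (view t)) ->
  (forall d x, d <= m -> d != d0 -> kd d -> view t = VX x -> col x != ti (tg d)) ->
  Inv (t |: A) D' r.
Proof.
move=> HtA [HD Hdis _] HA Hok Hdist H0 Hk Hfar Hcol; split=> //.
  by rewrite cardsU1 HtA; lia.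
exists (fun d => if d == d0 then kd' else kd d), (fun d => if d == d0 then w' else tg d).
split=> [d Hd|d d' Hd Hd'].
  case: (eqVneq d d0) => [->//|Hn]; apply: (okc_far Hd (Hok d Hd)) => //; first exact: Hfar.
  by move=> Hkd x; apply: Hcol.
case: (eqVneq d d0) => [E|Hn]; case: (eqVneq d' d0) => [E'|Hn'].
- by rewrite E E' eqxx.
- by move=> K1 K2 _; rewrite eq_sym; apply: Hk.
- by move=> K1 K2 _; apply: Hk.
- exact: Hdist.
Qed.

Lemma pselect_root d A t : (Cp d A = set0 /\ view t = VR d) \/
  (Cp d A = set0 -> view t <> VR d).
Proof.
case: (eqVneq (Cp d A) set0) => [E|/eqP H]; last by right.
case: (view t) => [x|d'|d' q b|d' w e]; try by right.
by case: (eqVneq d' d) => [->|/eqP H]; [left|right=> _ []].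
Qed.

Lemma Inv_step A D r t : Inv A D r.+1 -> t \notin A -> t \notin D ->
  exists2 D', Inv (t |: A) D' r & exists u, D' \subset u |: D.
Proof.
move=> [Hdis HA [kd [tg [Hok Hdist]]]] HtA HtD.
have HV' := validV t.
have Hcopy d0 : d0 <= m -> inC d0 (view t) -> (forall d, inC d (view t) -> d = d0) ->
    (forall x, view t <> VX x) -> exists2 D', Inv (t |: A) D' r & exists u, D' \subset u |: D.
  move=> Hd0 Hi Huniq HnX.
  have Hfar d : d <= m -> d != d0 -> ~~ inC d (view t).
    by move=> _ Hn; apply: contra Hn => /Huniq ->.
  have Hfin D' kd' w' : reply A D t D' -> okc (t |: A) D' r d0 kd' w' ->
     (kd' -> forall d, d <= m -> d != d0 -> kd d -> ti (tg d) != ti w') ->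
     exists2 D', Inv (t |: A) D' r & exists u, D' \subset u |: D.
    move=> HR H1 H2; exists D'; last by case: HR.
    apply: (Inv_assemble HtA HR HA Hok Hdist H1 H2 Hfar).
    by move=> d x _ _ _ /HnX.
  case: (pselect_root d0 A t) => [[HC Ht]|Hroot]; last first.
    have [D' [kd' [HR H1 H2]]] := okc_near Hd0 (Hok d0 Hd0) Hi Hdis HtD Hroot.
    by apply: (Hfin D' kd' _ HR H1) => /H2 K d Hd Hn Kd; apply: Hdist.
  (* A pick occupies its variable, the root of a cold copy the variable that this copy waits for.
     Counting both keeps the variables of cold copies distinct. *)
  pose g u := match view u with VX x => col x | VR d => ti (tg d) | _ => 0 end.
  have [|D' [kd' [w' [HR H1 H2]]]] := okc_root Hd0 HC Ht Hdis HtD HA (g := g).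
    by move=> x Hx _; rewrite /g codeK.
  apply: (Hfin D' kd' w' HR H1) => K d Hd Hn Kd.
  have HRA : VR d \at A by have := Hok d Hd; rewrite Kd => H; inversion H as [| | | | |w q []].
  by have := H2 K _ HRA; rewrite /g codeK.
case Ht: (view t) HV' => [x|d|d q b|d w e] HV'; last first.
- by apply: (Hcopy d); rewrite ?Ht /= ?eqxx //; case/and3P: HV' => // H _ _ ? /eqP.
- by apply: (Hcopy d); rewrite ?Ht /= ?eqxx //; case/andP: HV' => // H _ ? /eqP.
- by apply: (Hcopy d); rewrite ?Ht /= ?eqxx //; move=> ? /eqP.
case: (boolP [exists d : 'I_m.+1, kd d && (ti (tg d) == col x)]) => [/existsP[d /andP[Kd /eqP Cd]]|/existsPn Hn].
  have Hd : d <= m by rewrite -ltnS.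
  have [q Hcold] : exists q, cold A D d (tg d) q.
    by have := Hok d Hd; rewrite Kd => H; inversion H as [| | | | |w q Hq]; exists q.
  have [D' [kd' [HR H1]]] := okc_pick r Hd Hcold Ht (esym Cd) Hdis HtD.
  exists D'; last by case: HR.
  apply: (Inv_assemble HtA HR HA Hok Hdist H1).
  + by move=> _ d' Hd' Hn' Kd'; apply: Hdist.
  + by move=> *; rewrite Ht.
  + move=> d' y Hd' Hn' Kd'; rewrite Ht => -[<-]; rewrite -Cd eq_sym; exact: Hdist.
have HR := reply_none Hdis HtD.
exists D; last by exists t; apply: subsetUr.
apply: (Inv_assemble (d0 := 0) (kd' := kd 0) (w' := tg 0) HtA HR HA Hok Hdist).
- apply: (okc_far (leq0n m) (Hok 0 (leq0n m))); rewrite ?Ht // => K y [<-].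
  by have := Hn ord0; rewrite K /= eq_sym.
- by move=> K d Hd Hn' Kd; apply: Hdist.
- by move=> *; rewrite Ht.
- move=> d y Hd _ Kd; rewrite Ht => -[<-].
  by have := Hn (Ordinal (Hd : d < m.+1)); rewrite Kd /= eq_sym.
Qed.

Lemma Inv_weaken A D r : Inv A D r.+1 -> Inv A D r.
Proof.
move=> [Hdis HA [kd [tg [Hok Hdist]]]]; split=> //; first by lia.
exists kd, tg; split=> // d Hd; case: (Hok d Hd) => [w H|w H|w H|w [//]|w w' q [Hl HC Hr Hi]|w q H].
- exact: ok_dead.
- exact: ok_fresh.
- by apply: ok_hopeless; lia.
- by apply: (@ok_tight _ _ _ _ w w' q); split=> //; lia.
- exact: (@ok_cold _ _ _ _ _ q).
Qed.

Lemma Inv_sw A D B r : Inv A D r -> D \subset B -> ~~ sw gadj setT r A B.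
Proof.
elim: r A D B => [|r IH] A D B HI HD.
  by rewrite /= orbF; apply: Inv_not_won HI.
apply/negP; case/or3P => [H|/forallP H|/exists_inP[v _ /andP[HvB /forallP H]]].
- by have := Inv_not_won HI; rewrite H.
- have vR : valid (VR 0) by [].
  have /negP := IH A D (code (VR 0) |: B) (Inv_weaken HI) (subset_trans HD (subsetUr _ _)).
  by apply; apply: H.
have HvD : v \notin D by apply: contra HvB; apply: (subsetP HD).
(* In [sw] Staller may claim a vertex he already owns; this amounts to a pass. *)
case: (boolP (v \in A)) => HvA.
  have E : v |: A = A by apply/setUidPr; rewrite sub1set.
  have /negP := IH A D (v |: B) (Inv_weaken HI) (subset_trans HD (subsetUr _ _)).
  by apply; have := H v; rewrite E.
have [D' HI' [u Hu]] := Inv_step HI HvA HvD.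
have /negP := IH _ _ (u |: B) HI' (subset_trans Hu (setUS _ HD)).
by apply; apply: H.
Qed.

Lemma dominator_sw : ~~ sw gadj setT kk set0 set0.
Proof.
apply: (@Inv_sw set0 set0); last exact: sub0set.
split; first by rewrite disjoints_subset sub0set.
  by rewrite cards0.
exists (fun=> false), (fun=> 0); split=> // d Hd; apply: ok_fresh.
by apply/setP => t; rewrite !inE.
Qed.

End DominatorWins.
End Gadget.

(** * Numbering the vertices of the gadget *)

Section Number.
Variables (m V : nat) (c : nat -> nat -> nat -> nat -> bool) (hp : nat).

Definition oR := nX m V + m.+1.
Definition nY := m.+1 * (lv m * 2).
Definition oL := oR + nY.
Definition lsz := hp * nE m V.
Definition gN := oL + m.+1 * lsz.

Definition vnum i :=
  if i < nX m V then VX i else if i < oR then VR (i - nX m V)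
  else if i < oL then VY ((i - oR) %/ (lv m * 2)) ((i - oR) %/ 2 %% lv m) (odd (i - oR))
  else VL ((i - oL) %/ lsz) ((i - oL) %/ nE m V %% hp) ((i - oL) %% nE m V).

Definition cnum v := match v with
  | VX x => x | VR d => nX m V + d
  | VY d q b => oR + ((d * lv m + q) * 2 + b)
  | VL d w e => oL + ((d * hp + w) * nE m V + e) end.

(** [hp] stands for [2 ^ lv m], which a reduction receives as a function of the parameter. It also
    serves as the cap that makes powers of 2 definable with polynomial bounds. *)
Definition bitc w q := odd (w %/ iter q (fun a => minn (a * 2) hp) 1).

Definition half_adj l u :=
  let d := (l - oL) %/ lsz in let w := (l - oL) %/ nE m V %% hp in
  let e := (l - oL) %% nE m V in
  ((0 < e) && ~~ compat m V c w (x1 m V e) (x2 m V e)) ||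
  (if u < nX m V then (0 < e) && ((u == x1 m V e) || (u == x2 m V e)) else
   if u < oR then d == u - nX m V else
   (d == (u - oR) %/ (lv m * 2)) && (odd (u - oR) == bitc w ((u - oR) %/ 2 %% lv m))).

Definition adjn i j := (i != j) &&
  (if oL <= i then if oL <= j then false else half_adj i j
   else if oL <= j then half_adj j i else true).

Hypotheses (Hm : 1 < m) (HV : 0 < V) (Hhp : hp = 2 ^ lv m).

Lemma bitcE w q : q < lv m -> bitc w q = bit w q.
Proof.
move=> Hq; rewrite /bitc /bit; suff -> : iter q (fun a => minn (a * 2) hp) 1 = 2 ^ q by [].
have: q <= lv m by exact: ltnW.
elim: q {Hq} => [|q IH] Hq //; rewrite iterS IH 1?ltnW // -expnSr Hhp.
by apply/minn_idPl; rewrite leq_exp2l.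
Qed.

Lemma nE_gt0 : 0 < nE m V. Proof. by []. Qed.
Lemma hp_gt0 : 0 < hp. Proof. by rewrite Hhp expn_gt0. Qed.
Lemma lv_gt0 : 0 < lv m. Proof. by rewrite /lv; lia. Qed.

Lemma cnum_lt v : valid m V v -> cnum v < gN.
Proof.
have H1 := nE_gt0; have H2 := hp_gt0.
case: v => [x|d|d q b|d w e] /=.
- by rewrite /gN /oL /oR; lia.
- by rewrite /gN /oL /oR; lia.
- case/andP => Hd Hq; rewrite /gN /oL.
  have : (d * lv m + q) * 2 + b < nY.
    by rewrite /nY; have := leq_b1 b; move: Hd Hq; move: (lv m) (b : nat) => l b'; clear; nia.
  by lia.
- case/and3P => Hd Hw He; rewrite /gN ltn_add2l /lsz -Hhp in Hw *.
  move: Hd Hw He; move: (nE m V) => l; clear; nia.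
Qed.

Lemma cnumK v : valid m V v -> vnum (cnum v) = v.
Proof.
have H1 := nE_gt0; have H2 := hp_gt0; have H3 := lv_gt0.
case: v => [x|d|d q b|d w e] /=; rewrite /vnum.
- by move=> ->.
- move=> Hd; have -> : (nX m V + d < nX m V) = false by lia.
  by rewrite /oR ltn_add2l ltnS Hd addKn.
- case/andP => Hd Hq.
  have HY : (d * lv m + q) * 2 + b < nY.
    by rewrite /nY; have := leq_b1 b; move: Hd Hq; move: (lv m) (b : nat) => l b'; clear; nia.
  rewrite addKn /oL ltn_add2l HY.
  have -> : (oR + ((d * lv m + q) * 2 + b) < nX m V) = false by rewrite /oR; lia.
  have -> : (oR + ((d * lv m + q) * 2 + b) < oR) = false by lia.
  have -> : odd ((d * lv m + q) * 2 + b) = b by rewrite oddD oddM andbF; case: (b).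
  rewrite [lv m * 2]mulnC divnMA divnMDl // [b %/ 2]divn_small ?addn0; last by case: (b).
  by rewrite divnMDl // modnMDl (divn_small Hq) addn0 modn_small.
- case/and3P => Hd Hw He; rewrite -Hhp in Hw; rewrite addKn.
  have -> : (oL + ((d * hp + w) * nE m V + e) < nX m V) = false by rewrite /oL /oR; lia.
  have -> : (oL + ((d * hp + w) * nE m V + e) < oR) = false by rewrite /oL; lia.
  have -> : (oL + ((d * hp + w) * nE m V + e) < oL) = false by lia.
  rewrite /lsz [hp * _]mulnC divnMA !divnMDl // modnMDl (divn_small He) addn0.
  by rewrite divnMDl // modnMDl (divn_small Hw) addn0 !modn_small.
Qed.

Lemma vnum_valid i : i < gN -> valid m V (vnum i).
Proof.
have H1 := nE_gt0; have H2 := hp_gt0; have H3 := lv_gt0.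
move=> Hi; rewrite /vnum; case: ltnP => // G1.
case: (ltnP i oR) => G2; first by move: G2 => /=; rewrite /oR; lia.
case: (ltnP i oL) => G3 /=.
  rewrite ltn_mod H3 andbT -ltnS ltn_divLR ?muln_gt0 ?H3 //.
  by move: G2 G3; rewrite /oL /nY; lia.
rewrite -Hhp !ltn_mod H2 H1 !andbT -ltnS ltn_divLR /lsz ?muln_gt0 ?H2 ?H1 //.
by move: Hi G3; rewrite /gN /lsz; lia.
Qed.

Lemma vnumK i : i < gN -> cnum (vnum i) = i.
Proof.
move=> Hi; rewrite /vnum; case: ltnP => // G1.
case: (ltnP i oR) => G2 /=; first by lia.
case: (ltnP i oL) => G3 /=.
  rewrite [lv m * 2]mulnC divnMA -divn_eq -modn2 -divn_eq; lia.
rewrite /lsz [hp * _]mulnC divnMA -!divn_eq; lia.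
Qed.

Lemma adjnE i j : i < gN -> j < gN ->
  adjn i j = (i != j) && adjv m V c (vnum i) (vnum j).
Proof.
move=> Hi Hj; rewrite /adjn; congr andb.
have half l u : oL <= l -> l < gN -> u < oL -> half_adj l u = adjv m V c (vnum l) (vnum u).
  move=> Hl HlN Hu; rewrite /vnum /half_adj.
  have -> : (l < nX m V) = false by move: Hl; rewrite /oL /oR; lia.
  have -> : (l < oR) = false by move: Hl; rewrite /oL; lia.
  rewrite [l < oL]ltnNge Hl /= Hu /badl.
  case: (ltnP u (nX m V)) => // G1; case: (ltnP u oR) => // G2.
  by rewrite /= bitcE // ltn_mod lv_gt0.
have el u : u < oL -> if vnum u is VL _ _ _ then false else true.
  by move=> Hu; rewrite /vnum; case: ifP => // _; case: ifP => // _; rewrite Hu.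
have le u : oL <= u -> if vnum u is VL _ _ _ then true else false.
  move=> Hl; rewrite /vnum.
  have -> : (u < nX m V) = false by move: Hl; rewrite /oL /oR; lia.
  have -> : (u < oR) = false by move: Hl; rewrite /oL; lia.
  by rewrite [u < oL]ltnNge Hl.
case: (leqP oL i) => Gi; case: (leqP oL j) => Gj.
- by have := le i Gi; have := le j Gj; case: (vnum i) => //; case: (vnum j).
- exact: half.
- by rewrite half // adjvC.
- by have := el i Gi; have := el j Gj; case: (vnum i) => //; case: (vnum j).
Qed.

Definition adjI : rel 'I_gN := fun i j => adjn i j.

Lemma gN_gt0 : 0 < gN. Proof. by rewrite /gN /oL /oR; lia. Qed.

Definition codeI v : 'I_gN := insubd (Ordinal gN_gt0) (cnum v).

Lemma game_bcsp : staller_wins_within adjI Staller (kk m) <-> bcsp m V c.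
Proof.
pose view (i : 'I_gN) := vnum i.
have viewK (i : 'I_gN) : codeI (view i) = i.
  by apply: val_inj; rewrite val_insubd vnumK // ltn_ord.
have validV (i : 'I_gN) : valid m V (view i) by apply: vnum_valid.
have codeK v : valid m V v -> view (codeI v) = v.
  by move=> Hv; rewrite /view /codeI val_insubd cnum_lt // cnumK.
have Eadj : adjI = gadj m V c view.
  apply: fext => i; apply: fext => j; rewrite /adjI /gadj adjnE //.
have first_ok : (exists x : 'I_gN, true) by exists (Ordinal gN_gt0).
split=> [/staller_winsP[_]|[s [Hs Hc]]].
  (* Dominator's play presupposes that there is no solution, so this direction uses excluded
     middle. *)
  rewrite /swf /= Eadj => Hsw; case: (classic (bcsp m V c)) => // Hno.
  by have := dominator_sw Hm HV viewK validV codeK Hno; rewrite Hsw.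
apply/staller_winsP; split=> //; rewrite /swf /= Eadj.
exact: (staller_sw Hm HV viewK validV codeK Hs Hc).
Qed.

Lemma adjI_sym : symmetric adjI.
Proof. by move=> i j; rewrite /adjI !adjnE // eq_sym adjvC. Qed.

Lemma adjI_irr : irreflexive adjI.
Proof. by move=> i; rewrite /adjI /adjn eqxx. Qed.
End Number.

(** * The hardness reduction from constraint satisfaction *)

Section DefGame.
Variable mj : majorants.
Notation def := (def mj).
Variables (Fm FV Fhp : seq bool -> seq nat -> nat).
Hypotheses (Hm : def Fm) (HV : def FV) (Hhp : def Fhp).

Lemma def_lv F : def F -> def (fun x e => lv (F x e)).
Proof. by move=> HF; apply: def_ext (def_add HF HF) => x e; rewrite /lv addnn. Qed.

Let def_lvm := def_lv Hm.

Lemma def_nX : def (fun x e => nX (Fm x e) (FV x e)).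
Proof. by rewrite /nX; deft. Qed.

Lemma def_nE : def (fun x e => nE (Fm x e) (FV x e)).
Proof. by have := def_nX; rewrite /nE => H; deft. Qed.

Lemma def_oR : def (fun x e => oR (Fm x e) (FV x e)).
Proof. by have := def_nX; rewrite /oR => H; deft. Qed.

Lemma def_oL : def (fun x e => oL (Fm x e) (FV x e)).
Proof. by have := def_oR; rewrite /oL /nY => H; deft. Qed.

Lemma def_lsz : def (fun x e => lsz (Fm x e) (FV x e) (Fhp x e)).
Proof. by have := def_nE; rewrite /lsz => H; deft. Qed.

Lemma def_gN : def (fun x e => gN (Fm x e) (FV x e) (Fhp x e)).
Proof. by have := def_oL; have := def_lsz; rewrite /gN => H H'; deft. Qed.

Lemma def_compat (c : seq bool -> seq nat -> nat -> nat -> nat -> nat -> bool) w F G :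
  (forall q v r w, def q -> def v -> def r -> def w ->
     def (fun x e => c x e (q x e) (v x e) (r x e) (w x e) : nat)) ->
  def w -> def F -> def G ->
  def (fun x e => compat (Fm x e) (FV x e) (c x e) (w x e) (F x e) (G x e) : nat).
Proof.
move=> Hc Hw HF HG; rewrite /compat /col /ti /tj /valx.
repeat first [def_step | apply: Hc].
Qed.

Lemma def_half_adj (c : seq bool -> seq nat -> nat -> nat -> nat -> nat -> bool) F G :
  (forall q v r w, def q -> def v -> def r -> def w ->
     def (fun x e => c x e (q x e) (v x e) (r x e) (w x e) : nat)) ->
  def F -> def G ->
  def (fun x e => half_adj (Fm x e) (FV x e) (c x e) (Fhp x e) (F x e) (G x e) : nat).
Proof.
move=> Hc HF HG; rewrite /half_adj /bitc /x1 /x2 /=.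
have H1 := def_oL; have H2 := def_lsz; have H3 := def_nE; have H4 := def_nX; have H5 := def_oR.
have He : def (fun x e => (F x e - oL (Fm x e) (FV x e)) %% nE (Fm x e) (FV x e)) by deft.
have Hw : def (fun x e => (F x e - oL (Fm x e) (FV x e)) %/ nE (Fm x e) (FV x e) %% Fhp x e) by deft.
apply: def_or.
  apply: def_and; first by apply: def_leq; first exact: d_const.
  by apply: def_not; apply: def_compat => //; deft.
repeat first [exact: He | exact: Hw | def_step].
Qed.

Lemma def_adjn (c : seq bool -> seq nat -> nat -> nat -> nat -> nat -> bool) F G :
  (forall q v r w, def q -> def v -> def r -> def w ->
     def (fun x e => c x e (q x e) (v x e) (r x e) (w x e) : nat)) ->
  def F -> def G ->
  def (fun x e => adjn (Fm x e) (FV x e) (c x e) (Fhp x e) (F x e) (G x e) : nat).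
Proof.
move=> Hc HF HG; rewrite /adjn; have H1 := def_oL.
have H2 := def_half_adj Hc HF HG; have H3 := def_half_adj Hc HG HF.
deft.
Qed.
End DefGame.

(** The number [mk k] of variables depends on the parameter alone, and so does the budget
    [kk (mk k)]; the domain may grow with the word. Words that fail [ok] are sent to the empty word,
    which encodes no game. *)
Theorem fpt_to_game B A S N1 b1 mk
    (ok : seq bool -> nat -> nat -> bool) (VF : seq bool -> nat -> nat -> nat)
    (cF : seq bool -> nat -> nat -> nat -> nat -> nat -> nat -> bool) :
  let Es := [:: fun k => 2 ^ lv (mk k)] in
  fpt_reducible B A ->
  (forall mj F, def mj F -> def mj (fun x e => mk (F x e))) ->
  def poly (fun _ e => S e) -> def poly (fun _ e => N1 e) -> def poly b1 ->
  (forall F G, def poly F -> def poly G -> def poly (fun x e => ok x (F x e) (G x e) : nat)) ->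
  (forall F G, def poly F -> def poly G -> def poly (fun x e => VF x (F x e) (G x e))) ->
  (forall F G q v r w, def poly F -> def poly G -> def poly q -> def poly v ->
     def poly r -> def poly w ->
     def poly (fun x e => cF x (F x e) (G x e) (q x e) (v x e) (r x e) (w x e) : nat)) ->
  (forall k, 1 < mk k) -> (forall x L k, ok x L k -> 0 < VF x L k) ->
  (forall x k, let w := word_of Es S N1 b1 x k in
     A x k <-> ok w (size x) k /\ bcsp (mk k) (VF w (size x) k) (cF w (size x) k)) ->
  fpt_reducible B short_staller_mb_dom_game.
Proof.
move=> Es HBA Hmk HS HN1 Hb1 Hok HVF HcF Hm1 HV1 HA.
have Hv i : def poly (fun x e => nth 0 e i) by apply: d_var.
have HmF i : def poly (fun x e => mk (nth 0 e i)) by apply: Hmk.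
pose b (x : seq bool) e := gbit (gN (mk (nth 0 e 2)) (VF x (nth 0 e 1) (nth 0 e 2)) (nth 0 e 3))
   (adjn (mk (nth 0 e 2)) (VF x (nth 0 e 1) (nth 0 e 2)) (cF x (nth 0 e 1) (nth 0 e 2)) (nth 0 e 3))
   true (nth 0 e 0).
pose N x e := if ok x (nth 0 e 0) (nth 0 e 1) then
  gsize (gN (mk (nth 0 e 1)) (VF x (nth 0 e 0) (nth 0 e 1)) (nth 0 e 2)) else 0.
have Hb : def poly (fun x e => b x e : nat).
  have H1 : def poly (fun x e => VF x (nth 0 e 1) (nth 0 e 2)) by apply: HVF.
  have H2 := def_gN (HmF 2) H1 (Hv 3).
  rewrite /b /gbit; deft.
  apply: (@def_adjn _ _ _ _ (HmF 2) H1 (Hv 3) (fun x e => cF x (nth 0 e 1) (nth 0 e 2))); last 2 first.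
  - deft.
  - deft.
  by move=> *; apply: HcF.
have HN : def poly N.
  have H1 : def poly (fun x e => VF x (nth 0 e 0) (nth 0 e 1)) by apply: HVF.
  rewrite /N; apply: def_if; [exact: Hok| |exact: d_const].
  by apply: def_gsize; apply: def_gN.
have HE : elem_fun (fun k => 2 ^ lv (mk k)).
  by apply: def_exp2; apply: def_lv; apply: Hmk; apply: d_var.
have HK : elem_fun (fun k => kk (mk k)).
  have H := Hmk elem _ (d_var elem 0); have H' := def_lv H.
  rewrite /elem_fun /kk; apply: def_add; last exact: d_const.
  exact: def_add.
apply: (fpt_extend HBA (Es := Es) _ HK HS HN1 Hb1 Hb HN) => // x k.
rewrite HA /out_of; set w := word_of _ _ _ _ x k.
rewrite /N [nth 0 _ 0]/= [nth 0 (env_of _ _ _) 1]/= [nth 0 (env_of _ _ _) 2]/=.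
case Hw: (ok w (size x) k); last first.
  split=> [[]//|[n [adj [first [_ _]]]]].
  by move/(congr1 size); rewrite size_mkseq size_game.
have HV := HV1 _ _ _ Hw; have Hm := Hm1 k.
set V := VF w (size x) k in HV *; set c := cF w (size x) k.
set hp := 2 ^ lv (mk k).
set o := mkseq _ _.
have Eo : o = encode_game (@adjI (mk k) V c hp) Staller.
  rewrite (@encode_gameE _ _ _ (adjn (mk k) V c hp)) // /o /mkseq; apply: eq_map => i.
  by rewrite /b /=; case: (gbit _ _ _ _).
rewrite Eo; have Hg := game_bcsp c Hm HV (erefl hp).
split=> [[_ H]|[n [adj [first [Hs Hi E Hwin]]]]].
  exists (gN (mk k) V hp), (@adjI (mk k) V c hp), Staller; split=> //.
  - exact: adjI_sym.
  - exact: adjI_irr.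
  - exact/Hg.
split=> //; apply/Hg.
have En := congr1 nl E; rewrite !nl_game in En; subst n.
have -> : @adjI (mk k) V c hp = adj.
  apply: fext => i; apply: fext => j; have := arcx_game adj first i j.
  by rewrite -E arcx_game.
have Ef : is_staller first = true by have := firstx_game adj first; rewrite -E firstx_game.
by case: first Ef Hwin {E}.
Qed.

(** * From circuits to constraint satisfaction *)

Section Pos.
Variables (n : nat) (a : rel nat) (g : pred nat).

Definition degn z := count (fun j => a j z) (iota 0 n).

(* Node [z] may have value [b], as far as one can tell from [may] on the inputs
   and if the value [~~ is_and] of a large gate has a witness among the children
   singled out by [wit]. *)
Fixpoint pos (may : nat -> bool -> bool) (wit : rel nat) f b z : bool :=
  if f is f'.+1 then
    if degn z == 0 then may z b else
    if degn z == 1 then all (fun h => a h z ==> pos may wit f' (~~ b) h) (iota 0 n) else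
    if b == g z then all (fun h => a h z ==> pos may wit f' b h) (iota 0 n) else
    has (fun h => [&& a h z, (degn z <= 2) || wit z h & pos may wit f' b h]) (iota 0 n)
  else may z b.

(** [walk], [one] and [two] search backwards for [f] steps. The depth being fixed, they turn into a
    fixed number of nested quantifiers that test depth and weft. *)
Fixpoint walk f z : bool :=
  if f is f'.+1 then has (fun j => a j z && walk f' j) (iota 0 n) else true.

Definition large z := 2 < degn z.

Fixpoint one f z : bool := large z ||
  (if f is f'.+1 then has (fun j => a j z && one f' j) (iota 0 n) else false).

Fixpoint two f z : bool :=
  if f is f'.+1 then has (fun j => a j z && (large z && one f' j || two f' j)) (iota 0 n)
  else false.
End Pos.

Lemma hasI n (P : pred nat) : reflect (exists i : 'I_n, P i) (has P (iota 0 n)).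
Proof.
apply: (iffP hasP) => [[i]|[i Hi]]; first by rewrite mem_iota => /andP[_ H] Hi; exists (Ordinal H).
by exists (i : nat); rewrite ?mem_iota /=.
Qed.

Lemma allI n (P : pred nat) : reflect (forall i : 'I_n, P i) (all P (iota 0 n)).
Proof.
apply: (iffP allP) => [H i|H i]; first by apply: H; rewrite mem_iota /=.
by rewrite mem_iota => /andP[_ Hi]; apply: (H (Ordinal Hi)).
Qed.

(** * Depth, weft and guessed evaluation of circuits *)

Section Circuits.
Variables (n : nat) (C : circuit n) (a : rel nat) (g : pred nat).
Hypotheses (Ha : forall i j : 'I_n, arc C i j = a i j) (Hg : forall i : 'I_n, is_and C i = g i).
Notation e := (arc C).
Notation out := (output C).

Lemma degnE (z : 'I_n) : degn n a z = indegree C z.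
Proof.
rewrite /degn /indegree -val_enum_ord count_map -size_filter.
rewrite -(card_uniqP (filter_uniq _ (enum_uniq _))); apply: eq_card => j.
by rewrite mem_filter !inE /= mem_enum andbT Ha.
Qed.

Lemma walkP f (z : 'I_n) : reflect (exists i p, [/\ path e i p, last i p = z & size p = f])
  (walk n a f z).
Proof.
apply: (iffP idP).
  elim: f z => [|f IH] z /=; first by exists z, [::].
  case/hasI => j /andP[Hj /IH[i [p [H1 H2 H3]]]]; exists i, (rcons p z).
  by rewrite rcons_path last_rcons size_rcons H1 H2 H3 Ha Hj.
elim: f z => [|f IH] z //= [i [p [H1 H2 H3]]].
case/lastP: p H1 H2 H3 => [|p y] //; rewrite rcons_path last_rcons size_rcons.
case/andP => H1 Hy Ey [H3]; apply/hasI; exists (last i p); rewrite -Ey -Ha Hy /=.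
by apply: IH; exists i, p.
Qed.

Lemma largeE (z : 'I_n) : large n a z = is_large C z.
Proof. by rewrite /large degnE. Qed.

Lemma oneP f (z : 'I_n) : reflect
  (exists i p, [/\ path e i p, last i p = z, size p <= f & 0 < count (is_large C) (i :: p)])
  (one n a f z).
Proof.
apply: (iffP idP).
  elim: f z => [|f IH] z /=.
    by rewrite orbF largeE => H; exists z, [::]; rewrite /= H.
  case/orP => [|/hasI[j /andP[Hj /IH[i [p [H1 H2 H3 H4]]]]]].
    by rewrite largeE => H; exists z, [::]; rewrite /= H.
  exists i, (rcons p z); rewrite rcons_path last_rcons size_rcons H1 H2 Ha Hj; split=> //.
  by rewrite -cats1 count_cat addnA; apply: leq_trans H4 (leq_addr _ _).
elim: f z => [|f IH] z [i [p [H1 H2 H3 H4]]] /=.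
  case: p H3 H1 H2 H4 => //= _ _ ->; rewrite largeE orbF.
  by case: (is_large C z).
case: (boolP (large n a z)) => //= Hz; apply/hasI.
case/lastP: p H1 H2 H3 H4 => [|p y] H1 H2 H3 H4.
  by move: H4 Hz; rewrite /= largeE -H2 /=; case: (is_large C i).
move: H1 H2 H3 H4; rewrite rcons_path last_rcons size_rcons => /andP[H1 Hy] Ey H3 H4.
exists (last i p); rewrite -Ey -Ha Hy /=; apply: IH; exists i, p; split=> //.
by move: H4 Hz; rewrite -rcons_cons -cats1 count_cat Ey largeE /=; case: (is_large C z); rewrite // !addn0.
Qed.

Lemma twoP f (z : 'I_n) : reflect
  (exists i p, [/\ path e i p, last i p = z, size p <= f & 1 < count (is_large C) (i :: p)])
  (two n a f z).
Proof.
apply: (iffP idP).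
  elim: f z => [|f IH] z //= /hasI[j /andP[Hj /orP[/andP[Hz /oneP[i [p [H1 H2 H3 H4]]]]|/IH[i [p [H1 H2 H3 H4]]]]]];
    exists i, (rcons p z); rewrite rcons_path last_rcons size_rcons H1 H2 Ha Hj; split=> //;
    rewrite -cats1 count_cat addnA.
    by move: H4 Hz; rewrite largeE /= addn0 => H4 ->; rewrite addn1 ltnS.
  by apply: leq_trans H4 (leq_addr _ _).
elim: f z => [|f IH] z [i [p [H1 H2 H3 H4]]] /=.
  case: p H3 H1 H2 H4 => //= _ _ ->; case: (is_large C z) => //.
apply/hasI; case/lastP: p H1 H2 H3 H4 => [|p y] H1 H2 H3 H4.
  by move: H4 => /=; case: (is_large C i).
move: H1 H2 H3 H4; rewrite rcons_path last_rcons size_rcons => /andP[H1 Hy] Ey H3 H4.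
exists (last i p); rewrite -Ey -Ha Hy /= largeE.
move: H4; rewrite -rcons_cons -cats1 count_cat [count _ [:: y]]/= addn0.
case Hl: (is_large C y) => H4; apply/orP; [left; rewrite /=|right].
  by apply/oneP; exists i, p; split=> //; move: H4 => /=; rewrite addn1 ltnS.
by apply: IH; exists i, p; split=> //; move: H4 => /=; rewrite addn0.
Qed.

Section Acyclic.
Hypothesis Hac : forall i p, p <> [::] -> path e i p -> last i p <> i.

(** The number of ancestors: a topological rank of an acyclic circuit. *)
Definition rank j := #|[set i | connect e i j]|.

Lemma rank_lt i j : e i j -> rank i < rank j.
Proof.
move=> Hij; apply: proper_card; apply/properP; split.
  by apply/subsetP => x; rewrite !inE => Hx; apply: connect_trans Hx (connect1 Hij).
exists j; rewrite !inE ?connect0 //; apply/negP => /connectP[p Hp El].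
by apply: (Hac (i := i) (p := j :: p)) => //=; rewrite ?Hij.
Qed.

Lemma from_input z : exists i p, [/\ is_input C i, path e i p & last i p = z].
Proof.
move: {2}(rank z) (leqnn (rank z)) => r; elim: r z => [|r IH] z Hr.
  have : 0 < rank z by apply/card_gt0P; exists z; rewrite inE connect0.
  by lia.
case: (boolP (is_input C z)) => Hz; first by exists z, [::].
have : 0 < indegree C z by rewrite lt0n.
case/card_gt0P => j; rewrite inE => Hj.
have [|i [p [H1 H2 H3]]] := IH j; first by have := rank_lt Hj; lia.
by exists i, (rcons p z); rewrite rcons_path last_rcons H1 H2 H3 Hj.
Qed.

(** [depth_le] speaks only of paths from inputs, but any path to the output extends backwards to one
    by [from_input]. *)
Lemma depthP d : depth_le C d <-> ~~ walk n a d.+1 out.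
Proof.
split=> [H|/negP H i p Hi Hp Hl].
  apply/negP => /walkP[i [p [H1 H2 H3]]]; have [j [q [J1 J2 J3]]] := from_input i.
  have := H j (q ++ p) J1; rewrite cat_path J2 J3 H1 last_cat J3 H2 size_cat H3.
  by move=> /(_ isT (erefl _)); lia.
rewrite leqNgt; apply/negP => Hd; apply: H; apply/walkP.
exists (last i (take (size p - d.+1) p)), (drop (size p - d.+1) p).
move: Hp; rewrite -{1}(cat_take_drop (size p - d.+1) p) cat_path => /andP[_ ->].
by rewrite -last_cat cat_take_drop size_drop Hl; split=> //; lia.
Qed.

Lemma weftP d : depth_le C d -> weft_le C 1 <-> ~~ two n a d out.
Proof.
move=> Hd; split=> [H|/negP H i p Hi Hp Hl].
  apply/negP => /twoP[i [p [H1 H2 H3 H4]]]; have [j [q [J1 J2 J3]]] := from_input i.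
  have := H j (q ++ p) J1; rewrite cat_path J2 J3 H1 last_cat J3 H2.
  move=> /(_ isT (erefl _)); rewrite -cat_cons count_cat.
  suff : is_large C i <= count (is_large C) (j :: q) by move: H4 => /=; lia.
  rewrite -J3; case Hl: (is_large C (last j q)) => //.
  by rewrite -has_count; apply/hasP; exists (last j q) => //; apply: mem_last.
rewrite leqNgt; apply/negP => H1; apply: H; apply/twoP; exists i, p; split=> //.
exact: Hd Hi Hp Hl.
Qed.

(** Evaluation with fuel; by [ev_ext] the value no longer changes once the fuel exceeds the rank. *)
Fixpoint ev (t : pred 'I_n) f (z : 'I_n) : bool :=
  if f is f'.+1 then
    if indegree C z == 0 then t z else
    if indegree C z == 1 then ~~ [exists (j | e j z), ev t f' j] else
    if is_and C z then [forall (j | e j z), ev t f' j] else [exists (j | e j z), ev t f' j]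
  else false.

Lemma ev_ext t f f' z : rank z < f -> rank z < f' -> ev t f z = ev t f' z.
Proof.
elim: f f' z => [|f IH] [|f'] z //= Hf Hf'.
have E j : e j z -> ev t f j = ev t f' j.
  by move=> /rank_lt H; apply: IH; lia.
have Ex : [exists (j | e j z), ev t f j] = [exists (j | e j z), ev t f' j].
  by apply: eq_existsb => j; case Hj: (e j z) => //=; rewrite E.
have Ef : [forall (j | e j z), ev t f j] = [forall (j | e j z), ev t f' j].
  by apply: eq_forallb => j; case Hj: (e j z) => //=; rewrite E.
by rewrite Ex Ef.
Qed.

Lemma valuation_ex t : exists2 v, valuation C v & forall i, is_input C i -> v i = t i.
Proof.
pose r := (\max_(z : 'I_n) rank z).+1.
have Hr z : rank z < r by rewrite ltnS; apply: leq_bigmax.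
have E z : ev t r z = ev t r.+1 z by exact: (ev_ext t (Hr z) (leqW (Hr z))).
exists (ev t r) => [z|z]; last by rewrite /is_input E /= => ->.
case Hd: (indegree C z) => [|[|f]] //; first by rewrite E /= Hd.
by rewrite E /= Hd.
Qed.

Section Depth.
Variable d : nat.
Hypotheses (Hd : depth_le C d) (Hw : weft_le C 1).

Lemma last_is_input z p : path e z p -> last z p = out -> size p = d -> is_input C z.
Proof.
move=> Hp Hl Hs; apply/negPn/negP => Hz.
have : 0 < indegree C z by rewrite lt0n.
case/card_gt0P => j; rewrite inE => Hj.
have /depthP/negP := Hd; apply; apply/walkP; exists j, (z :: p).
by rewrite /= Hj Hp Hl Hs.
Qed.

Section Val.
Variables (v : pred 'I_n) (Hv : valuation C v).

Lemma val_not (z h : 'I_n) : indegree C z = 1 -> e h z -> v z = ~~ v h.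
Proof.
move=> Hz Hh; have := Hv z; rewrite Hz => ->; congr negb.
apply/exists_inP/idP => [[j Hj]|Hvh]; last by exists h.
have /eqP/cards1P[x Ex] := Hz.
have : h \in [set j | e j z] by rewrite inE.
have : j \in [set j | e j z] by rewrite inE.
by rewrite Ex !inE => /eqP -> /eqP ->.
Qed.

(** This treats both kinds of gates alike: the value [is_and C z] needs all children, the other
    value just one. *)
Lemma val_gate (z : 'I_n) : 1 < indegree C z ->
  (v z == is_and C z) = [forall (h | e h z), v h == is_and C z].
Proof.
move=> Hz; have := Hv z; case: (indegree C z) Hz => [|[|k]] // _ ->.
case: (is_and C z).
  by rewrite eqb_id; apply: eq_forallb => h; rewrite eqb_id.
rewrite eqbF_neg negb_exists_in; apply: eq_forallb => h; by rewrite eqbF_neg.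
Qed.

Variables (may : nat -> bool -> bool) (wit : rel nat).

Definition reaches z := exists2 p, path e z p & last z p = out.

(** True values survive the recursion when [may] admits them at the inputs and every large gate
    whose value rests on a single child has such a child in [wit]. At [f = 0] the path has used up
    the depth, so the node is an input. *)
Lemma pos_complete f b z p : path e z p -> last z p = out -> size p + f = d ->
  (forall i : 'I_n, is_input C i -> may i (v i)) ->
  (forall z : 'I_n, is_large C z -> reaches z -> v z != is_and C z ->
     exists h : 'I_n, [/\ e h z, wit z h & v h = v z]) ->
  v z = b -> pos n a g may wit f b z.
Proof.
move=> Hp Hl Hf Hm HW; elim: f b z p Hp Hl Hf => [|f IH] b z p Hp Hl Hf Hz /=.
  by rewrite -Hz; apply: Hm; apply: last_is_input Hp Hl _; rewrite -Hf addn0.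
have Hnext (h : 'I_n) b' : a h z -> v h = b' -> pos n a g may wit f b' h.
  by move=> Hh; apply: (IH b' h (z :: p)) => //=; rewrite ?Ha ?Hh //; lia.
rewrite degnE; case: eqP => H0; first by rewrite -Hz; apply: Hm; apply/eqP.
case: eqP => H1.
  apply/allI => h; apply/implyP => Hh; apply: Hnext => //.
  by rewrite -Hz (val_not H1 (h := h)) ?Ha // negbK.
have H2 : 1 < indegree C z by case: (indegree C z) H0 H1 => [|[|]].
have := val_gate H2; rewrite Hz -Hg; case: eqP => [Eb|Nb] /esym.
  move/forall_inP => Hall; apply/allI => h; apply/implyP => Hh; apply: Hnext => //.
  by rewrite Eb; apply/eqP/Hall; rewrite Ha.
case: (leqP (indegree C z) 2) => Hsm /=.
  move/negbT; rewrite negb_forall_in => /exists_inP[h Hh Hvh]; apply/hasI; exists h.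
  rewrite -Ha Hh /=; apply: Hnext; first by rewrite -Ha.
  by case: b (is_and C z) (v h) Nb Hvh {Hz} => [] [] [].
move=> _; have [|||h [Hh Hwh Hvh]] := HW z => //.
- by exists p.
- by rewrite Hz; apply/eqP.
apply/hasI; exists h; rewrite -Ha Hh Hwh /=; apply: Hnext; first by rewrite -Ha.
by rewrite Hvh.
Qed.

Lemma pos_refute Lam f b z p : path e z p -> last z p = out -> size p + f = d ->
  (forall z, exists2 s : seq 'I_n, size s <= Lam & forall h : 'I_n, wit z h -> h \in s) ->
  v z != b ->
  exists Z : seq 'I_n, [/\ size Z <= (Lam + 2) ^ f, all (is_input C) Z &
    forall may : nat -> bool -> bool, (forall i, i \in Z -> ~~ may i (~~ v i)) -> ~~ pos n a g may wit f b z].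
Proof.
move=> Hp Hl Hf HW; elim: f b z p Hp Hl Hf => [|f IH] b z p Hp Hl Hf Hz /=.
  exists [:: z]; split=> //=.
    by rewrite andbT; apply: last_is_input Hp Hl _; rewrite -Hf addn0.
  move=> mm /(_ z (mem_head _ _)); congr (~~ mm _ _).
  by case: (v z) b Hz => [] [].
have Hnext (h : 'I_n) b' : a h z -> v h != b' -> exists Z : seq 'I_n,
    [/\ size Z <= (Lam + 2) ^ f, all (is_input C) Z &
    forall may : nat -> bool -> bool, (forall i, i \in Z -> ~~ may i (~~ v i)) -> ~~ pos n a g may wit f b' h].
  by move=> Hh; apply: (IH b' h (z :: p)) => //=; rewrite ?Ha ?Hh //; lia.
have Hle : (Lam + 2) ^ f <= (Lam + 2) ^ f.+1 by rewrite leq_pexp2l //; lia.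
rewrite degnE; case: eqP => H0.
  exists [:: z]; split=> //=.
  - by rewrite expn_gt0; lia.
  - by rewrite andbT; apply/eqP.
  move=> mm /(_ z (mem_head _ _)); congr (~~ mm _ _).
  by case: (v z) b Hz => [] [].
have Hchild : exists h, e h z.
  have : 0 < indegree C z by rewrite lt0n; apply/eqP.
  by case/card_gt0P => j; rewrite inE => Hj; exists j.
case: eqP => H1.
  have [h Hh] := Hchild; have [||Z [Z1 Z2 Z3]] := Hnext h (~~ b).
  - by rewrite -Ha.
  - by move: Hz; rewrite (val_not H1 Hh); case: (v h) b => [] [].
  exists Z; split=> //; first exact: leq_trans Z1 Hle.
  move=> mm /Z3 Hn; apply/negP => /allI /(_ h); rewrite -Ha Hh /=; exact/negP.
have H2 : 1 < indegree C z by case: (indegree C z) H0 H1 => [|[|]].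
have := val_gate H2; rewrite -Hg; case: (b =P is_and C z) => [Eb|Nb].
  rewrite -Eb (negPf Hz) => /esym/negbT; rewrite negb_forall_in => /exists_inP[h Hh Hvh].
  have [||Z [Z1 Z2 Z3]] := Hnext h b => //; first by rewrite -Ha.
  exists Z; split=> //; first exact: leq_trans Z1 Hle.
  move=> mm /Z3 Hn; apply/negP => /allI /(_ h); rewrite -Ha Hh /=; exact/negP.
have -> : v z == is_and C z by case: (v z) b (is_and C z) Hz Nb => [] [] [].
move/esym/forall_inP => Hall.
have Hvb (h : 'I_n) : e h z -> v h != b.
  by move=> /Hall /eqP ->; rewrite eq_sym; apply/eqP.
have [s [Hs Hsz]] : exists s : seq 'I_n, size s <= Lam + 2 /\
    forall h : 'I_n, e h z -> (indegree C z <= 2) || wit z h -> h \in s.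
  case: leqP => Hsm /=.
    exists (enum [set j | e j z]); rewrite -cardE -/(indegree C z); split; first by lia.
    by move=> h Hh _; rewrite mem_enum inE.
  have [s Hs Hin] := HW z; exists s; split; first by lia.
  by move=> h _; apply: Hin.
have : exists Z : seq 'I_n, [/\ size Z <= size s * (Lam + 2) ^ f, all (is_input C) Z &
    forall may : nat -> bool -> bool, (forall i, i \in Z -> ~~ may i (~~ v i)) ->
    forall h : 'I_n, h \in s -> e h z -> ~~ pos n a g may wit f b h].
  elim: s {Hs Hsz} => [|h s [Z [Z1 Z2 Z3]]]; first by exists [::].
  case Hh: (e h z); last first.
    exists Z; split=> //; first by apply: leq_trans Z1 _; rewrite leq_mul2r /= leqnSn orbT.
    move=> mm HZ h'; rewrite inE => /predU1P[->|]; first by rewrite Hh.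
    exact: Z3 HZ h'.
  have [||Z' [Y1 Y2 Y3]] := Hnext h b; [by rewrite -Ha|exact: Hvb|].
  exists (Z' ++ Z); split.
  - by rewrite size_cat mulSn leq_add.
  - by rewrite all_cat Y2.
  move=> mm HZ h'; rewrite inE => /predU1P[-> _|Hin].
    by apply: Y3 => i Hi; apply: HZ; rewrite mem_cat Hi.
  by apply: Z3 => // i Hi; apply: HZ; rewrite mem_cat Hi orbT.
case=> Z [Z1 Z2 Z3]; exists Z; split=> //.
  by apply: leq_trans Z1 _; rewrite expnS leq_mul2r Hs orbT.
move=> mm /Z3 HZ; apply/negP => /hasI[h /and3P[Hh Hwh]]; apply/negP.
by apply: HZ; rewrite ?Ha //; apply: Hsz; rewrite ?Ha.
Qed.
End Val.

(** By weft 1 a large gate reaches the output through small nodes only. Going back from the output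
    through these, each step at most doubles the number of nodes, so at most [2 ^ d.+1] large gates
    are relevant. *)
Fixpoint level_set j : {set 'I_n} := if j is j'.+1 then
  \bigcup_(z in level_set j' | ~~ is_large C z) [set h | e h z] else [set out].

Lemma level_set_card j : #|level_set j| <= 2 ^ j.
Proof.
elim: j => [|j IH] /=; first by rewrite cards1.
apply: (@leq_trans (\sum_(z in level_set j | ~~ is_large C z) #|[set h | e h z]|)).
  elim/big_rec2: _ => [|z x y _ H]; first by rewrite cards0.
  by apply: leq_trans (leq_card_setU _ _) _; rewrite leq_add2l.
apply: (@leq_trans (\sum_(z in level_set j | ~~ is_large C z) 2)).
  by apply: leq_sum => z /andP[_]; rewrite -leqNgt.
apply: (@leq_trans (\sum_(z in level_set j) 2)).
  by rewrite [X in _ <= X](bigID (fun z => ~~ is_large C z)) /= leq_addr.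
by rewrite sum_nat_const expnS mulnC leq_mul2l IH orbT.
Qed.

Lemma large_level (z : 'I_n) : is_large C z -> reaches z ->
  exists2 j, j <= d & z \in level_set j.
Proof.
move=> Hz [p Hp Hl].
have [i [q [Q1 Q2 Q3]]] := from_input z.
have Hq : path e i (q ++ p) by rewrite cat_path Q2 Q3.
have Hql : last i (q ++ p) = out by rewrite last_cat Q3.
have Hsm : all (fun x => ~~ is_large C x) p.
  rewrite all_predC has_count -eqn0Ngt.
  have := Hw Q1 Hq Hql; rewrite -cat_cons count_cat.
  suff : 0 < count (is_large C) (i :: q) by rewrite -leqn0; move=> /=; lia.
  by rewrite -has_count; apply/hasP; exists z => //; rewrite -Q3; apply: mem_last.
exists (size p).
  by have := Hd Q1 Hq Hql; rewrite size_cat; apply: leq_trans; apply: leq_addl.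
elim: p z {Hz Q3 Hq Hql} Hp Hl Hsm => [|y p IH] z /=; first by move=> _ ->; rewrite inE.
case/andP => Hzy Hp Hl /andP[Hy Hsm]; apply/bigcupP; exists y.
  by rewrite (IH y).
by rewrite inE.
Qed.

Lemma large_list : exists2 s : seq 'I_n, size s <= 2 ^ d.+1 &
  forall z : 'I_n, is_large C z -> reaches z -> z \in s.
Proof.
exists (flatten [seq enum (level_set j) | j <- iota 0 d.+1]).
  elim: d.+1 => [|m IH] //.
  rewrite -[in iota _ _]addn1 iotaD map_cat flatten_cat size_cat /= cats0 -cardE add0n.
  by rewrite expnS mul2n -addnn leq_add // level_set_card.
move=> z Hz /(large_level Hz)[j Hj Hin]; apply/flattenP; exists (enum (level_set j)).
  by apply/mapP; exists j => //; rewrite mem_iota.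
by rewrite mem_enum.
Qed.
End Depth.
End Acyclic.
End Circuits.

(** * Digits and gaps *)

Section Numerals.
Variable M : nat.
Hypothesis HM : 0 < M.

Fixpoint num L (f : nat -> nat) := if L is L'.+1 then f 0 + num L' (fun l => f l.+1) * M else 0.

Lemma num_lt L f : (forall l, l < L -> f l < M) -> num L f < M ^ L.
Proof.
elim: L f => [|L IH] f Hf //=; rewrite expnSr.
have H0 := Hf 0 isT; have := IH (fun l => f l.+1) (fun l Hl => Hf l.+1 Hl).
by move: (num _ _) (M ^ L) H0 => x y H0 Hx; nia.
Qed.

Lemma num_digit L f l : (forall l, l < L -> f l < M) -> l < L ->
  dg M (M ^ L) (num L f) l = f l.
Proof.
move=> Hf Hl; rewrite /dg (@cpowE L.-1 M (M ^ L)) //; last 2 first.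
- by rewrite prednK //; lia.
- by rewrite prednK //; lia.
elim: L f l Hf Hl => [|L IH] f [|l] Hf Hl //=.
  by rewrite divn1 addnC modnMDl modn_small // Hf.
rewrite expnS divnMA addnC divnMDl // [f 0 %/ M]divn_small ?Hf // addn0.
by apply: IH => // l' Hl'; apply: Hf.
Qed.

Lemma dg_ltM W w l : dg M W w l < M. Proof. exact: ltn_pmod. Qed.
End Numerals.

Section Bounds.
Variables (k : nat) (bd : nat -> nat).
Hypothesis bd_lt : forall i, i <= k -> bd i < bd i.+1.

Lemma bd_le i j : i <= j -> j <= k.+1 -> bd i <= bd j.
Proof.
elim: j => [|j IH]; first by rewrite leqn0 => /eqP ->.
rewrite leq_eqVlt => /predU1P[-> //|Hi] Hj.
by apply: leq_trans (IH _ _) (ltnW (bd_lt _)); lia.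
Qed.

Lemma bd_uniq i j : i <= k -> j <= k.+1 -> bd i <= bd j -> bd j < bd i.+1 -> j = i.
Proof.
move=> Hi Hj H1 H2; case: (ltngtP j i) => // H.
  have Hj' : j <= k by lia.
  have H' : i <= k.+1 by lia.
  by have := bd_le H H'; have := bd_lt Hj'; lia.
by have := bd_le H Hj; lia.
Qed.

Lemma gap_ex x : bd 0 <= x -> x < bd k.+1 -> exists2 j, j <= k & bd j <= x < bd j.+1.
Proof.
move=> H0; have : k <= k by []. move: {1 3 4}k => l.
elim: l => [|l IH] Hl Hx; first by exists 0; rewrite ?H0.
case: (leqP (bd l.+1) x) => H; first by exists l.+1; rewrite ?H.
by have [j Hj Hjx] := IH (ltnW Hl) H; exists j => //; lia.
Qed.
End Bounds.

(** [lam] bounds the relevant large gates, see [large_list]; [gaps] bounds the inputs that refute a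
    value, see [pos_refute]. A value has room for a pair of digits for each of them. *)
Definition lam d := 2 ^ d.+1.
Definition gaps d := (lam d + 2) ^ d.
Definition ndig d := 2 * gaps d + 2 * lam d.

(** * The constraint problem of a circuit *)

Section CircuitCsp.
Variables (d n : nat) (a : rel nat) (g ox : pred nat) (k : nat).

(** In borders node [z] appears as [z.+1], so that [0] and [n.+1] are free to mark both ends. *)
Definition base := n.+2.
Definition cV := base ^ ndig d.
Definition even_dig v p := dg base cV v (2 * p).
Definition odd_dig v p := dg base cV v (2 * p).+1.
Definition gap q p := dg k.+1 (k.+1 ^ gaps d) q.-1 p.

(** Within a listed gap only the left border is true. An input whose gap is not listed may have
    either value. *)
Definition mayc v z b := all (fun p => (even_dig v p <= z.+1) && (z.+1 < odd_dig v p)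
  ==> (b == (z.+1 == even_dig v p))) (iota 0 (gaps d)).
Definition witc v z h := has (fun l => (even_dig v l == z) && (odd_dig v l == h)) (iota 0 (lam d)).

(** The outer borders are fixed; every other left border must be an input, namely a true one. *)
Definition gapc q v := all (fun p => [&& even_dig v p < odd_dig v p,
  (gap q p == 0) ==> (even_dig v p == 0), (gap q p == k) ==> (odd_dig v p == n.+1) &
  (0 < gap q p) ==> (0 < even_dig v p) && (degn n a (even_dig v p).-1 == 0)]) (iota 0 (gaps d)).

Definition matchc q v r w := all (fun p => all (fun p' =>
  ((gap q p == gap r p') ==> (even_dig v p == even_dig w p') && (odd_dig v p == odd_dig w p')) &&
  (((gap q p).+1 == gap r p') ==> (odd_dig v p == even_dig w p')))
  (iota 0 (gaps d))) (iota 0 (gaps d)).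

Definition posc v w := has (fun o => ox o && pos n a g (mayc w) (witc v) d true o) (iota 0 n).

(* Variable 0 guesses witnesses for the large gates.  The true inputs cut the
   nodes into [k.+1] gaps; variable [q.+1] guesses the borders of the gaps
   whose indices are the digits of [q]. *)
Definition ccon q v r w :=
  [&& (0 < q) ==> gapc q v, (0 < q) && (0 < r) ==> matchc q v r w &
      (q == 0) && (0 < r) ==> posc v w].

Definition cm := (k.+1 ^ gaps d).+1.

Variable C : circuit n.
Hypotheses (Ha : forall i j : 'I_n, arc C i j = a i j) (Hg : forall i : 'I_n, is_and C i = g i)
  (Ho : forall i : 'I_n, ox i = (i == output C)).
Hypotheses (Hac : forall i p, p <> [::] -> path (arc C) i p -> last i p <> i)
  (Hd : depth_le C d) (Hw : weft_le C 1).
Notation e := (arc C).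
Notation out := (output C).

Lemma gaps_gt0 : 0 < gaps d. Proof. by rewrite expn_gt0 addn2. Qed.

Lemma even_lt p : p < gaps d -> 2 * p < ndig d /\ (2 * p).+1 < ndig d.
Proof. by rewrite /ndig; lia. Qed.

Lemma wit_lt p : p < lam d -> 2 * p < ndig d /\ (2 * p).+1 < ndig d.
Proof.
rewrite /ndig => Hp; lia.
Qed.

Lemma poscP v w : posc v w = pos n a g (mayc w) (witc v) d true out.
Proof.
apply/hasI/idP => [[o]|H]; last by exists out; rewrite Ho eqxx.
by rewrite Ho => /andP[/eqP ->].
Qed.

Lemma gap_le q p : gap q p <= k. Proof. by rewrite -ltnS /gap dg_ltM. Qed.

Lemma gap_num f p : (forall p, p < gaps d -> f p <= k) -> p < gaps d ->
  gap (num k.+1 (gaps d) f).+1 p = f p.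
Proof. by move=> Hf Hp; rewrite /gap /= num_digit. Qed.

Section Complete.
Variables (v : pred 'I_n) (Hv : valuation C v) (Hout : v out)
  (HT : #|[set i | is_input C i && v i]| = k).

Let tt z := if insub z is Some i then is_input C i && v i else false.
Let ts := [seq z <- iota 0 n | tt z].
(** The borders of the given assignment: the [k] true inputs between the two end marks. *)
Let bd i := if i == 0 then 0 else if i <= k then (nth 0 ts i.-1).+1 else n.+1.

Lemma size_ts : size ts = k.
Proof.
rewrite /ts size_filter -val_enum_ord count_map -size_filter.
rewrite -(card_uniqP (filter_uniq _ (enum_uniq _))) -HT; apply: eq_card => j.
by rewrite mem_filter !inE /= mem_enum andbT /tt valK.
Qed.

Lemma ts_nth i : i < k -> nth 0 ts i < n /\ tt (nth 0 ts i).
Proof.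
move=> Hi; have : nth 0 ts i \in ts by apply: mem_nth; rewrite size_ts.
by rewrite mem_filter mem_iota => /andP[-> /andP[_]].
Qed.

Lemma bd_lt i : i <= k -> bd i < bd i.+1.
Proof.
move=> Hi; rewrite /bd /= Hi; case: i Hi => [|i] Hi /=.
  by case: ifP.
case: (ltnP i.+1 k) => H; last by rewrite ltnS; have [] := ts_nth Hi.
rewrite ltnS; have Hs : sorted ltn ts by apply: sorted_filter; [exact: ltn_trans|exact: iota_ltn_sorted].
by apply: (sorted_ltn_nth ltn_trans 0 Hs); rewrite ?inE ?size_ts.
Qed.

Lemma bd_bound i : i <= k.+1 -> bd i <= n.+1.
Proof.
move=> Hi; have := @bd_le k bd bd_lt i k.+1 Hi (leqnn _).
by rewrite {2}/bd /= ltnn.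
Qed.

Lemma bd_true (i : 'I_n) j : 0 < j -> j <= k -> bd j = i.+1 -> is_input C i /\ v i.
Proof.
case: j => [|j] // _ Hj; rewrite /bd /= Hj => -[E].
by have [_] := ts_nth Hj; rewrite E /tt valK => /andP[].
Qed.

Lemma true_bd (i : 'I_n) : is_input C i -> v i -> exists2 j, 0 < j <= k & bd j = i.+1.
Proof.
move=> Hi Hvi; have : (i : nat) \in ts.
  by rewrite mem_filter mem_iota /= ltn_ord /tt valK Hi Hvi.
move/(nthP 0) => [j]; rewrite size_ts => Hj E; exists j.+1; first by rewrite /=.
by rewrite /bd /= Hj E.
Qed.

Variable s : seq 'I_n.
Hypotheses (Hs : size s <= lam d)
  (Hsl : forall z : 'I_n, is_large C z -> reaches C z -> z \in s).

Definition wchild z := if insub z is Some i then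
  if [pick h | e h i && (v h == v i)] is Some h then (h : nat) else 0 else 0.

Definition wdigs l := let z := nth n.+1 [seq val i | i <- s] l./2 in
  if odd l then wchild z else z.

Definition gdigs q l := if odd l then bd (gap q l./2).+1 else
  if l./2 < gaps d then bd (gap q l./2) else 0.

Definition csol q := num base (ndig d) (if q == 0 then wdigs else gdigs q).

Lemma wdigs_lt l : wdigs l < base.
Proof.
have Hz : nth n.+1 [seq val i | i <- s] l./2 < base.
  case: (ltnP l./2 (size s)) => H; last by rewrite nth_default ?size_map.
  have : nth n.+1 [seq val i | i <- s] l./2 \in [seq val i | i <- s] by apply: mem_nth; rewrite size_map.
  by case/mapP => i _ ->; apply: leq_trans (ltn_ord i) _; rewrite /base; lia.
rewrite /wdigs; case: ifP => // _; rewrite /wchild; case: insubP => // i _ _.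
by case: pickP => // h _; apply: leq_trans (ltn_ord h) _; rewrite /base; lia.
Qed.

Lemma gdigs_lt q l : gdigs q l < base.
Proof.
rewrite /gdigs /base; case: ifP => _; first by rewrite ltnS bd_bound // ltnS gap_le.
by case: ifP => // _; rewrite ltnS bd_bound // leqW // gap_le.
Qed.

Lemma csol_digs q l : l < ndig d ->
  dg base cV (csol q) l = (if q == 0 then wdigs else gdigs q) l.
Proof.
by move=> Hl; rewrite /csol /cV num_digit // => l' _; case: ifP => _; [apply: wdigs_lt|apply: gdigs_lt].
Qed.

Lemma csol_gap q p : 0 < q -> p < gaps d ->
  even_dig (csol q) p = bd (gap q p) /\ odd_dig (csol q) p = bd (gap q p).+1.
Proof.
move=> Hq Hp; have [H1 H2] := even_lt Hp.
rewrite /even_dig /odd_dig !csol_digs // (gtn_eqF Hq) /gdigs.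
by rewrite mul2n /= odd_double /= uphalf_double doubleK Hp.
Qed.

Lemma csol_may q (i : 'I_n) : 0 < q -> is_input C i -> mayc (csol q) i (v i).
Proof.
move=> Hq Hi; apply/allP => p; rewrite mem_iota => /andP[_ Hp].
have [-> ->] := csol_gap Hq Hp; have Hgk := gap_le q p; set j := gap q p in Hgk *.
apply/implyP => /andP[H1 H2]; apply/eqP; apply/idP/eqP => [Hvi|E].
  have [j' /andP[J0 J1] E] := true_bd Hi Hvi.
  by rewrite -E; congr bd; apply: (bd_uniq bd_lt Hgk (leqW J1)); rewrite E.
have [] := @bd_true i j _ Hgk (esym E) => //.
by rewrite lt0n; apply/eqP => J0; move: E; rewrite J0.
Qed.

Lemma csol_wit (z : 'I_n) : is_large C z -> reaches C z -> v z != is_and C z ->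
  exists h : 'I_n, [/\ e h z, witc (csol 0) z h & v h = v z].
Proof.
move=> Hz Hr Hvz; have H2 : 1 < indegree C z by apply: ltnW.
have := val_gate Hv H2; rewrite (negPf Hvz) => /esym/negbT.
rewrite negb_forall_in => /exists_inP[h0 Hh0 Hvh0].
have Hw0 : wchild z = if [pick h | e h z && (v h == v z)] is Some h then (h : nat) else 0.
  by rewrite /wchild valK.
move: Hw0; case: pickP => [h /andP[Hh /eqP Hvh]|H]; last first.
  have := H h0; rewrite Hh0 /=.
  by case: (v h0) (v z) (is_and C z) Hvz Hvh0 => [] [] [].
move=> Ew; exists h; split=> //; apply/hasP; have Hin := Hsl Hz Hr.
have Hix : index z s < size s by rewrite index_mem.
exists (index z s); first by rewrite mem_iota; lia.
have [|H3 H4] := @wit_lt (index z s); first by lia.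
rewrite /even_dig /odd_dig !csol_digs //= /wdigs mul2n /= odd_double /= uphalf_double doubleK.
have -> : nth n.+1 [seq val i | i <- s] (index z s) = z by rewrite (nth_map z) // nth_index.
by rewrite Ew !eqxx.
Qed.

Lemma csol_ok : bcsp cm cV ccon.
Proof.
exists csol; split=> [q _|q r Hq Hr].
  by apply: num_lt => // l _; case: ifP => _; [apply: wdigs_lt|apply: gdigs_lt].
apply/and3P; split; apply/implyP.
- move=> Hq0; apply/allP => p; rewrite mem_iota => /andP[_ Hp].
  have [-> ->] := csol_gap Hq0 Hp; have Hgk := gap_le q p; set j := gap q p in Hgk *.
  rewrite bd_lt //=; apply/and3P; split; apply/implyP.
  + by move/eqP => ->.
  + by move/eqP => ->; rewrite /bd /= ltnn.
  + move=> Hj; have [i Ei] : exists i : 'I_n, bd j = i.+1.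
      rewrite /bd (gtn_eqF Hj) Hgk.
      by have [|H _] := @ts_nth j.-1; [lia|exists (Ordinal H)].
    by rewrite Ei /= (degnE Ha); have [] := bd_true Hj Hgk Ei.
- case/andP => Hq0 Hr0; apply/allP => p; rewrite mem_iota => /andP[_ Hp].
  apply/allP => p'; rewrite mem_iota => /andP[_ Hp'].
  have [-> ->] := csol_gap Hq0 Hp; have [-> ->] := csol_gap Hr0 Hp'.
  by apply/andP; split; apply/implyP => /eqP ->; rewrite !eqxx.
- case/andP => /eqP -> Hr0; rewrite poscP.
  apply: (pos_complete Ha Hg Hac Hd Hv (p := [::])) => //.
  + by move=> i Hi; apply: csol_may.
  + exact: csol_wit.
Qed.
End Complete.

Section Sound.
Variable s : nat -> nat.
Hypotheses (Hs : forall i j, i < cm -> j < cm -> ccon i (s i) j (s j)).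

(** Border [i] is read from variable [i.+1], whose first digit names gap [i]; the constraints
    [matchc] make all other variables agree with it. *)
Definition sbd i := if i <= k then even_dig (s i.+1) 0 else n.+1.

Lemma small_idx i : i <= k -> i.+1 < cm /\ gap i.+1 0 = i.
Proof.
move=> Hi; have H1 : k.+1 <= k.+1 ^ gaps d.
  by rewrite -{1}(expn1 k.+1) leq_pexp2l // gaps_gt0.
split; first by rewrite /cm; lia.
by rewrite /gap /dg divn1 modn_small.
Qed.

Lemma sgap q p : 0 < q -> q < cm -> p < gaps d ->
  even_dig (s q) p = sbd (gap q p) /\ odd_dig (s q) p = sbd (gap q p).+1.
Proof.
move=> Hq0 Hq Hp; have Hgk := gap_le q p.
have HM j : j <= k -> matchc q (s q) j.+1 (s j.+1).
  by move=> Hj; have [Hj1 _] := small_idx Hj; case/and3P: (Hs Hq Hj1) => _; rewrite Hq0.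
have HMp j : j <= k -> ((gap q p == j) ==> (even_dig (s q) p == even_dig (s j.+1) 0)
     && (odd_dig (s q) p == odd_dig (s j.+1) 0)) &&
   (((gap q p).+1 == j) ==> (odd_dig (s q) p == even_dig (s j.+1) 0)).
  move=> Hj; have [_ Ej] := small_idx Hj.
  have /allP/(_ p) := HM j Hj; rewrite mem_iota Hp => /(_ isT) /allP /(_ 0).
  by rewrite mem_iota /= gaps_gt0 Ej => /(_ isT).
split.
  by have := HMp _ Hgk; rewrite eqxx /= => /andP[/andP[/eqP -> _] _]; rewrite /sbd Hgk.
case: (ltnP (gap q p) k) => H.
  by have := HMp _ H; rewrite eqxx /= => /andP[_ /eqP ->]; rewrite /sbd H.
have E : gap q p = k by lia.
case/and3P: (Hs Hq Hq); rewrite Hq0 /= => /allP /(_ p); rewrite mem_iota Hp => /(_ isT).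
by rewrite E eqxx => /and4P[_ _ /eqP -> _] _ _; rewrite /sbd ltnn.
Qed.

Lemma sgapc i : i <= k -> [/\ sbd i < sbd i.+1, i = 0 -> sbd i = 0 &
  0 < i -> 0 < sbd i /\ degn n a (sbd i).-1 = 0].
Proof.
move=> Hi; have [Hc Ei] := small_idx Hi.
case/and3P: (Hs Hc Hc) => /= /allP /(_ 0); rewrite mem_iota gaps_gt0 => /(_ isT).
have [|||-> ->] := @sgap i.+1 0 => //; first exact: gaps_gt0.
rewrite Ei => /and4P[-> H2 _ H4] _ _; split=> // [E|Hi0].
  by move: H2; rewrite E eqxx => /eqP.
by move: H4; rewrite Hi0 => /andP[-> /eqP].
Qed.

Lemma sbd_lt i : i <= k -> sbd i < sbd i.+1. Proof. by case/sgapc. Qed.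

Lemma sbd0 : sbd 0 = 0. Proof. by have [_ H _] := sgapc (leq0n k); apply: H. Qed.

Lemma sbd_last : sbd k.+1 = n.+1. Proof. by rewrite /sbd ltnn. Qed.

Definition strue (z : nat) := has (fun i => (0 < i) && (sbd i == z.+1)) (iota 0 k.+1).

Lemma strueP (z : nat) i : i <= k -> sbd i <= z.+1 < sbd i.+1 -> strue z = (z.+1 == sbd i).
Proof.
move=> Hi /andP[H1 H2]; apply/hasP/eqP => [[j]|E].
  rewrite mem_iota => /andP[_ Hj] /andP[_ /eqP Ej].
  have Hj' : j <= k.+1 by lia.
  by rewrite -Ej; congr sbd; apply: (bd_uniq sbd_lt Hi Hj'); rewrite Ej.
exists i; first by rewrite mem_iota.
by rewrite E eqxx andbT lt0n; apply/eqP => I0; move: E; rewrite I0 sbd0.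
Qed.

Lemma strue_input (z : 'I_n) : strue z -> is_input C z.
Proof.
case/hasP => i; rewrite mem_iota => /andP[_ Hi] /andP[Hi0 /eqP E].
have [_ _ /(_ Hi0) [_]] := sgapc (Hi : i <= k).
by rewrite E /= (degnE Ha) => H; apply/eqP.
Qed.

(** The borders increase strictly, so the [k] inner ones name [k] different nodes. This is where the
    weight of the assignment is controlled. *)
Lemma strue_card : #|[set i : 'I_n | strue i]| = k.
Proof.
have Hlt (i : 'I_k) : (sbd i.+1).-1 < n.
  have [H1 _ /(_ isT) [H2 _]] := sgapc (ltn_ord i).
  by have := bd_le sbd_lt (ltn_ord i : i.+2 <= k.+1) (leqnn _); rewrite sbd_last; lia.
have Hpos (i : 'I_k) : 0 < sbd i.+1 by have [_ _ /(_ isT) []] := sgapc (ltn_ord i).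
pose F (i : 'I_k) : 'I_n := Ordinal (Hlt i).
have Fi : injective F.
  move=> i j [] E; apply: val_inj; have E' : sbd i.+1 = sbd j.+1.
    by have := Hpos i; have := Hpos j; lia.
  have [] // : j.+1 = i.+1.
  apply: (bd_uniq sbd_lt (ltn_ord i) _); rewrite ?E' //.
    by rewrite ltnS ltnW.
  by rewrite -E'; apply: sbd_lt.
rewrite -[RHS]card_ord -cardsT -(card_imset _ Fi); apply: eq_card => z; rewrite inE.
apply/idP/imsetP => [/hasP[i]|[i _ ->]].
  rewrite mem_iota => /andP[_ Hi] /andP[Hi0 /eqP E].
  have Hi' : i.-1 < k by lia.
  exists (Ordinal Hi') => //; apply: val_inj; rewrite /= prednK // E //.
apply/hasP; exists i.+1; first by rewrite mem_iota /= add0n ltnS.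
by rewrite /= prednK // eqxx.
Qed.

Lemma cc_sound : weighted_sat C k.
Proof.
have [v Hv Hvt] := valuation_ex Hac (fun i : 'I_n => strue i).
exists v; split=> //; last first.
  rewrite -strue_card; apply: eq_card => i; rewrite !inE.
  apply/andP/idP => [[Hi]|Hi]; first by rewrite Hvt.
  by have H := strue_input Hi; rewrite Hvt.
apply/negPn/negP => Hno.
have HW (z : nat) : exists2 l : seq 'I_n, size l <= lam d & forall h : 'I_n, witc (s 0) z h -> h \in l.
  exists (pmap insub [seq odd_dig (s 0) l | l <- iota 0 (lam d)]).
    rewrite size_pmap; apply: leq_trans (count_size _ _) _.
    by rewrite size_map size_iota.
  move=> h /hasP[l Hl /andP[_ /eqP E]]; rewrite mem_pmap_sub /=.
  by apply/mapP; exists l.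
have Hno' : v out != true by rewrite eqb_id.
have [|Z [Z1 Z2 Z3]] := pos_refute Ha Hg Hac Hd Hv (f := d) (p := [::]) _ (erefl _) (erefl _) HW Hno'.
  by [].
have Hgap (i : 'I_n) : exists j, (j <= k) && (sbd j <= i.+1 < sbd j.+1).
  have H0 : sbd 0 <= i.+1 by rewrite sbd0.
  have H1 : i.+1 < sbd k.+1 by rewrite sbd_last ltnS.
  by have [j Hj H] := gap_ex H0 H1; exists j; rewrite Hj.
pose G i := xchoose (Hgap i).
have GP i : (G i <= k) && (sbd (G i) <= i.+1 < sbd (G i).+1) := xchooseP (Hgap i).
(* The gaps of the refuting inputs become the digits of a variable, which therefore fixes the values
   of these inputs. Places beyond the length of [Z] are filled with the gap of the output, an
   arbitrary choice. *)
pose f p := G (nth out Z p).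
have Hf p : p < gaps d -> f p <= k by move=> _; have /andP[] := GP (nth out Z p).
set q := (num k.+1 (gaps d) f).+1.
have Hq : q < cm by rewrite /q /cm ltnS num_lt.
have := Hs (ltn0Sn _ : 0 < cm) Hq; rewrite /ccon /= poscP => Hpos.
suff : ~~ pos n a g (mayc (s q)) (witc (s 0)) d true out by rewrite Hpos.
apply: Z3 => i Hi; have Hix : index i Z < gaps d.
  by apply: leq_trans Z1; rewrite index_mem.
have [E1 E2] := sgap (ltn0Sn _ : 0 < q) Hq Hix.
have Eg : gap q (index i Z) = G i by rewrite /q gap_num // /f nth_index.
rewrite Eg in E1 E2; have /andP[Hk Hin] := GP i.
apply/negP => /allP /(_ (index i Z)); rewrite mem_iota Hix => /(_ isT).
have Hii : is_input C i by apply: (allP Z2).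
by rewrite E1 E2 Hin /= -(strueP Hk Hin) Hvt //; case: (strue i).
Qed.
End Sound.

Lemma circuit_csp : weighted_sat C k <-> bcsp cm cV ccon.
Proof.
split=> [[v [Hv Hout HT]]|[s [_ Hs]]]; last exact: cc_sound Hs.
have [l Hl1 Hl2] := large_list Hac Hd Hw.
exact: (csol_ok Hv Hout HT Hl1 Hl2).
Qed.
End CircuitCsp.

(** * Definability of the circuit constraints *)

Section DefCircuit.
Variable mj : majorants.
Notation def := (def mj).

Lemma def_dg F G H K : def F -> def G -> def H -> def K ->
  def (fun x e => dg (F x e) (G x e) (H x e) (K x e)).
Proof. by move=> HF HG HH HK; rewrite /dg /cpow; deft. Qed.

Lemma def_degn F : def F -> def (fun x e => degn (nl x) (arcx x) (F x e)).
Proof. by move=> HF; rewrite /degn; deft. Qed.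

Lemma def_walk f F : def F -> def (fun x e => walk (nl x) (arcx x) f (F x e) : nat).
Proof.
elim: f F => [|f IH] F HF /=; first exact: d_const.
by apply: def_has; [deft|apply: def_and; [deft|apply: IH; deft]].
Qed.

Lemma def_large F : def F -> def (fun x e => large (nl x) (arcx x) (F x e) : nat).
Proof. by move=> HF; have := def_degn HF; rewrite /large => H; deft. Qed.

Lemma def_one f F : def F -> def (fun x e => one (nl x) (arcx x) f (F x e) : nat).
Proof.
elim: f F => [|f IH] F HF /=.
  by apply: def_or; [exact: def_large|exact: (d_const mj 0)].
apply: def_or; first exact: def_large.
by apply: def_has; [deft|apply: def_and; [deft|apply: IH; deft]].
Qed.

Lemma def_two f F : def F -> def (fun x e => two (nl x) (arcx x) f (F x e) : nat).
Proof.
elim: f F => [|f IH] F HF /=; first exact: (d_const mj 0).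
apply: def_has; first by deft.
apply: def_and; first by deft.
apply: def_or; last by apply: IH; deft.
by apply: def_and; [apply: def_large; deft|apply: def_one; deft].
Qed.

Variable d : nat.

Lemma def_cV : def (fun x e => cV d (nl x)).
Proof. by rewrite /cV /base; apply: def_expc; deft. Qed.

Lemma def_even F G : def F -> def G -> def (fun x e => even_dig d (nl x) (F x e) (G x e)).
Proof.
move=> HF HG; rewrite /even_dig; apply: def_dg => //; rewrite ?/base; try exact: def_cV; deft.
Qed.

Lemma def_odd_dig F G : def F -> def G -> def (fun x e => odd_dig d (nl x) (F x e) (G x e)).
Proof.
move=> HF HG; rewrite /odd_dig; apply: def_dg => //; rewrite ?/base; try exact: def_cV; deft.
Qed.

Lemma def_gap F G H : def F -> def G -> def H -> def (fun x e => gap d (F x e) (G x e) (H x e)).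
Proof.
by move=> HF HG HH; rewrite /gap; apply: def_dg; deft.
Qed.

Lemma def_mayc F G b : def F -> def G -> def (fun x e => mayc d (nl x) (F x e) (G x e) b : nat).
Proof.
move=> HF HG; rewrite /mayc; apply: def_all; first exact: d_const.
have H1 := def_even (def_behead HF) (d_var mj 0); have H2 := def_odd_dig (def_behead HF) (d_var mj 0).
by case: b; deft.
Qed.

Lemma def_witc F G H : def F -> def G -> def H ->
  def (fun x e => witc d (nl x) (F x e) (G x e) (H x e) : nat).
Proof.
move=> HF HG HH; rewrite /witc; apply: def_has; first exact: d_const.
have H1 := def_even (def_behead HF) (d_var mj 0); have H2 := def_odd_dig (def_behead HF) (d_var mj 0).
by deft.
Qed.

(** The depth is a constant of the reduction, so the recursion is unfolded by induction, each step
    adding one bounded quantifier. *)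
Lemma def_pos f b Fv Fw F : def Fv -> def Fw -> def F ->
  def (fun x e => pos (nl x) (arcx x) (andx x) (mayc d (nl x) (Fw x e))
    (witc d (nl x) (Fv x e)) f b (F x e) : nat).
Proof.
elim: f b Fv Fw F => [|f IH] b Fv Fw F Hv Hw HF; first exact: def_mayc.
have IH' b' : def (fun x e => pos (nl x) (arcx x) (andx x) (mayc d (nl x) (Fw x (behead e)))
    (witc d (nl x) (Fv x (behead e))) f b' (nth 0 e 0) : nat).
  by apply: IH; [exact: def_behead|exact: def_behead|exact: d_var].
have Hdeg := def_degn HF; have Hdeg' := def_degn (def_behead HF).
have Hwit := def_witc (def_behead Hv) (def_behead HF) (d_var mj 0).
have Hmay := def_mayc b Hw HF.
rewrite [pos]lock /= -lock.
apply: def_ifb; [by deft|exact: Hmay|].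
apply: def_ifb; first by deft.
  by apply: def_all; [deft|apply: def_imp; [deft|exact: IH']].
apply: def_ifb; first by case: (b); deft.
  by apply: def_all; [deft|apply: def_imp; [deft|exact: IH']].
apply: def_has; first by deft.
by apply: def_and; [deft|apply: def_and; [deft|exact: IH']].
Qed.

Lemma def_ccon Fk q v r w : def Fk -> def q -> def v -> def r -> def w ->
  def (fun x e => ccon d (nl x) (arcx x) (andx x) (outx x) (Fk x e) (q x e) (v x e) (r x e) (w x e) : nat).
Proof.
move=> Hk Hq Hv Hr Hw; rewrite /ccon /gapc /matchc /posc.
apply: def_and; [|apply: def_and].
- apply: def_imp; first by deft.
  apply: def_all; first exact: d_const.
  have H1 := def_even (def_behead Hv) (d_var mj 0); have H2 := def_odd_dig (def_behead Hv) (d_var mj 0).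
  have H3 := def_gap (def_behead Hk) (def_behead Hq) (d_var mj 0).
  have H4 := def_degn (d_pred H1).
  by deft.
- apply: def_imp; first by deft.
  apply: def_all; first exact: d_const.
  apply: def_all; first exact: d_const.
  have H1 := def_even (def_behead (def_behead Hv)) (def_behead (d_var mj 0)).
  have H2 := def_odd_dig (def_behead (def_behead Hv)) (def_behead (d_var mj 0)).
  have H3 := def_gap (def_behead (def_behead Hk)) (def_behead (def_behead Hq)) (def_behead (d_var mj 0)).
  have H5 := def_even (def_behead (def_behead Hw)) (d_var mj 0).
  have H6 := def_odd_dig (def_behead (def_behead Hw)) (d_var mj 0).
  have H7 := def_gap (def_behead (def_behead Hk)) (def_behead (def_behead Hr)) (d_var mj 0).
  by deft.
- apply: def_imp; first by deft.
  apply: def_has; first by deft.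
  apply: def_and; first by deft.
  by apply: def_pos; [exact: def_behead|exact: def_behead|exact: d_var].
Qed.
End DefCircuit.

(** Form, depth and weft are part of [wcs], so the reduction has to test them. The bits from [L] on
    are those left by the rounds of [kahn]. *)
Definition circuit_ok d (w : seq bool) (L k : nat) :=
  [&& circuit_word w L, all (fun i => nth false w (L + i)) (iota 0 (nl w)) &
   all (fun i => outx w i ==> [&& all (fun j => ~~ arcx w i j) (iota 0 (nl w)),
     ~~ walk (nl w) (arcx w) d.+1 i & ~~ two (nl w) (arcx w) d i]) (iota 0 (nl w))].

Lemma def_circuit_ok mj d F G : def mj F -> def mj G ->
  def mj (fun x e => circuit_ok d x (F x e) (G x e) : nat).
Proof.
move=> HF HG; rewrite /circuit_ok /circuit_word.
have H1 := def_csize (def_nl mj).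
have H2 := def_walk d.+1 (d_var mj 0); have H3 := def_two d (d_var mj 0).
by deft.
Qed.

(* Bit [size x + i] of the word tells whether node [i] has been removed; a node
   is removed as soon as all its predecessors have been. *)
Definition kahn (w : seq bool) (e : seq nat) : nat :=
  if nth 0 e 0 < nth 0 e 1 then nth false w (nth 0 e 0) else
  all (fun j => arcx w j (nth 0 e 0 - nth 0 e 1) ==> nth false w (nth 0 e 1 + j)) (iota 0 (nl w)).

Lemma def_kahn mj : def mj kahn.
Proof. by rewrite /kahn; deft. Qed.

(** * Testing acyclicity by rounds of removal *)

Lemma nl_cat x u : nl x < size x -> nl (x ++ u) = nl x.
Proof. by move=> H; rewrite /nl index_cat -index_mem H. Qed.

Lemma nl_cat_lt x u : nl (x ++ u) < size x -> nl x < size x.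
Proof.
rewrite /nl index_cat index_mem; case: ifP => //= _; by rewrite ltnNge leq_addr.
Qed.

Section CatWord.
Variables (x u : seq bool).
Hypotheses (Hn : nl x < size x) (Hs : size x = csize (nl x)).

Lemma arcx_cat i j : i < nl x -> j < nl x -> arcx (x ++ u) i j = arcx x i j.
Proof.
move=> Hi Hj; rewrite /arcx nl_cat // nth_cat; case: ltnP => //; rewrite Hs /csize.
have : i * nl x + j < nl x * nl x by nia.
by lia.
Qed.

Lemma andx_cat i : i < nl x -> andx (x ++ u) i = andx x i.
Proof.
move=> Hi; rewrite /andx nl_cat // nth_cat; case: ltnP => //; rewrite Hs /csize.
by lia.
Qed.

Lemma outx_cat i : i < nl x -> outx (x ++ u) i = outx x i.
Proof.
move=> Hi; rewrite /outx nl_cat // nth_cat; case: ltnP => //; rewrite Hs /csize.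
by lia.
Qed.
End CatWord.

Lemma circuit_word_cat x u : circuit_word (x ++ u) (size x) = circuit_word x (size x).
Proof.
rewrite /circuit_word; case: (ltnP (nl x) (size x)) => Hn; last first.
  by case: ltnP => // H; have := nl_cat_lt H; rewrite ltnNge Hn.
rewrite nl_cat // Hn /=; case: eqP => //= Hs; congr (_ == 1); apply: eq_in_count => i.
by rewrite mem_iota => /andP[_ Hi]; apply: outx_cat.
Qed.

Section Kahn.
Variables (Es : seq (nat -> nat)) (x : seq bool) (k : nat).
Let S := fun e : seq nat => nth 0 e 0.
Let N1 := fun e : seq nat => nth 0 e 0 + nth 0 e 0.

Lemma kahn_word s : exists u, [/\ iter s (word_step N1 kahn (env_of Es x k)) x = x ++ u,
  s = 0 -> u = [::] &
  circuit_word x (size x) -> forall i, i < nl x ->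
    nth false (x ++ u) (size x + i) = ~~ walk (nl x) (arcx x) s i].
Proof.
elim: s => [|s [u [E _ Hu]]].
  by exists [::]; split; rewrite ?cats0 // => _ i _; rewrite nth_default // leq_addr.
set e := env_of Es x k in E *; rewrite iterS E.
have Ee i j : nth 0 (i :: e) 0 = i /\ nth 0 (i :: e) 1 = size x by [].
rewrite /word_step; have -> : N1 e = size x + size x by [].
rewrite mkseq_add.
pose f i := kahn (x ++ u) (i :: e) != 0; rewrite -/f; have -> : mkseq f (size x) = x.
  apply: (@eq_from_nth _ false); rewrite ?size_mkseq // => i Hi.
  rewrite nth_mkseq // /f /kahn /= Hi nth_cat Hi; by case: (nth _ _ _).
exists (mkseq (fun i => f (size x + i)) (size x)); split=> // Hx i Hi.
have /and3P[Hn /eqP Hs _] := Hx.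
have Hix : i < size x by apply: ltn_trans Hi Hn.
rewrite nth_cat ltnNge leq_addr /= addKn nth_mkseq // /f /kahn /=.
rewrite ltnNge leq_addr /= addKn nl_cat // -all_predC.
have -> (b : bool) : ((b : nat) != 0) = b by case: b.
apply: eq_in_all => j; rewrite mem_iota => /andP[_ Hj].
by rewrite arcx_cat // Hu //= negb_and implybE.
Qed.
End Kahn.

Section Acyclicity.
Variables (n : nat) (C : circuit n) (a : rel nat).
Hypothesis Ha : forall i j : 'I_n, arc C i j = a i j.

Lemma walk_suffix i p z f : path (arc C) i p -> last i p = z -> f <= size p -> walk n a f z.
Proof.
move=> Hp Hl Hf; apply/(walkP Ha).
exists (last i (take (size p - f) p)), (drop (size p - f) p).
move: Hp; rewrite -{1}(cat_take_drop (size p - f) p) cat_path => /andP[_ ->].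
by rewrite -last_cat cat_take_drop size_drop Hl; split=> //; lia.
Qed.

Lemma path_rank (Hac : forall i p, p <> [::] -> path (arc C) i p -> last i p <> i) i p :
  path (arc C) i p -> rank C i + size p <= rank C (last i p).
Proof.
elim: p i => [|j p IH] i /=; first by rewrite addn0.
by case/andP => /(rank_lt Hac) H /IH; lia.
Qed.

(** Ranks bound the length of walks by the number of nodes; a cycle, run through repeatedly, gives
    walks of any length. *)
Lemma acyclicP L : n < L -> (forall i p, p <> [::] -> path (arc C) i p -> last i p <> i) <->
  (forall i : 'I_n, ~~ walk n a L i).
Proof.
move=> HL; split=> [Hac z|H i p Hp Hpath E].
  apply/negP => /(walkP Ha)[i [p [H1 H2 H3]]]; have := path_rank Hac H1.
  rewrite H2 H3; have : rank C z <= n by rewrite -[X in _ <= X]card_ord max_card.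
  by lia.
have Hrep t : path (arc C) i (flatten (nseq t p)) /\ last i (flatten (nseq t p)) = i.
  by elim: t => //= t [I1 I2]; rewrite cat_path last_cat E Hpath I1.
have [I1 I2] := Hrep L; have /negP := H i; apply; apply: walk_suffix I1 I2 _.
rewrite size_flatten /shape map_nseq sumn_nseq.
by clear -Hp; case: p Hp => // y p _ /=; rewrite mulSn leq_addr.
Qed.
End Acyclicity.

Theorem wcs_to_game B d : fpt_reducible B (wcs 1 d) -> fpt_reducible B short_staller_mb_dom_game.
Proof.
move=> HB; apply: (fpt_to_game (A := wcs 1 d) (S := fun e => nth 0 e 0)
  (N1 := fun e => nth 0 e 0 + nth 0 e 0) (b1 := kahn) (mk := cm d) (ok := circuit_ok d)
  (VF := fun x _ _ => cV d (nl x))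
  (cF := fun x _ k => ccon d (nl x) (arcx x) (andx x) (outx x) k)) => //.
- by move=> mj F HF; rewrite /cm; apply: d_succ; apply: def_expc; apply: d_succ.
- exact: d_var.
- by apply: def_add; apply: d_var.
- exact: def_kahn.
- by move=> F G HF HG; apply: def_circuit_ok.
- by move=> F G _ _; apply: def_cV.
- by move=> F G q v r w _ HG; apply: def_ccon.
- by move=> k; rewrite /cm ltnS expn_gt0.
- by move=> x L k _; rewrite /cV expn_gt0.
move=> x k; rewrite /word_of [nth 0 _ 0]/=.
have [u [-> _ Hrem]] := kahn_word [:: fun k => 2 ^ lv (cm d k)] x k (size x).
case Hx: (circuit_word x (size x)); last first.
  rewrite /circuit_ok circuit_word_cat Hx; split=> [[n [C [_ _ _ E _]]]|[]//].
  by move: Hx; rewrite E circuit_word_enc.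
have {}Hrem := Hrem Hx; have [o Ex] := circuit_wordP Hx.
have /and3P[Hn /eqP Hs _] := Hx.
set C := decode_circuit o in Ex; set w := x ++ u in Hrem *.
have En : nl w = nl x by apply: nl_cat.
have Ha0 (i j : 'I_(nl x)) : arc C i j = arcx x i j by [].
have Ha (i j : 'I_(nl x)) : arc C i j = arcx w i j by rewrite /w arcx_cat.
have Hg (i : 'I_(nl x)) : is_and C i = andx w i by rewrite /w andx_cat.
have Ho (i : 'I_(nl x)) : outx w i = (i == output C).
  by rewrite /w outx_cat //; have := outx_circuit C (ltn_ord i); rewrite -Ex => ->.
have Hwcs : wcs 1 d x k <-> [/\ circuit_wf C, weft_le C 1, depth_le C d & weighted_sat C k].
  split=> [[n [C' [H1 H2 H3 E H4]]]|[H1 H2 H3 H4]]; last by exists (nl x), C.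
  have Enn : n = nl x by rewrite E nl_circuit.
  subst n; suff <- : C' = C by [].
  by apply: encode_circuit_inj; rewrite -E.
rewrite Hwcs /circuit_ok circuit_word_cat Hx En /=.
have Hrm : all (fun i => nth false w (size x + i)) (iota 0 (nl x)) <->
    (forall i p, p <> [::] -> path (arc C) i p -> last i p <> i).
  rewrite (acyclicP Ha0 Hn); split=> [/allI H i|H].
    by have := H i; rewrite Hrem.
  by apply/allI => i; rewrite Hrem.
have Hout P : all (fun i => outx w i ==> P i) (iota 0 (nl x)) <-> P (output C).
  split=> [/allI /(_ (output C))|HP]; first by rewrite Ho eqxx.
  by apply/allI => i; rewrite Ho; apply/implyP => /eqP ->.
have Hsucc : all (fun j => ~~ arcx w (output C) j) (iota 0 (nl x)) <->
    (forall i, ~~ arc C (output C) i).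
  split=> [/allI H i|H]; first by rewrite Ha.
  by apply/allI => i; rewrite -Ha.
split.
- case=> [[Hac Hos] Hwf Hdp Hsat]; split; last first.
    exact (iffLR (circuit_csp k Ha Hg Ho Hac Hdp Hwf) Hsat).
  apply/andP; split; first exact/Hrm.
  apply/Hout; apply/and3P; split; first exact/Hsucc.
    exact/(depthP Ha Hac).
  exact/(weftP Ha Hac Hdp).
- case=> /andP[/Hrm Hac /Hout /and3P[/Hsucc Hos /(depthP Ha Hac) Hdp /(weftP Ha Hac Hdp) Hwf]].
  move=> Hb; have Hsat := iffRL (circuit_csp k Ha Hg Ho Hac Hdp Hwf) Hb; split=> //.
Qed.

Theorem theorem3p6 : W_complete 1 short_staller_mb_dom_game.
Proof.
split; first exact: game_in_W.
by move=> B [d HB]; apply: wcs_to_game HB.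
Qed.
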